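(* Suppose that $X\in\mathring C^1(D,\mathbb R^2)$, $\Omega^\Gamma=(\Omega,\Gamma)\in\Xi$ and $q\in(2,q_0]$. For small $t\ge 0$ let $u^t\in W^1_{\Gamma,q}(\Omega)$ be the solution of $$\int_\Omega\beta(|B(t)\nabla u^t|^2)A(t)\nabla u^t\cdot\nabla\varphi+\xi(t)u^t\varphi\,dx=\int_\Omega f^t\varphi\,dx\quad\text{for all }\varphi\in W^1_{\Gamma,q'}(\Omega),$$ where $1/q+1/q'=1$, and let $u:=u^0$. (a) If $f\in L_q(D)$, then $$\lim_{t\searrow0}\|u^t-u\|_{W^1_q(\Omega)}=0\quad\text{and}\quad\lim_{t\searrow0}\|u^t-u\|_{C(\overline\Omega)}=0.$$ (b) If $f\in W^1_q(D)$, then there are $\tau>0$ and $c>0$ such that $$\|u^t-u\|_{C(\overline\Omega)}+\|u^t-u\|_{W^1_q(\Omega)}\le ct\quad\text{for all }t\in[0,\tau].$$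
   Context: Geometry. $D\subset\mathbb R^2$ is a fixed open bounded set. For $\Omega\subset\mathbb R^2$, $\Gamma\subset\partial\Omega$, the set $\Omega\cup\Gamma$ is regular (in the sense of Gröger) if $\Omega$ is a bounded Lipschitz domain, $\Gamma$ is relatively open in $\partial\Omega$, $\Gamma_0:=\partial\Omega\setminus\Gamma$ has positive measure, and $\Gamma_0$ is a finite union of closed and non-degenerate curved pieces of $\partial\Omega$. $\Xi:=\{(\Omega,\Gamma):\Omega\subset D,\ \Gamma\subset\partial\Omega,\ \Omega\cup\Gamma\text{ regular}\}$, $\Omega^\Gamma:=(\Omega,\Gamma)$. Spaces. $W^1_{\Gamma,p}(\Omega)$ is the closure in $W^1_p(\Omega)$ of $\{f|_\Omega:f\in C^\infty(\mathbb R^2),\ \operatorname{supp}f\cap\Gamma_0=\emptyset\}$, $W^{-1}_{\Gamma,p}(\Omega):=(W^1_{\Gamma,p'}(\Omega))^*$, $1/p+1/p'=1$. $Lu:=(u,\nabla u)^\top$. $\mathring C^1(D,\mathbb R^2)$: functions continuously differentiable on $\overline D$ (up to the boundary) vanishing on $\partial D$. Data. $\beta\in C^1(\mathbb R)$ satisfies: $\bar\beta\le\beta\le\underline\beta$ for some constants $\bar\beta,\underline\beta>0$; $(\beta(x)-\beta(y))(x-y)\ge0$ for all $x,y\in\mathbb R$; there are $k,K>0$ with $k|\eta|^2\le\beta(|p|^2)|\eta|^2+2\beta'(|p|^2)|p\cdot\eta|^2\le K|\eta|^2$ for all $\eta,p\in\mathbb R^2$. Flow. $\Phi_t$ is the flow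 of $x'(t)=X(x(t))$; $\xi(t):=\det(\partial\Phi_t)$, $A(t):=\det(\partial\Phi_t)(\partial\Phi_t)^{-1}(\partial\Phi_t)^{-\top}$, $B(t):=(\partial\Phi_t)^{-\top}$, $f^t:=\det(\partial\Phi_t)\,f\circ\Phi_t$. The number $q_0$. Let $\langle\mathcal Jv,w\rangle:=\int_\Omega\nabla v\cdot\nabla w+vw\,dx$, $M_p:=\sup\{\|v\|_{W^1_p(\Omega)}:v\in W^1_{\Gamma,p}(\Omega),\ \|\mathcal Jv\|_{W^{-1}_{\Gamma,p}(\Omega)}\le1\}$ with $\|v\|_{W^1_p(\Omega)}=\|\,|Lv|\,\|_{L_p(\Omega)}$, and $\Omega^\Gamma\in R_p$ if $\mathcal J$ maps $W^1_{\Gamma,p}(\Omega)$ onto $W^{-1}_{\Gamma,p}(\Omega)$. With $m:=\min\{k,1\}$, $M:=\max\{K,1\}$, $q_0>2$ is a fixed number with $\Omega^\Gamma\in R_{q_0}$ and $M_q(1-m^2/M^2)^{1/2}<1$ for all $q\in[2,q_0]$. For such $q_0$ there is $\delta>0$ such that for all $t\in[0,\delta]$ and $q\in[2,q_0]$ the operators $W^1_{\Gamma,q}(\Omega)\to W^{-1}_{\Gamma,q}(\Omega)$ induced by the left-hand side of the equation for $u^t$ are bijective with inverses that are Lipschitz with a constant independent of $t$. *)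

(* Defs.v *)
From HB Require Import structures.
From mathcomp Require Import all_boot all_order all_algebra.
From mathcomp Require Import all_classical all_reals all_analysis.

Set Implicit Arguments.
Unset Strict Implicit.
Unset Printing Implicit Defensive.

Import Order.TTheory GRing.Theory Num.Theory.
Import numFieldNormedType.Exports.

Local Open Scope classical_set_scope.
Local Open Scope ring_scope.

(* The plane is the product R * R, which carries both the product topology and
   the product measure.  Its library norm is the sup norm, so Euclidean lengths
   are taken after conversion to column vectors. *)

Section euclidean.
Context {R : realType}.

Definition vec2 (x : R * R) : 'cV[R]_2 := \col_i (if i == 0 then x.1 else x.2).

Definition basis2 (i : 'I_2) : R * R := ((i == 0)%:R, (i != 0)%:R).

Definition dot n (v w : 'cV[R]_n) : R := \sum_i v i 0 * w i 0.

Definition norm2 n (v : 'cV[R]_n) : R := Num.sqrt (dot v v).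

Definition edist (x y : R * R) : R := norm2 (vec2 x - vec2 y).

Definition grad (f : R * R -> R) (x : R * R) : 'cV[R]_2 :=
  \col_i 'D_(basis2 i) f x.

Definition jac (F : R * R -> R * R) (x : R * R) : 'M[R]_2 :=
  \matrix_(i, j) 'D_(basis2 j) (fun y => vec2 (F y) i 0) x.

(* measurableTypeR R is R with the Borel sigma-algebra on which
   lebesgue_measure is defined; functions on R * R are read as functions on
   this product for measurability and integration. *)
Definition mplane : measurableType _ :=
  (measurableTypeR R * measurableTypeR R)%type.

Definition leb2 : {measure set mplane -> \bar R} :=
  (@lebesgue_measure R \x @lebesgue_measure R)%E.

End euclidean.

Section regularity.
Context {R : realType}.

Definition bd (A : set (R * R)) : set (R * R) := closure A `\` interior A.

(* The element 0 makes the diameter of the empty set equal to 0, not -oo. *)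
Definition ediam (A : set (R * R)) : \bar R :=
  ereal_sup (0%E |` [set (edist x y)%:E | x in A & y in A]).

(* One-dimensional Hausdorff measure: the length measure on boundaries. *)
Definition hausdorff1 (A : set (R * R)) : \bar R :=
  ereal_sup [set
    ereal_inf [set (\sum_(i <oo) ediam (U i))%E | U in
      [set U : nat -> set (R * R) |
        A `<=` \bigcup_i U i /\ forall i, (ediam (U i) <= r%:E)%E]]
    | r in [set r : R | 0 < r]].

(* Near each boundary point, Omega is the strict epigraph of a Lipschitz
   function in the orthonormal frame (e, e^perp) centred at that point. *)
Definition lipschitz_domain (Omega : set (R * R)) : Prop :=
  [/\ Omega !=set0, open Omega, connected Omega &
   forall x, bd Omega x ->
     exists r : R, 0 < r /\
     exists (e : R * R) (g : R -> R),
       [/\ norm2 (vec2 e) = 1, [lipschitz g s | s in [set: R]] &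
        forall y, edist y x < r ->
          (Omega y <-> g (dot (vec2 (y - x)) (vec2 e))
                       < dot (vec2 (y - x)) (vec2 (- e.2, e.1)))]].

(* Injectivity makes the arc non-degenerate; arcs are compact, hence closed.
   A closed curve is the union of two arcs. *)
Definition jordan_arc (P : set (R * R)) : Prop :=
  exists gamma : R -> R * R,
    [/\ {within `[0, 1], continuous gamma}, set_inj `[0, 1] gamma &
     P = gamma @` `[0, 1]].

Definition groger_regular (Omega Gamma : set (R * R)) : Prop :=
  [/\ bounded_set Omega /\ lipschitz_domain Omega,
   exists U, open U /\ Gamma = bd Omega `&` U,
   (0 < hausdorff1 (bd Omega `\` Gamma))%E &
   exists (n : nat) (P : 'I_n -> set (R * R)),
     (forall i, jordan_arc (P i)) /\ bd Omega `\` Gamma = \bigcup_i P i].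

Definition Xi (D Omega Gamma : set (R * R)) : Prop :=
  [/\ Omega `<=` D, Gamma `<=` bd Omega & groger_regular Omega Gamma].

End regularity.

Section sobolev.
Context {R : realType}.
Implicit Types (Omega Gamma : set (R * R)) (u v w f phi : R * R -> R) (p : R).

Fixpoint Ck n f : Prop :=
  if n is n'.+1 then
    continuous f /\ forall i : 'I_2,
      (forall x, derivable f x (basis2 i)) /\ Ck n' ('D_(basis2 i) f)
  else continuous f.

Definition smooth f : Prop := forall n, Ck n f.

Definition tsupp f : set (R * R) := closure [set x | f x != 0].

Definition test_function Omega phi : Prop :=
  [/\ smooth phi, compact (tsupp phi) & tsupp phi `<=` Omega].

(* Elements of Lebesgue and Sobolev spaces over Omega are represented by total
   functions, of which only the restriction to Omega matters. *)

Definition Lp_norm Omega p f : \bar R :=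
  'N[leb2]_p%:E[EFin \o (f \_ Omega)].

Definition Lp Omega p f : Prop :=
  measurable_fun (Omega : set mplane) (f : mplane -> R) /\
  (Lp_norm Omega p f < +oo)%E.

Definition loc_integrable Omega f : Prop :=
  measurable_fun (Omega : set mplane) (f : mplane -> R) /\
  forall A, A `<=` Omega -> compact A ->
    (\int[leb2]_(x in A) `|f x|%:E < +oo)%E.

Definition is_wgrad Omega u (G : R * R -> 'cV[R]_2) : Prop :=
  [/\ loc_integrable Omega u,
   forall i, loc_integrable Omega (fun x => G x i 0) &
   forall phi, test_function Omega phi -> forall i,
     Rintegral leb2 Omega (fun x => u x * grad phi x i 0)
     = - Rintegral leb2 Omega (fun x => G x i 0 * phi x)].

(* A choice of weak gradient, unique almost everywhere on Omega if it exists,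
   and a junk value if it does not. *)
Definition wgrad Omega u : R * R -> 'cV[R]_2 := get (is_wgrad Omega u).

Definition Lop Omega u (x : R * R) : 'cV[R]_(1 + 2) :=
  col_mx (u x)%:M (wgrad Omega u x).

(* Meaningful only for weakly differentiable functions. *)
Definition W1_norm Omega p u : \bar R :=
  Lp_norm Omega p (fun x => norm2 (Lop Omega u x)).

Definition W1 Omega p u : Prop :=
  (exists G, is_wgrad Omega u G) /\ (W1_norm Omega p u < +oo)%E.

Definition W1G Omega Gamma p u : Prop :=
  W1 Omega p u /\
  forall e : R, 0 < e -> exists f,
    [/\ smooth f, tsupp f `&` (bd Omega `\` Gamma) = set0 &
     (W1_norm Omega p (fun x => (u x - f x)%R) < e%:E)%E].

Definition conj_exp p : R := p / (p - 1).

(* The norm on the dual of W1G Omega Gamma (conj_exp p). *)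
Definition dual_norm Omega Gamma p (F : (R * R -> R) -> R) : \bar R :=
  ereal_sup [set `|F w|%:E | w in
    [set w | W1G Omega Gamma (conj_exp p) w /\
             (W1_norm Omega (conj_exp p) w <= 1)%E]].

(* The space W^{-1}_{Gamma,p}(Omega).  Finiteness of the norm forces F to
   vanish on functions of norm 0, hence to respect a.e. equality. *)
Definition Wdual Omega Gamma p (F : (R * R -> R) -> R) : Prop :=
  (forall (a : R) v w, W1G Omega Gamma (conj_exp p) v ->
     W1G Omega Gamma (conj_exp p) w ->
     F (fun x => a * v x + w x) = a * F v + F w) /\
  (dual_norm Omega Gamma p F < +oo)%E.

Definition J Omega v w : R :=
  Rintegral leb2 Omega
    (fun x => dot (wgrad Omega v x) (wgrad Omega w x) + v x * w x).

Definition R_class Omega Gamma p : Prop :=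
  forall F, Wdual Omega Gamma p F ->
    exists v, W1G Omega Gamma p v /\
      forall w, W1G Omega Gamma (conj_exp p) w -> J Omega v w = F w.

Definition M_const Omega Gamma p : \bar R :=
  ereal_sup [set W1_norm Omega p v | v in
    [set v | W1G Omega Gamma p v /\
             (dual_norm Omega Gamma p (J Omega v) <= 1)%E]].

(* The sup over closure Omega of |w|, where w is the continuous representative
   of v.  The continuous representative is unique on closure Omega when Omega
   is open; if there is none, the value is +oo. *)
Definition C_norm Omega v : \bar R :=
  ereal_inf [set ereal_sup [set `|w x|%:E | x in closure Omega] | w in
    [set w : R * R -> R | {within closure Omega, continuous w} /\
      {ae leb2, forall x, Omega x -> w x = v x}]].

End sobolev.

Section data.
Context {R : realType}.

(* Continuously differentiable on D up to the boundary and 0 on the boundary: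
   the partial derivatives in D extend continuously to closure D. *)
Definition C1_zero_bd (D : set (R * R)) (X : R * R -> R * R) : Prop :=
  [/\ {within closure D, continuous X},
   forall x, bd D x -> X x = 0,
   forall x, D x -> differentiable X x &
   exists G : R * R -> 'M[R]_2,
     (forall i j, {within closure D, continuous (fun x => G x i j)}) /\
     forall x, D x -> G x = jac X x].

Definition is_flow (D : set (R * R)) (X : R * R -> R * R)
    (Phi : R -> R * R -> R * R) : Prop :=
  forall x, closure D x -> Phi 0 x = x /\
    forall t : R, closure D (Phi t x) /\
      is_derive t (1 : R) (fun s => Phi s x) (X (Phi t x)).

Definition beta_admissible (beta : R -> R) (bmin bmax k K : R) : Prop :=
  [/\ (forall x : R, derivable beta x 1) /\ continuous (derive1 beta),
   [/\ 0 < bmin, 0 < bmax & forall x, bmin <= beta x <= bmax],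
   forall x y, 0 <= (beta x - beta y) * (x - y) &
   [/\ 0 < k, 0 < K & forall eta zeta : 'cV[R]_2,
     k * norm2 eta ^+ 2
       <= beta (norm2 zeta ^+ 2) * norm2 eta ^+ 2
          + 2 * derive1 beta (norm2 zeta ^+ 2) * `|dot zeta eta| ^+ 2
       <= K * norm2 eta ^+ 2]].

(* The fields below are attached to a map F of the plane, namely F = Phi_t. *)

Definition xi (F : R * R -> R * R) (x : R * R) : R := \det (jac F x).

Definition Amat (F : R * R -> R * R) (x : R * R) : 'M[R]_2 :=
  \det (jac F x) *: (invmx (jac F x) *m (invmx (jac F x))^T).

Definition Bmat (F : R * R -> R * R) (x : R * R) : 'M[R]_2 :=
  (invmx (jac F x))^T.

Definition is_solution (Omega Gamma : set (R * R)) (beta : R -> R)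
    (F : R * R -> R * R) (f : R * R -> R) (q : R) (u : R * R -> R) : Prop :=
  W1G Omega Gamma q u /\
  forall phi, W1G Omega Gamma (conj_exp q) phi ->
    Rintegral leb2 Omega (fun x =>
      beta (norm2 (Bmat F x *m wgrad Omega u x) ^+ 2)
        * dot (Amat F x *m wgrad Omega u x) (wgrad Omega phi x)
      + xi F x * u x * phi x)
    = Rintegral leb2 Omega (fun x => xi F x * f (F x) * phi x).

End data.

(* Main.v *)
Require Import Defs.
From HB Require Import structures.
From mathcomp Require Import all_boot all_order all_algebra.
From mathcomp Require Import all_classical all_reals all_analysis.
From mathcomp Require Import measurable_realfun.
From mathcomp Require Import ring lra.

Set Implicit Arguments.
Unset Strict Implicit.
Unset Printing Implicit Defensive.

Import Order.TTheory GRing.Theory Num.Theory.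
Import numFieldNormedType.Exports.

Local Open Scope classical_set_scope.
Local Open Scope ring_scope.

(* Write v = u_t - u_0, b(y) = beta(|y|^2) y, m = min(k,1), M = max(K,1) and
   kappa = 1 - m^2/M^2.  The bounds on the derivative of b say that
   y - (m/M^2) b(y) is a contraction with constant kappa; in the form
   |e . (y - z) - (m/M^2) e . (b(y) - b(z))| <= kappa |e| |y - z|
   this is the Cauchy-Schwarz inequality for a positive semidefinite quadratic
   form.  Subtracting the equations of u_t and u_0 therefore gives
     |<J v, w>| <= (kappa ||v|| + (m/M^2) (C t ||u_t|| + ||xi f o Phi_t - f||_q)) ||w||
   and, as M_q kappa < 1, the term kappa ||v|| is absorbed by the definition of
   M_q.  The W^1_q statements thus reduce to ||f o Phi_t - f||_q -> 0 for f in L_q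
   and to ||f o Phi_t - f||_q <= C t for f in W^1_q.

   Both rest on |Phi_t(E)| <= C |E|, which only uses that Phi_t is bi-Lipschitz:
   X vanishes on the boundary of D, so its extension by 0 is Lipschitz on the
   plane, although D itself is an arbitrary bounded open set.  The second one is
   Morrey's estimate on squares whose side is comparable to the displacement
   |Phi_t x - x|.

   Morrey's estimate compares averages against product bump kernels: the
   difference of two such kernels is the divergence of an explicit field with
   compact support, so the definition of the weak gradient applies directly.
   Along a sequence of squares shrinking to the vertex of a cone the comparison
   errors form a geometric series, which bounds the supremum norm on a
   Lipschitz domain by the W^1_q norm. *)

(** * The plane *)

(** The boundary of D is arbitrary, so f cannot be extended across it, and no chain rule for f o
    Phi_t is invoked. Both are replaced by one fact: the displacement Phi_t x - x is at most C t
    times the distance from x to any point outside D, so for small t the squares used in Morrey's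
    estimate stay inside D. Their sides vary with x, so the local energies are taken on windows of
    one radius r of order t; Tonelli turns their integral into (2 r)^2 times the total energy, and
    r^(q-2) r^2 = r^q becomes the rate t after the q-th root.

    The flow is given only through its integral curves. Convergence of its difference quotients in
    x, their distance C t from the identity and their measurability are derived before the
    transported coefficients can be used. Weak gradients are chosen values, so identities between
    them hold almost everywhere.

    The smallness hypothesis contains the square root of kappa, the estimate kappa itself: the
    derivative of b is symmetric, and kappa, lying in [0, 1], is at most its square root. On the
    right ||u_t|| is replaced by ||v|| + ||u_0||, and C t ||v|| is absorbed as well. *)

Section plane.
Context {R : realType}.
Implicit Types (x y z : R * R) (r : R) (U A : set (R * R)).

Definition obox z r : set (R * R) :=
  [set x | `|x.1 - z.1| < r /\ `|x.2 - z.2| < r].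
Definition cbox z r : set (R * R) :=
  [set x | `|x.1 - z.1| <= r /\ `|x.2 - z.2| <= r].

Lemma obox_cbox z r : obox z r `<=` cbox z r.
Proof. by move=> x [/ltW a /ltW b]. Qed.

Lemma cbox_obox z r s : r < s -> cbox z r `<=` obox z s.
Proof. by move=> rs x [a b]; split; apply: le_lt_trans rs. Qed.

Lemma ball_obox z r : ball z r = obox z r.
Proof.
apply/seteqP; split => x; rewrite /ball/= /prod_ball /ball/= /obox/=.
  by move=> [a b]; split; rewrite distrC.
by move=> [a b]; split; rewrite distrC.
Qed.

Lemma nbhs_obox U z : nbhs z U <-> exists2 r, 0 < r & obox z r `<=` U.
Proof.
rewrite -nbhs_ballE; split => -[r r0 rU]; exists r => //.
  by rewrite -ball_obox.
by rewrite ball_obox.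
Qed.

Lemma open_obox z r : open (obox z r).
Proof.
rewrite openE => x [x1 x2]; apply/nbhs_obox.
exists (Order.min (r - `|x.1 - z.1|) (r - `|x.2 - z.2|)).
  by rewrite lt_min !subr_gt0 x1 x2.
move=> y []; rewrite !lt_min => /andP[a _] /andP[_ b]; split.
  by have := ler_distD x.1 y.1 z.1; lra.
by have := ler_distD x.2 y.2 z.2; lra.
Qed.

Lemma nbhs_cbox U z : nbhs z U -> exists2 r, 0 < r & cbox z r `<=` U.
Proof.
move/nbhs_obox => [r r0 rU]; exists (r / 2); first lra.
by move=> x [a b]; apply: rU; split; lra.
Qed.

(** Rational centres and half-widths are coded by naturals; a code whose closed box leaves [U] is
    sent to one fixed good box, so that the family is indexed by all naturals. Closed boxes inside
    [U] are kept because local integrability only speaks of compact subsets. *)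
Lemma open_bigcup_obox U : open U -> U !=set0 ->
  exists (z : nat -> R * R) (r : nat -> R),
    (forall i, 0 < r i /\ cbox (z i) (r i) `<=` U) /\
    U = \bigcup_i obox (z i) (r i).
Proof.
move=> oU [p Up].
have /nbhs_cbox[rp rp0 rpU] : nbhs p U by apply: open_nbhs_nbhs.
pose c (t : rat * rat * rat) : (R * R) * R :=
  ((ratr t.1.1, ratr t.1.2), ratr t.2).
pose good (t : (R * R) * R) := `[< 0 < t.2 /\ cbox t.1 t.2 `<=` U >].
pose g (i : nat) := if unpickle i is Some t then
   if good (c t) then c t else (p, rp) else (p, rp).
exists (fun i => (g i).1), (fun i => (g i).2).
have H i : 0 < (g i).2 /\ cbox (g i).1 (g i).2 `<=` U.
  rewrite /g; case: unpickle => // t; case: ifPn => // /asboolP //.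
split=> //; apply/seteqP; split=> [x Ux|x [i _ /obox_cbox]]; last exact: (H i).2.
have /nbhs_cbox[r r0 rU] : nbhs x U by apply: open_nbhs_nbhs.
(* The centre moves by less than r/4, which is below [ratr q0], so x stays in the box; and every
   point of the closed box is within r/2 + r/4 < r of x. *)
have [q0 /itvP q0r] : exists q : rat, ratr q \in `]r / 4, r / 2[.
  by apply: rat_in_itvoo; lra.
have [q1 /itvP q1r] : exists q : rat, ratr q \in `](x.1 - r / 4), (x.1 + r / 4)[.
  by apply: rat_in_itvoo; lra.
have [q2 /itvP q2r] : exists q : rat, ratr q \in `](x.2 - r / 4), (x.2 + r / 4)[.
  by apply: rat_in_itvoo; lra.
exists (pickle (q1, q2, q0)) => //.
have G : good (c (q1, q2, q0)).
  apply/asboolP; split => /=.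
    by have : r / 4 < ratr q0 by [rewrite q0r]; rewrite /c/=; lra.
  move=> y [] /=; rewrite /c/= => a b; apply: rU; split.
    have := ler_distD (ratr q1) y.1 x.1; have : `|ratr q1 - x.1| < r / 4.
      by rewrite ltr_distl !q1r.
    have : ratr q0 < r / 2 by rewrite q0r.
    lra.
  have := ler_distD (ratr q2) y.2 x.2; have : `|ratr q2 - x.2| < r / 4.
    by rewrite ltr_distl !q2r.
  have : ratr q0 < r / 2 by rewrite q0r.
  lra.
rewrite /g pickleK G /obox/=.
have : r / 4 < ratr q0 by rewrite q0r.
have : `|x.1 - ratr q1| < r / 4 by rewrite distrC ltr_distl !q1r.
have : `|x.2 - ratr q2| < r / 4 by rewrite distrC ltr_distl !q2r.
move=> *; split; lra.
Qed.

Lemma oboxE z r : obox z r =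
  `](z.1 - r), (z.1 + r)[ `*` `](z.2 - r), (z.2 + r)[.
Proof. by apply/seteqP; split => x /=; rewrite /obox/= !in_itv/= !ltr_distl. Qed.

Lemma cboxE z r : cbox z r =
  `[(z.1 - r), (z.1 + r)] `*` `[(z.2 - r), (z.2 + r)].
Proof. by apply/seteqP; split => x /=; rewrite /cbox/= !in_itv/= !ler_distl. Qed.

Lemma measurable_obox z r : measurable (obox z r : set mplane).
Proof. by rewrite oboxE; apply: measurableX; exact: measurable_itv. Qed.

Lemma measurable_cbox z r : measurable (cbox z r : set mplane).
Proof. by rewrite cboxE; apply: measurableX; exact: measurable_itv. Qed.

Lemma open_mplane U : open U -> measurable (U : set mplane).
Proof.
move=> oU; have [->|/set0P U0] := eqVneq U set0; first exact: measurable0.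
have [z [r [_ ->]]] := open_bigcup_obox oU U0.
by apply: bigcup_measurable => i _; exact: measurable_obox.
Qed.

Lemma closed_mplane U : closed U -> measurable (U : set mplane).
Proof.
by move=> cU; rewrite -(setCK U); apply: measurableC; apply: open_mplane; rewrite openC.
Qed.

Lemma open_within_measurable U (f : R * R -> R) : open U ->
  {within U, continuous f} -> measurable_fun (U : set mplane) (f : mplane -> R).
Proof.
move=> oU; rewrite continuous_open_subspace// => cf.
apply: (measurability _ (measurable_realfun.RGenOpens.measurableE R)).
move=> _ [_ [a [b ->] <-]]; apply: open_mplane.
rewrite openE => x [Ux fx]; apply: filterI; first exact: open_nbhs_nbhs.
by apply: (cf x (mem_set Ux)); apply: open_nbhs_nbhs; split.
Qed.

Lemma continuous_mplane (f : R * R -> R) : continuous f ->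
  measurable_fun (setT : set mplane) (f : mplane -> R).
Proof.
by move=> cf; apply: open_within_measurable; [exact: openT|exact: continuous_subspaceT].
Qed.

Lemma continuous_mplane2 (F : R * R -> R * R) : continuous F ->
  measurable_fun (setT : set mplane) (F : mplane -> mplane).
Proof.
move=> cF; apply/measurable_fun_pairP; split; apply: continuous_mplane => x.
  by apply: continuous_comp; [exact: cF|exact: cvg_fst].
by apply: continuous_comp; [exact: cF|exact: cvg_snd].
Qed.

Lemma leb2_rect (I J : interval R) : leb2 ([set` I] `*` [set` J]) =
  (lebesgue_measure [set` I] * lebesgue_measure [set` J])%E.
Proof. by apply: product_measure1E; exact: measurable_itv. Qed.

Lemma leb2_cbox z r : 0 <= r -> leb2 (cbox z r) = ((2 * r) ^+ 2)%:E.
Proof.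
move=> r0; rewrite cboxE leb2_rect !lebesgue_measure_itv/= !lte_fin.
case: ltP => h1; last first.
  have -> : r = 0 by lra.
  by rewrite mul0e; congr EFin; rewrite mulr0 expr0n.
case: ltP => h2; last by exfalso; lra.
by rewrite -!EFinB -EFinM; congr EFin; ring.
Qed.

Lemma bounded_cbox A : bounded_set A -> exists2 r, 0 < r & A `<=` cbox 0 r.
Proof.
move=> /pinfty_ex_gt0[r r0 H]; exists r => // x Ax.
have := H _ Ax; rewrite /Num.norm/= ge_max => /andP[a b].
by split; rewrite /= subr0.
Qed.

Lemma bounded_leb2 A : bounded_set A -> measurable (A : set mplane) ->
  (leb2 A < +oo)%E.
Proof.
move=> /bounded_cbox[r r0 Ar] mA; apply: (@le_lt_trans _ _ (leb2 (cbox 0 r))).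
  by apply: le_measure; rewrite ?inE//; exact: measurable_cbox.
by rewrite leb2_cbox ?ltry// ltW.
Qed.

End plane.

(** * Smooth functions *)

Section smooth_line.
Context {R : realType}.
Implicit Types (f g : R -> R) (x : R).

(** Continuity is asked only at the last order, because on the line it follows from derivability;
    partial derivatives in the plane do not give it, whence the different shape of [Ck]. *)
Fixpoint C1n n f : Prop :=
  if n is n'.+1 then
    (forall x, derivable f x 1) /\ C1n n' (fun x => 'D_1 f x)
  else continuous f.

Definition smooth1 f : Prop := forall n, C1n n f.

Lemma derivable_continuous1 f : (forall x, derivable f x 1) -> continuous f.
Proof. by move=> df x; apply/differentiable_continuous/derivable1_diffP. Qed.

Lemma C1nS n f : C1n n.+1 f -> C1n n f.
Proof.
elim: n f => [f [df _]|n ih f [df cf]]; first exact: derivable_continuous1.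
by split => //; exact: ih.
Qed.

Lemma C1n_cst n c : C1n n (cst c : R -> R).
Proof.
elim: n c => [c|n ih c]; first exact: cst_continuous.
split; first by move=> x; exact: derivable_cst.
by rewrite (_ : (fun x => _) = cst 0) //; apply/funext => x; rewrite derive_cst.
Qed.

Lemma C1nD n f g : C1n n f -> C1n n g -> C1n n (fun x => f x + g x).
Proof.
elim: n f g => [f g cf cg x|n ih f g [df cf] [dg cg]]; first exact: cvgD (cf x) (cg x).
split; first by move=> x; exact: derivableD.
rewrite (_ : (fun x => _) = (fun x => 'D_1 f x + 'D_1 g x)); first exact: ih.
by apply/funext => x; rewrite (@deriveD _ _ _ f g).
Qed.

Lemma C1nM n f g : C1n n f -> C1n n g -> C1n n (fun x => f x * g x).
Proof.
elim: n f g => [f g cf cg x|n ih f g cf' cg']; first exact: cvgM (cf x) (cg x).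
have [df cf] := cf'; have [dg cg] := cg'.
split; first by move=> x; exact: derivableM.
rewrite (_ : (fun x => _) = (fun x => f x * 'D_1 g x + g x * 'D_1 f x)).
  by apply: C1nD; apply: ih => //; exact: C1nS.
by apply/funext => x; rewrite (@deriveM _ _ f g).
Qed.

Lemma C1nV n f : (forall x, f x != 0) -> C1n n f -> C1n n (fun x => (f x)^-1).
Proof.
move=> f0; elim: n => [cf x|n ih cf']; first exact: cvgV (f0 x) (cf x).
have [df cf] := cf'; split; first by move=> x; exact: derivableV.
rewrite (_ : (fun x => _) =
    (fun x => (-1) * ((f x)^-1 * ((f x)^-1 * 'D_1 f x)))).
  apply: C1nM; first exact: C1n_cst.
  by apply: C1nM; [exact/ih/C1nS|apply: C1nM => //; exact/ih/C1nS].
apply/funext => x; rewrite deriveV//= /GRing.scale/= expr2 invfM; ring.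
Qed.

Lemma is_derive_affine f a b x df : is_derive (a * x + b) 1 f df ->
  is_derive x 1 (fun x => f (a * x + b)) (a * df).
Proof.
move=> H; have H2 : is_derive x 1 (fun x => a * x + b) a.
  apply: is_derive_eq.
  by rewrite addr0 /GRing.scale/= mulr1.
apply: (is_derive_eq (@is_derive1_comp _ f (fun x => a * x + b) x _ _ H H2)).
by rewrite /GRing.scale/= mulrC.
Qed.

Lemma C1n_affine n f a b : C1n n f -> C1n n (fun x => f (a * x + b)).
Proof.
elim: n f => [f cf x|n ih f [df cf]].
  apply: (@continuous_comp _ _ _ (fun x => a * x + b) f); last exact: cf.
  by apply: cvgD; [apply: cvgM; [exact: cvg_cst|exact: cvg_id]|exact: cvg_cst].
have H x := is_derive_affine (derivableP (df (a * x + b))).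
split; first by move=> x; have [] := H x.
rewrite (_ : (fun x => _) = (fun x => a * 'D_1 f (a * x + b))).
  by apply: C1nM; [exact: C1n_cst|exact: (ih (fun x => 'D_1 f x))].
by apply/funext => x; have [] := H x.
Qed.

Lemma smooth1_derive f : smooth1 f -> smooth1 (fun x => 'D_1 f x).
Proof. by move=> sf n; have [] := sf n.+1. Qed.

(** The term of order n + 2 of the exponential series at 1/x bounds [expR x^-1] from below. The two
    spare powers give quadratic decay at 0, enough for a zero derivative there. *)
Lemma expRN_invX (n : nat) x : 0 < x -> x^-1 ^+ n * expR (- x^-1) <= n.+2`!%:R * x ^+ 2.
Proof.
move=> x0; have xi0 : 0 < x^-1 by rewrite invr_gt0.
rewrite expRN ler_pdivrMr ?expR_gt0//.
have /(le_trans _) H := expR_ge1Dxn n.+1 (ltW xi0).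
have : x^-1 ^+ n.+2 / n.+2`!%:R <= expR x^-1 by apply: H; lra.
rewrite ler_pdivrMr ?ltr0n ?fact_gt0// => H2.
rewrite -mulrA [_ ^+ 2 * _]mulrC mulrA [_%:R * _]mulrC -ler_pdivrMr ?exprn_gt0//.
by rewrite -exprVn -exprD addn2.
Qed.

(* The parameter p makes the family closed under derivation. *)
Definition flat (p : {poly R}) x : R :=
  if x <= 0 then 0 else p.[x^-1] * expR (- x^-1).

Lemma flat_bound (p : {poly R}) : exists2 C, 0 <= C & forall x, `|flat p x| <= C * x ^+ 2.
Proof.
exists (\sum_(i < size p) `|p`_i| * i.+2`!%:R).
  by apply: sumr_ge0 => i _; rewrite mulr_ge0.
move=> x; rewrite /flat; case: (leP x 0) => x0 /=.
  rewrite normr0 mulr_ge0 ?sqr_ge0//.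
  by apply: sumr_ge0 => i _; rewrite mulr_ge0.
rewrite normrM (ger0_norm (expR_ge0 _)) horner_coef.
apply: (@le_trans _ _ ((\sum_(i < size p) `|p`_i| * x^-1 ^+ i) * expR (- x^-1))).
  rewrite ler_wpM2r ?expR_ge0//; apply: le_trans (ler_norm_sum _ _ _) _.
  apply: ler_sum => i _; rewrite normrM normrX (@ger0_norm _ x^-1)//.
  by rewrite invr_ge0 ltW.
rewrite !mulr_suml; apply: ler_sum => i _.
by rewrite -!mulrA ler_wpM2l// expRN_invX.
Qed.

Lemma is_derive_quad f C : (forall x, `|f x| <= C * x ^+ 2) -> is_derive (0 : R) (1 : R) f 0.
Proof.
move=> H; have f0 : f 0 = 0.
  by apply/eqP; rewrite -normr_le0 (le_trans (H 0))// expr0n mulr0.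
have C0 : 0 <= C by have := H 1; rewrite expr1n mulr1; apply: le_trans.
suff F : (fun h => h^-1 *: (f (h *: 1 + 0) - f 0)) @ 0^' --> (0 : R).
  by apply: DeriveDef; [apply/cvg_ex; exists 0|exact: cvg_lim F].
apply/cvgrPdist_le => e e0.
have Ce : 0 < e / (C + 1) by rewrite divr_gt0// ltr_wpDl.
near=> h; rewrite sub0r normrN f0 subr0 addr0 /GRing.scale/= mulr1.
have h0 : h != 0 by near: h; exact: nbhs_dnbhs_neq.
rewrite normrM normfV ler_pdivrMl ?normr_gt0//.
apply: le_trans (H h) _; rewrite -real_normK ?num_real// expr2 mulrA.
rewrite [X in _ <= X]mulrC ler_wpM2r//.
have : `|h| <= e / (C + 1).
  near: h; apply: dnbhs0_le => //.
rewrite ler_pdivlMr; last by rewrite ltr_wpDl.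
have := normr_ge0 h; nra.
Unshelve. all: by end_near. Qed.

(** For x > 0 the chain rule gives x^-2 (p - p')(1/x) exp(-1/x), which is again of the form [flat];
    at 0 the quadratic bound of [flat_bound] forces the derivative 0. *)
Lemma is_derive_flat (p : {poly R}) x :
  is_derive x 1 (flat p) (flat ('X^2 * (p - p^`())) x).
Proof.
case: (ltgtP x 0) => x0.
- rewrite {2}/flat (ltW x0); apply: (near_eq_is_derive (f := cst 0)).
    near=> y; rewrite /flat; suff -> : y <= 0 by [].
    by apply/ltW; near: y; exact: lt_nbhsl.
- pose F := fun y : R => p.[y^-1] * expR (- y^-1).
  have -> : flat ('X^2 * (p - p^`())) x =
     x^-1 ^+ 2 * (p.[x^-1] - p^`().[x^-1]) * expR (- x^-1).
    by rewrite /flat leNgt x0/= !hornerE.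
  apply: (near_eq_is_derive (f := F)).
    near=> y; rewrite /flat leNgt; suff -> : 0 < y by [].
    by near: y; exact: lt_nbhsr.
  have D1 : is_derive x 1 (fun y => y^-1) (- x^-1 ^+ 2).
    have := @is_deriveV _ id x 1 1 (lt0r_neq0 x0) (is_derive_id _ _).
    by rewrite /GRing.scale/= mulr1 exprVn.
  have D2 : is_derive x^-1 1 (horner p) p^`().[x^-1].
    apply: DeriveDef; first exact: derivable_horner.
    by rewrite derivE derive1E.
  have D3 := @is_derive1_comp _ _ _ _ _ _ D2 D1.
  have D1' : is_derive x 1 (fun y : R => - y^-1) (x^-1 ^+ 2).
    by apply: (is_derive_eq (is_deriveN D1)); rewrite opprK.
  have D4 := @is_derive1_comp _ expR (fun y => - y^-1) _ _ _ (is_derive_expR (- x^-1)) D1'.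
  apply: (is_derive_eq (is_deriveM D3 D4)).
  by rewrite /GRing.scale/=; ring.
- rewrite x0 {2}/flat lexx.
  have [C _] := flat_bound p; exact: is_derive_quad.
Unshelve. all: by end_near. Qed.

Lemma smooth1_flat p : smooth1 (flat p).
Proof.
move=> n; elim: n p => [p|n ih p].
  by apply: derivable_continuous1 => x; have [] := is_derive_flat p x.
split; first by move=> x; have [] := is_derive_flat p x.
rewrite (_ : (fun x => _) = flat ('X^2 * (p - p^`()))); first exact: ih.
by apply/funext => x; have [] := is_derive_flat p x.
Qed.

Definition theta x : R := flat 1 x.

Lemma theta0 x : x <= 0 -> theta x = 0.
Proof. by rewrite /theta /flat => ->. Qed.

Lemma thetaE x : 0 < x -> theta x = expR (- x^-1).
Proof. by move=> x0; rewrite /theta /flat leNgt x0/= hornerE mul1r. Qed.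

Lemma theta_gt0 x : 0 < x -> 0 < theta x.
Proof. by move=> x0; rewrite thetaE// expR_gt0. Qed.

Lemma theta_ge0 x : 0 <= theta x.
Proof. by case: (leP x 0) => [/theta0->//|/theta_gt0/ltW]. Qed.

Lemma theta_le1 x : theta x <= 1.
Proof.
case: (leP x 0) => [/theta0->//|x0].
by rewrite thetaE// expR_le1 oppr_le0 invr_ge0 ltW.
Qed.

Definition step x : R := theta (1 + x) / (theta (1 + x) + theta (1 - x)).

Let step_den x : 0 < theta (1 + x) + theta (1 - x).
Proof.
have := theta_ge0 (1 + x); have := theta_ge0 (1 - x).
case: (leP x 0) => x0 ? ?.
  by have : 0 < theta (1 - x); [apply: theta_gt0|]; lra.
by have : 0 < theta (1 + x); [apply: theta_gt0|]; lra.
Qed.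

Lemma smooth1_step : smooth1 step.
Proof.
move=> n; have A : C1n n (fun x => theta (1 + x)).
  rewrite (_ : (fun x => _) = fun x => theta (1 * x + 1)).
    by apply: C1n_affine; exact: smooth1_flat.
  by apply/funext => x; rewrite mul1r addrC.
apply: C1nM => //; apply: C1nV => [x|]; first by rewrite gt_eqF.
apply: C1nD => //.
rewrite (_ : (fun x => _) = fun x => theta (-1 * x + 1)).
  by apply: C1n_affine; exact: smooth1_flat.
by apply/funext => x; rewrite mulN1r addrC.
Qed.

Lemma step0 x : x <= -1 -> step x = 0.
Proof. by move=> x1; rewrite /step (@theta0 (1 + x)) ?mul0r//; lra. Qed.

Lemma step1 x : 1 <= x -> step x = 1.
Proof.
move=> x1; have := step_den x; rewrite /step (@theta0 (1 - x)); last lra.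
by rewrite addr0 => /lt0r_neq0 ?; rewrite divff.
Qed.

Lemma step_itv x : 0 <= step x <= 1.
Proof.
have d0 := step_den x; rewrite /step divr_ge0 ?theta_ge0 ?(ltW d0)//=.
by rewrite ler_pdivrMr// mul1r lerDl theta_ge0.
Qed.

(** The kernel is a derivative by construction, so its primitive is explicit: its integral is 1 by
    the fundamental theorem, and the difference of two rescaled kernels is the derivative of a
    difference of steps, which has compact support. *)
Definition bumpf x : R := 'D_1 step x.

Lemma is_derive_step x : is_derive x 1 step (bumpf x).
Proof. by apply: derivableP; have [] := smooth1_step 1%N. Qed.

Lemma smooth1_bumpf : smooth1 bumpf.
Proof. exact: smooth1_derive smooth1_step. Qed.

Lemma bumpf0 x : 1 < `|x| -> bumpf x = 0.
Proof.
move=> x1.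
have [xl|xr] := leP x 0.
  have xl1 : x < -1 by rewrite ler0_norm// in x1; lra.
  have : is_derive x 1 step 0.
    apply: (near_eq_is_derive (f := cst 0)).
    near=> y; rewrite /= step0//; apply/ltW; near: y; exact: lt_nbhsl.
  by move=> [_].
have xr1 : 1 < x by rewrite gtr0_norm in x1.
have : is_derive x 1 step 0.
  apply: (near_eq_is_derive (f := cst (1 : R))).
  near=> y; rewrite /= step1//; apply/ltW; near: y; exact: lt_nbhsr.
by move=> [_].
Unshelve. all: by end_near. Qed.

Lemma bumpf_bounded : exists2 M, 0 < M & forall x, `|bumpf x| <= M.
Proof.
have cb : {within `[-1, 1], continuous bumpf}.
  by apply: continuous_subspaceT; exact: (smooth1_bumpf 0%N).
have /compact_bounded /pinfty_ex_gt0[M M0 HM] :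
   compact (bumpf @` `[-1, 1]).
  by apply: continuous_compact => //; exact: segment_compact.
exists M => // x; have [x1|x1] := leP `|x| 1; last by rewrite bumpf0// normr0 ltW.
by apply: HM; exists x => //=; rewrite in_itv/= -ler_norml.
Qed.

End smooth_line.

(** * Smooth functions of two variables and test functions *)

Section smooth_plane.
Context {R : realType}.
Implicit Types (f g : R * R -> R) (h : R -> R) (x z : R * R) (i : 'I_2).

Lemma CkS n f : Ck n.+1 f -> Ck n f.
Proof.
elim: n f => [f []//|n ih f [cf H]]; split=> // i.
by have [df /ih] := H i.
Qed.

Lemma Ck_cst n (c : R) : Ck n (cst c).
Proof.
elim: n c => [c|n ih c]; first exact: cst_continuous.
split; first exact: cst_continuous.
move=> i; split; first by move=> x; exact: derivable_cst.
by rewrite (_ : 'D_(basis2 i) _ = cst 0) //; apply/funext => x; rewrite derive_cst.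
Qed.

Lemma CkD n f g : Ck n f -> Ck n g -> Ck n (fun x => f x + g x).
Proof.
elim: n f g => [f g cf cg x|n ih f g [cf Hf] [cg Hg]]; first exact: cvgD (cf x) (cg x).
split=> [x|i]; first exact: cvgD (cf x) (cg x).
have [df Df] := Hf i; have [dg Dg] := Hg i.
split; first by move=> x; exact: derivableD.
rewrite (_ : 'D_(basis2 i) _ = (fun x => 'D_(basis2 i) f x + 'D_(basis2 i) g x)).
  exact: ih.
by apply/funext => x; rewrite (@deriveD _ _ _ f g).
Qed.

Lemma CkM n f g : Ck n f -> Ck n g -> Ck n (fun x => f x * g x).
Proof.
elim: n f g => [f g cf cg x|n ih f g Cf Cg]; first exact: cvgM (cf x) (cg x).
have [cf Hf] := Cf; have [cg Hg] := Cg.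
split=> [x|i]; first exact: cvgM (cf x) (cg x).
have [df Df] := Hf i; have [dg Dg] := Hg i.
split; first by move=> x; exact: derivableM.
rewrite (_ : 'D_(basis2 i) _ =
    (fun x => f x * 'D_(basis2 i) g x + g x * 'D_(basis2 i) f x)).
  by apply: CkD; apply: ih => //; exact: CkS.
by apply/funext => x; rewrite (@deriveM _ _ f g).
Qed.

Lemma basis2_0 : basis2 (0 : 'I_2) = (1, 0) :> R * R. Proof. by []. Qed.
Lemma basis2_1 : basis2 (1 : 'I_2) = (0, 1) :> R * R. Proof. by []. Qed.

Lemma ord2P i : {i = 0} + {i = 1}.
Proof. by case: i => -[|[|//]] Hi; [left|right]; exact/val_inj. Qed.

Lemma is_derive_fst1 h x d : is_derive x.1 1 h d ->
  is_derive x (1, 0) (fun y => h y.1) d.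
Proof. by case=> A B; split. Qed.

Lemma is_derive_snd1 h x d : is_derive x.2 1 h d ->
  is_derive x (0, 1) (fun y => h y.2) d.
Proof. by case=> A B; split. Qed.

Lemma is_derive_fst0 h x : is_derive x (0, 1) (fun y => h y.1) 0.
Proof.
have H : (fun y : R => y^-1 *: (h (y *: (0 : R) + x.1) - h x.1)) = cst 0.
  by apply/funext => y; rewrite scaler0 add0r subrr scaler0.
split; rewrite /derivable /derive /=; rewrite [X in X @ _]H.
  exact: is_cvg_cst.
exact: lim_cst.
Qed.

Lemma is_derive_snd0 h x : is_derive x (1, 0) (fun y => h y.2) 0.
Proof.
have H : (fun y : R => y^-1 *: (h (y *: (0 : R) + x.2) - h x.2)) = cst 0.
  by apply/funext => y; rewrite scaler0 add0r subrr scaler0.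
split; rewrite /derivable /derive /=; rewrite [X in X @ _]H.
  exact: is_cvg_cst.
exact: lim_cst.
Qed.

Lemma Ck_fst n h : C1n n h -> Ck n (fun x => h x.1).
Proof.
elim: n h => [h ch x|n ih h [dh Dh]].
  by apply: continuous_comp; [exact: cvg_fst|exact: ch].
split.
  move=> x; apply: continuous_comp; first exact: cvg_fst.
  exact: derivable_continuous1.
move=> i; case: (ord2P i) => ->.
  rewrite basis2_0; have H x := is_derive_fst1 (derivableP (dh x.1)).
  split; first by move=> x; have [] := H x.
  rewrite (_ : 'D_ _ _ = (fun x => 'D_1 h x.1)).
    exact: (ih _ Dh).
  by apply/funext => x; have [] := H x.
rewrite basis2_1; have H x := is_derive_fst0 h x.
split; first by move=> x; have [] := H x.
rewrite (_ : 'D_ _ _ = cst 0); first exact: Ck_cst.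
by apply/funext => x; have [] := H x.
Qed.

Lemma Ck_snd n h : C1n n h -> Ck n (fun x => h x.2).
Proof.
elim: n h => [h ch x|n ih h [dh Dh]].
  by apply: continuous_comp; [exact: cvg_snd|exact: ch].
split.
  move=> x; apply: continuous_comp; first exact: cvg_snd.
  exact: derivable_continuous1.
move=> i; case: (ord2P i) => ->; last first.
  rewrite basis2_1; have H x := is_derive_snd1 (derivableP (dh x.2)).
  split; first by move=> x; have [] := H x.
  rewrite (_ : 'D_ _ _ = (fun x => 'D_1 h x.2)).
    exact: (ih _ Dh).
  by apply/funext => x; have [] := H x.
rewrite basis2_0; have H x := is_derive_snd0 h x.
split; first by move=> x; have [] := H x.
rewrite (_ : 'D_ _ _ = cst 0); first exact: Ck_cst.
by apply/funext => x; have [] := H x.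
Qed.

Lemma smooth_cst c : smooth (cst c : R * R -> R).
Proof. by move=> n; exact: Ck_cst. Qed.

Lemma smoothD f g : smooth f -> smooth g -> smooth (fun x => f x + g x).
Proof. by move=> sf sg n; exact: CkD. Qed.

Lemma smoothM f g : smooth f -> smooth g -> smooth (fun x => f x * g x).
Proof. by move=> sf sg n; exact: CkM. Qed.

Lemma smooth_fst h : smooth1 h -> smooth (fun x => h x.1).
Proof. by move=> sh n; exact: Ck_fst. Qed.

Lemma smooth_snd h : smooth1 h -> smooth (fun x => h x.2).
Proof. by move=> sh n; exact: Ck_snd. Qed.

Lemma smooth_scale c f : smooth f -> smooth (fun x => c * f x).
Proof. by move=> sf; apply: smoothM => //; exact: (smooth_cst c). Qed.

Lemma smoothB f g : smooth f -> smooth g -> smooth (fun x => f x - g x).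
Proof.
move=> sf sg; rewrite (_ : (fun x => _) = (fun x => f x + (-1) * g x)).
  by apply: smoothD => //; exact: smooth_scale.
by apply/funext => x; rewrite mulN1r.
Qed.

Lemma smooth_continuous f : smooth f -> continuous f.
Proof. by move=> /(_ 0%N). Qed.

Lemma smooth_derivable f i x : smooth f -> derivable f x (basis2 i).
Proof. by move=> /(_ 1%N)[_ /(_ i)[]]. Qed.

Lemma smooth_derive f i : smooth f -> smooth ('D_(basis2 i) f).
Proof. by move=> sf n; have [_ /(_ i)[]] := sf n.+1. Qed.

Lemma gradE f x i : grad f x i 0 = 'D_(basis2 i) f x.
Proof. by rewrite mxE. Qed.

Lemma compact_cbox z r : compact (cbox z r).
Proof. by rewrite cboxE; apply: compact_setX; exact: segment_compact. Qed.

Lemma closed_cbox z r : closed (cbox z r).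
Proof. by apply: compact_closed; [exact: norm_hausdorff|exact: compact_cbox]. Qed.

Lemma smooth1_affine h a b : smooth1 h -> smooth1 (fun t => h (a * t + b)).
Proof. by move=> sh n; exact: C1n_affine. Qed.

Lemma smooth1M h k : smooth1 h -> smooth1 k -> smooth1 (fun t => h t * k t).
Proof. by move=> sh sk n; exact: C1nM. Qed.

Lemma smooth1B h k : smooth1 h -> smooth1 k -> smooth1 (fun t => h t - k t).
Proof.
move=> sh sk n; rewrite (_ : (fun t => _) = (fun t => h t + (-1) * k t)).
  by apply: C1nD => //; apply: C1nM => //; exact: C1n_cst.
by apply/funext => x; rewrite mulN1r.
Qed.

Lemma smooth1_cst c : smooth1 (cst c : R -> R).
Proof. by move=> n; exact: C1n_cst. Qed.

Lemma test_function_cbox Omega f z r : smooth f ->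
  (forall x, ~ cbox z r x -> f x = 0) -> cbox z r `<=` Omega ->
  test_function Omega f.
Proof.
move=> sf f0 sub.
have S : tsupp f `<=` cbox z r.
  rewrite /tsupp (closure_id (cbox z r)).1; last exact: closed_cbox.
  apply: closure_subset => x /= /eqP fx; apply: contrapT => H.
  by apply: fx; exact: f0.
split => //; last exact: subset_trans sub.
apply: (@subclosed_compact _ _ (cbox z r)) => //; first exact: closed_closure.
exact: compact_cbox.
Qed.

Lemma tsupp0 f x : ~ tsupp f x -> f x = 0.
Proof.
move=> H; apply: contrapT => /eqP fx; apply: H; exact: subset_closure.
Qed.

Lemma compact_bounded_norm (A : set (R * R)) f : compact A -> continuous f ->
  exists2 M, 0 < M & forall x, A x -> `|f x| <= M.
Proof.
move=> cA cf; have /compact_bounded /pinfty_ex_gt0[M M0 HM] : compact (f @` A).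
  by apply: continuous_compact => //; exact: continuous_subspaceT.
by exists M => // x Ax; apply: HM; exists x.
Qed.

Lemma test_function_bounded Omega f : test_function Omega f ->
  exists2 M, 0 < M & forall x, `|f x| <= M.
Proof.
move=> [sf cf _]; have [M M0 H] := compact_bounded_norm cf (smooth_continuous sf).
exists M => // x; have [/H//|] := pselect (tsupp f x).
by move/tsupp0 => ->; rewrite normr0 ltW.
Qed.

Lemma derive_tsupp f i x : ~ tsupp f x -> 'D_(basis2 i) f x = 0.
Proof.
move=> H; rewrite -(derive_cst (0 : R) x (basis2 i)).
apply: near_eq_derive.
have : open (~` tsupp f) by rewrite openC; exact: closed_closure.
move=> oT; have : nbhs x (~` tsupp f) by apply: open_nbhs_nbhs.
by apply: filterS => y /tsupp0.
Qed.

End smooth_plane.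

Lemma continuous_pair (T : topologicalType) (R : realType) (f g : T -> R) x :
  {for x, continuous f} -> {for x, continuous g} ->
  {for x, continuous (fun t => (f t, g t))}.
Proof.
move=> cf cg.
exact: (@cvg_pair T R R (nbhs x) (nbhs (f x)) (nbhs (g x)) _ _ _ f g cf cg).
Qed.

Lemma cvg_Rintegral_dominated d (T : measurableType d) (R : realType)
    (mu : {measure set T -> \bar R}) (D : set T) (f_ : nat -> T -> R) (f g : T -> R) :
  measurable D -> (forall n, measurable_fun D (f_ n)) -> measurable_fun D f ->
  (forall x, D x -> f_ ^~ x @ \oo --> f x) ->
  mu.-integrable D (EFin \o g) ->
  (forall n x, D x -> `|f_ n x| <= g x) ->
  (fun n => Rintegral mu D (f_ n)) @ \oo --> Rintegral mu D f.
Proof.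
move=> mD mf_ mf ff ig fg.
have [If _ H] : [/\ mu.-integrable D (EFin \o f), 
  [sequence (\int[mu]_(x in D) (`| (EFin \o f_ n) x - (EFin \o f) x|))%E]_n @ \oo --> 0%E &
  [sequence (\int[mu]_(x in D) ((EFin \o f_ n) x))%E]_n @ \oo --> (\int[mu]_(x in D) (EFin \o f) x)%E ].
  apply: (@dominated_convergence _ _ _ mu D mD (fun n => EFin \o f_ n) (EFin \o f) (EFin \o g)) => //.
  - by move=> n; exact/measurable_EFinP.
  - exact/measurable_EFinP.
  - by apply/aeW => x Dx; apply: cvg_EFin (ff x Dx); exact: nearW.
  - by apply/aeW => x n Dx; rewrite /= lee_fin; exact: fg.
by apply: fine_cvg; rewrite fineK//; exact: integrable_fin_num.
Qed.

Lemma aeS d (T : measurableType d) (R : realType)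
    (mu : {measure set T -> \bar R}) (P Q : T -> Prop) :
  (forall x, P x -> Q x) -> {ae mu, forall x, P x} -> {ae mu, forall x, Q x}.
Proof. by move=> PQ; apply: (@filterS _ _ (ae_filter_ringOfSetsType mu)). Qed.

Lemma ae_and d (T : measurableType d) (R : realType)
    (mu : {measure set T -> \bar R}) (P Q : T -> Prop) :
  {ae mu, forall x, P x} -> {ae mu, forall x, Q x} ->
  {ae mu, forall x, P x /\ Q x}.
Proof. exact: (@filterI _ _ (ae_filter_ringOfSetsType mu)). Qed.

Lemma integrable_dominated d (T : measurableType d) (R : realType)
    (mu : {measure set T -> \bar R}) (D : set T) (f g : T -> R) :
  measurable D -> measurable_fun D f ->
  (forall x, D x -> `|f x| <= `|g x|) -> mu.-integrable D (EFin \o g) ->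
  mu.-integrable D (EFin \o f).
Proof.
move=> mD mf fg; apply: le_integrable => //; exact/measurable_EFinP.
Qed.

(** * Uniqueness of weak gradients *)

Section generators.
Context {R : realType}.

Definition orect (a b c d : R) : set (R * R) := `]a, b[ `*` `]c, d[.

Lemma measurable_orect a b c d : measurable (orect a b c d : set mplane).
Proof. by apply: measurableX; exact: measurable_itv. Qed.

(** One inclusion is [open_mplane]. For the other, the identity from the Borel structure to the
    product structure is measurable as soon as both projections are. *)
Lemma mplane_open : @measurable _ (@mplane R) = <<s [set U | open (U : set (R * R))] >>.
Proof.
apply/seteqP; split; last first.
  by apply: smallest_sub; [exact: sigma_algebra_measurable|move=> U; exact: open_mplane].
pose T := g_sigma_algebraType [set U | open (U : set (R * R))].
have : measurable_fun (setT : set T) (id : T -> mplane).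
  apply/measurable_fun_pairP; split;
    apply: (measurability _ (measurable_realfun.RGenOpens.measurableE R));
    move=> _ [_ [a [b ->] <-]]; rewrite setTI; apply: sub_sigma_algebra => /=.
    by apply: open_comp => [x _|]; [exact: cvg_fst|exact: interval_open].
  by apply: open_comp => [x _|]; [exact: cvg_snd|exact: interval_open].
by move=> H A mA; have := H measurableT A mA; rewrite setTI.
Qed.

(** Rectangles instead of the squares [obox]: the Dynkin argument needs a generating family closed
    under intersection. *)
Definition orects : set (set (R * R)) :=
  [set A | exists a b c d, A = orect a b c d].

Lemma mplane_orects : @measurable _ (@mplane R) = <<s orects >>.
Proof.
apply/seteqP; split; last first.
  apply: smallest_sub; first exact: sigma_algebra_measurable.
  by move=> _ [a [b [c [d ->]]]]; exact: measurable_orect.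
rewrite mplane_open; apply: smallest_sub; first exact: smallest_sigma_algebra.
move=> U oU; have [->|/set0P U0] := eqVneq U set0.
  by have [] := smallest_sigma_algebra setT orects.
have [z [r [_ ->]]] := open_bigcup_obox oU U0.
apply: sigma_algebra_bigcup => i; apply: sub_sigma_algebra.
by rewrite oboxE; do 4 eexists.
Qed.

Lemma orectI a b c d a' b' c' d' : orect a b c d `&` orect a' b' c' d' =
  orect (Order.max a a') (Order.min b b') (Order.max c c') (Order.min d d').
Proof.
apply/seteqP; split => x; rewrite /orect/= !in_itv/= !gt_max !lt_min.
  by move=> [[/andP[-> ->] /andP[-> ->]] [/andP[-> ->] /andP[-> ->]]].
by move=> [/andP[/andP[-> ->] /andP[-> ->]] /andP[/andP[-> ->] /andP[-> ->]]].
Qed.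

Lemma orects_setI : setI_closed orects.
Proof.
move=> _ _ [a [b [c [d ->]]]] [a' [b' [c' [d' ->]]]].
by rewrite orectI; do 4 eexists.
Qed.

End generators.

Section du_bois_reymond.
Context {R : realType}.
Implicit Types (Omega : set (R * R)) (g u v phi : R * R -> R).

Lemma loc_integrable_test Omega g phi : open Omega -> loc_integrable Omega g ->
  test_function Omega phi ->
  leb2.-integrable Omega (EFin \o (fun x => g x * phi x)).
Proof.
move=> oO [mg ig] tphi; have [sphi cphi sub] := tphi.
have mO := open_mplane oO.
have mS : measurable (tsupp phi : set mplane).
  by apply: closed_mplane; exact: closed_closure.
have [M M0 HM] := test_function_bounded tphi.
have I1 : leb2.-integrable (tsupp phi) (EFin \o g).
  apply/integrableP; split; last exact: ig.
  by apply/measurable_EFinP; exact: measurable_funS mg.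
have I2 : leb2.-integrable Omega (EFin \o (g \_ (tsupp phi))).
  rewrite -restrict_EFin; apply/(integrable_restrict leb2 mS mO).
  by rewrite setIidr.
apply: (@integrable_dominated _ mplane _ leb2 Omega _ (fun x => M * (g \_ (tsupp phi)) x)) => //.
- apply: measurable_funM => //; apply: measurable_funTS.
  by apply: continuous_mplane; exact: smooth_continuous.
- move=> x Ox; rewrite /patch; case: ifPn; rewrite ?inE ?notin_setE => Sx.
    by rewrite !normrM mulrC ler_wpM2r// (le_trans (HM x))// ler_norm.
  by rewrite (@tsupp0 _ phi)// !mulr0.
- rewrite (_ : EFin \o _ = (fun x => M%:E * (EFin \o (g \_ (tsupp phi))) x)%E) //.
  exact: integrableZl.
Qed.

(** The indicator of the rectangle is a pointwise limit of test functions with values in [0, 1] and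
    support in [cbox z r]; dominated convergence carries the hypothesis over to it. *)
Lemma integral_orect0 Omega g a b c d z r : open Omega -> loc_integrable Omega g ->
  (forall phi, test_function Omega phi -> Rintegral leb2 Omega (fun x => g x * phi x) = 0) ->
  orect a b c d `<=` cbox z r -> cbox z r `<=` Omega ->
  Rintegral leb2 (orect a b c d) g = 0.
Proof.
move=> oO lg H sub1 sub2; have [mg ig] := lg.
have mO := open_mplane oO.
(* One factor per side of the rectangle: [theta] vanishes on nonpositive numbers, and
   [theta (n.+1%:R * y)] tends to 1 for every y > 0. *)
pose phi n x : R :=
  theta (n.+1%:R * x.1 + - (n.+1%:R * a)) * theta (- n.+1%:R * x.1 + n.+1%:R * b)
  * (theta (n.+1%:R * x.2 + - (n.+1%:R * c)) * theta (- n.+1%:R * x.2 + n.+1%:R * d)).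
have sth : smooth1 (theta : R -> R) by exact: smooth1_flat.
have sphi n : smooth (phi n).
  apply: smoothM; apply: smoothM;
    [apply: (smooth_fst (h := fun t => theta (_ * t + _)))
    |apply: (smooth_fst (h := fun t => theta (_ * t + _)))
    |apply: (smooth_snd (h := fun t => theta (_ * t + _)))
    |apply: (smooth_snd (h := fun t => theta (_ * t + _)))]; exact: smooth1_affine.
have phi0 n x : ~ orect a b c d x -> phi n x = 0.
  rewrite /orect/= !in_itv/= => /not_andP nx; rewrite /phi.
  have n0 : (0 : R) <= n.+1%:R by [].
  case: nx => /negP; rewrite negb_and -!leNgt => /orP[] nx.
  - by rewrite theta0 ?mul0r//; nra.
  - by rewrite (@theta0 _ (- _ * _ + _)) ?mulr0 ?mul0r//; nra.
  - by rewrite (@theta0 _ (_ * x.2 - _)) ?mulr0 ?mul0r ?mulr0//; nra.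
  - by rewrite (@theta0 _ (- _ * x.2 + _)) ?mulr0//; nra.
have phi1 n x : 0 <= phi n x <= 1.
  by rewrite /phi; do 3 (apply/andP; split; [rewrite ?mulr_ge0 ?theta_ge0//|
     rewrite ?mulr_ile1 ?mulr_ge0 ?theta_ge0 ?theta_le1//]).
have tphi n : test_function Omega (phi n).
  apply: (test_function_cbox (sphi n) _ sub2) => x Nx; apply: phi0 => Rx.
  by apply: Nx; exact: sub1.
have lim_th (y : R) : 0 < y -> theta (n.+1%:R * y) @[n --> \oo] --> (1 : R).
  move=> y0; suff : theta (n.+1%:R * y) @[n --> \oo] --> expR (- (y^-1 * 0)).
    by rewrite mulr0 oppr0 expR0.
  have -> : (fun n => theta (n.+1%:R * y)) = fun n : nat => expR (- (y^-1 * n.+1%:R^-1)).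
    apply/funext => n; rewrite thetaE; last exact: mulr_gt0.
    by rewrite invfM mulrC.
  apply: continuous_cvg; first exact: continuous_expR.
  by apply: cvgN; apply: cvgM; [exact: cvg_cst|exact: cvg_harmonic].
have phi_lim x : orect a b c d x -> phi n x @[n --> \oo] --> (1 : R).
  rewrite /orect/= !in_itv/= => -[/andP[ax xb] /andP[cx xd]].
  have -> : phi ^~ x = fun n : nat => theta (n.+1%:R * (x.1 - a)) * theta (n.+1%:R * (b - x.1))
    * (theta (n.+1%:R * (x.2 - c)) * theta (n.+1%:R * (d - x.2))).
    by apply/funext => n; rewrite /phi; congr (theta _ * theta _ * (theta _ * theta _)); ring.
  rewrite [X in _ --> X](_ : 1 = 1 * 1 * (1 * 1)); last by rewrite !mulr1.
  apply: cvgM; apply: cvgM; apply: lim_th; rewrite ?subr_gt0//.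
have mR : measurable (orect a b c d : set mplane) by exact: measurable_orect.
have RO : orect a b c d `<=` Omega by exact: subset_trans sub2.
have IQ : leb2.-integrable Omega (EFin \o (g \_ (orect a b c d))).
  rewrite -restrict_EFin; apply/(integrable_restrict leb2 mR mO).
  rewrite setIidr//; apply: (integrableS (measurable_cbox z r) mR sub1).
  apply/integrableP; split; last by apply: ig => //; exact: compact_cbox.
  apply/measurable_EFinP; apply: measurable_funS mg => //.
have : (fun n => Rintegral leb2 Omega (fun x => g x * phi n x)) @ \oo -->
  Rintegral leb2 Omega (g \_ (orect a b c d)).
  apply: (@cvg_Rintegral_dominated _ mplane _ leb2 Omega _ _ (fun x => `|(g \_ (orect a b c d)) x|)) => //.
  - move=> n; apply: measurable_funM => //; apply: measurable_funTS.
    by apply: continuous_mplane; exact: smooth_continuous.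
  - by have /measurable_int/measurable_EFinP := IQ.
  - move=> x Ox; rewrite /patch; case: ifPn; rewrite ?inE ?notin_setE => Rx.
      by rewrite -{2}(mulr1 (g x)); apply: cvgM; [exact: cvg_cst|exact: phi_lim].
    by under eq_fun do rewrite phi0// mulr0; exact: cvg_cst.
  - exact: integrable_norm.
  - move=> n x Ox; rewrite /patch; case: ifPn; rewrite ?inE ?notin_setE => Rx.
      by have /andP[? ?] := phi1 n x; rewrite normrM ler_piMr// ger0_norm.
    by rewrite phi0// mulr0.
under eq_fun do rewrite (H _ (tphi _)).
rewrite -Rintegral_mkcondr setIidr// => L.
by apply: (cvg_unique (@Rhausdorff R) L); exact: cvg_cst.
Qed.

(** The measurable sets E such that g has integral 0 over their trace on the box form a Dynkin class
    containing the open rectangles, hence contain every measurable set. *)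
Lemma ae_eq0_obox Omega g z r : open Omega -> loc_integrable Omega g ->
  (forall phi, test_function Omega phi -> Rintegral leb2 Omega (fun x => g x * phi x) = 0) ->
  cbox z r `<=` Omega -> {ae leb2, forall x, obox z r x -> g x = 0}.
Proof.
move=> oO lg H sub; have [mg ig] := lg; have mO := open_mplane oO.
set O := obox z r; have mOb : measurable (O : set mplane) := measurable_obox z r.
have OQ : O `<=` cbox z r := @obox_cbox _ z r.
have IO : leb2.-integrable O (EFin \o g).
  apply: (integrableS (measurable_cbox z r) mOb OQ).
  apply/integrableP; split; last by apply: ig => //; exact: compact_cbox.
  apply/measurable_EFinP; apply: measurable_funS mg => //.
have IS (E : set mplane) : measurable E -> leb2.-integrable (O `&` E) (EFin \o g).
  by move=> mE; apply: integrableS IO => //; exact: measurableI.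
have D (E : set mplane) : measurable E -> Rintegral leb2 (O `&` E) g = 0.
  rewrite mplane_orects; move: E; apply: dynkin_induction.
  - exact: mplane_orects.
  - exact: orects_setI.
  - rewrite setIT /O oboxE; apply: (integral_orect0 oO lg H _ sub).
    by move: OQ; rewrite /O oboxE.
  - move=> _ [a [b [c [d ->]]]]; rewrite /O oboxE orectI.
    apply: (integral_orect0 oO lg H _ sub); rewrite -orectI.
    by move: OQ; rewrite /O oboxE => OQ x [/OQ].
  - move=> S mS S0; have : Rintegral leb2 (O `&` setT) g = 0.
      rewrite setIT /O oboxE; apply: (integral_orect0 oO lg H _ sub).
      by move: OQ; rewrite /O oboxE.
    rewrite -(setUv S) setIUr Rintegral_setU ?S0 ?add0r//.
    + exact: measurableI.
    + by apply: measurableI => //; exact: measurableC.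
    + by rewrite -setIUr setUv setIT.
    + by apply/disj_setPS => x [[_ ?] [_ ?]].
  - move=> F mF tF F0; rewrite setI_bigcupr /Rintegral integral_bigcup//.
    + rewrite eseries0// => n _ _; have := F0 n.
      rewrite /Rintegral => /eqP; rewrite fine_eq0; first by move/eqP.
      by apply: integrable_fin_num; [exact: measurableI|exact: IS].
    + by apply: trivIset_setIl.
    + by move=> k; exact: measurableI.
    + rewrite -setI_bigcupr; apply: IS; exact: bigcup_measurable.
have : ae_eq leb2 O (EFin \o g) (cst 0%E).
  apply: integral_ae_eq => // E EO mE; rewrite integral0.
  have := D E mE; rewrite setIidr// /Rintegral => /eqP; rewrite fine_eq0; first by move/eqP.
  by apply: integrable_fin_num => //; apply: integrableS IO.
by apply: filterS => x /= h /h [].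
Qed.

(** The fundamental lemma of the calculus of variations. Countably many boxes cover [Omega], so the
    exceptional sets stay negligible together. *)
Lemma ae_eq0_test Omega g : open Omega -> loc_integrable Omega g ->
  (forall phi, test_function Omega phi -> Rintegral leb2 Omega (fun x => g x * phi x) = 0) ->
  {ae leb2, forall x, Omega x -> g x = 0}.
Proof.
move=> oO lg H; have [->|/set0P U0] := eqVneq Omega set0; first exact: aeW.
have [z [r [P ->]]] := open_bigcup_obox oO U0.
have /ae_foralln : forall i, {ae leb2, forall x, obox (z i) (r i) x -> g x = 0}.
  by move=> i; exact: (ae_eq0_obox oO lg H (P i).2).
by apply: filterS => x Hx [i _ /Hx].
Qed.

Lemma loc_integrable_lin Omega a u v : loc_integrable Omega u ->
  loc_integrable Omega v -> open Omega -> loc_integrable Omega (fun x => a * u x + v x).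
Proof.
move=> [mu iu] [mv iv] oO; have mO := open_mplane oO.
split; first by apply: measurable_funD => //; exact: measurable_funM.
move=> A AO cA; have mA : measurable (A : set mplane).
  by apply: closed_mplane; apply: compact_closed => //; exact: norm_hausdorff.
have Iu : leb2.-integrable A (EFin \o u).
  apply/integrableP; split; last exact: iu.
  by apply/measurable_EFinP; exact: measurable_funS mu.
have Iv : leb2.-integrable A (EFin \o v).
  apply/integrableP; split; last exact: iv.
  by apply/measurable_EFinP; exact: measurable_funS mv.
have : leb2.-integrable A (fun x => (a%:E * (u x)%:E + (v x)%:E)%E).
  by apply: integrableD => //; exact: integrableZl.
by case/integrableP.
Qed.

Lemma loc_integrable_continuous Omega u : open Omega -> continuous u ->
  loc_integrable Omega u.
Proof.
move=> oO cu; split; first by apply: measurable_funTS; exact: continuous_mplane.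
move=> A AO cA; have mA : measurable (A : set mplane).
  by apply: closed_mplane; apply: compact_closed => //; exact: norm_hausdorff.
have [M M0 HM] := compact_bounded_norm cA cu.
apply: (@le_lt_trans _ _ (\int[leb2]_(x in A) M%:E)%E).
  apply: ge0_le_integral => //.
  - by apply/measurable_EFinP; apply: measurableT_comp => //;
      apply: measurable_funTS; exact: continuous_mplane.
rewrite integral_cst// lte_mul_pinfty ?lee_fin ?ltW//.
by apply: bounded_leb2 => //; exact: compact_bounded.
Qed.

End du_bois_reymond.

Section weak_gradient.
Context {R : realType}.
Implicit Types (Omega : set (R * R)) (u v f phi : R * R -> R)
  (G H : R * R -> 'cV[R]_2).

Lemma test_function_grad Omega phi i : test_function Omega phi ->
  test_function Omega (fun x => grad phi x i 0).
Proof.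
move=> [sphi cphi sub].
have S : tsupp (fun x => grad phi x i 0) `<=` tsupp phi.
  rewrite [X in _ `<=` X](closure_id _).1; last exact: closed_closure.
  apply: closure_subset => x /= Dx; apply: contrapT => Nx.
  by move: Dx; rewrite gradE derive_tsupp// eqxx.
split.
- by rewrite (_ : (fun x => _) = 'D_(basis2 i) phi);
    [exact: smooth_derive|apply/funext => x; rewrite gradE].
- by apply: (subclosed_compact _ cphi S); exact: closed_closure.
- exact: subset_trans sub.
Qed.

Lemma is_wgrad_lin Omega a u v G H : open Omega ->
  is_wgrad Omega u G -> is_wgrad Omega v H ->
  is_wgrad Omega (fun x => a * u x + v x) (fun x => a *: G x + H x).
Proof.
move=> oO [lu lG uG] [lv lH vH]; have mO := open_mplane oO; split.
- exact: loc_integrable_lin.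
- move=> i; rewrite (_ : (fun x => _) = (fun x => a * G x i 0 + H x i 0)).
    exact: loc_integrable_lin.
  by apply/funext => x; rewrite !mxE.
- move=> phi tphi i.
  have tdphi := test_function_grad i tphi.
  have Iu := loc_integrable_test oO lu tdphi.
  have Iv := loc_integrable_test oO lv tdphi.
  have IG := loc_integrable_test oO (lG i) tphi.
  have IH := loc_integrable_test oO (lH i) tphi.
  have IZ w : leb2.-integrable Omega (EFin \o w) ->
      leb2.-integrable Omega (EFin \o (fun x => a * w x)).
    by move=> Iw; exact: (integrableZl mO a Iw).
  transitivity (a * Rintegral leb2 Omega (fun x => u x * grad phi x i 0) +
      Rintegral leb2 Omega (fun x => v x * grad phi x i 0)).
    rewrite -RintegralZl// -RintegralD//; last exact: IZ.
    by apply: eq_Rintegral => x _; ring.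
  rewrite uG// vH// mulrN -opprD -RintegralZl// -RintegralD//; last exact: IZ.
  by congr (- _); apply: eq_Rintegral => x _; rewrite !mxE; ring.
Qed.

(** Since [wgrad] is a choice, this is the only access to its values: linearity and the agreement
    with [grad] on smooth functions are read off almost everywhere through it. *)
Lemma is_wgrad_unique Omega u G H : open Omega ->
  is_wgrad Omega u G -> is_wgrad Omega u H ->
  {ae leb2, forall x, Omega x -> G x = H x}.
Proof.
move=> oO [_ lG uG] [_ lH uH]; have mO := open_mplane oO.
have D i : {ae leb2, forall x, Omega x -> (-1) * G x i 0 + H x i 0 = 0}.
  apply: ae_eq0_test => //; first exact: loc_integrable_lin.
  move=> phi tphi.
  have IG := loc_integrable_test oO (lG i) tphi.
  have IH := loc_integrable_test oO (lH i) tphi.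
  have IZ : leb2.-integrable Omega (EFin \o (fun x => (-1) * (G x i 0 * phi x))).
    exact: (integrableZl mO (-1) IG).
  transitivity (- 1 * Rintegral leb2 Omega (fun x => G x i 0 * phi x) +
      Rintegral leb2 Omega (fun x => H x i 0 * phi x)).
    rewrite -RintegralZl// -RintegralD//.
    by apply: eq_Rintegral => x _; ring.
  have := uG _ tphi i; have := uH _ tphi i; lra.
apply: filterS (ae_and (D 0) (D 1)) => x [D0 D1] Ox; apply/matrixP => i j.
rewrite ord1; case: (ord2P i) => ->; first by have := D0 Ox; lra.
by have := D1 Ox; lra.
Qed.

Lemma is_wgrad_wgrad Omega u G : is_wgrad Omega u G ->
  is_wgrad Omega u (wgrad Omega u).
Proof. by move=> H; exact: (getPex (ex_intro _ G H)). Qed.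

Lemma wgrad_ae Omega u G : open Omega -> is_wgrad Omega u G ->
  {ae leb2, forall x, Omega x -> wgrad Omega u x = G x}.
Proof.
by move=> oO H; apply: (is_wgrad_unique oO _ H); exact: is_wgrad_wgrad H.
Qed.

Let slice1 f x y : (fun h : R => h^-1 *: ((f \o shift (x, y)) (h *: basis2 0) - f (x, y))) =
  (fun h : R => h^-1 *: (((fun t => f (t, y)) \o shift x) (h *: 1) - f (x, y))).
Proof.
apply/funext => h /=; congr (_ *: (f _ - _)); congr pair.
by rewrite /= scaler0 add0r.
Qed.

Let slice2 f x y : (fun h : R => h^-1 *: ((f \o shift (x, y)) (h *: basis2 1) - f (x, y))) =
  (fun h : R => h^-1 *: (((fun t => f (x, t)) \o shift y) (h *: 1) - f (x, y))).
Proof.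
apply/funext => h /=; congr (_ *: (f _ - _)); congr pair.
by rewrite /= scaler0 add0r.
Qed.

Let FTC0 (h : R -> R) r : 0 < r -> (forall x, derivable h x 1) ->
  continuous (fun x => 'D_1 h x) -> (forall x, r < `|x| -> h x = 0) ->
  (\int[lebesgue_measure]_x ('D_1 h x)%:E = 0)%E.
Proof.
move=> r0 dh ch h0; pose s := r + 1.
have D0 x : r < `|x| -> 'D_1 h x = 0.
  move=> rx; rewrite -(derive_cst (0 : R) x 1); apply: near_eq_derive.
  near=> y; rewrite h0//; near: y.
  by apply: (@cvgr_norm_gt _ _ _ _ _ id x _ r rx); exact: cvg_id.
rewrite (_ : (fun x => _) = (EFin \o (fun x => 'D_1 h x)) \_ `[-s, s]); last first.
  apply/funext => x; rewrite /patch; case: ifPn => //; rewrite notin_setE/=.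
  rewrite in_itv/= -ler_norml => /negP; rewrite -ltNge => sx.
  by rewrite D0//; apply: lt_trans sx; rewrite /s; lra.
rewrite -integral_mkcond (@continuous_FTC2 _ _ h) //.
- by rewrite !h0 ?subee// /s ?normrN ger0_norm; lra.
- by rewrite /s; lra.
- exact: continuous_subspaceT.
- have chh := derivable_continuous1 dh; split => //.
  + by apply: cvg_at_right_filter; exact: chh.
  + by apply: cvg_at_left_filter; exact: chh.
- by move=> x _; rewrite derive1E.
Unshelve. all: by end_near. Qed.

(** Fubini with the inner integral along direction [i], where the one-dimensional fundamental
    theorem gives 0 on each line. *)
Lemma integral_derive0 f r i : smooth f -> 0 < r ->
  (forall x, ~ cbox 0 r x -> f x = 0) ->
  Rintegral leb2 setT (fun x => 'D_(basis2 i) f x) = 0.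
Proof.
move=> sf r0 f0.
have S : tsupp f `<=` cbox 0 r.
  rewrite [X in _ `<=` X](closure_id (cbox 0 r)).1; last exact: closed_cbox.
  apply: closure_subset => x /= /eqP Dx; apply: contrapT => Nx.
  by apply: Dx; exact: f0.
have D0 x : ~ cbox 0 r x -> 'D_(basis2 i) f x = 0.
  by move=> Nx; apply: derive_tsupp => /S.
have cD : continuous ('D_(basis2 i) f).
  by apply: smooth_continuous; exact: smooth_derive.
have ID : leb2.-integrable setT (EFin \o ('D_(basis2 i) f)).
  have mQ := @measurable_cbox R 0 r.
  rewrite (_ : EFin \o _ = (EFin \o ('D_(basis2 i) f)) \_ (cbox 0 r)); last first.
    apply/funext => x; rewrite /patch; case: ifPn => //; rewrite notin_setE => Nx.
    by rewrite /= D0.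
  apply/(integrable_restrict leb2 mQ measurableT); rewrite setTI.
  have [_ +] := loc_integrable_continuous openT cD.
  move=> /(_ (cbox 0 r) (@subsetT _ _) (@compact_cbox _ 0 r)) fin.
  apply/integrableP; split => //; apply/measurable_EFinP.
  by apply: measurable_funTS; exact: continuous_mplane.
rewrite /Rintegral; case: (ord2P i) => i01; move: cD D0 ID; rewrite i01 => cD D0 ID.
  rewrite -[X in fine X](integral21_prod_meas1 ID) integral0_eq// => y _.
  rewrite /fubini_G.
  have E x : 'D_(basis2 0) f (x, y) = 'D_1 (fun t => f (t, y)) x.
    by rewrite /derive slice1.
  under eq_integral do rewrite /= E.
  apply: (FTC0 r0).
  - move=> x; have := @smooth_derivable _ f 0 (x, y) sf.
    by rewrite /derivable slice1.
  - under eq_fun do rewrite -E; move=> x.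
    apply: (@continuous_comp _ _ _ (fun t => (t, y)) ('D_(basis2 0) f)); last exact: cD.
    by apply: continuous_pair; [exact: cvg_id|exact: cvg_cst].
  - move=> x rx; apply: f0 => -[/=]; rewrite subr0; lra.
rewrite -[X in fine X](integral12_prod_meas1 ID) integral0_eq// => x _.
rewrite /fubini_F.
have E y : 'D_(basis2 1) f (x, y) = 'D_1 (fun t => f (x, t)) y.
  by rewrite /derive slice2.
under eq_integral do rewrite /= E.
apply: (FTC0 r0).
- move=> y; have := @smooth_derivable _ f 1 (x, y) sf.
  by rewrite /derivable slice2.
- under eq_fun do rewrite -E; move=> y.
  apply: (@continuous_comp _ _ _ (fun t => (x, t)) ('D_(basis2 1) f)); last exact: cD.
  by apply: continuous_pair; [exact: cvg_cst|exact: cvg_id].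
- move=> y ry; apply: f0 => -[/= _]; rewrite subr0; lra.
Qed.

Lemma is_wgrad_smooth Omega f : open Omega -> smooth f -> is_wgrad Omega f (grad f).
Proof.
move=> oO sf; have mO := open_mplane oO; split.
- by apply: loc_integrable_continuous => //; exact: smooth_continuous.
- move=> i; apply: loc_integrable_continuous => //.
  rewrite (_ : (fun x => _) = 'D_(basis2 i) f); last by apply/funext => x; rewrite gradE.
  by apply: smooth_continuous; exact: smooth_derive.
move=> phi tphi i; have [sphi cphi sub] := tphi.
have [r r0 phir] := bounded_cbox (compact_bounded cphi).
(* The derivative of this product lives inside [Omega], so its zero integral over the plane is
   exactly integration by parts on [Omega]. *)
pose psi x := f x * phi x.
have spsi : smooth psi by exact: smoothM.
have psi0 x : ~ cbox 0 r x -> psi x = 0.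
  by move=> Nx; rewrite /psi (@tsupp0 _ phi) ?mulr0// => /phir.
have := integral_derive0 i spsi r0 psi0.
have Dpsi x : 'D_(basis2 i) psi x = f x * 'D_(basis2 i) phi x + 'D_(basis2 i) f x * phi x.
  rewrite /psi (@deriveM _ _ f phi); [|exact: smooth_derivable..].
  by rewrite /GRing.scale/=; ring.
rewrite (_ : Rintegral _ _ _ = Rintegral leb2 Omega (fun x =>
   f x * grad phi x i 0 + grad f x i 0 * phi x)); last first.
  rewrite [RHS]Rintegral_mkcond; apply: eq_Rintegral => x _; rewrite Dpsi /patch.
  case: ifPn; first by rewrite !gradE.
  rewrite notin_setE => NO; have Nt : ~ tsupp phi x by move=> /sub.
  by rewrite (@tsupp0 _ phi)// derive_tsupp// !mulr0 addr0.
have c0 : continuous ('D_(basis2 i) f).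
  by apply: smooth_continuous; exact: smooth_derive.
have I2 : leb2.-integrable Omega (EFin \o (fun x => grad f x i 0 * phi x)).
  apply: (loc_integrable_test oO _ tphi).
  rewrite (_ : (fun x => _) = 'D_(basis2 i) f); last by apply/funext => x; rewrite gradE.
  exact: loc_integrable_continuous.
have I1 : leb2.-integrable Omega (EFin \o (fun x => f x * grad phi x i 0)).
  apply: (loc_integrable_test oO _ (test_function_grad i tphi)).
  by apply: loc_integrable_continuous => //; exact: smooth_continuous.
rewrite RintegralD// => /eqP; rewrite addr_eq0 => /eqP ->.
by [].
Qed.

End weak_gradient.

(** * Lebesgue and Sobolev norms *)

Section euclidean_algebra.
Context {R : realType}.

Lemma dotC n (v w : 'cV[R]_n) : dot v w = dot w v.
Proof. by apply: eq_bigr => i _; rewrite mulrC. Qed.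

Lemma dotDl n (u v w : 'cV[R]_n) : dot (u + v) w = dot u w + dot v w.
Proof. by rewrite -big_split; apply: eq_bigr => i _; rewrite mxE mulrDl. Qed.

Lemma dotZl n a (v w : 'cV[R]_n) : dot (a *: v) w = a * dot v w.
Proof. by rewrite /dot mulr_sumr; apply: eq_bigr => i _; rewrite mxE mulrA. Qed.

Lemma dotNl n (v w : 'cV[R]_n) : dot (- v) w = - dot v w.
Proof. by rewrite -scaleN1r dotZl mulN1r. Qed.

Lemma dotBl n (u v w : 'cV[R]_n) : dot (u - v) w = dot u w - dot v w.
Proof. by rewrite dotDl dotNl. Qed.

Lemma dotDr n (u v w : 'cV[R]_n) : dot u (v + w) = dot u v + dot u w.
Proof. by rewrite dotC dotDl !(dotC u). Qed.

Lemma dotZr n a (v w : 'cV[R]_n) : dot v (a *: w) = a * dot v w.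
Proof. by rewrite dotC dotZl dotC. Qed.

Lemma dotBr n (u v w : 'cV[R]_n) : dot u (v - w) = dot u v - dot u w.
Proof. by rewrite dotC dotBl !(dotC u). Qed.

Lemma dot_ge0 n (v : 'cV[R]_n) : 0 <= dot v v.
Proof. by apply: sumr_ge0 => i _; rewrite -expr2 sqr_ge0. Qed.

Lemma dot_eq0 n (v : 'cV[R]_n) : dot v v = 0 -> v = 0.
Proof.
move/eqP; rewrite psumr_eq0; last by move=> i _; rewrite -expr2 sqr_ge0.
move/allP => H; apply/matrixP => i j; rewrite ord1 mxE; apply/eqP.
by have := H i (mem_index_enum i); rewrite mulf_eq0 orbb.
Qed.

Lemma norm2_ge0 n (v : 'cV[R]_n) : 0 <= norm2 v.
Proof. exact: sqrtr_ge0. Qed.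

Lemma sqr_norm2 n (v : 'cV[R]_n) : norm2 v ^+ 2 = dot v v.
Proof. by rewrite sqr_sqrtr// dot_ge0. Qed.

Lemma dot_CS n (v w : 'cV[R]_n) : `|dot v w| <= norm2 v * norm2 w.
Proof.
rewrite -ler_sqr ?nnegrE// ?mulr_ge0 ?norm2_ge0// real_normK ?num_real//.
rewrite exprMn !sqr_norm2.
have [w0|wn0] := eqVneq (dot w w) 0.
  have -> : dot v w = 0 by rewrite (dot_eq0 w0) -(scale0r w) dotZr mul0r.
  by rewrite w0 mulr0 expr0n.
have w0 : 0 < dot w w by rewrite lt_def wn0 dot_ge0.
have := dot_ge0 (dot w w *: v - dot v w *: w).
rewrite !(dotBl, dotBr, dotZl, dotZr) (dotC w v).
set a := dot v v; set b := dot v w; set c := dot w w.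
rewrite (_ : _ - _ = c * (a * c - b ^+ 2)); last by ring.
by rewrite pmulr_rge0// subr_ge0.
Qed.

Lemma norm2D n (v w : 'cV[R]_n) : norm2 (v + w) <= norm2 v + norm2 w.
Proof.
rewrite -ler_sqr ?nnegrE ?addr_ge0 ?norm2_ge0// sqrrD !sqr_norm2 !(dotDl, dotDr).
have := dot_CS v w; rewrite ler_norml => /andP[_]; rewrite (dotC w v); lra.
Qed.

Lemma norm2Z n a (v : 'cV[R]_n) : norm2 (a *: v) = `|a| * norm2 v.
Proof. by rewrite /norm2 dotZl dotZr mulrA -expr2 sqrtrM ?sqr_ge0// sqrtr_sqr. Qed.

Lemma coord_norm2 n (v : 'cV[R]_n) i : `|v i 0| <= norm2 v.
Proof.
rewrite -ler_sqr ?nnegrE ?norm2_ge0// sqr_norm2 real_normK ?num_real//.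
rewrite /dot (bigD1 i)//= -expr2 lerDl; apply: sumr_ge0 => j _.
by rewrite -expr2 sqr_ge0.
Qed.

Lemma dot2E (v w : 'cV[R]_2) : dot v w = v 0 0 * w 0 0 + v 1 0 * w 1 0.
Proof.
rewrite /dot big_ord_recl big_ord1; congr (_ + _).
by congr (v _ _ * w _ _); apply/val_inj.
Qed.

Lemma dot_col_mx (a b : R) n (v w : 'cV[R]_n) :
  dot (col_mx (a%:M : 'M[R]_1) v) (col_mx (b%:M : 'M[R]_1) w) = a * b + dot v w.
Proof.
rewrite /dot big_split_ord/= big_ord1 !col_mxEu !mxE eqxx !mulr1n.
by congr (_ + _); apply: eq_bigr => i _; rewrite !col_mxEd.
Qed.

End euclidean_algebra.

Section Lp_norms.
Context {R : realType}.
Implicit Types (Omega : set (R * R)) (f g u v : R * R -> R) (p q : R).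

Lemma Lp_normE Omega p f : p != 0 ->
  Lp_norm Omega p f = ((\int[leb2]_(x in Omega) (`|f x| `^ p)%:E) `^ p^-1)%E.
Proof.
move=> p0; rewrite /Lp_norm unlock /= [in RHS]integral_mkcond; congr (_ `^ _)%E.
apply: (@eq_integral _ mplane R leb2) => x _; rewrite /patch /=.
by case: ifPn => //; rewrite normr0 powR0.
Qed.

Lemma Lp_norm_ge0 Omega p f : (0 <= Lp_norm Omega p f)%E.
Proof. exact: Lnorm_ge0. Qed.

Lemma measurable_Lp_int Omega p f :
  measurable_fun (Omega : set mplane) (f : mplane -> R) ->
  measurable_fun (Omega : set mplane) (fun x : mplane => (`|f x| `^ p)%:E).
Proof.
move=> mf; apply/measurable_EFinP.
apply: (@measurableT_comp _ _ _ _ _ _ (fun x : R => x `^ p)); first exact: measurable_powR.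
exact: measurableT_comp.
Qed.

Lemma Lp_norm_le Omega p f g : 0 < p -> measurable (Omega : set mplane) ->
  measurable_fun (Omega : set mplane) (f : mplane -> R) ->
  measurable_fun (Omega : set mplane) (g : mplane -> R) ->
  {ae leb2, forall x, Omega x -> `|f x| <= `|g x|} ->
  (Lp_norm Omega p f <= Lp_norm Omega p g)%E.
Proof.
move=> p0 mO mf mg fg; rewrite !Lp_normE ?gt_eqF//.
have H : (\int[leb2]_(x in Omega) (`|f x| `^ p)%:E <=
    \int[leb2]_(x in Omega) (`|g x| `^ p)%:E)%E.
  apply: (@ae_ge0_le_integral _ mplane R leb2 Omega mO).
  - by move=> x _; rewrite lee_fin powR_ge0.
  - exact: measurable_Lp_int.
  - by move=> x _; rewrite lee_fin powR_ge0.
  - exact: measurable_Lp_int.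
  apply: (aeS _ fg) => x fgx Ox; rewrite lee_fin; apply: ge0_ler_powR.
  - exact: ltW.
  - by rewrite nnegrE.
  - by rewrite nnegrE.
  - exact: fgx.
apply: gt0_ler_poweR H; rewrite ?invr_ge0 ?ltW//.
- by rewrite in_itv/= leey andbT integral_ge0// => x _; rewrite lee_fin powR_ge0.
- by rewrite in_itv/= leey andbT integral_ge0// => x _; rewrite lee_fin powR_ge0.
Qed.

Lemma Lp_normZ Omega p f a : 0 < p -> measurable (Omega : set mplane) ->
  measurable_fun (Omega : set mplane) (f : mplane -> R) ->
  Lp_norm Omega p (fun x => a * f x) = (`|a|%:E * Lp_norm Omega p f)%E.
Proof.
move=> p0 mO mf; rewrite !Lp_normE ?gt_eqF//.
under eq_integral do rewrite normrM powRM// EFinM.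
rewrite (@ge0_integralZl _ mplane R leb2)//.
- rewrite poweRM ?lee_fin ?powR_ge0//.
    by rewrite poweR_EFin -powRrM mulfV ?gt_eqF// powRr1.
  by apply: integral_ge0 => x _; rewrite lee_fin powR_ge0.
- exact: measurable_Lp_int.
Qed.

Lemma Lp_normD Omega p f g : 1 <= p -> measurable (Omega : set mplane) ->
  measurable_fun (Omega : set mplane) (f : mplane -> R) ->
  measurable_fun (Omega : set mplane) (g : mplane -> R) ->
  (Lp_norm Omega p (fun x => f x + g x)%R <= Lp_norm Omega p f + Lp_norm Omega p g)%E.
Proof.
move=> p1 mO mf mg.
have -> : Lp_norm Omega p (fun x => f x + g x) =
    ('N[leb2]_p%:E[EFin \o ((f \_ Omega) \+ (g \_ Omega))%R])%E.
  rewrite /Lp_norm; congr Lnorm; apply/funext => x /=; rewrite /patch.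
  by case: ifPn => // _; rewrite addr0.
exact: (minkowski_EFin leb2 ((measurable_restrictT f mO).1 mf) ((measurable_restrictT g mO).1 mg) p1).
Qed.

Lemma conj_expP p : 1 < p -> [/\ 1 < conj_exp p, 0 < p, 0 < conj_exp p &
  p^-1 + (conj_exp p)^-1 = 1].
Proof.
move=> p1; have p0 : 0 < p by lra.
have q1 : 1 < conj_exp p by rewrite /conj_exp ltr_pdivlMr; lra.
split=> //; first by lra.
rewrite /conj_exp invf_div; field; lra.
Qed.

(** Hölder for an integrand merely dominated by a product: integrability and bound come together,
    and the nonlinear integrands of the weak equations, which are not products, are covered. *)
Lemma Holder_pairing Omega p a b g : 1 < p -> measurable (Omega : set mplane) ->
  measurable_fun (Omega : set mplane) (a : mplane -> R) ->
  measurable_fun (Omega : set mplane) (b : mplane -> R) ->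
  measurable_fun (Omega : set mplane) (g : mplane -> R) ->
  {ae leb2, forall x, Omega x -> `|g x| <= `|a x * b x|} ->
  (Lp_norm Omega p a < +oo)%E -> (Lp_norm Omega (conj_exp p) b < +oo)%E ->
  leb2.-integrable Omega (EFin \o g) /\
  (`|Rintegral leb2 Omega g|%:E <= Lp_norm Omega p a * Lp_norm Omega (conj_exp p) b)%E.
Proof.
move=> p1 mO ma mb mg gab fa fb; have [q1 p0 q0 pq] := conj_expP p1.
have H : (\int[leb2]_(x in Omega) `|g x|%:E <=
    Lp_norm Omega p a * Lp_norm Omega (conj_exp p) b)%E.
  apply: (@le_trans _ _ (\int[leb2]_(x in Omega) `|a x * b x|%:E)%E).
    apply: (@ae_ge0_le_integral _ mplane R leb2) => //.
    - by apply/measurable_EFinP; exact: measurableT_comp.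
    - apply/measurable_EFinP; apply: measurableT_comp => //; exact: measurable_funM.
  have := @hoelder _ mplane R leb2 (a \_ Omega) (b \_ Omega) p (conj_exp p)
    ((measurable_restrictT a mO).1 ma) ((measurable_restrictT b mO).1 mb) p0 q0 pq.
  rewrite Lnorm1 -/(Lp_norm Omega p a) -/(Lp_norm Omega (conj_exp p) b).
  apply: le_trans; rewrite integral_mkcond le_eqVlt; apply/orP; left; apply/eqP.
  by apply: eq_integral => x _ /=; rewrite /patch; case: ifPn => // _; rewrite mulr0 normr0.
have I : leb2.-integrable Omega (EFin \o g).
  apply/integrableP; split; first exact/measurable_EFinP.
  apply: le_lt_trans H _; apply: lte_mul_pinfty => //; first exact: Lp_norm_ge0.
  by rewrite ge0_fin_numE// Lp_norm_ge0.
split => //; apply: le_trans H; rewrite EFin_normr_Rintegral//.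
by apply: le_abse_integral => //; exact/measurable_EFinP.
Qed.

End Lp_norms.

Section sobolev_space.
Context {R : realType}.
Implicit Types (Omega Gamma : set (R * R)) (f g u v : R * R -> R) (p q : R).

Definition wdiff Omega u := exists G, is_wgrad Omega u G.

Lemma wdiffP Omega u : wdiff Omega u -> is_wgrad Omega u (wgrad Omega u).
Proof. by case=> G; exact: is_wgrad_wgrad. Qed.

Lemma wdiff_lin Omega a u v : open Omega -> wdiff Omega u -> wdiff Omega v ->
  wdiff Omega (fun x => a * u x + v x).
Proof. by move=> oO [G HG] [H HH]; exists (fun x => a *: G x + H x); exact: is_wgrad_lin. Qed.

Lemma wdiff_smooth Omega f : open Omega -> smooth f -> wdiff Omega f.
Proof. by move=> oO sf; exists (grad f); exact: is_wgrad_smooth. Qed.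

Lemma wdiff_measurable Omega u : wdiff Omega u ->
  measurable_fun (Omega : set mplane) (u : mplane -> R).
Proof. by move=> /wdiffP[[]]. Qed.

Lemma wgrad_measurable Omega u i : wdiff Omega u ->
  measurable_fun (Omega : set mplane) (fun x : mplane => wgrad Omega u x i 0).
Proof. by move=> /wdiffP[_ /(_ i)[]]. Qed.

Lemma dot_Lop Omega Omega' u v x : dot (Lop Omega u x) (Lop Omega' v x) =
  u x * v x + dot (wgrad Omega u x) (wgrad Omega' v x).
Proof. exact: dot_col_mx. Qed.

Lemma measurable_norm2Lop Omega u : wdiff Omega u ->
  measurable_fun (Omega : set mplane) (fun x : mplane => norm2 (Lop Omega u x)).
Proof.
move=> wu; apply: (@measurableT_comp _ _ _ _ _ _ (@Num.sqrt R)).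
  by apply: continuous_measurable_fun; exact: sqrt_continuous.
rewrite (_ : (fun x => _) = (fun x => u x * u x +
   (wgrad Omega u x 0 0 * wgrad Omega u x 0 0 + wgrad Omega u x 1 0 * wgrad Omega u x 1 0))).
  have mg i := wgrad_measurable i wu; have mu := wdiff_measurable wu.
  by apply: measurable_funD; [exact: measurable_funM|apply: measurable_funD;
     exact: measurable_funM].
by apply/funext => x; rewrite dot_Lop dot2E.
Qed.

Lemma Lop_lin_ae Omega a u v : open Omega -> wdiff Omega u -> wdiff Omega v ->
  {ae leb2, forall x, Omega x ->
    Lop Omega (fun x => a * u x + v x) x = a *: Lop Omega u x + Lop Omega v x}.
Proof.
move=> oO wu wv; apply: (aeS _ (wgrad_ae oO (is_wgrad_lin a oO (wdiffP wu) (wdiffP wv)))) => x H Ox; rewrite /Lop (H Ox) scale_col_mx add_col_mx.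
by congr col_mx; apply/matrixP => i j; rewrite !ord1 !mxE eqxx !mulr1n.
Qed.

Lemma Lop_smooth_ae Omega f : open Omega -> smooth f ->
  {ae leb2, forall x, Omega x -> wgrad Omega f x = grad f x}.
Proof. by move=> oO sf; apply: wgrad_ae => //; exact: is_wgrad_smooth. Qed.

Lemma W1_norm_ge0 Omega p u : (0 <= W1_norm Omega p u)%E.
Proof. exact: Lp_norm_ge0. Qed.

Lemma W1_norm_lin Omega p a u v : open Omega -> 1 <= p ->
  wdiff Omega u -> wdiff Omega v ->
  (W1_norm Omega p (fun x => a * u x + v x)%R <=
   `|a|%:E * W1_norm Omega p u + W1_norm Omega p v)%E.
Proof.
move=> oO p1 wu wv; have mO := open_mplane oO; have p0 : 0 < p by lra.
have mu := measurable_norm2Lop wu; have mv := measurable_norm2Lop wv.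
have mau : measurable_fun (Omega : set mplane)
  (fun x : mplane => `|a| * norm2 (Lop Omega u x)) by exact: measurable_funM.
apply: (@le_trans _ _ (Lp_norm Omega p
    (fun x => `|a| * norm2 (Lop Omega u x) + norm2 (Lop Omega v x)))).
  apply: Lp_norm_le p0 mO _ _ _.
  - exact: measurable_norm2Lop (wdiff_lin a oO wu wv).
  - exact: measurable_funD.
  apply: (aeS _ (Lop_lin_ae a oO wu wv)) => x H Ox; rewrite H//.
  rewrite [X in X <= _]ger0_norm ?norm2_ge0//.
  rewrite [X in _ <= X]ger0_norm ?addr_ge0 ?mulr_ge0 ?norm2_ge0//.
  by rewrite -norm2Z; exact: norm2D.
apply: le_trans (Lp_normD p1 mO mau mv) _.
by rewrite (Lp_normZ _ p0 mO mu) normr_id.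
Qed.

Lemma W1_normZ_le Omega p a u : open Omega -> 1 <= p -> wdiff Omega u ->
  (W1_norm Omega p (fun x => a * u x)%R <= `|a|%:E * W1_norm Omega p u)%E.
Proof.
move=> oO p1 wu; have mO := open_mplane oO; have p0 : 0 < p by lra.
have w0 : wdiff Omega (cst 0 : R * R -> R) by apply: wdiff_smooth => //; exact: smooth_cst.
have W0 : W1_norm Omega p (cst 0 : R * R -> R) = 0%E.
  apply/eqP; rewrite eq_le W1_norm_ge0 andbT.
  apply: (@le_trans _ _ (Lp_norm Omega p (cst (0 : R)))).
    apply: Lp_norm_le p0 mO _ _ _; first exact: measurable_norm2Lop.
      exact: measurable_cst.
    apply: (aeS _ (Lop_smooth_ae oO (smooth_cst (0 : R)))) => x H Ox.
    rewrite /= /norm2 dot_Lop H// dot2E !gradE !derive_cst !mulr0 !addr0 sqrtr0.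
    by rewrite normr0.
  rewrite Lp_normE ?gt_eqF//.
  under eq_integral do rewrite /cst normr0 powR0 ?gt_eqF//.
  by rewrite integral0 poweR0r// invr_eq0 gt_eqF.
have := W1_norm_lin a oO p1 wu w0; rewrite W0 adde0.
by under [in X in (X <= _)%E -> _]eq_fun do rewrite addr0.
Qed.

Lemma W1_norm0 Omega p : open Omega -> 1 <= p ->
  W1_norm Omega p (fun=> 0 : R) = 0%E.
Proof.
move=> oO p1; apply/eqP; rewrite eq_le W1_norm_ge0 andbT.
have w0 : wdiff Omega (cst 0 : R * R -> R) by apply: wdiff_smooth => //; exact: smooth_cst.
have := W1_normZ_le 0 oO p1 w0; rewrite normr0 mul0e.
by under [in X in (X <= _)%E -> _]eq_fun do rewrite mul0r.
Qed.

Lemma W1_normZ Omega p a u : open Omega -> 1 <= p -> wdiff Omega u ->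
  W1_norm Omega p (fun x => a * u x) = (`|a|%:E * W1_norm Omega p u)%E.
Proof.
move=> oO p1 wu; have [->|a0] := eqVneq a 0.
  rewrite normr0 mul0e; under eq_fun do rewrite mul0r.
  exact: W1_norm0.
apply/eqP; rewrite eq_le W1_normZ_le//=.
have wau : wdiff Omega (fun x => a * u x).
  have [G HG] := wdiff_lin a oO wu (wdiff_smooth oO (smooth_cst 0)).
  by exists G; move: HG; under eq_fun do rewrite addr0.
have := W1_normZ_le a^-1 oO p1 wau.
under [in X in (X <= _)%E -> _]eq_fun do rewrite mulrA mulVf// mul1r.
move=> H; apply: (@le_trans _ _ (`|a|%:E * (`|a^-1|%:E *
   W1_norm Omega p (fun x => (a * u x)%R)))%E).
  by rewrite lee_pmul2l// ?lte_fin ?normr_gt0.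
by rewrite muleA -EFinM -normrM mulfV// normr1 mul1e.
Qed.

Lemma W1_normB Omega p u v : open Omega -> 1 <= p -> wdiff Omega u -> wdiff Omega v ->
  (W1_norm Omega p (fun x => u x - v x)%R <= W1_norm Omega p u + W1_norm Omega p v)%E.
Proof.
move=> oO p1 wu wv; have := W1_norm_lin (-1) oO p1 wv wu.
rewrite normrN normr1 mul1e addeC.
by under [in X in (X <= _)%E -> _]eq_fun do rewrite mulN1r addrC.
Qed.

Lemma wdiffB Omega u v : open Omega -> wdiff Omega u -> wdiff Omega v ->
  wdiff Omega (fun x => u x - v x).
Proof.
move=> oO wu wv; have := wdiff_lin (-1) oO wv wu.
by under eq_fun do rewrite mulN1r addrC.
Qed.

Lemma Lp_norm_W1 Omega p u : open Omega -> 0 < p -> wdiff Omega u ->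
  (Lp_norm Omega p u <= W1_norm Omega p u)%E.
Proof.
move=> oO p0 wu; apply: Lp_norm_le p0 _ _ _ _.
- exact: open_mplane.
- exact: wdiff_measurable.
- exact: measurable_norm2Lop.
apply: aeW => x Ox; rewrite [X in _ <= X]ger0_norm ?norm2_ge0//.
have := coord_norm2 (Lop Omega u x) (lshift 2 0).
by rewrite /Lop col_mxEu mxE eqxx mulr1n.
Qed.

Lemma Lp_norm_wgrad Omega p u i : open Omega -> 0 < p -> wdiff Omega u ->
  (Lp_norm Omega p (fun x => wgrad Omega u x i 0)%R <= W1_norm Omega p u)%E.
Proof.
move=> oO p0 wu; apply: Lp_norm_le p0 _ _ _ _.
- exact: open_mplane.
- exact: wgrad_measurable.
- exact: measurable_norm2Lop.
apply: aeW => x Ox; rewrite [X in _ <= X]ger0_norm ?norm2_ge0//.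
have := coord_norm2 (Lop Omega u x) (rshift 1 i).
by rewrite /Lop col_mxEd.
Qed.

Lemma tsupp_lin a f g : tsupp (fun x => a * f x + g x) `<=` tsupp f `|` tsupp g.
Proof.
rewrite -closureU; apply: closure_subset => x /= H; apply: contrapT => /not_orP[].
move=> /negP; rewrite negbK => /eqP f0 /negP; rewrite negbK => /eqP g0.
by move: H; rewrite f0 g0 mulr0 addr0 eqxx.
Qed.

Lemma W1G_lin Omega Gamma p a u v : open Omega -> 1 <= p ->
  W1G Omega Gamma p u -> W1G Omega Gamma p v ->
  W1G Omega Gamma p (fun x => a * u x + v x).
Proof.
move=> oO p1 [[wu fu] au] [[wv fv] av]; split.
  split; first exact: wdiff_lin.
  apply: le_lt_trans (W1_norm_lin _ _ _ _ _) _ => //.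
  by apply: lte_add_pinfty fv; apply: lte_mul_pinfty fu.
(* The summand 1 keeps the tolerance e / 2 / (|a| + 1) meaningful when a = 0. *)
move=> e e0; have a0 : 0 < `|a| + 1 by rewrite ltr_wpDl.
have [f [sf tf uf]] := au (e / 2 / (`|a| + 1)) (divr_gt0 (divr_gt0 e0 (ltr0n R 2)) a0).
have [g [sg tg vg]] := av (e / 2) (divr_gt0 e0 (ltr0n R 2)).
exists (fun x => a * f x + g x); split.
- by apply: smoothD => //; exact: smooth_scale.
- apply/seteqP; split => // x [/tsupp_lin[] Tx Gx].
    by rewrite -tf.
  by rewrite -tg.
have wf := wdiff_smooth oO sf; have wg := wdiff_smooth oO sg.
have := W1_norm_lin a oO p1 (wdiffB oO wu wf) (wdiffB oO wv wg).
rewrite (_ : (fun x => a * (u x - f x) + (v x - g x)) =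
  (fun x => a * u x + v x - (a * f x + g x))); last by apply/funext => x; ring.
move/le_lt_trans; apply.
apply: (@lt_le_trans _ _ (`|a|%:E * (e / 2 / (`|a| + 1))%:E + (e / 2)%:E)%E).
  apply: lee_ltD => //; last by rewrite lee_pmul ?W1_norm_ge0 ?lee_fin// ltW.
  rewrite ge0_fin_numE ?mule_ge0 ?W1_norm_ge0 ?lee_fin//.
  apply: lte_mul_pinfty; [by rewrite lee_fin|by []|exact: lt_trans uf (ltry _)].
rewrite -EFinM -EFinD lee_fin.
have : `|a| * (e / 2 / (`|a| + 1)) <= e / 2.
  by rewrite mulrCA ler_piMr ?ltW ?divr_gt0// ltr_pdivrMr// mul1r ltrDl.
lra.
Qed.

Lemma W1GB Omega Gamma p u v : open Omega -> 1 <= p ->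
  W1G Omega Gamma p u -> W1G Omega Gamma p v ->
  W1G Omega Gamma p (fun x => u x - v x).
Proof.
move=> oO p1 wu wv; have := W1G_lin (-1) oO p1 wv wu.
by under eq_fun do rewrite mulN1r addrC.
Qed.

End sobolev_space.

(** * Morrey's inequality *)

Section line_kernels.
Context {R : realType}.
Implicit Types (z r t : R).

Definition step_at z r t : R := step (r^-1 * t + - (r^-1 * z)).
Definition bump_at z r t : R := r^-1 * bumpf (r^-1 * t + - (r^-1 * z)).

Lemma is_derive_step_at z r t : is_derive t 1 (step_at z r) (bump_at z r t).
Proof. exact: is_derive_affine (is_derive_step _). Qed.

Lemma smooth1_step_at z r : smooth1 (step_at z r).
Proof. by apply: smooth1_affine; exact: smooth1_step. Qed.

Lemma smooth1_bump_at z r : smooth1 (bump_at z r).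
Proof.
apply: smooth1M; first exact: smooth1_cst.
by apply: smooth1_affine; exact: smooth1_bumpf.
Qed.

Lemma step_at0 z r t : 0 < r -> t <= z - r -> step_at z r t = 0.
Proof.
move=> r0 tz; apply: step0; rewrite -mulrBr.
by rewrite mulrC ler_pdivrMr// mulN1r; lra.
Qed.

Lemma step_at1 z r t : 0 < r -> z + r <= t -> step_at z r t = 1.
Proof.
move=> r0 tz; apply: step1; rewrite -mulrBr.
by rewrite mulrC ler_pdivlMr// mul1r; lra.
Qed.

Lemma bump_at0 z r t : 0 < r -> r < `|t - z| -> bump_at z r t = 0.
Proof.
move=> r0 tz; rewrite /bump_at bumpf0 ?mulr0// -mulrBr normrM gtr0_norm ?invr_gt0//.
by rewrite mulrC ltr_pdivlMr// mul1r.
Qed.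

Lemma integral_bump_at z r : 0 < r -> (\int[lebesgue_measure]_t (bump_at z r t)%:E = 1)%E.
Proof.
move=> r0; have cb : continuous (bump_at z r) := smooth1_bump_at z r 0%N.
rewrite (_ : (fun t => _) = (EFin \o bump_at z r) \_ `[z - r, z + r]); last first.
  apply/funext => t; rewrite /patch; case: ifPn => //; rewrite notin_setE/=.
  by rewrite in_itv/= -ler_distl => /negP; rewrite -ltNge => sx; rewrite bump_at0.
rewrite -integral_mkcond (@continuous_FTC2 _ _ (step_at z r)) //.
- by rewrite (@step_at1 z r (z + r))// (@step_at0 z r (z - r))// sube0.
- lra.
- exact: continuous_subspaceT.
- have ch : continuous (step_at z r) := smooth1_step_at z r 0%N.
  split; first by move=> x _; have [] := is_derive_step_at z r x.
  + by apply: cvg_at_right_filter; exact: ch.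
  + by apply: cvg_at_left_filter; exact: ch.
- by move=> x _; rewrite derive1E; have [] := is_derive_step_at z r x.
Qed.

End line_kernels.

Section box_averages.
Context {R : realType}.
Implicit Types (O : set (R * R)) (v f : R * R -> R) (x y z w c : R * R) (r rho E : R).

Definition kern z r x : R := bump_at z.1 r x.1 * bump_at z.2 r x.2.

Lemma smooth_kern z r : smooth (kern z r).
Proof.
by apply: smoothM; [apply: smooth_fst|apply: smooth_snd]; exact: smooth1_bump_at.
Qed.

Lemma kern0 z r x : 0 < r -> ~ cbox z r x -> kern z r x = 0.
Proof.
move=> r0 /not_andP[] /negP; rewrite -ltNge => H; rewrite /kern.
  by rewrite (bump_at0 r0 H) mul0r.
by rewrite (bump_at0 r0 H) mulr0.
Qed.

Lemma test_kern O z r : 0 < r -> cbox z r `<=` O -> test_function O (kern z r).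
Proof.
by move=> r0; apply: test_function_cbox; [exact: smooth_kern|move=> x; exact: kern0].
Qed.

Definition bumpM : R := sval (cid2 (@bumpf_bounded R)).

Lemma bumpM_gt0 : 0 < bumpM. Proof. by rewrite /bumpM; case: cid2. Qed.

Lemma bump_le (x : R) : `|bumpf x| <= bumpM.
Proof. by rewrite /bumpM; case: cid2 => /= M _. Qed.

Lemma bump_at_le (z r t : R) : 0 < r -> `|bump_at z r t| <= bumpM / r.
Proof.
move=> r0; rewrite /bump_at normrM gtr0_norm ?invr_gt0// mulrC ler_wpM2r ?bump_le//.
by rewrite invr_ge0 ltW.
Qed.

Lemma kern_le z r x : 0 < r -> `|kern z r x| <= (bumpM / r) ^+ 2.
Proof. by move=> r0; rewrite /kern normrM expr2 ler_pM// bump_at_le. Qed.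

Lemma integral_kern O z r : open O -> 0 < r -> cbox z r `<=` O ->
  Rintegral leb2 O (kern z r) = 1.
Proof.
move=> oO r0 sub; have mO := open_mplane oO.
have IK : leb2.-integrable setT (EFin \o kern z r).
  rewrite (_ : EFin \o _ = EFin \o (fun x => (cst 1 : R * R -> R) x * kern z r x)).
    apply: loc_integrable_test; first exact: openT.
      by apply: loc_integrable_continuous => //; [exact: openT|exact: cst_continuous].
    by apply: test_kern.
  by apply/funext => x /=; rewrite mul1r.
rewrite Rintegral_mkcond (_ : _ \_ _ = kern z r); last first.
  apply/funext => x; rewrite /patch; case: ifPn => //; rewrite notin_setE => Nx.
  by rewrite kern0// => /sub.
rewrite /Rintegral -[X in fine X](integral12_prod_meas1 IK) /fubini_F.
rewrite -[RHS]/(fine 1%E) -(integral_bump_at z.1 r0); congr fine.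
apply: eq_integral => x _; rewrite /kern /=.
under eq_integral do rewrite EFinM.
rewrite integralZl//; first by rewrite integral_bump_at// mule1.
rewrite (_ : (fun t => _) = (EFin \o bump_at z.2 r) \_ `[(z.2 - r)%R, (z.2 + r)%R]); last first.
  apply/funext => t; rewrite /patch; case: ifPn => //; rewrite notin_setE/=.
  by rewrite in_itv/= -ler_distl => /negP; rewrite -ltNge => sx; rewrite bump_at0.
apply/(integrable_restrict lebesgue_measure (measurable_itv _) measurableT).
rewrite setTI; apply: continuous_compact_integrable; first exact: segment_compact.
by apply: continuous_subspaceT; exact: (smooth1_bump_at z.2 r 0%N).
Qed.

Definition avg O v z r : R := Rintegral leb2 O (fun x => v x * kern z r x).

(** Hölder on a square of side 2 rho: the constant m has conjugate norm m ((2 rho)^2)^(1 - 1/q),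
    which is where the exponent 2 - 2/q comes from. *)
Lemma bounded_pairing O Q q g psi m E rho w : 1 < q ->
  measurable (O : set mplane) -> Q = cbox w rho -> 0 < rho -> Q `<=` O ->
  measurable_fun (O : set mplane) (g : mplane -> R) -> continuous psi ->
  (forall x, ~ Q x -> psi x = 0) -> (forall x, `|psi x| <= m) ->
  (Lp_norm Q q g <= E%:E)%E ->
  `|Rintegral leb2 O (fun x => g x * psi x)| <= m * (2 * rho) `^ (2 - 2 / q) * E.
Proof.
move=> q1 mO QE rho0 sub mg cpsi psi0 psim gE.
have [q'1 q0 q'0 qq] := conj_expP q1.
have m0 : 0 <= m by apply: le_trans (psim 0).
have mQ : measurable (Q : set mplane) by rewrite QE; exact: measurable_cbox.
have mgQ : measurable_fun (Q : set mplane) (g : mplane -> R) by exact: measurable_funS mg.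
have mpsi : measurable_fun (Q : set mplane) (psi : mplane -> R).
  by apply: measurable_funTS; exact: continuous_mplane.
rewrite (_ : Rintegral _ _ _ = Rintegral leb2 Q (fun x => g x * psi x)); last first.
  rewrite -[in RHS](setIidr sub) Rintegral_mkcondr; apply: eq_Rintegral => x _.
  rewrite /patch; case: ifPn => //; rewrite notin_setE => /psi0 ->.
  by rewrite mulr0.
have L : Lp_norm Q (conj_exp q) (cst m) = (m * (2 * rho) `^ (2 - 2 / q))%:E.
  rewrite Lp_normE ?gt_eqF//.
  rewrite (_ : (fun x => _) = cst (m `^ conj_exp q)%:E); last first.
    by apply/funext => x; rewrite /cst ger0_norm.
  rewrite integral_cst// QE leb2_cbox ?(ltW rho0)// -EFinM poweR_EFin; congr EFin.
  rewrite [LHS]powRM ?powR_ge0 ?sqr_ge0// -powRrM mulfV ?gt_eqF// powRr1//; congr (_ * _).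
  rewrite -powR_mulrn ?mulr_ge0 ?(ltW rho0)// -powRrM; congr (_ `^ _).
  by rewrite (_ : (conj_exp q)^-1 = 1 - q^-1); [rewrite mulrBr mulr1|lra].
have B : {ae leb2, forall x, Q x -> `|g x * psi x| <= `|g x * cst m x|}.
  by apply: aeW => x _; rewrite !normrM ler_wpM2l// (le_trans (psim x))// ler_norm.
have [_] := @Holder_pairing R Q q g (cst m) (fun x => g x * psi x) q1 mQ mgQ
  (measurable_cst _) (measurable_funM mgQ mpsi) B (le_lt_trans gE (ltry _))
  (eq_ind_r (fun e => e < +oo)%E (ltry _) L).
rewrite L => H.
rewrite -lee_fin; apply: (le_trans H); rewrite muleC [X in (_ <= X)%E]EFinM.
by apply: lee_wpmul2l => //; rewrite lee_fin mulr_ge0// powR_ge0.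
Qed.

Lemma cbox_sub1 z r w rho : 0 <= r -> cbox z r `<=` cbox w rho ->
  [/\ w.1 - rho <= z.1 - r, z.1 + r <= w.1 + rho,
      w.2 - rho <= z.2 - r & z.2 + r <= w.2 + rho].
Proof.
move=> r0 sub.
have [] := sub (z.1 - r, z.2 - r); first by split; rewrite /= addrC addKr normrN ger0_norm.
have [] := sub (z.1 + r, z.2 + r); first by split; rewrite /= addrC addKr ger0_norm.
by rewrite /= !ler_distl => /andP[? ?] /andP[? ?] /andP[? ?] /andP[? ?].
Qed.

(* The difference of two box kernels is the divergence of a field supported in
   any box containing both. *)
Lemma avg_compare O v G q Q w rho z r z' r' E : open O -> 1 < q ->
  is_wgrad O v G -> Q = cbox w rho -> Q `<=` O -> 0 < rho ->
  cbox z r `<=` Q -> cbox z' r' `<=` Q -> rho / 4 <= r -> rho / 4 <= r' ->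
  (forall i, (Lp_norm Q q (fun x => G x i 0)%R <= E%:E)%E) ->
  `|avg O v z r - avg O v z' r'| <= 32 * bumpM * rho `^ (1 - 2 / q) * E.
Proof.
move=> oO q1 vG QE QO rho0 zQ z'Q rr rr' GE.
have mO := open_mplane oO; have [lv lG Hv] := vG.
have r0 : 0 < r by lra.
have r'0 : 0 < r' by lra.
move: (zQ) (z'Q); rewrite QE => /cbox_sub1 - /(_ (ltW r0))[a1 a2 a3 a4].
move=> /cbox_sub1 - /(_ (ltW r'0))[b1 b2 b3 b4].
(* For product kernels, a b - a' b' = (a - a') b + a' (b - b'), and each difference is integrated in
   its own variable. The differences of steps vanish outside the large box, because there both steps
   are 0 or both are 1. *)
pose Psi1 x := (step_at z.1 r x.1 - step_at z'.1 r' x.1) * bump_at z.2 r x.2.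
pose Psi2 x := bump_at z'.1 r' x.1 * (step_at z.2 r x.2 - step_at z'.2 r' x.2).
have s1 : smooth Psi1.
  apply: smoothM; last by apply: smooth_snd; exact: smooth1_bump_at.
  by apply: (smooth_fst (h := fun t => step_at z.1 r t - step_at z'.1 r' t)); apply: smooth1B; exact: smooth1_step_at.
have s2 : smooth Psi2.
  apply: smoothM; first by apply: smooth_fst; exact: smooth1_bump_at.
  by apply: (smooth_snd (h := fun t => step_at z.2 r t - step_at z'.2 r' t)); apply: smooth1B; exact: smooth1_step_at.
have st_dif (z1 z2 t l : R) : l - rho <= z1 - r -> l - rho <= z2 - r' ->
    z1 + r <= l + rho -> z2 + r' <= l + rho -> rho < `|t - l| -> step_at z1 r t - step_at z2 r' t = 0.
  move=> c1 c2 c3 c4; rewrite ltr_normr => /orP[] H.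
    by rewrite !step_at1// ?subrr//; lra.
  by rewrite !step_at0// ?subrr//; lra.
have Psi10 x : ~ Q x -> Psi1 x = 0.
  rewrite QE => /not_andP[] /negP; rewrite -ltNge => H; rewrite /Psi1.
    by rewrite (st_dif _ _ _ w.1) ?mul0r//; lra.
  rewrite [bump_at _ _ _]bump_at0 ?mulr0//; move: H; rewrite !ltr_normr => /orP[] H; apply/orP; [left|right]; lra.
have Psi20 x : ~ Q x -> Psi2 x = 0.
  rewrite QE => /not_andP[] /negP; rewrite -ltNge => H; rewrite /Psi2.
    rewrite bump_at0 ?mul0r//; move: H; rewrite !ltr_normr => /orP[] H; apply/orP; [left|right]; lra.
  by rewrite (st_dif _ _ _ w.2) ?mulr0//; lra.
have dst (t z1 z2 : R) : `|step_at z1 r t - step_at z2 r' t| <= 1.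
  have := step_itv (r^-1 * t + - (r^-1 * z1)).
  have := step_itv (r'^-1 * t + - (r'^-1 * z2)).
  by rewrite -/(step_at z2 r' t) -/(step_at z1 r t) ler_norml; lra.
(* The bound on every [bump_at] whose radius is at least rho/4. *)
pose m := 4 * bumpM / rho; have M0 := bumpM_gt0.
have bpm (z1 r1 t : R) : rho / 4 <= r1 -> `|bump_at z1 r1 t| <= m.
  move=> r1r; have r10 : 0 < r1 by lra.
  apply: le_trans (bump_at_le _ _ r10) _; rewrite /m ler_pdivrMr// mulrAC ler_pdivlMr//.
  nra.
have P1m x : `|Psi1 x| <= m.
  by rewrite /Psi1 normrM -[m]mul1r ler_pM// bpm.
have P2m x : `|Psi2 x| <= m.
  by rewrite /Psi2 normrM -[m]mulr1 ler_pM// bpm.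
have t1 : test_function O Psi1.
  by apply: (test_function_cbox (z := w) (r := rho) s1); rewrite -QE.
have t2 : test_function O Psi2.
  by apply: (test_function_cbox (z := w) (r := rho) s2); rewrite -QE.
have D1 x : grad Psi1 x 0 0 = (bump_at z.1 r x.1 - bump_at z'.1 r' x.1) * bump_at z.2 r x.2.
  rewrite gradE basis2_0.
  have H1 : is_derive x (1, 0) (fun x => step_at z.1 r x.1 - step_at z'.1 r' x.1) (bump_at z.1 r x.1 - bump_at z'.1 r' x.1).
    apply: (@is_derive_fst1 _ (fun t => step_at z.1 r t - step_at z'.1 r' t)).
    exact: is_deriveB (is_derive_step_at _ _ _) (is_derive_step_at _ _ _).
  have H2 := @is_derive_snd0 _ (bump_at z.2 r) x.
  have [_ ->] := is_deriveM H1 H2.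
  by rewrite /GRing.scale/= mulr0 add0r mulrC.
have D2 x : grad Psi2 x 1 0 = bump_at z'.1 r' x.1 * (bump_at z.2 r x.2 - bump_at z'.2 r' x.2).
  rewrite gradE basis2_1.
  have H1 : is_derive x (0, 1) (fun x => step_at z.2 r x.2 - step_at z'.2 r' x.2) (bump_at z.2 r x.2 - bump_at z'.2 r' x.2).
    apply: (@is_derive_snd1 _ (fun t => step_at z.2 r t - step_at z'.2 r' t)).
    exact: is_deriveB (is_derive_step_at _ _ _) (is_derive_step_at _ _ _).
  have H2 := @is_derive_fst0 _ (bump_at z'.1 r') x.
  have [_ ->] := is_deriveM H2 H1.
  by rewrite /GRing.scale/= mulr0 addr0.
have Iz z1 r1 : 0 < r1 -> cbox z1 r1 `<=` Q ->
    leb2.-integrable O (EFin \o (fun x => v x * kern z1 r1 x)).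
  by move=> r10 sub; apply: (loc_integrable_test oO lv); apply: test_kern => //; exact: subset_trans QO.
have Ig1 := loc_integrable_test oO lv (test_function_grad 0 t1).
have Ig2 := loc_integrable_test oO lv (test_function_grad 1 t2).
have -> : avg O v z r - avg O v z' r' =
   - Rintegral leb2 O (fun x => G x 0 0 * Psi1 x) - Rintegral leb2 O (fun x => G x 1 0 * Psi2 x).
  rewrite /avg -(RintegralB mO (Iz _ _ r0 zQ) (Iz _ _ r'0 z'Q)).
  rewrite -(Hv _ t1 0) -(Hv _ t2 1).
  rewrite -(RintegralD mO Ig1 Ig2); apply: eq_Rintegral => x _; rewrite D1 D2 /kern.
  by move: (bump_at _ _ _) (bump_at _ _ _) (bump_at _ _ _) (bump_at _ _ _) (v x) => b c d e h; ring.
(* One factor 4 comes from [m], the other from 2^(2 - 2/q) <= 4; the two components of the field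
   then double 16 to the 32 of the statement. *)
have aE : rho `^ (1 - 2 / q) * 16 * bumpM >= m * (2 * rho) `^ (2 - 2 / q).
  have -> : (2 * rho) `^ (2 - 2 / q) = 2 `^ (2 - 2 / q) * (rho * rho `^ (1 - 2 / q)).
    rewrite powRM ?(ltW rho0)//; congr (_ * _).
    rewrite -{2}(powRr1 (ltW rho0)) -powRD; first by congr (_ `^ _); ring.
    by rewrite (gt_eqF rho0) implybT.
  have le4 : (2 : R) `^ (2 - 2 / q) <= 4.
    apply: (@le_trans _ _ ((2 : R) `^ 2)).
      rewrite ler_powR//; first lra.
      by rewrite gerBl divr_ge0//; lra.
    by rewrite powR_mulrn//; lra.
  have -> : m * (2 `^ (2 - 2 / q) * (rho * rho `^ (1 - 2 / q))) =
     4 * bumpM * rho `^ (1 - 2 / q) * 2 `^ (2 - 2 / q).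
    by rewrite /m; field; rewrite gt_eqF.
  have := powR_ge0 rho (1 - 2 / q); set p := rho `^ _ => p0.
  have : 0 <= bumpM * p by rewrite mulr_ge0// ltW.
  nra.
have E0 : 0 <= E by rewrite -lee_fin; apply: le_trans (GE 0); exact: Lp_norm_ge0.
have mG i : measurable_fun (O : set mplane) (fun x : mplane => G x i 0) by have [] := lG i.
have B1 := bounded_pairing q1 mO QE rho0 QO (mG 0) (smooth_continuous s1) Psi10 P1m (GE 0).
have B2 := bounded_pairing q1 mO QE rho0 QO (mG 1) (smooth_continuous s2) Psi20 P2m (GE 1).
apply: le_trans (ler_normB _ _) _; rewrite normrN.
have := ler_wpM2r E0 aE; lra.
Qed.

End box_averages.

Lemma geometric_cauchy (R : realType) (u : nat -> R) (C mu : R) :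
  0 <= C -> 0 < mu < 1 -> (forall n, `|u n.+1 - u n| <= C * mu ^+ n) ->
  exists2 L, u @ \oo --> L & `|u 0%N - L| <= C / (1 - mu).
Proof.
move=> C0 /andP[mu0 mu1] H.
have mun : `|mu| < 1 by rewrite ger0_norm ?ltW.
have B n : `|u 0%N - u n| <= C / (1 - mu).
  have : `|u 0%N - u n| <= C * ((1 - mu ^+ n) / (1 - mu)).
    elim: n => [|n ih]; first by rewrite subrr normr0 expr0 subrr mul0r mulr0.
    apply: le_trans (ler_distD (u n) _ _) _; rewrite (distrC (u n)).
    have := H n; have -> : C * ((1 - mu ^+ n.+1) / (1 - mu)) =
       C * ((1 - mu ^+ n) / (1 - mu)) + C * mu ^+ n.
      by rewrite exprS; field; lra.
    lra.
  move/le_trans; apply; rewrite ler_wpM2l// ler_piMl ?invr_ge0 ?subr_ge0 ?(ltW mu1)//.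
  by rewrite gerBl exprn_ge0// ltW.
have cu : cvgn u.
  pose w n := u n.+1 - u n.
  have uE : u = fun n => u 0%N + series w n.
    apply/funext => n; rewrite /series/= /w.
    by rewrite telescope_sumr//; ring.
  rewrite uE; apply: is_cvgD; first exact: is_cvg_cst.
  apply: normed_cvg.
  apply: (series_le_cvg _ _ _ (@is_cvg_geometric_series _ C mu mun)) => n /=.
  - exact: normr_ge0.
  - by rewrite mulr_ge0// exprn_ge0// ltW.
  - exact: H.
exists (limn u) => //.
have cB : (fun n => `|u 0%N - u n|) @ \oo --> `|u 0%N - limn u|.
  by apply: cvg_norm; apply: cvgB => //; exact: cvg_cst.
rewrite -(cvg_lim (@Rhausdorff R) cB); apply: limr_le; first by apply/cvg_ex; exists (`|u 0%N - limn u|).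
by apply: nearW => n; exact: B.
Qed.

Section box_chains.
Context {R : realType}.
Implicit Types (O S : set (R * R)) (v f : R * R -> R) (x y z w c : R * R) (r rho E : R).

Lemma Lp_norm_sub O S q g : 0 < q -> S `<=` O -> measurable (S : set mplane) ->
  measurable (O : set mplane) -> measurable_fun (O : set mplane) (g : mplane -> R) ->
  (Lp_norm S q g <= Lp_norm O q g)%E.
Proof.
move=> q0 SO mS mO mg; rewrite !Lp_normE ?gt_eqF//.
have H : (\int[leb2]_(x in S) (`|g x| `^ q)%:E <= \int[leb2]_(x in O) (`|g x| `^ q)%:E)%E.
  apply: (@ge0_subset_integral _ mplane R leb2 S O mS mO) => //.
    exact: measurable_Lp_int.
apply: gt0_ler_poweR H; rewrite ?invr_ge0 ?ltW//.
- by rewrite in_itv/= leey andbT integral_ge0// => x _; rewrite lee_fin powR_ge0.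
- by rewrite in_itv/= leey andbT integral_ge0// => x _; rewrite lee_fin powR_ge0.
Qed.

Lemma avg_bound O v q z r E : open O -> 1 < q -> loc_integrable O v ->
  0 < r -> cbox z r `<=` O -> (Lp_norm (cbox z r) q v <= E%:E)%E ->
  `|avg O v z r| <= (bumpM / r) ^+ 2 * (2 * r) `^ (2 - 2 / q) * E.
Proof.
move=> oO q1 [mv _] r0 sub vE.
apply: (@bounded_pairing R O (cbox z r) q v (kern z r) _ E r z) => //.
- exact: open_mplane.
- by apply: smooth_continuous; exact: smooth_kern.
- by move=> x; exact: kern0.
- by move=> x; exact: kern_le.
Qed.

(** The box only has to be close to y, not to contain it: along a cone the boxes approach the vertex
    from one side. *)
Lemma avg_continuous O v y : open O -> continuous v -> forall e, 0 < e ->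
  exists2 d, 0 < d & forall z r, 0 < r -> cbox z r `<=` O ->
    cbox z r `<=` obox y d -> `|avg O v z r - v y| <= e.
Proof.
move=> oO cv e e0; have mO := open_mplane oO; have M0 := @bumpM_gt0 R.
(* The kernel is at most (bumpM / r)^2 on a square of area (2 r)^2, so averaging magnifies an
   oscillation by at most 4 bumpM^2. *)
pose e1 := e / (4 * bumpM ^+ 2).
have e10 : 0 < e1 by rewrite divr_gt0// mulr_gt0// exprn_gt0.
have : nbhs y [set x | `|v x - v y| <= e1].
  by have /cvgrPdist_le/(_ _ e10) := cv y; apply: filterS => x; rewrite distrC.
move/nbhs_obox => [d d0 sub]; exists d => // z r r0 zO zy.
have lv := loc_integrable_continuous oO cv.
have mQ := @measurable_cbox R z r.
have tk := test_kern r0 zO.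
have I1 := loc_integrable_test oO lv tk.
have I2 := loc_integrable_test oO (loc_integrable_continuous oO (@cst_continuous _ _ (v y))) tk.
have I3 : leb2.-integrable O (EFin \o (fun x => cst 1 x * kern z r x)).
  by apply: loc_integrable_test => //; apply: loc_integrable_continuous => //; exact: cst_continuous.
have -> : avg O v z r - v y = Rintegral leb2 O (fun x => v x * kern z r x - cst (v y) x * kern z r x).
  rewrite (RintegralB mO I1 I2); congr (_ - _).
  transitivity (v y * Rintegral leb2 O (fun x => cst 1 x * kern z r x)).
    rewrite (_ : Rintegral leb2 O _ = 1) ?mulr1//.
    transitivity (Rintegral leb2 O (kern z r)); last exact: integral_kern.
    by apply: eq_Rintegral => x _; rewrite /cst/= mul1r.
  rewrite -(RintegralZl _ mO I3); apply: eq_Rintegral => x _.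
  by rewrite /cst/= mul1r.
rewrite (_ : Rintegral _ _ _ = Rintegral leb2 (cbox z r)
    (fun x => v x * kern z r x - cst (v y) x * kern z r x)); last first.
  rewrite -[in RHS](setIidr zO) Rintegral_mkcondr; apply: eq_Rintegral => x _.
  rewrite /patch; case: ifPn => //; rewrite notin_setE => Nx.
  by rewrite kern0// !mulr0 subrr.
have I4 : leb2.-integrable (cbox z r) (EFin \o (fun x => v x * kern z r x - cst (v y) x * kern z r x)).
  by apply: (integrableS mO mQ zO); exact: (integrableB mO I1 I2).
rewrite -lee_fin (EFin_normr_Rintegral mQ I4).
apply: (le_trans (le_abse_integral _ mQ (measurable_int _ I4))).
apply: (@le_trans _ _ (\int[leb2]_(x in cbox z r) (e1 * (bumpM / r) ^+ 2)%:E)%E).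
  apply: (@ge0_le_integral _ mplane R leb2) => //.
  - by apply: measurableT_comp => //; exact: (measurable_int _ I4).
  - move=> x Qx; rewrite /= lee_fin /cst -mulrBl normrM.
    by apply: ler_pM => //; [apply: sub; exact: zy|exact: kern_le].
rewrite integral_cst// leb2_cbox ?(ltW r0)// -EFinM lee_fin /e1.
rewrite le_eqVlt; apply/orP; left; apply/eqP; field.
by rewrite !gt_eqF.
Qed.

Definition scale_pt y c s : R * R := (y.1 + s * c.1, y.2 + s * c.2).

(** The boxes have centre y + s c and radius rho s with s = h (1 - rho)^n. One step shortens s by
    rho s, so the next box stays in the box of radius 2 rho s, where [avg_compare] costs a power
    s^(1 - 2/q). The exponent is positive since q > 2, so the costs form a geometric series of ratio
    (1 - rho)^(1 - 2/q). The choice c = 0 gives concentric boxes, used for the representative inside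
    D. *)
Lemma avg_chain O S v G q y c rho h E : open O -> 2 < q -> is_wgrad O v G ->
  measurable (S : set mplane) -> S `<=` O ->
  `|c.1| <= 1 -> `|c.2| <= 1 -> 0 < rho -> rho <= 1 / 2 -> 0 < h ->
  (forall s, 0 < s -> s <= h -> cbox (scale_pt y c s) (2 * rho * s) `<=` S) ->
  (forall i, (Lp_norm S q (fun x => G x i 0)%R <= E%:E)%E) ->
  exists2 L,
    avg O v (scale_pt y c (h * (1 - rho) ^+ n)) (rho * (h * (1 - rho) ^+ n)) @[n --> \oo] --> L &
    `|avg O v (scale_pt y c h) (rho * h) - L| <=
      32 * bumpM * (2 * rho * h) `^ (1 - 2 / q) / (1 - (1 - rho) `^ (1 - 2 / q)) * E.
Proof.
move=> oO q2 vG mS SO c1 c2 rho0 rho1 h0 sub GE.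
pose a := 1 - 2 / q; have a0 : 0 < a.
  by rewrite subr_gt0 ltr_pdivrMr; lra.
pose l := 1 - rho; have l0 : 0 < l by rewrite /l; lra.
have l1 : l < 1 by rewrite /l; lra.
pose s n := h * l ^+ n.
have s0 n : 0 < s n by rewrite mulr_gt0// exprn_gt0.
have sh n : s n <= h by rewrite ler_piMr ?(ltW h0)// exprn_ile1 ?ltW.
have E0 : 0 <= E by rewrite -lee_fin; apply: le_trans (GE 0); exact: Lp_norm_ge0.
pose mu := l `^ a.
have mu01 : 0 < mu < 1.
  rewrite powR_gt0//=; have := @gt0_ltr_powR R a a0 l 1.
  by rewrite powR1; apply; rewrite ?nnegrE// ltW.
pose C := 32 * bumpM * (2 * rho * h) `^ a * E.
have C0 : 0 <= C.
  by rewrite /C !mulr_ge0 ?powR_ge0// ltW// bumpM_gt0.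
have [_ lG _] := vG.
have B n : `|avg O v (scale_pt y c (s n.+1)) (rho * s n.+1) -
    avg O v (scale_pt y c (s n)) (rho * s n)| <= C * mu ^+ n.
  have sub_ : cbox (scale_pt y c (s n)) (2 * rho * s n) `<=` S by exact: sub.
  have rs0 : 0 < rho * s n by exact: mulr_gt0.
  have sS : s n.+1 = l * s n by rewrite /s exprS; ring.
  have rs1 : s n.+1 = s n - rho * s n by rewrite sS /l; ring.
  have rs1' : rho * s n.+1 <= rho * s n.
    by rewrite ler_wpM2l ?(ltW rho0)//; lra.
  have shift_le t : `|t| <= 1 -> `|s n.+1 * t - s n * t| <= rho * s n.
    move=> t1; rewrite -mulrBl normrM (_ : s n.+1 - s n = - (rho * s n)); last lra.
    by rewrite normrN (gtr0_norm rs0); apply: ler_piMr => //; exact: ltW.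
  have -> : C * mu ^+ n = 32 * bumpM * (2 * rho * s n) `^ a * E.
    rewrite /C /s (_ : 2 * rho * (h * l ^+ n) = 2 * rho * h * l ^+ n); last by ring.
    rewrite [in RHS]powRM ?mulr_ge0 ?exprn_ge0 ?(ltW rho0) ?(ltW h0) ?(ltW l0)//.
    rewrite /mu -(powR_mulrn n (powR_ge0 l a)) -(powR_mulrn n (ltW l0)) -!powRrM.
    by rewrite (mulrC a); ring.
  apply: (avg_compare (G := G) (w := scale_pt y c (s n)) oO _ vG erefl) => //.
  - lra.
  - exact: subset_trans SO.
  - by apply: mulr_gt0 => //; apply: mulr_gt0.
  - move=> x [x1 x2]; split.
    + have := shift_le _ c1.
      have := ler_distD ((scale_pt y c (s n.+1)).1) x.1 (scale_pt y c (s n)).1.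
      rewrite {3 4}/scale_pt/= opprD addrACA subrr add0r.
      move: x1; lra.
    + have := shift_le _ c2.
      have := ler_distD ((scale_pt y c (s n.+1)).2) x.2 (scale_pt y c (s n)).2.
      rewrite {3 4}/scale_pt/= opprD addrACA subrr add0r.
      move: x2; lra.
  - by move=> x [x1 x2]; split; lra.
  (* This is where [rho <= 1 / 2] enters: the next radius is at least half the previous one, as the
     lower bound on radii in [avg_compare] asks. *)
  - have : rho * s n.+1 = rho * s n - rho * (rho * s n) by rewrite rs1; ring.
    have : rho * (rho * s n) <= 1 / 2 * (rho * s n) by rewrite ler_wpM2r// ltW.
    lra.
  - lra.
  - move=> i; apply: le_trans (GE i); apply: Lp_norm_sub => //.
    + lra.
    + exact: measurable_cbox.
    + by apply: measurable_funS (lG i).1; [exact: open_mplane|].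
have [L uL BL] := geometric_cauchy C0 mu01 B.
exists L => //; move: BL; rewrite /s expr0 mulr1 => /le_trans; apply.
by rewrite /C -/a -/l -/mu mulrAC.
Qed.

End box_chains.

Section vec2_algebra.
Context {R : realType}.
Implicit Types x y : R * R.

Lemma vec2_0 x : vec2 x 0 0 = x.1. Proof. by rewrite mxE. Qed.
Lemma vec2_1 x : vec2 x 1 0 = x.2. Proof. by rewrite mxE. Qed.

Lemma dot_vec2 x y : dot (vec2 x) (vec2 y) = x.1 * y.1 + x.2 * y.2.
Proof. by rewrite dot2E !vec2_0 !vec2_1. Qed.

Lemma edist_le x y : Defs.edist x y <= `|x.1 - y.1| + `|x.2 - y.2|.
Proof.
rewrite -ler_sqr ?nnegrE ?addr_ge0 ?norm2_ge0// sqr_norm2.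
rewrite dot2E !mxE/= -!expr2 -(real_normK (num_real (x.1 - y.1))).
rewrite -(real_normK (num_real (x.2 - y.2))).
have := normr_ge0 (x.1 - y.1); have := normr_ge0 (x.2 - y.2); nra.
Qed.

End vec2_algebra.

(** * Interior cones of a Lipschitz domain and the sup bound for smooth functions *)

Section cone_condition.
Context {R : realType}.
Implicit Types (Omega Gamma : set (R * R)) (x y z c : R * R) (h rho d : R).

Definition cone_at Omega c rho h y : Prop :=
  forall s, 0 < s -> s <= h -> cbox (scale_pt y c s) (2 * rho * s) `<=` Omega.

(** One direction and one opening serve every point of [Omega] near x0; this uniformity is what the
    compactness argument over the closure consumes. The direction is the vertical axis of the local
    graph. *)
Lemma lipschitz_domain_cone Omega x0 : lipschitz_domain Omega -> closure Omega x0 ->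
  exists c rho h d, [/\ `|c.1| <= 1 /\ `|c.2| <= 1, 0 < rho <= 1 / 2, 0 < h, 0 < d &
    forall y, Omega y -> obox x0 d y -> cone_at Omega c rho h y].
Proof.
move=> [_ oO _ bdO] clx0.
have [Ox0|NOx0] := pselect (Omega x0).
  have /nbhs_cbox[r r0 sub] : nbhs x0 Omega by exact: open_nbhs_nbhs.
  (* Away from the boundary the degenerate direction 0 is enough: the boxes remain centred at y. *)
  exists (0, 0), (1 / 2), (r / 2), (r / 2); split.
  - by rewrite /= normr0; split.
  - by apply/andP; split; lra.
  - lra.
  - lra.
  move=> y Oy [y1 y2] s s0 sr x [x1 x2]; apply: sub; rewrite /= !mulr0 !addr0 in x1 x2.
  split; [have := ler_distD y.1 x.1 x0.1|have := ler_distD y.2 x.2 x0.2]; lra.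
have bx0 : bd Omega x0 by split => //; rewrite ((interior_id Omega).1 oO).
have [r [r0 [e [g [e1 lg gO]]]]] := bdO x0 bx0.
have [L L0 HL] : exists2 L, 0 < L & forall a b : R, `|g a - g b| <= L * `|a - b|.
  move: lg => /pinfty_ex_gt0[L L0 H]; exists L => // a b.
  exact: (H (a, b)).
have e12 : e.1 ^+ 2 + e.2 ^+ 2 = 1.
  by have := sqr_norm2 (vec2 e); rewrite e1 dot_vec2 expr1n !expr2.
have e1b : `|e.1| <= 1.
  rewrite -(@ler_sqr _ `|e.1|) ?nnegrE// real_normK ?num_real// expr1n.
  by have := sqr_ge0 e.2; lra.
have e2b : `|e.2| <= 1.
  rewrite -(@ler_sqr _ `|e.2|) ?nnegrE// real_normK ?num_real// expr1n.
  by have := sqr_ge0 e.1; lra.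
(* A deviation of at most 2 rho s per coordinate changes each frame coordinate by at most 4 rho s.
   The graph then rises by at most 4 L rho s and the point sinks by at most 4 rho s, together s/2,
   less than the gain s along the axis. *)
pose rho := (8 * (L + 1))^-1.
have rhoE : rho * (8 * (L + 1)) = 1 by rewrite mulVf// gt_eqF//; lra.
have rho0 : 0 < rho by rewrite invr_gt0; lra.
have rho1 : rho <= 1 / 8 by nra.
exists (- e.2, e.1), rho, (r / 8), (r / 8); split.
- by rewrite /= normrN.
- by apply/andP; split; lra.
- lra.
- lra.
move=> y Oy [y1 y2] s s0 sr x [/= x1 x2].
have edy : Defs.edist y x0 < r by apply: le_lt_trans (edist_le _ _) _; lra.
move/(gO y edy): Oy; rewrite !dot_vec2/= => gy.
pose d1 := x.1 - (y.1 + s * - e.2); pose d2 := x.2 - (y.2 + s * e.1).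
have d1b : `|d1| <= 2 * rho * s by exact: x1.
have d2b : `|d2| <= 2 * rho * s by exact: x2.
have xE1 : x.1 - x0.1 = (y.1 - x0.1) - s * e.2 + d1 by rewrite /d1; ring.
have xE2 : x.2 - x0.2 = (y.2 - x0.2) + s * e.1 + d2 by rewrite /d2; ring.
have rs : 2 * rho * s <= s / 4 by nra.
have se1 : `|s * e.1| <= s by rewrite normrM gtr0_norm// ler_piMr// ltW.
have se2 : `|s * e.2| <= s by rewrite normrM gtr0_norm// ler_piMr// ltW.
have edx : Defs.edist x x0 < r.
  apply: le_lt_trans (edist_le _ _) _; rewrite xE1 xE2.
  have := ler_normD (y.1 - x0.1 - s * e.2) d1.
  have := ler_normB (y.1 - x0.1) (s * e.2).
  have := ler_normD (y.2 - x0.2 + s * e.1) d2.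
  have := ler_normD (y.2 - x0.2) (s * e.1).
  lra.
apply/(gO x edx); rewrite !dot_vec2/= xE1 xE2.
have de : `|d1 * e.1 + d2 * e.2| <= 4 * rho * s.
  apply: le_trans (ler_normD _ _) _; rewrite !normrM.
  have := ler_pM (normr_ge0 d1) (normr_ge0 e.1) d1b e1b.
  have := ler_pM (normr_ge0 d2) (normr_ge0 e.2) d2b e2b.
  lra.
have dn : `|- d1 * e.2 + d2 * e.1| <= 4 * rho * s.
  apply: le_trans (ler_normD _ _) _; rewrite !normrM normrN.
  have := ler_pM (normr_ge0 d1) (normr_ge0 e.2) d1b e2b.
  have := ler_pM (normr_ge0 d2) (normr_ge0 e.1) d2b e1b.
  lra.
set a := (X in g X < _); set a0 := (X in g X < _) in gy.
have aE : a - a0 = d1 * e.1 + d2 * e.2 by rewrite /a /a0; ring.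
have := HL a a0; rewrite aE => /(le_trans (ler_norm _)) gaa.
have Lde : L * `|d1 * e.1 + d2 * e.2| <= L * (4 * rho * s) by rewrite ler_wpM2l// ltW.
have -> : (y.1 - x0.1 - s * e.2 + d1) * - e.2 + (y.2 - x0.2 + s * e.1 + d2) * e.1 =
  (y.1 - x0.1) * - e.2 + (y.2 - x0.2) * e.1 + s * (e.1 ^+ 2 + e.2 ^+ 2) +
  (- d1 * e.2 + d2 * e.1) by ring.
rewrite e12 mulr1; move: dn; rewrite ler_norml => /andP[dn _].
have : L * (4 * rho * s) + 4 * rho * s = s / 2.
  have -> : L * (4 * rho * s) + 4 * rho * s = (rho * (8 * (L + 1))) * (s / 2) by field.
  by rewrite rhoE mul1r.
move: gy gaa Lde dn s0; lra.
Qed.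

Lemma scale_cvg h rho : 0 < rho <= 1 / 2 -> 0 < h -> forall e, 0 < e ->
  \forall n \near \oo, h * (1 - rho) ^+ n < e.
Proof.
move=> /andP[rho0 rho1] h0 e e0.
have l1 : `|1 - rho| < 1 by rewrite ger0_norm; lra.
have /cvgrPdist_lt/(_ (e / h) (divr_gt0 e0 h0)) := cvg_expr l1.
apply: filterS => n; rewrite sub0r normrN ger0_norm; last by rewrite exprn_ge0//; lra.
by rewrite ltr_pdivlMr// mulrC.
Qed.

(** The averages along the cone converge to f y by continuity, so f y is the average at the widest
    box, bounded by the L_q norm, plus the chain error, bounded by the gradient. The constant
    depends on the shape of the cone but not on its vertex. *)
Lemma cone_sup_bound Omega c rho h q : open Omega -> 2 < q ->
  `|c.1| <= 1 -> `|c.2| <= 1 -> 0 < rho <= 1 / 2 -> 0 < h ->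
  exists2 C, 0 <= C & forall f y E, smooth f -> cone_at Omega c rho h y ->
    (W1_norm Omega q f <= E%:E)%E -> `|f y| <= C * E.
Proof.
move=> oO q2 c1 c2 rho01 h0; have /andP[rho0 rho1] := rho01.
have mO := open_mplane oO.
have q0 : 0 < q by lra.
pose C1 := (@bumpM R / (rho * h)) ^+ 2 * (2 * (rho * h)) `^ (2 - 2 / q).
pose C2 := 32 * @bumpM R * (2 * rho * h) `^ (1 - 2 / q) / (1 - (1 - rho) `^ (1 - 2 / q)).
exists (`|C1| + `|C2|); first by rewrite addr_ge0.
move=> f y E sf cone fE.
have wf := wdiff_smooth oO sf; have wgf := wdiffP wf; have [lf lG _] := wgf.
have E0 : 0 <= E by rewrite -lee_fin; apply: le_trans fE; exact: W1_norm_ge0.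
have GE i : (Lp_norm Omega q (fun x => wgrad Omega f x i 0)%R <= E%:E)%E.
  by apply: le_trans fE; exact: Lp_norm_wgrad.
have [L fL BL] := avg_chain oO q2 wgf mO (@subset_refl _ Omega) c1 c2 rho0 rho1 h0 cone GE.
have rh0 : 0 < rho * h by exact: mulr_gt0.
have sub1 s : 0 < s -> s <= h -> cbox (scale_pt y c s) (rho * s) `<=` Omega.
  move=> s0 sh; apply: subset_trans (cone s s0 sh) => x [x1 x2].
  have : 0 < rho * s by exact: mulr_gt0.
  by split; lra.
have A1 : `|avg Omega f (scale_pt y c h) (rho * h)| <= C1 * E.
  apply: avg_bound => //; [lra|exact: sub1|].
  apply: le_trans fE; apply: (@le_trans _ _ (Lp_norm Omega q f)).
    apply: Lp_norm_sub => //; [exact: sub1|exact: measurable_cbox|exact: wdiff_measurable].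
  exact: Lp_norm_W1.
have <- : L = f y.
  apply: (cvg_unique (@Rhausdorff R) fL); apply/cvgrPdist_le => e e0.
  have [d d0 Hd] := avg_continuous y oO (smooth_continuous sf) e0.
  near=> n.
  have s0 : 0 < h * (1 - rho) ^+ n by rewrite mulr_gt0// exprn_gt0//; lra.
  have sh : h * (1 - rho) ^+ n <= h by rewrite ler_piMr ?(ltW h0)// exprn_ile1//; lra.
  have sd : h * (1 - rho) ^+ n < d / 2 by near: n; apply: scale_cvg => //; lra.
  move: s0 sh sd; set s := h * _ => s0 sh sd.
  rewrite distrC; apply: Hd; [exact: mulr_gt0|exact: sub1|].
  have sc t : `|t| <= 1 -> `|s * t| <= s.
    by move=> t1; rewrite normrM gtr0_norm// ler_piMr// ltW.
  have rs : rho * s <= s / 2 by nra.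
  move=> x [x1 x2]; split.
    have := ler_distD (scale_pt y c s).1 x.1 y.1; have := sc _ c1.
    have -> : (scale_pt y c s).1 - y.1 = s * c.1 by rewrite /scale_pt/=; ring.
    lra.
  have := ler_distD (scale_pt y c s).2 x.2 y.2; have := sc _ c2.
  have -> : (scale_pt y c s).2 - y.2 = s * c.2 by rewrite /scale_pt/=; ring.
  lra.
have -> : L = avg Omega f (scale_pt y c h) (rho * h) -
  (avg Omega f (scale_pt y c h) (rho * h) - L) by ring.
apply: le_trans (ler_normB _ _) _; rewrite mulrDl; apply: lerD.
  by apply: le_trans A1 _; rewrite ler_wpM2r// ler_norm.
by apply: le_trans BL _; rewrite ler_wpM2r// ler_norm.
Unshelve. all: by end_near. Qed.

Lemma closure_compact (A : set (R * R)) : bounded_set A -> compact (closure A).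
Proof.
move=> /bounded_cbox[r r0 Ar]; apply: (subclosed_compact _ (@compact_cbox R 0 r)).
  exact: closed_closure.
rewrite [X in _ `<=` X](closure_id (cbox 0 r)).1; last exact: closed_cbox.
exact: closure_subset.
Qed.

(** Compactness of the closure turns the local constants into one. The covering predicate concerns
    only points of [Omega], the vertices of cones; boundary points follow from the continuity of
    f. *)
Lemma morrey_smooth Omega q : bounded_set Omega -> lipschitz_domain Omega -> 2 < q ->
  exists2 C, 0 < C & forall f E x, smooth f -> (W1_norm Omega q f <= E%:E)%E ->
    closure Omega x -> `|f x| <= C * E.
Proof.
move=> bO lO q2; have [_ oO _ _] := lO.
pose P (C : R) x := Omega x -> forall f E, smooth f -> (W1_norm Omega q f <= E%:E)%E ->
  `|f x| <= C * E.
have cov : \forall C \near +oo, closure Omega `<=` P C.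
  have /compact_near_coveringP := closure_compact bO.
  apply => x0 clx0.
  have [c [rho [h [d [[c1 c2] rho01 h0 d0 cone]]]]] := lipschitz_domain_cone lO clx0.
  have [C C0 HC] := cone_sup_bound oO q2 c1 c2 rho01 h0.
  exists (obox x0 d, [set C' | C <= C']).
    by split => /=; [apply/nbhs_obox; exists d|by apply: nbhs_pinfty_ge; exact: num_real].
  move=> [y C'] [/= yd CC'] Oy f E sf fE.
  have E0 : 0 <= E by rewrite -lee_fin; apply: le_trans fE; exact: W1_norm_ge0.
  apply: le_trans (HC f y E sf (cone y Oy yd) fE) _.
  by rewrite ler_wpM2r.
have [C C0 HC] := pinfty_ex_gt0 cov.
exists C => // f E x sf fE clx.
have cl : closed [set x | `|f x| <= C * E].
  apply: (@closed_comp _ _ (fun x => `|f x|) [set t | t <= C * E]); last exact: closed_le.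
  move=> y _; apply: cvg_norm; exact: smooth_continuous.
have : closure Omega `<=` [set x | `|f x| <= C * E].
  rewrite [X in _ `<=` X](closure_id _).1//; apply: closure_subset => y Oy.
  by apply: (HC y (subset_closure Oy) Oy).
exact.
Qed.

End cone_condition.

(** * Continuous representatives up to the boundary *)

Section continuous_representative.
Context {R : realType}.
Implicit Types (Omega Gamma : set (R * R)) (u v f : R * R -> R) (q E : R).

Lemma Lp_norm_bounded Omega q g m : 1 <= q -> measurable (Omega : set mplane) ->
  measurable_fun (Omega : set mplane) (g : mplane -> R) -> 0 <= m ->
  (forall x, Omega x -> `|g x| <= m) ->
  (Lp_norm Omega q g <= m%:E * (leb2 Omega) `^ q^-1)%E.
Proof.
move=> q1 mO mg m0 gm; have q0 : 0 < q by lra.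
apply: (@le_trans _ _ (Lp_norm Omega q (cst m))).
  apply: Lp_norm_le => //; apply: aeW => x Ox; rewrite /cst [X in _ <= X]ger0_norm//.
  exact: gm.
rewrite Lp_normE ?gt_eqF// (_ : (fun x => _) = cst (m `^ q)%:E); last first.
  by apply/funext => x; rewrite /cst ger0_norm.
rewrite integral_cst// poweRM ?lee_fin ?powR_ge0//.
by rewrite poweR_EFin -powRrM mulfV ?gt_eqF// powRr1.
Qed.

Lemma Lp_norm_eq0 Omega q g : 0 < q -> measurable (Omega : set mplane) ->
  measurable_fun (Omega : set mplane) (g : mplane -> R) ->
  Lp_norm Omega q g = 0%E -> {ae leb2, forall x, Omega x -> g x = 0}.
Proof.
move=> q0 mO mg g0.
have mr : measurable_fun [set: mplane] (EFin \o (g \_ Omega)).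
  by apply/measurable_EFinP; apply/(measurable_restrictT _ mO).
have := @Lnorm_eq0_eq0 _ mplane R leb2 (EFin \o (g \_ Omega)) q%:E mr _ g0.
rewrite lte_fin => /(_ q0); apply: aeS => x /(_ I) H Ox.
by move: H; rewrite /= /patch mem_set//= => -[].
Qed.

Lemma C_norm_ge0 Omega v : Omega !=set0 -> (0 <= C_norm Omega v)%E.
Proof.
move=> [x Ox]; apply: le_ereal_inf_tmp => _ [w _ <-].
apply: (@le_trans _ _ `|w x|%:E); first by rewrite lee_fin.
by apply: ereal_sup_ubound; exists x => //; exact: subset_closure.
Qed.

(** Smooth approximants of v at distance 1/(n+1) exist by definition of [W1G]. The bound for smooth
    functions, applied to their differences, makes them uniformly Cauchy on the closure; the limit
    is a representative admissible in [C_norm]. *)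
Lemma C_norm_le_W1 Omega Gamma q : bounded_set Omega -> lipschitz_domain Omega ->
  2 < q -> exists2 C, 0 < C & forall v, W1G Omega Gamma q v ->
    (C_norm Omega v <= C%:E * W1_norm Omega q v)%E.
Proof.
move=> bO lO q2; have [_ oO _ _] := lO.
have [C C0 HC] := morrey_smooth bO lO q2; exists C => // v [[wv fv] apv].
have mO := open_mplane oO; have q1 : 1 <= q by lra.
have q0 : 0 < q by lra.
pose e (n : nat) : R := n.+1%:R^-1.
have e0 n : 0 < e n by rewrite invr_gt0.
have [f Hf] := choice (fun n => apv (e n) (e0 n)).
have sf n : smooth (f n) by have [] := Hf n.
have vf n : (W1_norm Omega q (fun x => (v x - f n x)%R) <= (e n)%:E)%E.
  by have [_ _ /ltW] := Hf n.
have wf n := wdiff_smooth oO (sf n).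
have ff n m : (W1_norm Omega q (fun x => f n x - f m x)%R <= (e n + e m)%:E)%E.
  have := W1_normB oO q1 (wdiffB oO wv (wf m)) (wdiffB oO wv (wf n)).
  rewrite (_ : (fun x => _) = (fun x => f n x - f m x)); last by apply/funext => x; ring.
  move/le_trans; apply; rewrite EFinD addeC; apply: leeD; exact: vf.
have fb n m x : closure Omega x -> `|f n x - f m x| <= C * (e n + e m).
  by apply: (HC (fun x => f n x - f m x)) (ff n m); exact: smoothB.
have ecvg : e @ \oo --> (0 : R) by exact: cvg_harmonic.
pose w x := limn (fun n => f n x).
have fw x : closure Omega x -> f n x @[n --> \oo] --> w x.
  move=> clx; apply: (@cauchy_cvg _ ((fun n => f n x) @ \oo)); apply: cauchy_exP => d d0.
  have d2 : 0 < d / (2 * C) by rewrite divr_gt0// mulr_gt0.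
  have /cvgrPdist_lt/(_ _ d2) [N _ HN] := ecvg.
  exists (f N x); exists N => // n /= Nn.
  rewrite /ball/=; apply: le_lt_trans (fb N n x clx) _.
  have := HN N (leqnn N); have := HN n Nn.
  rewrite /= !sub0r !normrN !gtr0_norm// !ltr_pdivlMr ?mulr_gt0//; lra.
have fwb n x : closure Omega x -> `|f n x - w x| <= C * e n.
  move=> clx.
  have c1 : (fun m => `|f n x - f m x|) @ \oo --> `|f n x - w x|.
    by apply: cvg_norm; apply: cvgB; [exact: cvg_cst|exact: fw].
  have c2 : (fun m => C * (e n + e m)) @ \oo --> C * (e n + 0).
    apply: cvgM; first exact: cvg_cst.
    by apply: cvgD; [exact: cvg_cst|exact: ecvg].
  rewrite addr0 in c2.
  rewrite -(cvg_lim (@Rhausdorff R) c1) -(cvg_lim (@Rhausdorff R) c2).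
  apply: ler_lim; [by apply/cvg_ex; eexists; exact: c1|by apply/cvg_ex; eexists; exact: c2|].
  by apply: nearW => m; exact: fb.
have cw : {within closure Omega, continuous w}.
  apply/subspace_continuousP => x clx; apply/cvgrPdist_le => d d0.
  have d2 : 0 < d / (3 * C) by rewrite divr_gt0// mulr_gt0.
  have /cvgrPdist_lt/(_ _ d2) [N _ HN] := ecvg.
  have eN : C * e N <= d / 3.
    have := HN N (leqnn N); rewrite /= sub0r normrN gtr0_norm// ltr_pdivlMr ?mulr_gt0//; lra.
  have cf := smooth_continuous (sf N) (x := x).
  have /cvgrPdist_lt/(_ (d / 3) (divr_gt0 d0 (ltr0n R 3))) nf := cf.
  rewrite /within; near_simpl; apply: filterS nf => y yf cly.
  have := fwb N x clx; have := fwb N y cly.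
  have := ler_distD (f N x) (w x) (w y); have := ler_distD (f N y) (f N x) (w y).
  rewrite (distrC (w x) (f N x)); lra.
have mw : measurable_fun (Omega : set mplane) (w : mplane -> R).
  apply: open_within_measurable => //.
  by apply: continuous_subspaceW cw; exact: subset_closure.
have mv := wdiff_measurable wv.
have mf n := wdiff_measurable (wf n).
have finO : (leb2 Omega < +oo)%E by exact: bounded_leb2.
pose V := fine ((leb2 Omega) `^ q^-1)%E.
have VE : ((leb2 Omega) `^ q^-1)%E = V%:E.
  by rewrite fineK// ge0_fin_numE ?poweR_ge0// poweR_lty.
(* The approximants tend to [w] uniformly, hence in L_q because [Omega] has finite measure, and to
   [v] in the Sobolev norm. *)
have wv0 : Lp_norm Omega q (fun x => w x - v x) = 0%E.
  have B n : (Lp_norm Omega q (fun x => w x - v x)%R <= (e n * (C * V + 1))%:E)%E.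
    have m1 : measurable_fun (Omega : set mplane) (fun x : mplane => w x - f n x).
      exact: measurable_funB.
    have m2 : measurable_fun (Omega : set mplane) (fun x : mplane => f n x - v x).
      exact: measurable_funB.
    have := Lp_normD q1 mO m1 m2.
    rewrite (_ : (fun x => _ + _) = (fun x => w x - v x)); last by apply/funext => x; ring.
    move/le_trans; apply; rewrite mulrDr mulr1 EFinD; apply: leeD.
      rewrite mulrCA mulrA EFinM -VE; apply: Lp_norm_bounded => //.
        by rewrite mulr_ge0// ltW.
      by move=> x Ox; rewrite distrC; apply: fwb; exact: subset_closure.
    apply: le_trans (vf n); apply: le_trans (Lp_norm_W1 oO q0 (wdiffB oO wv (wf n))).
    apply: Lp_norm_le q0 mO m2 _ _; first exact: measurable_funB.
    by apply: aeW => x _; rewrite distrC.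
  apply/eqP; rewrite eq_le Lp_norm_ge0 andbT.
  apply/lee_addgt0Pr => d d0; rewrite add0e.
  have V0 : 0 <= V by apply: fine_ge0; exact: poweR_ge0.
  have K0 : 0 < C * V + 1 by rewrite ltr_wpDl// mulr_ge0// ltW.
  have /cvgrPdist_lt/(_ _ (divr_gt0 d0 K0)) [N _ HN] := ecvg.
  apply: le_trans (B N) _; rewrite lee_fin.
  by have := HN N (leqnn N); rewrite /= sub0r normrN gtr0_norm// ltr_pdivlMr// => /ltW.
have wvae : {ae leb2, forall x, Omega x -> w x = v x}.
  apply: (aeS _ (Lp_norm_eq0 q0 mO _ wv0)); last exact: measurable_funB.
  by move=> x H Ox; apply/eqP; rewrite -subr_eq0 H.
have fE : W1_norm Omega q v \is a fin_num by rewrite ge0_fin_numE// W1_norm_ge0.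
set N := W1_norm Omega q v in fv fE *.
have NE : N = (fine N)%:E by rewrite fineK.
apply: (@le_trans _ _ (ereal_sup [set `|w x|%:E | x in closure Omega])).
  by apply: ereal_inf_lbound; exists w.
apply: ge_ereal_sup => _ [x clx <-]; rewrite NE -EFinM lee_fin.
have B n : `|w x| <= C * fine N + 2 * C * e n.
  have fn : (W1_norm Omega q (f n) <= (fine N + e n)%:E)%E.
    have := W1_normB oO q1 wv (wdiffB oO wv (wf n)).
    rewrite (_ : (fun x => _) = f n); last by apply/funext => y; ring.
    by move/le_trans; apply; rewrite EFinD -NE; apply: leeD => //; exact: vf.
  have := HC (f n) _ x (sf n) fn clx; have := fwb n x clx.
  have := ler_distD (f n x) (w x) 0; rewrite !subr0 (distrC (w x)); lra.
rewrite -[X in _ <= X]addr0; apply/ler_addgt0Pr => d d0; rewrite addr0.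
have d2 : 0 < d / (2 * C) by rewrite divr_gt0// mulr_gt0.
have /cvgrPdist_lt/(_ _ d2) [M _ HM] := ecvg.
have := HM M (leqnn M); rewrite /= sub0r normrN gtr0_norm// ltr_pdivlMr ?mulr_gt0//.
have := B M; lra.
Unshelve. all: by end_near. Qed.

End continuous_representative.

Lemma cvg_coord (R : realType) T (F : set_system T) (FF : Filter F) (f : T -> R * R) (l : R * R) :
  f @ F --> l -> (fun t => (f t).1) @ F --> l.1 /\ (fun t => (f t).2) @ F --> l.2.
Proof.
have c1 : {for l, continuous (fst : R * R -> R)} by exact: cvg_fst.
have c2 : {for l, continuous (snd : R * R -> R)} by exact: cvg_snd.
by move=> H; split; [exact: cvg_comp H c1|exact: cvg_comp H c2].
Qed.

(** * The flow *)

Section field.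
Context {R : realType}.
Implicit Types (x y z p : R * R) (D : set (R * R)) (X : R * R -> R * R).

Definition norm1 x : R := `|x.1| + `|x.2|.

Lemma norm1_ge0 x : 0 <= norm1 x. Proof. by rewrite addr_ge0. Qed.

Lemma norm1D x y : norm1 (x + y) <= norm1 x + norm1 y.
Proof. by rewrite /norm1/= addrACA lerD// ler_normD. Qed.

Lemma norm1N x : norm1 (- x) = norm1 x. Proof. by rewrite /norm1/= !normrN. Qed.

Lemma norm1_dist x y : norm1 (x - y) = norm1 (y - x).
Proof. by rewrite -norm1N opprB. Qed.

Lemma coord_norm1 x : `|x.1| <= norm1 x /\ `|x.2| <= norm1 x.
Proof. by rewrite /norm1 lerDl lerDr. Qed.

Definition crd X (i : 'I_2) y : R := vec2 (X y) i 0.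

Lemma crd0 X y : crd X 0 y = (X y).1. Proof. exact: vec2_0. Qed.
Lemma crd1 X y : crd X 1 y = (X y).2. Proof. exact: vec2_1. Qed.

(** The entries of [jac] are only directional derivatives along the axes; linearity of the
    differential extends them to every direction. *)
Lemma is_derive_comp_field X i x v : differentiable X x ->
  is_derive x v (crd X i) (v.1 * jac X x i 0 + v.2 * jac X x i 1).
Proof.
move=> dX.
have H w : is_derive x w (crd X i) (vec2 ('d X x w) i 0).
  have dw : (fun h : R => h^-1 *: ((X \o shift x) (h *: w) - X x)) @ 0^' --> 'd X x w.
    by have /cvgP := @diff_derivable _ _ _ X x w dX; rewrite -deriveE//; exact: diff_derivable.
  have K : (fun h : R => h^-1 *: ((crd X i \o shift x) (h *: w) - crd X i x)) @ 0^' -->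
      vec2 ('d X x w) i 0.
    have [d1 d2] := cvg_coord _ dw.
    case: (ord2P i) => ->; rewrite ?vec2_0 ?vec2_1.
      by under eq_fun do rewrite /= !crd0.
    by under eq_fun do rewrite /= !crd1.
  by apply: DeriveDef; [apply/cvg_ex; eexists; exact: K|exact: cvg_lim K].
have jE j : jac X x i j = vec2 ('d X x (basis2 j)) i 0.
  by rewrite mxE; have [_ <-] := H (basis2 j).
apply: is_derive_eq; rewrite !jE.
have {1}-> : v = v.1 *: basis2 0 + v.2 *: basis2 1.
  rewrite basis2_0 basis2_1; case: v => v1 v2.
  by change ((v1, v2) = (v1 * 1 + v2 * 0, v1 * 0 + v2 * 1)); congr pair; ring.
rewrite linearD !linearZ/=.
by case: (ord2P i) => ->; rewrite ?vec2_0 ?vec2_1.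
Qed.

Definition seg p z (s : R) : R * R := (p.1 + s * (z.1 - p.1), p.2 + s * (z.2 - p.2)).

Lemma seg0 p z : seg p z 0 = p.
Proof. by rewrite /seg !mul0r !addr0; case: p. Qed.

Lemma seg1 p z : seg p z 1 = z.
Proof. by rewrite /seg !mul1r !subrKC; case: z. Qed.

Lemma continuous_seg p z : continuous (seg p z).
Proof.
move=> s; have H (a b : R) : {for s, continuous (fun t : R => a + t * b)}.
  by apply: cvgD; [exact: cvg_cst|apply: cvgM; [exact: cvg_id|exact: cvg_cst]].
exact: (continuous_pair (H p.1 (z.1 - p.1)) (H p.2 (z.2 - p.2))).
Qed.

Lemma is_derive_seg X i p z s d : is_derive (seg p z s) (z - p) (crd X i) d ->
  is_derive s 1 (fun s => crd X i (seg p z s)) d.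
Proof.
have E : (fun h : R => h^-1 *: ((crd X i \o shift (seg p z s)) (h *: (z - p)) - crd X i (seg p z s))) =
  (fun h : R => h^-1 *: (((fun s => crd X i (seg p z s)) \o shift s) (h *: 1) - crd X i (seg p z s))).
  apply/funext => h /=; congr (_ *: (crd X i _ - _)).
  rewrite /seg /GRing.scale/= mulr1; congr pair.
    by change (h * (z.1 - p.1) + (p.1 + s * (z.1 - p.1)) = p.1 + (h + s) * (z.1 - p.1)); ring.
  by change (h * (z.2 - p.2) + (p.2 + s * (z.2 - p.2)) = p.2 + (h + s) * (z.2 - p.2)); ring.
by case=> d1 d2; split; move: d1 d2; rewrite /derivable /derive E.
Qed.

(** Only the open segment has to lie in D. Endpoints on the boundary, where the field vanishes but
    need not be differentiable, are thus allowed. *)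
Lemma segment_mvt D X i p z :
  {within closure D, continuous X} -> (forall x, D x -> differentiable X x) ->
  closure D p -> closure D z -> (forall s, 0 < s -> s < 1 -> D (seg p z s)) ->
  exists s, [/\ 0 < s, s < 1 & crd X i z - crd X i p =
    (z - p).1 * jac X (seg p z s) i 0 + (z - p).2 * jac X (seg p z s) i 1].
Proof.
move=> cX dX Dp Dz Ds.
have [|||c c01] := @MVT R (fun s => crd X i (seg p z s))
  (fun s => (z - p).1 * jac X (seg p z s) i 0 + (z - p).2 * jac X (seg p z s) i 1) 0 1.
- lra.
- move=> s; rewrite in_itv/= => /andP[s0 s1].
  apply: is_derive_seg.
  by apply: is_derive_comp_field; apply: dX; exact: Ds.
- have cl s : s \in `[0, 1] -> closure D (seg p z s).
    rewrite in_itv/= => /andP[s0 s1].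
    have [->|s0'] := eqVneq s 0; first by rewrite seg0.
    have [->|s1'] := eqVneq s 1; first by rewrite seg1.
    by apply: subset_closure; apply: Ds; rewrite lt_neqAle ?s0 ?s1 ?s1' // eq_sym s0'.
  have cc : {within `[0, 1], continuous (X \o seg p z)}.
    apply/subspace_continuousP => s s01.
    move/subspace_continuousP : cX => /(_ _ (cl _ s01)) cX.
    have H1 : seg p z @ within `[0, 1] (nbhs s) `=>` within (closure D) (nbhs (seg p z s)).
      move=> A HA; have := @continuous_seg p z s _ HA.
      suff S : (seg p z @^-1` (fun x => closure D x -> A x)) `<=`
          (fun t => `[0, 1]%classic t -> A (seg p z t)) by exact: filterS S.
      by move=> t Ht t01; apply: Ht; exact: cl.
    exact: cvg_comp H1 cX.
  apply/subspace_continuousP => s s01.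
  move/subspace_continuousP : cc => /(_ _ s01) cc.
  have [d1 d2] := cvg_coord _ cc.
  case: (ord2P i) => ->; rewrite ?crd0 ?crd1.
    rewrite (_ : (fun s => _) = (fun t => ((X \o seg p z) t).1))//.
    by apply/funext => t; rewrite crd0.
  rewrite (_ : (fun s => _) = (fun t => ((X \o seg p z) t).2))//.
  by apply/funext => t; rewrite crd1.
rewrite seg1 seg0 subr0 mulr1 => ->.
by move: c01; rewrite in_itv/= => /andP[? ?]; exists c.
Unshelve. all: by end_near. Qed.

Lemma segment_bound D X (G : R * R -> 'M[R]_2) M p z :
  {within closure D, continuous X} ->
  (forall x, D x -> differentiable X x) -> (forall x, D x -> G x = jac X x) ->
  (forall x i j, D x -> `|G x i j| <= M) ->
  closure D p -> closure D z ->
  (forall s, 0 < s -> s < 1 -> D (seg p z s)) ->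
  norm1 (X z - X p) <= 2 * M * norm1 (z - p).
Proof.
move=> cX dX GE GM Dp Dz Ds.
have B i : `|crd X i z - crd X i p| <= M * norm1 (z - p).
  have [c [c0 c1 ->]] := segment_mvt i cX dX Dp Dz Ds.
  have Dc : D (seg p z c) by exact: Ds.
  rewrite -(GE _ Dc).
  apply: le_trans (ler_normD _ _) _; rewrite !normrM /norm1 mulrDr.
  by apply: lerD; rewrite mulrC ler_wpM2r// GM.
have := lerD (B 0) (B 1); rewrite !crd0 !crd1 -[norm1 (X z - X p)]/(`|(X z).1 - (X p).1| + `|(X z).2 - (X p).2|).
lra.
Qed.

Lemma closed_first_exit (F : set R) : closed F -> F `<=` `[0, 1] -> F !=set0 ->
  exists a b, [/\ F a, F b & forall s, F s -> a <= s <= b].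
Proof.
move=> cF F01 F0.
have cpt : compact F by apply: (subclosed_compact cF (@segment_compact _ 0 1)).
have cid : {within F, continuous (id : R -> R)} by apply: continuous_subspaceT => x; exact: cvg_id.
have [a /set_mem Fa Ha] := compact_EVT_min F0 cpt cid.
have [b /set_mem Fb Hb] := compact_EVT_max F0 cpt cid.
by exists a, b; split => // s Fs; rewrite Ha ?Hb// inE.
Qed.

Section global_lipschitz.
Context (D : set (R * R)) (X : R * R -> R * R) (G : R * R -> 'M[R]_2) (M : R)
  (oD : open D) (cX : {within closure D, continuous X})
  (X0 : forall x, bd D x -> X x = 0)
  (dX : forall x, D x -> differentiable X x) (GE : forall x, D x -> G x = jac X x)
  (GM : forall x i j, D x -> `|G x i j| <= M) (M0 : 0 <= M).

Definition ext_field x := (X \_ D) x.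

Lemma ext_fieldE x : closure D x -> ext_field x = X x.
Proof.
move=> clx; rewrite /ext_field /patch; case: ifPn => //; rewrite notin_setE => NDx.
by rewrite X0//; split => //; rewrite ((interior_id D).1 oD).
Qed.

Lemma ext_field0 x : ~ D x -> ext_field x = 0.
Proof. by move=> NDx; rewrite /ext_field /patch memNset. Qed.

Let seg_closure p z : (forall s, 0 < s -> s < 1 -> D (seg p z s)) -> closure D z.
Proof.
move=> H B; rewrite -(seg1 p z) => nB.
have /nbhs_ballP[e /= e0 eB] := @continuous_seg p z 1 _ nB.
pose s := 1 - Order.min e 1 / 2.
have m0 : 0 < Order.min e 1 by rewrite lt_min e0 ltr01.
have me : Order.min e 1 <= e by rewrite ge_min lexx.
have m1 : Order.min e 1 <= 1 by rewrite ge_min lexx orbT.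
exists (seg p z s); split; first by apply: H; rewrite /s; lra.
apply: eB; rewrite /ball/= /s opprB addrC subrK ger0_norm; lra.
Qed.

(* At the first exit from D along the segment X vanishes, so the mean value
   theorem on the part inside D bounds X p. *)
Let exit_bound p z a : 0 <= a -> ~ D (seg p z a) ->
  (forall s, 0 <= s -> s < a -> D (seg p z s)) ->
  norm1 (ext_field p) <= 2 * M * (a * norm1 (z - p)).
Proof.
move=> a0 NDa Dlt.
have [aE|aN] := eqVneq a 0.
  rewrite ext_field0; last by rewrite -(seg0 p z) -aE.
  by rewrite /norm1/= normr0 addr0 aE mul0r mulr0.
have apos : 0 < a by rewrite lt_neqAle eq_sym aN.
have segE s : seg p (seg p z a) s = seg p z (s * a).
  by rewrite /seg /=; congr pair; ring.
have Ds s : 0 < s -> s < 1 -> D (seg p (seg p z a) s).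
  move=> s0 s1; rewrite segE; apply: Dlt; first by rewrite mulr_ge0// ltW.
  by rewrite gtr_pMl.
have clp : closure D p by apply: subset_closure; rewrite -(seg0 p z); exact: Dlt.
have cla : closure D (seg p z a) := seg_closure Ds.
have Xa : X (seg p z a) = 0.
  by apply: X0; split => //; rewrite ((interior_id D).1 oD).
have := segment_bound cX dX GE GM clp cla Ds.
rewrite Xa sub0r norm1N ext_fieldE// => /le_trans; apply.
have e1 : (seg p z a - p).1 = a * (z.1 - p.1).
  by change (p.1 + a * (z.1 - p.1) - p.1 = a * (z.1 - p.1)); ring.
have e2 : (seg p z a - p).2 = a * (z.2 - p.2).
  by change (p.2 + a * (z.2 - p.2) - p.2 = a * (z.2 - p.2)); ring.
rewrite ler_wpM2l ?mulr_ge0// {1}/norm1 e1 e2.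
by rewrite !normrM ger0_norm// -mulrDr.
Qed.

(** If the segment leaves D, let a and b be its first and last parameters outside D. The extended
    field vanishes at both, so its values at x and y are controlled by the end pieces, of relative
    lengths a and 1 - b, whose sum is at most 1. *)
Lemma ext_field_lip x y : norm1 (ext_field y - ext_field x) <= 2 * M * norm1 (y - x).
Proof.
have R0 p z : 0 <= 2 * M * norm1 (p - z) by rewrite !mulr_ge0// norm1_ge0.
have [Ax|NA] := pselect (forall s, 0 <= s <= 1 -> D (seg x y s)).
  have clx : closure D x by apply: subset_closure; rewrite -(seg0 x y); apply: Ax; lra.
  have cly : closure D y by apply: subset_closure; rewrite -(seg1 x y); apply: Ax; lra.
  rewrite !ext_fieldE//; apply: (segment_bound cX dX GE GM) => // s s0 s1.
  by apply: Ax; lra.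
pose F := [set` `[0, 1 : R]] `&` (seg x y @^-1` ~` D).
have F0 : F !=set0.
  apply: contrapT => H; apply: NA => s s01; apply: contrapT => ND.
  by apply: H; exists s; split => //=; rewrite in_itv.
have cF : closed F.
  apply: closedI; first exact: itv_closed.
  apply: closed_comp; first by move=> s _; exact: continuous_seg.
  by rewrite closedC.
have F01 : F `<=` `[0, 1] by move=> s [].
have [a [b [[a01 Fa] [b01 Fb] ab]]] := closed_first_exit cF F01 F0.
move: a01 b01; rewrite /= !in_itv/= => /andP[a0 a1] /andP[b0 b1].
have Dlt s : 0 <= s -> s < a -> D (seg x y s).
  move=> s0 sa; apply: contrapT => ND.
  have /ab : F s by split => //=; rewrite in_itv/=; lra.
  lra.
have Dgt s : b < s -> s <= 1 -> D (seg x y s).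
  move=> bs s1; apply: contrapT => ND.
  have /ab : F s by split => //=; rewrite in_itv/=; lra.
  lra.
have leab : a <= b by have /ab : F b by [split => //=; rewrite in_itv/=; lra]; lra.
have Xx := exit_bound a0 Fa Dlt.
have segC s : seg y x s = seg x y (1 - s) by rewrite /seg; congr pair; ring.
have Xy : norm1 (ext_field y) <= 2 * M * ((1 - b) * norm1 (x - y)).
  apply: exit_bound; first lra.
    by rewrite segC opprB addrC subrK.
  by move=> s s0 sb; rewrite segC; apply: Dgt; lra.
apply: le_trans (norm1D _ _) _; rewrite norm1N.
apply: le_trans (lerD Xy Xx) _; rewrite (norm1_dist x y) -mulrDr -mulrDl.
rewrite ler_wpM2l ?mulr_ge0// ler_piMl ?norm1_ge0//; lra.
Qed.

End global_lipschitz.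

(** Adding the constant e / K makes the inequality homogeneous; multiplied by exp(- K s), the result
    is nonincreasing. *)
Lemma gronwall (n dn : R -> R) K e : 0 < K -> 0 <= e ->
  (forall t : R, is_derive t 1 n (dn t)) ->
  forall t, 0 <= t -> (forall s, 0 <= s <= t -> dn s <= K * n s + e) ->
  n t + e / K <= expR (K * t) * (n 0 + e / K).
Proof.
move=> K0 e0 dnn t t0 Hn.
pose p s := (n s + e / K) * expR (- K * s).
pose dp s := (dn s - K * n s - e) * expR (- K * s).
have dP (s : R) : is_derive s (1 : R) p (dp s).
  have d1 : is_derive s 1 (fun s => - K * s + 0) (- K * 1 + 0).
    by apply: is_derive_eq; rewrite /GRing.scale/= mulr1.
  have d2 : is_derive s 1 (fun s : R => expR (- K * s)) (- K * expR (- K * s)).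
    have := is_derive_affine (a := - K) (b := 0) (is_derive_expR (- K * s + 0)).
    by rewrite addr0; under [X in is_derive _ _ X _ -> _]eq_fun do rewrite addr0.
  have d3 : is_derive s 1 (fun s => n s + e / K) (dn s).
    by apply: is_derive_eq; rewrite addr0.
  apply: is_derive_eq; rewrite /GRing.scale/= /dp; field; lra.
have : p t <= p 0.
  have [|c c0t] := @MVT_segment R p dp 0 t t0.
  - by apply: derivable_within_continuous => s _; have [] := dP s.
  rewrite subr0 => E; rewrite -subr_le0 E mulr_le0_ge0// /dp.
  rewrite mulr_le0_ge0 ?expR_ge0//; move: c0t; rewrite in_itv/= => c0t.
  by have := Hn c c0t; lra.
rewrite /p mulr0 expR0 mulr1 mulNr expRN ler_pdivrMr ?expR_gt0// => H.
by apply: le_trans H _; rewrite mulrC.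
Qed.

End field.

Section curves.
Context {R : realType}.
Implicit Types (x y p : R * R) (t s : R).

(** Unlike [norm1] it is differentiable along curves, so Gronwall is run on it; the Lipschitz bounds
    stay in [norm1], and each passage costs at most a factor 2. *)
Definition sqn x : R := x.1 ^+ 2 + x.2 ^+ 2.

Lemma sqn_ge0 x : 0 <= sqn x. Proof. by rewrite addr_ge0 ?sqr_ge0. Qed.

Lemma sqn_norm1 x : sqn x <= norm1 x ^+ 2.
Proof.
rewrite /sqn /norm1 -(real_normK (num_real x.1)) -(real_normK (num_real x.2)).
by have := normr_ge0 x.1; have := normr_ge0 x.2; nra.
Qed.

Lemma norm1_sqn x : norm1 x ^+ 2 <= 2 * sqn x.
Proof.
rewrite /sqn /norm1 -(real_normK (num_real x.1)) -(real_normK (num_real x.2)).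
by have := sqr_ge0 (`|x.1| - `|x.2|); nra.
Qed.

Lemma sqn_eq0 x : sqn x <= 0 -> x = 0.
Proof.
case: x => a b; rewrite /sqn/= => H.
have := sqr_ge0 a; have := sqr_ge0 b => b0 a0.
have /eqP : a ^+ 2 = 0 by lra.
have /eqP : b ^+ 2 = 0 by lra.
by rewrite !sqrf_eq0 => /eqP -> /eqP ->.
Qed.

Lemma dotp_le x y : `|x.1 * y.1 + x.2 * y.2| <= norm1 x * norm1 y.
Proof.
apply: le_trans (ler_normD _ _) _; rewrite !normrM /norm1.
have := mulr_ge0 (normr_ge0 x.1) (normr_ge0 y.2).
have := mulr_ge0 (normr_ge0 x.2) (normr_ge0 y.1); lra.
Qed.

(** The sign [sg] makes the notion stable under time reversal, so that estimates for t >= 0 cover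
    negative times. *)
Definition is_curve (F : R * R -> R * R) (sg : R) (a : R -> R * R) : Prop := forall t,
  is_derive t (1 : R) (fun s => (a s).1) (sg * (F (a t)).1) /\
  is_derive t (1 : R) (fun s => (a s).2) (sg * (F (a t)).2).

Lemma is_derive_sqn (f g : R -> R) t df dg : is_derive t 1 f df -> is_derive t 1 g dg ->
  is_derive t 1 (fun s => f s ^+ 2 + g s ^+ 2) (2 * (f t * df + g t * dg)).
Proof.
move=> Hf Hg.
have -> : (fun s => f s ^+ 2 + g s ^+ 2) = (f * f + g * g).
  by apply/funext => s; rewrite !expr2.
by apply: is_derive_eq; rewrite /GRing.scale/=; ring.
Qed.

Context (F : R * R -> R * R) (L : R).
Context (L0 : 0 < L) (lipF : forall x y, norm1 (F y - F x) <= L * norm1 (y - x)).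

Lemma curve_gronwall sg a b : `|sg| <= 1 -> is_curve F sg a -> is_curve F sg b ->
  forall t, 0 <= t -> sqn (a t - b t) <= expR (4 * L * t) * sqn (a 0 - b 0).
Proof.
move=> sg1 ca cb t t0.
pose dn s := 2 * (((a s).1 - (b s).1) * (sg * (F (a s)).1 - sg * (F (b s)).1) +
  ((a s).2 - (b s).2) * (sg * (F (a s)).2 - sg * (F (b s)).2)).
have D s : is_derive s (1 : R) (fun s => ((a s).1 - (b s).1) ^+ 2 + ((a s).2 - (b s).2) ^+ 2) (dn s).
  have [ca1 ca2] := ca s; have [cb1 cb2] := cb s.
  by apply: is_derive_sqn; exact: is_deriveB.
(* A factor 2 comes from the derivative of the square, another from norm1^2 <= 2 sqn. *)
have K0 : 0 < 4 * L by rewrite mulr_gt0.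
have B s : 0 <= s <= t -> dn s <= 4 * L * (((a s).1 - (b s).1) ^+ 2 + ((a s).2 - (b s).2) ^+ 2) + 0.
  move=> _; rewrite addr0 -[X in _ * X]/(sqn (a s - b s)).
  have -> : dn s = 2 * (sg * ((a s - b s).1 * (F (a s) - F (b s)).1 +
     (a s - b s).2 * (F (a s) - F (b s)).2)).
    rewrite /dn -[(a s - b s).1]/((a s).1 - (b s).1) -[(a s - b s).2]/((a s).2 - (b s).2).
    rewrite -[(F (a s) - F (b s)).1]/((F (a s)).1 - (F (b s)).1).
    rewrite -[(F (a s) - F (b s)).2]/((F (a s)).2 - (F (b s)).2); ring.
  have := dotp_le (a s - b s) (F (a s) - F (b s)); set w := _ + _ => Hw.
  have Hsw : sg * w <= `|w|.
    by apply: le_trans (ler_norm _) _; rewrite normrM ler_piMl.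
  have := lipF (b s) (a s); have := norm1_sqn (a s - b s); have := norm1_ge0 (a s - b s).
  move: Hw; set d := norm1 (a s - b s) => Hw d0 d2 Hl.
  have : d * norm1 (F (a s) - F (b s)) <= d * (L * d) by rewrite ler_wpM2l.
  have : L * d ^+ 2 <= L * (2 * sqn (a s - b s)) by rewrite ler_wpM2l// ltW.
  have -> : d * (L * d) = L * d ^+ 2 by ring.
  lra.
have := gronwall K0 (lexx 0) D t0 B.
by rewrite !mul0r !addr0.
Qed.

Lemma curve_rev sg a : is_curve F sg a -> is_curve F (- sg) (fun t => a (- t)).
Proof.
move=> ca t; have [c1 c2] := ca (- t).
have H (f : R -> R) d : is_derive (- t) 1 f d -> is_derive t 1 (fun s => f (- s)) (- d).
  move=> fd; have := @is_derive_affine R f (-1) 0 t d.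
  rewrite mulN1r addr0 => /(_ fd); rewrite mulN1r.
  by under [X in is_derive _ _ X _ -> _]eq_fun do rewrite mulN1r addr0.
by split; rewrite mulNr; [exact: (H (fun s => (a s).1))|exact: (H (fun s => (a s).2))].
Qed.

Lemma curve_shift sg a s0 : is_curve F sg a -> is_curve F sg (fun t => a (t + s0)).
Proof.
move=> ca t; have [c1 c2] := ca (t + s0).
have H (f : R -> R) d : is_derive (t + s0) 1 f d -> is_derive t 1 (fun s => f (s + s0)) d.
  move=> fd; have := @is_derive_affine R f 1 s0 t d.
  rewrite mul1r => /(_ fd); rewrite mul1r.
  by under [X in is_derive _ _ X _ -> _]eq_fun do rewrite mul1r.
by split; [exact: (H (fun s => (a s).1))|exact: (H (fun s => (a s).2))].
Qed.

Lemma curve_gronwallT sg a b : `|sg| <= 1 -> is_curve F sg a -> is_curve F sg b ->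
  forall t, sqn (a t - b t) <= expR (4 * L * `|t|) * sqn (a 0 - b 0).
Proof.
move=> sg1 ca cb t; have [t0|t0] := leP 0 t; first by rewrite ger0_norm//; exact: curve_gronwall ca cb _ _.
have nt0 : 0 <= - t by lra.
have := @curve_gronwall (- sg) _ _ _ (curve_rev ca) (curve_rev cb) (- t) nt0.
by rewrite normrN opprK oppr0 (ltr0_norm t0); apply.
Qed.

Lemma curve_unique sg a b : `|sg| <= 1 -> is_curve F sg a -> is_curve F sg b ->
  a 0 = b 0 -> a = b.
Proof.
move=> sg1 ca cb ab; apply/funext => t.
have s00 : sqn (0 : R * R) = 0 by rewrite /sqn/= expr0n/= addr0.
have := curve_gronwallT sg1 ca cb t; rewrite ab subrr s00 mulr0.
by move/sqn_eq0 => /eqP; rewrite subr_eq0 => /eqP.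
Qed.

End curves.

Lemma compact_within_bounded (T : topologicalType) (R : realType) (A : set T) (f : T -> R) :
  compact A -> {within A, continuous f} -> exists2 M, 0 < M & forall x, A x -> `|f x| <= M.
Proof.
move=> cA cf; have /compact_bounded /pinfty_ex_gt0[M M0 HM] : compact (f @` A).
  exact: continuous_compact.
by exists M => // x Ax; apply: HM; exists x.
Qed.

(** * The flow extended by the identity *)

Section flow.
Context {R : realType} (D : set (R * R)) (X : R * R -> R * R) (Phi : R -> R * R -> R * R).
Context (hD : open D /\ bounded_set D) (hX : C1_zero_bd D X) (hPhi : is_flow D X Phi).
Implicit Types (x y p z : R * R) (t s h : R).

Let oD : open D := hD.1.

(** [is_flow] says nothing outside the closure of D; with this value there, all curves are integral
    curves of one globally Lipschitz field and uniqueness applies to each of them. *)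
Definition eflow t x : R * R := if `[< closure D x >] then Phi t x else x.

Lemma eflowE t x : closure D x -> eflow t x = Phi t x.
Proof. by move=> clx; rewrite /eflow asboolT. Qed.

Let Xe := ext_field D X.

Lemma field_bound : exists2 M, 0 < M & forall x i j, D x -> `|jac X x i j| <= M.
Proof.
have [cX X0 dX [G [cG GE]]] := hX.
have cD : compact (closure D) by apply: closure_compact; case: hD.
have B i j := compact_within_bounded cD (cG i j).
have [M00 p00 H00] := B 0 0; have [M01 p01 H01] := B 0 1.
have [M10 p10 H10] := B 1 0; have [M11 p11 H11] := B 1 1.
exists (M00 + M01 + M10 + M11); first lra.
move=> x i j Dx; rewrite -GE//; have clx := subset_closure Dx.
case: (ord2P i) => ->; case: (ord2P j) => ->.
- by apply: le_trans (H00 x clx) _; lra.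
- by apply: le_trans (H01 x clx) _; lra.
- by apply: le_trans (H10 x clx) _; lra.
- by apply: le_trans (H11 x clx) _; lra.
Qed.

Definition fieldM : R := sval (cid2 field_bound).

Lemma fieldM_gt0 : 0 < fieldM. Proof. by rewrite /fieldM; case: cid2. Qed.

Lemma fieldM_jac x i j : D x -> `|jac X x i j| <= fieldM.
Proof. by rewrite /fieldM; case: cid2 => /= M _; exact. Qed.

Let L := 2 * fieldM.
Let L0 : 0 < L. Proof. by rewrite mulr_gt0// fieldM_gt0. Qed.

Let X0 x : bd D x -> X x = 0. Proof. by case: hX => _ + _ _; exact. Qed.

Lemma Xe_lip x y : norm1 (Xe y - Xe x) <= L * norm1 (y - x).
Proof.
have [cX _ dX _] := hX.
apply: (ext_field_lip (G := jac X) oD cX X0 dX) => //; last exact/ltW/fieldM_gt0.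
exact: fieldM_jac.
Qed.

Lemma eflow_curve x : is_curve Xe 1 (eflow^~ x).
Proof.
move=> t; rewrite !mul1r.
have [clx|Nclx] := pselect (closure D x); last first.
  rewrite /Xe ext_field0; last first.
    by rewrite /eflow asboolF// => Dx; apply: Nclx; exact: subset_closure.
  rewrite /eflow asboolF//; split; exact: is_derive_cst.
have [_ /(_ t)[clt [dt dE]]] := hPhi clx.
rewrite eflowE// /Xe ext_fieldE//.
rewrite (_ : (fun s => (eflow s x).1) = (fun s => (Phi s x).1)); last first.
  by apply/funext => s; rewrite eflowE.
rewrite (_ : (fun s => (eflow s x).2) = (fun s => (Phi s x).2)); last first.
  by apply/funext => s; rewrite eflowE.
have dw : (fun h : R => h^-1 *: (((fun s => Phi s x) \o shift t) (h *: 1) - Phi t x)) @ 0^'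
   --> X (Phi t x).
  by rewrite -dE.
have [d1 d2] := cvg_coord _ dw.
have K1 : (fun h : R => h^-1 *: (((fun s => (Phi s x).1) \o shift t) (h *: 1) - (Phi t x).1)) @ 0^'
   --> (X (Phi t x)).1 by exact: d1.
have K2 : (fun h : R => h^-1 *: (((fun s => (Phi s x).2) \o shift t) (h *: 1) - (Phi t x).2)) @ 0^'
   --> (X (Phi t x)).2 by exact: d2.
split; apply: DeriveDef.
- by apply/cvg_ex; exists (X (Phi t x)).1; exact: K1.
- exact: cvg_lim K1.
- by apply/cvg_ex; exists (X (Phi t x)).2; exact: K2.
- exact: cvg_lim K2.
Qed.

Lemma eflow0 x : eflow 0 x = x.
Proof. by rewrite /eflow; case: ifPn => // /asboolP /hPhi[]. Qed.

(** The extended field vanishes outside D, so the constant curve solves the equation; on the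
    boundary of D this is a statement about [Phi]. *)
Lemma eflow_out t x : ~ D x -> eflow t x = x.
Proof.
move=> NDx; have cc : is_curve Xe 1 (fun=> x).
  move=> s; rewrite /Xe ext_field0// !mulr0; split; exact: is_derive_cst.
have n11 : `|1 : R| <= 1 by rewrite normr1.
have := curve_unique L0 Xe_lip n11 (eflow_curve x) cc (eflow0 x).
by move/(congr1 (fun f => f t)).
Qed.

Lemma eflowD s t x : eflow s (eflow t x) = eflow (s + t) x.
Proof.
have n11 : `|1 : R| <= 1 by rewrite normr1.
have := curve_unique L0 Xe_lip n11 (eflow_curve (eflow t x)) (curve_shift t (eflow_curve x)).
rewrite eflow0 add0r => /(_ erefl) /(congr1 (fun f => f s)); exact.
Qed.

Lemma eflowK t x : eflow (- t) (eflow t x) = x.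
Proof. by rewrite eflowD addNr eflow0. Qed.

(** A point reached outside D would be fixed by the backward flow, which nevertheless returns it to
    x in D. *)
Lemma eflow_in t x : D x -> D (eflow t x).
Proof.
move=> Dx; apply: contrapT => ND.
have := eflow_out (- t) ND; rewrite eflowK => xE.
by apply: ND; rewrite -xE.
Qed.

(** Gronwall over |t| <= 1 gives exp(4 L) for squared lengths; the factor 2 pays for comparing [sqn]
    with [norm1]. *)
Definition flowK : R := 2 * expR (4 * L).

Lemma flowK_ge1 : 1 <= flowK.
Proof.
have : 1 <= expR (4 * L) by rewrite -expR0 ler_expR mulr_ge0// ltW.
by rewrite /flowK; lra.
Qed.

Lemma eflow_lip t x y : `|t| <= 1 -> norm1 (eflow t x - eflow t y) <= flowK * norm1 (x - y).
Proof.
move=> t1; have n11 : `|1 : R| <= 1 by rewrite normr1.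
have := curve_gronwallT L0 Xe_lip n11 (eflow_curve x) (eflow_curve y) t.
rewrite !eflow0 => H.
have K1 := flowK_ge1; have nx := norm1_ge0 (x - y).
have K0 := le_trans ler01 K1.
rewrite -ler_sqr ?nnegrE ?norm1_ge0 ?mulr_ge0//.
apply: le_trans (norm1_sqn _) _.
have E1 : expR (4 * L * `|t|) <= expR (4 * L).
  by rewrite ler_expR ler_piMr// mulr_ge0// ltW.
have E2 : expR (4 * L * `|t|) * sqn (x - y) <= expR (4 * L) * norm1 (x - y) ^+ 2.
  by rewrite ler_pM ?expR_ge0 ?sqn_ge0 ?sqn_norm1.
rewrite exprMn; have : 2 * expR (4 * L) <= flowK ^+ 2.
  by rewrite expr2 -/flowK ler_peMl// (le_trans ler01).
move/(ler_wpM2r (sqr_ge0 (norm1 (x - y)))); lra.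
Qed.

Definition flowC : R := 2 * L * flowK.

Lemma flowC_gt0 : 0 < flowC.
Proof. by apply: mulr_gt0; [exact: mulr_gt0|exact: lt_le_trans ltr01 flowK_ge1]. Qed.

(** The displacement is Lipschitz with constant of order t, since its time derivative is the field
    along the two curves. A fixed y outside D then gives [eflow_disp_out], and y tending to x gives
    [flow_jac_near_id]. *)
Lemma eflow_dd t x y : 0 <= t <= 1 ->
  norm1 (eflow t x - eflow t y - (x - y)) <= flowC * t * norm1 (x - y).
Proof.
move=> /andP[t0 t1].
have B (f : R * R -> R) : (forall z, `|f z| <= norm1 z) ->
    (forall z w, f (z - w) = f z - f w) ->
    (forall z s, is_derive s (1 : R) (fun s => f (eflow s z)) (f (Xe (eflow s z)))) ->
  `|f (eflow t x - eflow t y - (x - y))| <= L * flowK * t * norm1 (x - y).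
  move=> fn fB fd.
  pose p s := f (eflow s x) - f (eflow s y).
  have dp s : is_derive s (1 : R) p (f (Xe (eflow s x)) - f (Xe (eflow s y))).
    exact: is_deriveB.
  have [|c ct] := @MVT_segment R p _ 0 t t0 (fun s _ => dp s).
    by apply: derivable_within_continuous => s _; have [] := dp s.
  rewrite /p !eflow0 subr0 -!fB => ->.
  have c1 : `|c| <= 1 by move: ct; rewrite in_itv/= => /andP[? ?]; rewrite ger0_norm//; lra.
  rewrite normrM (ger0_norm t0).
  have := le_trans (fn _) (le_trans (Xe_lip (eflow c y) (eflow c x))
    (ler_wpM2l (ltW L0) (eflow_lip x y c1))).
  by move/(ler_wpM2r t0); rewrite -!mulrA (mulrC t).
have d1 z s : is_derive s (1 : R) (fun s => (eflow s z).1) (Xe (eflow s z)).1.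
  by have [+ _] := eflow_curve z s; rewrite mul1r.
have d2 z s : is_derive s (1 : R) (fun s => (eflow s z).2) (Xe (eflow s z)).2.
  by have [_ +] := eflow_curve z s; rewrite mul1r.
have B1 := B (fun z => z.1) (fun z => (coord_norm1 z).1) (fun _ _ => erefl) d1.
have B2 := B (fun z => z.2) (fun z => (coord_norm1 z).2) (fun _ _ => erefl) d2.
apply: le_trans (lerD B1 B2) _; rewrite /flowC; lra.
Qed.

(** The point p does not move, so the displacement of x fades near the complement of D. This keeps
    squares comparable to the displacement inside D. *)
Lemma eflow_disp_out t x p : 0 <= t <= 1 -> ~ D p ->
  norm1 (eflow t x - x) <= flowC * t * norm1 (x - p).
Proof.
move=> t01 ND; have := eflow_dd x p t01; rewrite (eflow_out t ND).
by rewrite (_ : _ - _ - _ = eflow t x - x)// opprB addrA subrK.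
Qed.

Lemma eflow_disp : exists2 C, 0 < C & forall t x, 0 <= t <= 1 -> norm1 (eflow t x - x) <= C * t.
Proof.
have [r r0 Dr] := bounded_cbox hD.2.
(* Any fixed point outside the bounded set D gives a uniform bound, as its distance to the points of
   D is bounded. *)
have NDp : ~ D (2 * r, 0) by move=> /Dr[/= + _]; rewrite subr0 ger0_norm; lra.
exists (flowC * (5 * r)); first by apply: mulr_gt0; [exact: flowC_gt0|exact: mulr_gt0].
move=> t x t01; have [Dx|NDx] := pselect (D x); last first.
  rewrite eflow_out// subrr /norm1/= normr0 addr0.
  case/andP: t01 => t0 _; apply: mulr_ge0 => //; apply: mulr_ge0; first exact/ltW/flowC_gt0.
  by apply: mulr_ge0 => //; exact: ltW.
apply: le_trans (eflow_disp_out x t01 NDp) _.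
rewrite mulrAC ler_wpM2r//; first by case/andP: t01.
rewrite ler_wpM2l//; first exact/ltW/flowC_gt0.
have [/= x1 x2] := Dr x Dx; rewrite !subr0 in x1 x2.
rewrite -[norm1 _]/(`|x.1 - 2 * r| + `|x.2 - 0|) subr0.
by have := ler_normB x.1 (2 * r); rewrite (ger0_norm (_ : 0 <= 2 * r)); lra.
Qed.

Lemma eflow_continuous t : `|t| <= 1 -> continuous (eflow t).
Proof.
move=> t1 x; move=> A /nbhs_obox[r r0 rA].
have K0 : 0 < flowK by apply: lt_le_trans flowK_ge1.
have d0 : 0 < r / (2 * flowK) by rewrite divr_gt0// mulr_gt0.
apply/nbhs_obox; exists (r / (2 * flowK)) => // y [y1 y2]; apply: rA.
have H := eflow_lip y x t1.
have : norm1 (y - x) < r / flowK.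
  have -> : r / flowK = r / (2 * flowK) + r / (2 * flowK) by field; lra.
  by rewrite -[norm1 _]/(`|y.1 - x.1| + `|y.2 - x.2|) ltrD.
rewrite ltr_pdivlMr// mulrC => Hr.
have [a b] := coord_norm1 (eflow t y - eflow t x).
by split; [apply: le_lt_trans a _|apply: le_lt_trans b _]; exact: le_lt_trans Hr.
Qed.

End flow.

(** * Difference quotients of the flow in the initial point *)

Section flow_jacobian.
Context {R : realType} (D : set (R * R)) (X : R * R -> R * R) (Phi : R -> R * R -> R * R).
Context (hD : open D /\ bounded_set D) (hX : C1_zero_bd D X) (hPhi : is_flow D X Phi).
Implicit Types (x y p z e : R * R) (t s h k : R).

Let oD : open D := hD.1.
Let Xe := ext_field D X.
Let M := fieldM hD hX.
Let Lam := flowK hD hX.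
Let C := flowC hD hX.
Let fl := eflow D Phi.

Lemma jac_field_near y0 (eta : R) : D y0 -> 0 < eta ->
  exists2 rho, 0 < rho & forall y, obox y0 rho y ->
    D y /\ forall i j, `|jac X y i j - jac X y0 i j| <= eta.
Proof.
move=> Dy0 eta0; have [_ _ _ [G [cG GE]]] := hX.
have N i j : nbhs y0 [set y | D y /\ `|jac X y i j - jac X y0 i j| <= eta].
  have cGD : {within D, continuous (fun x => G x i j)}.
    by apply: continuous_subspaceW (cG i j); exact: subset_closure.
  have cy0 : {for y0, continuous (fun x => G x i j)}.
    by move: cGD; rewrite continuous_open_subspace// => /(_ y0 (mem_set Dy0)).
  have /cvgrPdist_le/(_ _ eta0) H := cy0.
  have nD : nbhs y0 D by exact: open_nbhs_nbhs.
  apply: filterS (filterI H nD) => y [Hy Dy]; split => //.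
  by rewrite -!GE// distrC.
have [r r0 sub] := (nbhs_obox _ _).1 (filterI (filterI (N 0 0) (N 0 1)) (filterI (N 1 0) (N 1 1))).
exists r => // y /sub[[[Dy h00] [_ h01]] [[_ h10] [_ h11]]]; split => // i j.
by case: (ord2P i) => ->; case: (ord2P j) => ->.
Qed.

(** The mean value theorem replaces the increment by the Jacobian at an intermediate point, and
    continuity of the Jacobian returns to y. Compactness makes the radius uniform, as needed along a
    whole trajectory. *)
Lemma strict_differentiability (K : set (R * R)) (eta : R) : compact K -> K `<=` D -> 0 < eta ->
  exists2 r, 0 < r & forall y z, K y -> norm1 (z - y) < r -> D z /\
    forall i : 'I_2, `|crd X i z - crd X i y -
      ((z - y).1 * jac X y i 0 + (z - y).2 * jac X y i 1)| <= eta * norm1 (z - y).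
Proof.
move=> cK KD eta0; have [cX _ dX _] := hX.
pose P r y := forall z, norm1 (z - y) < r -> D z /\
    forall i : 'I_2, `|crd X i z - crd X i y -
      ((z - y).1 * jac X y i 0 + (z - y).2 * jac X y i 1)| <= eta * norm1 (z - y).
have cov : \forall r \near 0^'+, K `<=` P r.
  move/compact_near_coveringP : cK; apply => y0 Ky0.
  have e2 : 0 < eta / 2 by lra.
  have [rho rho0 Hrho] := jac_field_near (KD _ Ky0) e2.
  exists (obox y0 (rho / 2), [set r | r < rho / 2]).
    split => /=; first by apply/nbhs_obox; exists (rho / 2) => //; lra.
    by apply: nbhs_right_lt; lra.
  move=> [y r] [/= [y1 y2] rr] z zr.
  have [d1 d2] := coord_norm1 (z - y).
  have D1 : `|z.1 - y.1| < rho / 2 by apply: le_lt_trans d1 _; lra.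
  have D2 : `|z.2 - y.2| < rho / 2 by apply: le_lt_trans d2 _; lra.
  have sg s : 0 <= s -> s <= 1 -> obox y0 rho (seg y z s).
    have aux (a b c : R) : `|a - c| < rho / 2 -> `|b - a| < rho / 2 -> 0 <= s -> s <= 1 ->
        `|a + s * (b - a) - c| < rho.
      move=> ac ba s0 s1; rewrite addrAC.
      have := ler_normD (a - c) (s * (b - a)); rewrite normrM (ger0_norm s0).
      have : s * `|b - a| <= `|b - a| by rewrite ler_piMl.
      lra.
    by move=> s0 s1; split; apply: aux.
  have Dz : D z by have [] := Hrho _ (sg 1 ler01 (lexx _)); rewrite seg1.
  have Dy : D y by have [] := Hrho _ (sg 0 (lexx _) ler01); rewrite seg0.
  split => // i.
  have Ds s : 0 < s -> s < 1 -> D (seg y z s).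
    by move=> /ltW s0 /ltW s1; have [] := Hrho _ (sg s s0 s1).
  have [s [s0 s1 ->]] := segment_mvt i cX dX (subset_closure Dy) (subset_closure Dz) Ds.
  have [_ Hs] := Hrho _ (sg s (ltW s0) (ltW s1)).
  have [_ Hy] := Hrho y (ltac:(have := sg 0 (lexx _) ler01; rewrite seg0; exact)).
  have B j : `|jac X (seg y z s) i j - jac X y i j| <= eta.
    have := Hs i j; have := Hy i j; rewrite distrC => a b.
    have := ler_distD (jac X y0 i j) (jac X (seg y z s) i j) (jac X y i j); lra.
  rewrite (_ : _ - _ = (z - y).1 * (jac X (seg y z s) i 0 - jac X y i 0) +
     (z - y).2 * (jac X (seg y z s) i 1 - jac X y i 1)); last by ring.
  apply: le_trans (ler_normD _ _) _; rewrite !normrM -[norm1 _]/(`|(z - y).1| + `|(z - y).2|) mulrDr.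
  by apply: lerD; rewrite mulrC ler_wpM2r.
have [r [r0 HP]] : exists r, 0 < r /\ K `<=` P r.
  near (0 : R)^'+ => r; exists r; split; first by near: r; exact: nbhs_right_gt.
  by near: r.
by exists r => // y z Ky; exact: HP.
Unshelve. all: by end_near. Qed.

Definition quot t x e h : R * R :=
  (h^-1 * ((fl t (h *: e + x)).1 - (fl t x).1), h^-1 * ((fl t (h *: e + x)).2 - (fl t x).2)).

Lemma flow_curve_continuous x : continuous (fun s => fl s x).
Proof.
move=> s.
have c1 : {for s, continuous (fun s => (fl s x).1)}.
  apply/differentiable_continuous/derivable1_diffP.
  by have [[]] := eflow_curve hD hX hPhi x s.
have c2 : {for s, continuous (fun s => (fl s x).2)}.
  apply/differentiable_continuous/derivable1_diffP.
  by have [_ []] := eflow_curve hD hX hPhi x s.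
have := continuous_pair c1 c2.
by rewrite (_ : (fun s => ((fl s x).1, (fl s x).2)) = (fun s => fl s x))//;
  apply/funext => u; rewrite -surjective_pairing.
Qed.

(* Differentiability of the flow in x is not assumed: the difference of two
   difference quotients satisfies, up to an error that strict differentiability
   of X makes small, the linearised equation, and Gronwall applies. *)
Lemma quot_cauchy t x e (eps : R) : D x -> 0 <= t <= 1 -> norm1 e <= 1 -> 0 < eps ->
  exists2 d, 0 < d & forall h k, h != 0 -> `|h| < d -> k != 0 -> `|k| < d ->
    norm1 (quot t x e h - quot t x e k) <= eps.
Proof.
move=> Dx /andP[t0 t1] e1 eps0.
have M0 : 0 < M := fieldM_gt0 hD hX.
have L0 : 0 < Lam := lt_le_trans ltr01 (flowK_ge1 hD hX).
(* Solved backwards: the Gronwall defect 8 eta Lam^2 divided by 4 M and multiplied by exp(4 M) is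
   then eps^2 / 2. *)
pose eta := eps ^+ 2 * M / (4 * Lam ^+ 2 * expR (4 * M)).
have E0 := expR_gt0 (4 * M).
have eta0 : 0 < eta.
  apply: divr_gt0; first by apply: mulr_gt0 => //; exact: exprn_gt0.
  by apply: mulr_gt0 => //; apply: mulr_gt0 => //; exact: exprn_gt0.
have cK : compact ((fun s => fl s x) @` `[0, 1]).
  apply: continuous_compact; last exact: segment_compact.
  by apply: continuous_subspaceT; exact: flow_curve_continuous.
have KD : (fun s => fl s x) @` `[0, 1] `<=` D.
  by move=> _ [s _ <-]; exact: (eflow_in hD hX hPhi).
have [r r0 Hr] := strict_differentiability cK KD eta0.
exists (r / Lam); first by rewrite divr_gt0.
have fl_e h s : `|s| <= 1 -> norm1 (fl s (h *: e + x) - fl s x) <= Lam * `|h|.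
  move=> s1; apply: le_trans (eflow_lip hD hX hPhi _ _ s1) _.
  rewrite -/Lam ler_wpM2l ?(ltW L0)// addrK.
  rewrite -[norm1 _]/(`|h * e.1| + `|h * e.2|) !normrM -mulrDr.
  by rewrite ler_piMr.
(* The amount by which a difference quotient fails the linearised equation; strict differentiability
   bounds it by eta Lam, uniformly in s. *)
pose er h s i := h^-1 * (crd Xe i (fl s (h *: e + x)) - crd Xe i (fl s x)) -
   ((quot s x e h).1 * jac X (fl s x) i 0 + (quot s x e h).2 * jac X (fl s x) i 1).
have erB h s i : h != 0 -> `|h| < r / Lam -> 0 <= s <= 1 -> `|er h s i| <= eta * Lam.
  move=> h0 hr /andP[s0 s1]; have s1' : `|s| <= 1 by rewrite ger0_norm.
  have flh := fl_e h s s1'.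
  have zr : norm1 (fl s (h *: e + x) - fl s x) < r.
    apply: le_lt_trans flh _; rewrite mulrC -ltr_pdivlMr//.
  have Ks : ((fun s => fl s x) @` `[0, 1]) (fl s x) by exists s => //=; rewrite in_itv/= s0 s1.
  have [Dz /(_ i) H] := Hr _ _ Ks zr.
  have Dy : D (fl s x) by exact: KD.
  have -> : er h s i = h^-1 * (crd X i (fl s (h *: e + x)) - crd X i (fl s x) -
      ((fl s (h *: e + x) - fl s x).1 * jac X (fl s x) i 0 +
       (fl s (h *: e + x) - fl s x).2 * jac X (fl s x) i 1)).
    rewrite /er /crd /Xe !(ext_fieldE oD)//; [|by have [] := hX|exact: subset_closure|
      by have [] := hX|exact: subset_closure].
    rewrite -[(fl s (h *: e + x) - fl s x).1]/((fl s (h *: e + x)).1 - (fl s x).1).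
    rewrite -[(fl s (h *: e + x) - fl s x).2]/((fl s (h *: e + x)).2 - (fl s x).2).
    by rewrite /quot/=; ring.
  rewrite normrM normfV ler_pdivrMl ?normr_gt0//; apply: le_trans H _.
  by apply: le_trans (ler_wpM2l (ltW eta0) flh) _; rewrite le_eqVlt; apply/orP; left; apply/eqP; ring.
move=> h k h0 hr k0 kr.
have dq (w s : R) : is_derive s (1 : R) (fun s => (quot s x e w).1)
      (w^-1 * (crd Xe 0 (fl s (w *: e + x)) - crd Xe 0 (fl s x))) /\
    is_derive s (1 : R) (fun s => (quot s x e w).2)
      (w^-1 * (crd Xe 1 (fl s (w *: e + x)) - crd Xe 1 (fl s x))).
  have [a1 a2] := eflow_curve hD hX hPhi (w *: e + x) s.
  have [b1 b2] := eflow_curve hD hX hPhi x s.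
  rewrite !mul1r in a1 a2 b1 b2; rewrite !crd0 !crd1.
  by split; [exact: (is_deriveZ w^-1 (is_deriveB a1 b1))|
    exact: (is_deriveZ w^-1 (is_deriveB a2 b2))].
pose f1 s := (quot s x e h).1 - (quot s x e k).1.
pose f2 s := (quot s x e h).2 - (quot s x e k).2.
pose df i s := f1 s * jac X (fl s x) i 0 + f2 s * jac X (fl s x) i 1 + (er h s i - er k s i).
have df1 (s : R) : is_derive s (1 : R) f1 (df 0 s).
  have [a1 _] := dq h s; have [b1 _] := dq k s.
  by apply: (is_derive_eq (is_deriveB a1 b1)); rewrite /df /er /f1 /f2; ring.
have df2 (s : R) : is_derive s (1 : R) f2 (df 1 s).
  have [_ a2] := dq h s; have [_ b2] := dq k s.
  by apply: (is_derive_eq (is_deriveB a2 b2)); rewrite /df /er /f1 /f2; ring.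
have q0 w : w != 0 -> quot 0 x e w = e.
  move=> w0; rewrite /quot /fl !(eflow0 hPhi).
  rewrite -[(w *: e + x).1]/(w * e.1 + x.1) -[(w *: e + x).2]/(w * e.2 + x.2) !addrK.
  by rewrite !mulrA !mulVf// !mul1r -surjective_pairing.
have qB w s : w != 0 -> `|s| <= 1 -> norm1 (quot s x e w) <= Lam.
  move=> w0 s1; rewrite /quot -[norm1 _]/(`|_ * _| + `|_ * _|) /= !normrM -mulrDr normfV.
  by rewrite ler_pdivrMl ?normr_gt0// mulrC; exact: fl_e.
have K0 : 0 < 4 * M by lra.
(* The two defects add to 2 eta Lam per component, the quotients differ by at most 2 Lam, and
   differentiating the square brings another 2. *)
have e0 : 0 <= 8 * eta * Lam ^+ 2.
  by apply: mulr_ge0; [apply: mulr_ge0 => //; exact: ltW|exact: sqr_ge0].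
have Bd s : 0 <= s <= t -> 2 * (f1 s * df 0 s + f2 s * df 1 s) <=
    4 * M * (f1 s ^+ 2 + f2 s ^+ 2) + 8 * eta * Lam ^+ 2.
  move=> /andP[s0 st]; have s01 : 0 <= s <= 1 by lra.
  have s1 : `|s| <= 1 by rewrite ger0_norm//; lra.
  have J i j : `|jac X (fl s x) i j| <= M.
    by apply: fieldM_jac; exact: (eflow_in hD hX hPhi).
  have eh i := erB h s i h0 hr s01; have ek i := erB k s i k0 kr s01.
  have nf : `|f1 s| + `|f2 s| <= 2 * Lam.
    have := lerD (qB h s h0 s1) (qB k s k0 s1).
    have := norm1D (quot s x e h) (- quot s x e k); rewrite norm1N.
    rewrite -[norm1 (_ - _)]/(`|f1 s| + `|f2 s|); lra.
  have dfB i : `|df i s| <= M * (`|f1 s| + `|f2 s|) + 2 * (eta * Lam).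
    apply: le_trans (ler_normD _ _) _; apply: lerD.
      apply: le_trans (ler_normD _ _) _; rewrite !normrM mulrDr.
      by apply: lerD; rewrite mulrC ler_wpM2r.
    apply: le_trans (ler_normB _ _) _; have := eh i; have := ek i; lra.
  have A i (f : R) : f * df i s <= `|f| * (M * (`|f1 s| + `|f2 s|) + 2 * (eta * Lam)).
    by apply: le_trans (ler_norm _) _; rewrite normrM ler_wpM2l.
  have := lerD (A 0 (f1 s)) (A 1 (f2 s)); rewrite -mulrDl.
  set F := `|f1 s| + `|f2 s| in nf *.
  have F0 : 0 <= F by rewrite addr_ge0.
  have F2 : F ^+ 2 <= 2 * (f1 s ^+ 2 + f2 s ^+ 2).
    rewrite /F -(real_normK (num_real (f1 s))) -(real_normK (num_real (f2 s))).
    by have := sqr_ge0 (`|f1 s| - `|f2 s|); nra.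
  have MF : M * F ^+ 2 <= M * (2 * (f1 s ^+ 2 + f2 s ^+ 2)) by rewrite ler_wpM2l// ltW.
  have eF : eta * Lam * F <= eta * Lam * (2 * Lam).
    by rewrite ler_wpM2l// mulr_ge0// ltW.
  have -> : F * (M * F + 2 * (eta * Lam)) = M * F ^+ 2 + 2 * (eta * Lam * F) by ring.
  have -> : 8 * eta * Lam ^+ 2 = 4 * (eta * Lam * (2 * Lam)) by ring.
  lra.
have G := gronwall K0 e0 (fun s => is_derive_sqn (df1 s) (df2 s)) t0 Bd.
have f10 : f1 0 = 0 by rewrite /f1 !q0// subrr.
have f20 : f2 0 = 0 by rewrite /f2 !q0// subrr.
rewrite f10 f20 expr0n/= addr0 add0r in G.
set nn := f1 t ^+ 2 + f2 t ^+ 2 in G.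
have nnE : nn <= eps ^+ 2 / 2.
  have Et : expR (4 * M * t) <= expR (4 * M) by rewrite ler_expR ler_piMr// ltW.
  have e'0 : 0 <= 8 * eta * Lam ^+ 2 / (4 * M) by rewrite divr_ge0// ltW.
  have := ler_wpM2r e'0 Et.
  have -> : expR (4 * M) * (8 * eta * Lam ^+ 2 / (4 * M)) = eps ^+ 2 / 2.
    by rewrite /eta; field; rewrite !gt_eqF.
  lra.
rewrite -ler_sqr ?nnegrE ?norm1_ge0 ?(ltW eps0)//; apply: le_trans (norm1_sqn _) _.
rewrite -[sqn _]/nn; lra.
Qed.

End flow_jacobian.

Section flow_jac.
Context {R : realType} (D : set (R * R)) (X : R * R -> R * R) (Phi : R -> R * R -> R * R).
Context (hD : open D /\ bounded_set D) (hX : C1_zero_bd D X) (hPhi : is_flow D X Phi).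
Implicit Types (x y p z e : R * R) (t s h k : R) (i j : 'I_2).

Let C := flowC hD hX.
Let fl := eflow D Phi.

Let flq t x i j h : R :=
  h^-1 * (vec2 (fl t (h *: basis2 j + x)) i 0 - vec2 (fl t x) i 0).

Lemma norm1_basis2 j : norm1 (basis2 j) = 1 :> R.
Proof. by case: (ord2P j) => ->; rewrite /norm1 /basis2/= normr1 normr0 ?addr0 ?add0r. Qed.

Lemma quot_flq t x i j h : flq t x i j h = vec2 (quot D Phi t x (basis2 j) h) i 0.
Proof. by rewrite /flq /quot; case: (ord2P i) => ->; rewrite ?vec2_0 ?vec2_1. Qed.

Lemma coord_vec2_norm1 x i : `|vec2 x i 0| <= norm1 x.
Proof. by have [a b] := coord_norm1 x; case: (ord2P i) => ->; rewrite ?vec2_0 ?vec2_1. Qed.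

Lemma flq_cvg t x i j : D x -> 0 <= t <= 1 -> cvg (flq t x i j h @[h --> 0^']).
Proof.
move=> Dx t01; apply/cauchy_cvgP/cauchyP => eps eps0.
have e2 : 0 < eps / 2 by lra.
have n11 : norm1 (basis2 j) <= 1 :> R by rewrite norm1_basis2.
have [d d0 H] := quot_cauchy hD hX hPhi Dx t01 n11 e2.
exists (flq t x i j (d / 2)).
suff : \forall h \near 0^', ball (flq t x i j (d / 2)) eps (flq t x i j h) by [].
near=> h.
have h0 : h != 0 by near: h; exact: nbhs_dnbhs_neq.
have hd : `|h| < d by near: h; exact: dnbhs0_lt.
have d20 : d / 2 != 0 by rewrite gt_eqF//; lra.
have d2d : `|d / 2| < d by rewrite ger0_norm; lra.
have := H _ _ d20 d2d h0 hd; rewrite /ball/= !quot_flq.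
set a := quot _ _ _ _ _ _; set b := quot _ _ _ _ _ _ => ab.
have -> : vec2 a i 0 - vec2 b i 0 = vec2 (a - b) i 0.
  by case: (ord2P i) => ->; rewrite ?vec2_0 ?vec2_1.
by apply: le_lt_trans (coord_vec2_norm1 _ _) _; lra.
Unshelve. all: by end_near. Qed.

(** [jac] is built from [Phi], the estimates from [eflow]; they agree near x because D is open, and
    derivatives depend only on germs. *)
Lemma flow_jac_cvg t x i j : D x -> 0 <= t <= 1 ->
  flq t x i j h @[h --> 0^'] --> jac (Phi t) x i j.
Proof.
move=> Dx t01; rewrite mxE.
have E : \near x, vec2 (Phi t x) i 0 = vec2 (fl t x) i 0.
  have nD : nbhs x D by apply: open_nbhs_nbhs; split => //; exact: hD.1.
  by apply: filterS nD => y Dy; rewrite /fl eflowE//; exact: subset_closure.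
rewrite (near_eq_derive _ E); exact: flq_cvg.
Qed.

Lemma flow_jac_near_id t x i j : D x -> 0 <= t <= 1 ->
  `|jac (Phi t) x i j - (i == j)%:R| <= C * t.
Proof.
move=> Dx t01; have H := @flow_jac_cvg t x i j Dx t01.
have H2 : `|flq t x i j h - (i == j)%:R| @[h --> 0^'] --> `|jac (Phi t) x i j - (i == j)%:R|.
  by apply: cvg_norm; apply: cvgB => //; exact: cvg_cst.
rewrite -(cvg_lim _ H2)//; apply: limr_le; first by apply/cvg_ex; eexists; exact: H2.
near=> h; have h0 : h != 0 by near: h; exact: nbhs_dnbhs_neq.
have := eflow_dd hD hX hPhi (h *: basis2 j + x) x t01.
rewrite -/fl -/C addrK.
have -> : norm1 (h *: basis2 j) = `|h|.
  by rewrite -[norm1 _]/(`|h * (basis2 j).1| + `|h * (basis2 j).2|) !normrM -mulrDr -[X in _ * X]/(norm1 (basis2 j)) norm1_basis2 mulr1.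
set a := _ - _ - _ => aC.
have -> : flq t x i j h - (i == j)%:R = h^-1 * vec2 a i 0.
  rewrite /flq /a; case: (ord2P i) => ->; rewrite ?vec2_0 ?vec2_1/=;
  case: (ord2P j) => -> /=; rewrite /GRing.scale/=; field; exact: h0.
rewrite normrM normfV ler_pdivrMl ?normr_gt0// mulrC.
exact: le_trans (coord_vec2_norm1 _ _) aC.
Unshelve. all: by end_near. Qed.

Lemma flow_jac0 x i j : D x -> jac (Phi 0) x i j = (i == j)%:R.
Proof.
move=> Dx; have := @flow_jac_near_id 0 x i j Dx; rewrite lexx ler01 mulr0 => /(_ isT).
by rewrite normr_le0 subr_eq0 => /eqP.
Qed.

(** A pointwise limit of continuous difference quotients, with step 1/(n+1). *)
Lemma flow_jac_measurable t i j : 0 <= t <= 1 ->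
  measurable_fun (D : set mplane) (fun x : mplane => jac (Phi t) x i j).
Proof.
move=> t01.
have t1 : `|t| <= 1 by case/andP: t01 => t0 t1; rewrite ger0_norm.
apply: (@measurable_fun_cvg _ mplane R D (fun n x => flq t x i j (n.+1%:R^-1))).
  move=> n.
  have cv (x : R * R -> R * R) : continuous x -> continuous (fun y => vec2 (x y) i 0).
    move=> cx y; have [c1 c2] := cvg_coord _ (cx y).
    case: (ord2P i) => ->.
      by rewrite (_ : (fun y => vec2 (x y) 0 0) = (fun y => (x y).1))//; apply/funext => ?; rewrite vec2_0.
    by rewrite (_ : (fun y => vec2 (x y) 1 0) = (fun y => (x y).2))//; apply/funext => ?; rewrite vec2_1.
  have cfl := @eflow_continuous R D X Phi hD hX hPhi t t1.
  apply: measurable_funTS; apply: continuous_mplane => x.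
  apply: cvgMr; apply: cvgB; last exact: cv.
  apply: (cv (fun y => fl t (n.+1%:R^-1 *: basis2 j + y))) => y.
  apply: continuous_comp; last exact: cfl.
  by apply: cvgD; [exact: cvg_cst|exact: cvg_id].
move=> x Dx; have /cvgr_dnbhsP := @flow_jac_cvg t x i j Dx t01; apply; split => //.
  exact: cvg_harmonic.
Qed.

End flow_jac.

(** * Transport of measures and of Lebesgue functions *)

Section plane_regularity.
Context {R : realType}.
Implicit Types (E F U K B : set (R * R)) (x y z : R * R).

Lemma leb2_sigma_finite : sigma_finite setT (@leb2 R).
Proof.
exists (fun n => cbox 0 n%:R).
  apply/seteqP; split => // x _; pose m := Order.max `|x.1| `|x.2|.
  have m0 : 0 <= m by rewrite le_max normr_ge0.
  have [n xn] : exists n, m < n%:R by exists (Num.truncn m).+1; have /andP[] := truncn_itv m0.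
  exists n => //; rewrite /cbox/= !subr0; move: xn; rewrite gt_max => /andP[a b].
  by rewrite !ltW.
by move=> n; split; [exact: measurable_cbox|rewrite leb2_cbox ?ltry//].
Qed.

(** The same measure repackaged with its sigma-finiteness, which the Fubini theorems on pairs of
    points of the plane expect. *)
Definition leb2s : {sigma_finite_measure set (@mplane R) -> \bar R} :=
  HB.pack (@Measure.sort _ _ _ (@leb2 R))
    (@Measure_isSigmaFinite.Build _ _ R (@leb2 R) leb2_sigma_finite).

Lemma leb2_tonelli (f : mplane * mplane -> \bar R) : measurable_fun setT f ->
  (forall w, 0 <= f w)%E ->
  (\int[leb2]_x \int[leb2]_y f (x, y))%E = (\int[leb2]_y \int[leb2]_x f (x, y))%E.
Proof. exact: (@fubini_tonelli _ _ mplane mplane R leb2s leb2s). Qed.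

(** Two-sided approximation is symmetric under complements, so good sets can be shown to form a
    sigma-algebra. The error is measured inside a set B of finite measure, because countable unions
    need continuity from above. *)
Let good (B : set mplane) E := measurable (E : set mplane) /\ forall e : R, 0 < e -> exists F U,
  [/\ closed F, open U, F `<=` E, E `<=` U & (leb2 ((U `\` F) `&` B) < e%:E)%E].

Let good_cbox B z r : measurable B -> 0 <= r -> good B (cbox z r).
Proof.
move=> mB r0; split; first exact: measurable_cbox.
move=> e e0; pose h := Order.min 1 (e / (8 * r + 5)).
have h0 : 0 < h by rewrite lt_min ltr01 divr_gt0//; lra.
have h1 : h <= 1 by rewrite ge_min lexx.
have he : h * (8 * r + 5) <= e by rewrite -ler_pdivlMr ?ge_min ?lexx ?orbT//; lra.
exists (cbox z r), (obox z (r + h)); split => //; first exact: closed_cbox.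
- exact: open_obox.
- by apply: cbox_obox; lra.
have mc s : measurable (cbox z s : set mplane) by exact: measurable_cbox.
apply: (@le_lt_trans _ _ (leb2 (cbox z (r + h) `\` cbox z r))).
  apply: le_measure; rewrite ?inE.
  - apply: measurableI => //; apply: measurableD => //; exact: measurable_obox.
  - exact: measurableD.
  - by move=> x [[/obox_cbox]].
have rh0 : 0 <= r + h by lra.
rewrite measureD//; last by change (leb2 (cbox z (r + h)) < +oo)%E; rewrite leb2_cbox ?ltry.
rewrite (_ : _ `&` _ = cbox z r); last first.
  by apply/setIidr => x [a b]; split; apply: le_trans a _ || apply: le_trans b _; lra.
change (leb2 (cbox z (r + h)) - leb2 (cbox z r) < e%:E)%E.
rewrite !leb2_cbox// -EFinB lte_fin.
have : h * (h * 1) <= h * 1 by rewrite ler_wpM2l ?mulr1// ltW.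
by rewrite mulr1; nra.
Qed.

Let good_bigcup B : measurable B -> (leb2 B < +oo)%E ->
  forall A : (set (R * R))^nat, (forall n, good B (A n)) -> good B (\bigcup_n A n).
Proof.
move=> mB fB A gA; split; first by apply: bigcup_measurable => n _; have [] := gA n.
move=> e e0.
have ch n : exists FU : set (R * R) * set (R * R),
    [/\ closed FU.1, open FU.2, FU.1 `<=` A n, A n `<=` FU.2 &
     (leb2 ((FU.2 `\` FU.1) `&` B) < (e / 2 / (2 ^ n.+1)%:R)%:E)%E].
  have e'0 : 0 < e / 2 / (2 ^ n.+1)%:R by rewrite !divr_gt0// ltr0n expn_gt0.
  by have [F [U ?]] := (gA n).2 _ e'0; exists (F, U).
have [FU HFU] := choice ch.
pose F n := (FU n).1; pose U n := (FU n).2.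
have mF n : measurable (F n : set mplane) by apply: closed_mplane; have [] := HFU n.
have mU n : measurable (U n : set mplane) by apply: open_mplane; have [] := HFU n.
(* A countable union of closed sets need not be closed, so the inner union is cut at a finite stage;
   the errors decrease to the one of the full union. *)
pose H n := ((\bigcup_k U k) `\` \bigcup_(k < n) F k) `&` B.
have mUU : measurable (\bigcup_k U k : set mplane) by apply: bigcup_measurable.
have mH n : measurable (H n : set mplane).
  by apply: measurableI => //; apply: measurableD => //; exact: bigcup_measurable.
have HH : \bigcap_n H n = ((\bigcup_k U k) `\` \bigcup_k F k) `&` B.
  apply/seteqP; split => [x Hx|x [[Ux NF] Bx] n _].
    have [[U0 _] B0] := Hx 0%N I; split => //; split => // -[k _ Fk].
    by have [[_ N] _] := Hx k.+1 I; apply: N; exists k => /=.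
  by split => //; split => // -[k _ Fk]; apply: NF; exists k.
have lim : (leb2 \o H) n @[n --> \oo] --> leb2 (\bigcap_n H n).
  apply: nonincreasing_cvg_mu => //.
  - apply: le_lt_trans fB; apply: le_measure; rewrite ?inE//; exact: subIsetr.
  - by rewrite HH; apply: measurableI => //; apply: measurableD => //; exact: bigcup_measurable.
  - move=> n m nm; apply/subsetPset => x [[Ux NF] Bx]; split => //; split => // -[k /= kn Fk].
    by apply: NF; exists k => //=; exact: leq_trans nm.
have small : (leb2 (\bigcap_n H n) < e%:E)%E.
  apply: (@le_lt_trans _ _ (e / 2)%:E); last by rewrite lte_fin; lra.
  have mD n : measurable ((U n `\` F n) `&` B : set mplane).
    by apply: measurableI => //; exact: measurableD.
  have sub : \bigcap_n H n `<=` \bigcup_n ((U n `\` F n) `&` B).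
    rewrite HH => x [[[k _ Uk] NF] Bx]; exists k => //; split => //; split => // Fk.
    by apply: NF; exists k.
  apply: (@le_trans _ _ (\sum_(0 <= n <oo) leb2 ((U n `\` F n) `&` B))%E).
    apply: measure_sigma_subadditive => //.
    by rewrite HH; apply: measurableI => //; apply: measurableD => //; exact: bigcup_measurable.
  apply: (@le_trans _ _ (\sum_(0 <= n <oo) (e / 2 / (2 ^ n.+1)%:R)%:E)%E).
    by apply: lee_nneseries => // n _; have [_ _ _ _ /ltW] := HFU n.
  by apply: epsilon_trick0; lra.
have [N _ HN] : \forall n \near \oo, (leb2 (H n) < e%:E)%E by apply: (lim [set u | (u < e%:E)%E]); exact: open_ereal_lt'.
exists (\bigcup_(k < N) F k), (\bigcup_k U k); split.
- have -> : \bigcup_(k < N) F k = \big[setU/set0]_(k < N) F k by rewrite -bigcup_mkord.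
  by apply: closed_bigsetU => k _; have [] := HFU k.
- by apply: bigcup_open => k _; have [] := HFU k.
- by move=> x [k _ Fk]; exists k => //; have [_ _ + _ _] := HFU k; apply.
- by move=> x [k _ Ak]; exists k => //; have [_ _ _ + _] := HFU k; apply.
- by apply: HN => /=.
Qed.

Lemma mplane_regular B E : measurable (B : set mplane) -> (leb2 B < +oo)%E ->
  measurable (E : set mplane) -> forall e : R, 0 < e -> exists F U,
  [/\ closed F, open U, F `<=` E, E `<=` U & (leb2 ((U `\` F) `&` B) < e%:E)%E].
Proof.
move=> mB fB mE; suff [] : good B E by [].
have g0 : good B set0.
  split => // e e0; exists set0, set0; rewrite setD0 set0I measure0 lte_fin.
  by split => //; exact: closed0.
have gU := good_bigcup mB fB.
move: mE; rewrite mplane_open; apply: smallest_sub.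
  split; [exact: g0| |exact: gU] => A [mA gA].
  split; first by rewrite setTD; exact: measurableC.
  move=> e /gA[F [U [cF oU FA AU H]]]; exists (~` U), (~` F); rewrite setTD.
  split; [by rewrite closedC|by rewrite openC|exact: subsetC|exact: subsetC|].
  by rewrite setDE setCK (setIC (~` F)) -setDE.
move=> U oU; have [->//|/set0P U0] := eqVneq U set0.
have [z [r [zr UE]]] := open_bigcup_obox oU U0.
suff -> : U = \bigcup_i cbox (z i) (r i).
  by apply: gU => n; apply: good_cbox => //; have [/ltW] := zr n.
apply/seteqP; split; last by move=> x [i _ xi]; have [_] := zr i; exact.
by rewrite {1}UE => x [i _ xi]; exists i => //; exact: obox_cbox.
Qed.

Lemma bounded_regular (rho : R) E : 0 <= rho -> measurable (E : set mplane) -> E `<=` obox 0 rho ->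
  forall e : R, 0 < e -> exists K U,
  [/\ compact K, open U, K `<=` E, E `<=` U & U `<=` obox 0 rho /\ (leb2 (U `\` K) < e%:E)%E].
Proof.
move=> rho0 mE Eb e e0; have mB : measurable (cbox 0 rho : set (@mplane R)) by exact: measurable_cbox.
have fB : (leb2 (cbox (0 : R * R)%R rho) < +oo)%E by rewrite leb2_cbox ?ltry.
have [F [U [cF oU FE EU UF]]] := mplane_regular mB fB mE e0.
exists F, (U `&` obox 0 rho); split => //.
- apply: (@subclosed_compact _ _ (cbox 0 rho)) => //; first exact: compact_cbox.
  exact: subset_trans FE (subset_trans Eb (@obox_cbox _ _ _)).
- by apply: openI => //; exact: open_obox.
- by move=> x Ex; split; [exact: EU|exact: Eb].
split; first exact: subIsetr.
apply: le_lt_trans UF; apply: le_measure; rewrite ?inE.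
- apply: measurableD; last exact: closed_mplane.
  by apply: measurableI; [exact: open_mplane|exact: measurable_obox].
- by apply: measurableI => //; apply: measurableD; [exact: open_mplane|exact: closed_mplane].
- by move=> x [[Ux /obox_cbox bx] NF]; split.
Qed.

Lemma compact_open_margin K U : compact K -> open U -> K `<=` U ->
  exists2 r : R, 0 < r & forall x, K x -> cbox x r `<=` U.
Proof.
move=> cK oU KU.
have cov : \forall r \near (0 : R)^'+, K `<=` [set x | cbox x r `<=` U].
  move/compact_near_coveringP : cK; apply => x Kx.
  have [s s0 sU] := nbhs_cbox (open_nbhs_nbhs (conj oU (KU _ Kx))).
  exists (obox x (s / 2), [set r | r < s / 2]).
    split => /=; first by apply/nbhs_obox; exists (s / 2) => //; lra.
    by apply: nbhs_right_lt; lra.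
  move=> [y r] [/= [y1 y2] rs] w [w1 w2]; apply: sU; split.
    by have := ler_distD y.1 w.1 x.1; lra.
  by have := ler_distD y.2 w.2 x.2; lra.
near (0 : R)^'+ => r; exists r; last by near: r.
by near: r; exact: nbhs_right_gt.
Unshelve. all: by end_near. Qed.

End plane_regularity.

Import HBNNSimple.

(** Immediate on simple functions, level set by level set; monotone convergence does the rest. *)
Lemma ge0_integral_le_measure d (T : measurableType d) (R : realType) (mu nu : {measure set T -> \bar R})
    (C : R) (f : T -> \bar R) : 0 <= C ->
  (forall E, measurable E -> mu E <= C%:E * nu E)%E ->
  measurable_fun setT f -> (forall x, 0 <= f x)%E ->
  (\int[mu]_x f x <= C%:E * \int[nu]_x f x)%E.
Proof.
move=> C0 H mf f0; pose g := nnsfun_approx measurableT mf.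
have gf x : (fun n => (g n x)%:E) @ \oo --> f x by exact: cvg_nnsfun_approx.
have ndg x : {homo (g^~ x) : n m / (n <= m)%N >-> n <= m}.
  by move=> n m nm; have /lefP := nd_nnsfun_approx measurableT mf nm; apply.
have gle n x : ((g n x)%:E <= f x)%E.
  rewrite -(cvg_lim _ (gf x))//; apply: lime_ge; first by apply/cvg_ex; eexists; exact: gf.
  by exists n => // m /= nm; rewrite lee_fin; exact: ndg.
rewrite (@nd_ge0_integral_lim _ _ _ mu _ g)//; apply: lime_le.
  apply: ereal_nondecreasing_is_cvgn => n m nm /=.
  rewrite -!integralT_nnsfun; apply: ge0_le_integral => //;
    do ?[by move=> y _; rewrite lee_fin; exact: fun_ge0|exact/measurable_EFinP].
  by move=> y _; rewrite lee_fin; exact: (ndg y n m nm).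
near=> n => /=.
apply: (@le_trans _ _ (C%:E * sintegral nu (g n))%E); last first.
  rewrite -integralT_nnsfun lee_wpmul2l ?lee_fin//; apply: ge0_le_integral => //;
    do ?[by move=> y _; rewrite lee_fin; exact: fun_ge0|exact/measurable_EFinP].
rewrite !sintegralE ge0_mule_fsumr; last first.
  move=> y; have [y0|y0] := leP 0 y; first by apply: mule_ge0; rewrite ?lee_fin.
  rewrite (_ : _ @^-1` _ = set0) ?measure0 ?mule0//; apply/seteqP; split => // x /= gy.
  by have : 0 <= g n x by [rewrite fun_ge0]; rewrite gy leNgt y0.
apply: lee_fsum => // _ [x _ <-].
rewrite muleCA; apply: lee_wpmul2l; first by rewrite lee_fin.
exact: H.
Unshelve. all: by end_near. Qed.

(** * Measure distortion under a map with Lipschitz inverse *)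

Section lipschitz_image.
Context {R : realType} (S T : R * R -> R * R) (L : R).
Context (cS : continuous S) (TS : cancel S T) (ST : cancel T S) (L0 : 0 < L).
Context (lipT : forall x y, norm1 (T x - T y) <= L * norm1 (x - y)).
Implicit Types (E F U K : set (R * R)) (x y z : R * R).

Let mS : measurable_fun (setT : set mplane) (S : mplane -> mplane).
Proof. exact: continuous_mplane2. Qed.

Let mpre E : measurable (E : set mplane) -> measurable (S @^-1` E : set mplane).
Proof. by move=> mE; have := mS measurableT mE; rewrite setTI. Qed.

Lemma preimage_cbox y r : S @^-1` cbox y r `<=` cbox (T y) (2 * L * r).
Proof.
move=> x /= [a b]; have := lipT (S x) y; rewrite TS.
rewrite -[X in _ <= _ * X]/(`|(S x).1 - y.1| + `|(S x).2 - y.2|) => H.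
have [c d] := coord_norm1 (x - T y).
have ab : L * (`|(S x).1 - y.1| + `|(S x).2 - y.2|) <= L * (r + r).
  by rewrite ler_wpM2l ?(ltW L0)// lerD.
by split; [apply: le_trans c _|apply: le_trans d _]; lra.
Qed.

Lemma integral_indicT (A : set mplane) : measurable A ->
  (\int[leb2]_x (\1_A x)%:E)%E = leb2 A :> \bar R.
Proof. by move=> mA; rewrite integral_indic// setIT. Qed.

Lemma measurable_compact K : compact K -> measurable (K : set (@mplane R)).
Proof. by move=> cK; apply: closed_mplane; apply: compact_closed => //; exact: norm_hausdorff. Qed.

(* Tonelli for the set of pairs with S x in K and y within r of S x. *)
Let push_compact K U : compact K -> open U -> K `<=` U ->
  (leb2 (S @^-1` K) <= (4 * L ^+ 2)%:E * leb2 U)%E.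
Proof.
move=> cK oU KU; have [r r0 rU] := compact_open_margin cK oU KU.
have mK : measurable (K : set (@mplane R)).
  by exact: measurable_compact.
have mU := open_mplane oU.
pose V (w : @mplane R * @mplane R) : mplane := S w.1 - w.2.
have mV : measurable_fun setT V.
  have m1 : measurable_fun setT (fun w : @mplane R * @mplane R => S w.1 : mplane).
    by move=> mT Y mY; exact: (@measurable_fst _ _ mplane mplane measurableT _ (mpre mY)).
  have m2 : measurable_fun setT (fun w : @mplane R * @mplane R => w.2) by exact: measurable_snd.
  have [m11 m12] := (measurable_fun_pairP _).1 m1.
  have [m21 m22] := (measurable_fun_pairP _).1 m2.
  apply/measurable_fun_pairP; split.
    exact: (measurable_funB m11 m21).
  exact: (measurable_funB m12 m22).
pose P : set (@mplane R * @mplane R) := [set w | K (S w.1) /\ cbox 0 r (V w)].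
have mP : measurable P.
  have m1 : measurable_fun setT (fun w : @mplane R * @mplane R => S w.1 : mplane).
    by move=> mT Y mY; exact: (@measurable_fst _ _ mplane mplane measurableT _ (mpre mY)).
  have := measurableI _ _ (m1 measurableT _ mK) (mV measurableT _ (measurable_cbox 0 r)).
  by rewrite !setTI.
have mf : measurable_fun setT (fun w => (\1_P w)%:E : \bar R).
  by apply/measurable_EFinP; exact: measurable_indic.
have := leb2_tonelli mf (fun w => ltac:(by rewrite lee_fin)).
have cb x y : cbox 0 r (V (x, y)) = cbox (S x) r y.
  by rewrite /cbox /V/= !subr0 (distrC y.1) (distrC y.2).
have -> : (\int[leb2]_x \int[leb2]_y (\1_P (x, y))%:E =
    ((2 * r) ^+ 2)%:E * leb2 (S @^-1` K) :> \bar R)%E.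
  have E x : (\int[leb2]_y (\1_P (x, y))%:E = ((2 * r) ^+ 2)%:E * (\1_(S @^-1` K) x)%:E :> \bar R)%E.
    have [Kx|NKx] := pselect (K (S x)).
      rewrite [in RHS]indicE mem_set//= mule1 -(@leb2_cbox _ (S x)) ?(ltW r0)//.
      rewrite -integral_indicT; last exact: measurable_cbox.
      apply: eq_integral => y _; rewrite !indicE; congr ((nat_of_bool _)%:R%:E).
      by apply/idP/idP; rewrite !inE /P/= cb; [case|].
    rewrite [in RHS]indicE memNset// mule0.
    apply: integral0_eq => y _; rewrite indicE memNset// => -[].
      by move=> /NKx.
  under eq_integral do rewrite E.
  rewrite ge0_integralZl//.
  - by rewrite integral_indicT//; exact: mpre.
  - by apply/measurable_EFinP; apply: measurable_indic; exact: mpre.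
  - by rewrite lee_fin sqr_ge0.
move=> HE.
(* For fixed y in U, the admissible x lie in the preimage of a box of radius r, hence in a box of
   radius 2 L r. In the other order each fibre has area (2 r)^2; the quotient of the two areas is
   the constant 4 L^2. *)
have ub : (\int[leb2]_y \int[leb2]_x (\1_P (x, y))%:E <= ((4 * L * r) ^+ 2)%:E * leb2 U :> \bar R)%E.
  rewrite -(integral_indicT mU).
  rewrite -ge0_integralZl//; [|by apply/measurable_EFinP; exact: measurable_indic|
    by rewrite lee_fin sqr_ge0].
  apply: ge0_le_integral => //.
  - by move=> y _; apply: integral_ge0 => x _; rewrite lee_fin.
  - exact: (@measurable_fun_fubini_tonelli_G _ _ mplane mplane R leb2s _ mf (fun w => ltac:(by rewrite lee_fin))).
  - by apply: measurable_funeM; apply/measurable_EFinP; exact: measurable_indic.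
  move=> y _; have [Uy|NUy] := pselect (U y); last first.
    rewrite [in leRHS]indicE memNset// mule0 integral0_eq// => x _.
    rewrite indicE memNset// => -[/= Kx]; rewrite cb => /(rU _ Kx); exact: NUy.
  rewrite [in leRHS]indicE mem_set// mule1.
  have -> : (4 * L * r) ^+ 2 = (2 * (2 * L * r)) ^+ 2 by ring.
  rewrite -(@leb2_cbox _ (T y)) ?mulr_ge0 ?(ltW L0) ?(ltW r0)//.
  rewrite -integral_indicT; last exact: measurable_cbox.
  apply: ge0_le_integral => //.
  - apply/measurable_EFinP; apply: measurable_indic.
    have -> : (fun x => P (x, y)) = ysection P y.
      by apply/seteqP; split => x; rewrite ysectionE.
    exact: (measurable_ysection y mP).
  - by apply/measurable_EFinP; apply: measurable_indic; exact: measurable_cbox.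
  move=> x _; rewrite lee_fin !indicE ler_nat; case: (boolP ((x, y) \in P)) => //.
  rewrite inE => -[_ /=]; rewrite cb => cx; rewrite mem_set//; apply: preimage_cbox => /=.
  by move: cx; rewrite /cbox/= (distrC y.1) (distrC y.2).
rewrite -HE in ub.
have r2 : 0 < (2 * r) ^+ 2 by rewrite exprn_gt0// mulr_gt0.
rewrite -(@lee_pmul2l _ ((2 * r) ^+ 2)%:E)//.
apply: le_trans ub _; rewrite muleA -EFinM le_eqVlt; apply/orP; left; apply/eqP.
by congr (_%:E * _)%E; ring.
Qed.

(** The preimage of E is approximated by a compact K' from inside and E by an open U from outside;
    the image of K' is compact and contained in U, which is the case already settled. *)
Let push_bounded rho E : 0 <= rho -> measurable (E : set mplane) -> E `<=` obox 0 rho ->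
  (leb2 (S @^-1` E) <= (4 * L ^+ 2)%:E * leb2 E)%E.
Proof.
move=> rho0 mE Eb.
have C0 : 0 < 4 * L ^+ 2 by rewrite mulr_gt0// exprn_gt0.
have [rho' rho'0 SEb] : exists2 rho', 0 <= rho' & S @^-1` E `<=` obox 0 rho'.
  exists (`|(T 0).1| + `|(T 0).2| + 2 * L * rho + 1).
    by rewrite addr_ge0// addr_ge0// ?addr_ge0// !mulr_ge0// ltW.
  move=> x /Eb /obox_cbox /preimage_cbox [a b]; rewrite /obox/= !subr0.
  have := ler_normD (x.1 - (T 0).1) (T 0).1; have := ler_normD (x.2 - (T 0).2) (T 0).2.
  rewrite !subrK; have := normr_ge0 (T 0).1; have := normr_ge0 (T 0).2; lra.
apply/lee_addgt0Pr => e e0.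
pose e' := e / (1 + 4 * L ^+ 2).
have e'0 : 0 < e' by rewrite divr_gt0// addr_gt0.
have [K' [U' [cK' oU' KE' EU' [_ HK']]]] := bounded_regular rho'0 (mpre mE) SEb e'0.
have [K [U [cK oU KE EU [Ub HK]]]] := bounded_regular rho0 mE Eb e'0.
have cSK : compact (S @` K') by apply: continuous_compact => //; exact: continuous_subspaceT.
have SKU : S @` K' `<=` U by move=> _ [x /KE' /= Ex <-]; exact: EU.
have mK' : measurable (K' : set (@mplane R)).
  by exact: measurable_compact.
have mK : measurable (K : set (@mplane R)).
  by exact: measurable_compact.
have mU := open_mplane oU; have mU' := open_mplane oU'.
have H1 : (leb2 K' <= (4 * L ^+ 2)%:E * leb2 U)%E.
  apply: le_trans (push_compact cSK oU SKU).
  apply: le_measure; rewrite ?inE//; last by move=> x Kx; exists x.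
  apply: mpre; exact: measurable_compact.
have H2 : (leb2 (S @^-1` E) <= leb2 K' + e'%:E)%E.
  apply: (@le_trans _ _ (leb2 (K' `|` (U' `\` K')))).
    apply: le_measure; rewrite ?inE.
    - exact: mpre.
    - by apply: measurableU => //; exact: measurableD.
    - by move=> x /EU' Ux; have [?|?] := pselect (K' x); [left|right].
  apply: le_trans (measureU2 leb2 mK' (measurableD mU' mK')) _.
  by rewrite leeD2l// ltW.
have H3 : (leb2 U <= leb2 E + e'%:E)%E.
  apply: (@le_trans _ _ (leb2 (E `|` (U `\` K)))).
    apply: le_measure; rewrite ?inE//.
    - by apply: measurableU => //; exact: measurableD.
    - by move=> x Ux; have [?|NE] := pselect (E x); [left|right; split => // /KE].
  apply: le_trans (measureU2 leb2 mE (measurableD mU mK)) _.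
  by rewrite leeD2l// ltW.
apply: le_trans H2 _; apply: (@le_trans _ _ ((4 * L ^+ 2)%:E * (leb2 E + e'%:E) + e'%:E)%E).
  by rewrite leeD2r//; apply: le_trans H1 _; rewrite lee_wpmul2l// lee_fin ltW.
rewrite ge0_muleDr// ?lee_fin ?(ltW e'0)// -addeA -EFinM -EFinD.
rewrite leeD2l// lee_fin /e' le_eqVlt; apply/orP; left; apply/eqP.
by field; rewrite gt_eqF//; lra.
Qed.

Lemma push_measurable E : measurable (E : set mplane) ->
  (leb2 (S @^-1` E) <= (4 * L ^+ 2)%:E * leb2 E)%E.
Proof.
move=> mE; pose En n := E `&` obox 0 n%:R.
have mEn n : measurable (En n : set mplane).
  by apply: measurableI => //; exact: measurable_obox.
have cov : \bigcup_n (S @^-1` En n) = S @^-1` E.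
  apply/seteqP; split => [x [n _ []]//|x Ex].
  pose m := Order.max `|(S x).1| `|(S x).2|.
  have m0 : 0 <= m by rewrite le_max normr_ge0.
  exists (Num.truncn m).+1 => //; split => //.
  have /andP[_] := truncn_itv m0.
  by rewrite gt_max => /andP[a b]; rewrite /obox/= !subr0.
have lim : (leb2 \o (fun n => S @^-1` En n)) n @[n --> \oo] --> leb2 (\bigcup_n (S @^-1` En n)).
  apply: nondecreasing_cvg_mu.
  - by move=> n; exact: mpre.
  - by rewrite cov; exact: mpre.
  - move=> n m nm; apply/subsetPset => x [Ex [a b]]; split => //.
    by split; [apply: lt_le_trans a _|apply: lt_le_trans b _]; rewrite ler_nat.
rewrite -cov -(cvg_lim _ lim)//; apply: lime_le; first by apply/cvg_ex; eexists; exact: lim.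
near=> n => /=; apply: le_trans (push_bounded _ (mEn n) _) _.
- exact: ler0n.
- by move=> x [].
apply: lee_wpmul2l; first by rewrite lee_fin mulr_ge0 ?sqr_ge0.
by apply: le_measure; rewrite ?inE//; exact: subIsetl.
Unshelve. all: by end_near. Qed.

Lemma ge0_integral_push (f : mplane -> \bar R) : measurable_fun setT f -> (forall x, 0 <= f x)%E ->
  (\int[leb2]_x f (S x) <= (4 * L ^+ 2)%:E * \int[leb2]_x f x)%E.
Proof.
move=> mf f0.
have -> : (\int[leb2]_x f (S x))%E = (\int[pushforward leb2 (S : mplane -> mplane)]_x f x)%E.
  by rewrite (ge0_integral_pushforward mS)// preimage_setT.
apply: (@ge0_integral_le_measure _ mplane R
  (measure_function_pushforward__canonical__measure_function_Measure leb2 mS) leb2) => //; first by rewrite mulr_ge0 ?sqr_ge0.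
exact: push_measurable.
Qed.

End lipschitz_image.

Section Lp_bound.
Context {R : realType}.
Implicit Types (O : set (R * R)) (f g : R * R -> R).

Lemma Lp_norm_le_int O p f (e : R) : 0 < p -> 0 <= e ->
  (\int[leb2]_(x in O) (`|f x| `^ p)%:E <= (e `^ p)%:E)%E -> (Lp_norm O p f <= e%:E)%E.
Proof.
move=> p0 e0 H; rewrite Lp_normE ?gt_eqF//.
rewrite -[e]powRr1// -(mulfV (lt0r_neq0 p0)) powRrM -poweR_EFin.
apply: gt0_ler_poweR H; rewrite ?invr_ge0 ?ltW//.
  by rewrite in_itv/= leey andbT integral_ge0// => x _; rewrite lee_fin powR_ge0.
by rewrite in_itv/= leey andbT lee_fin powR_ge0.
Qed.

Lemma Lp_norm_eq O p f g : (forall x, O x -> f x = g x) -> Lp_norm O p f = Lp_norm O p g.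
Proof.
move=> fg; rewrite /Lp_norm; congr Lnorm; apply/funext => x /=; rewrite /patch.
by case: ifPn => // /set_mem/fg ->.
Qed.

End Lp_bound.

(** * Strong continuity of transport by the flow in L_q *)

Section flow_transport.
Context {R : realType} (D : set (R * R)) (X : R * R -> R * R) (Phi : R -> R * R -> R * R).
Context (hD : open D /\ bounded_set D) (hX : C1_zero_bd D X) (hPhi : is_flow D X Phi).
Context (q : R) (q1 : 1 <= q).
Implicit Types (x y p z e : R * R) (t s h k : R) (f g : R * R -> R).

Let fl := eflow D Phi.
Let Lam := flowK hD hX.
Let mD : measurable (D : set mplane) := open_mplane hD.1.
Let q0 : 0 < q. Proof. exact: lt_le_trans ltr01 q1. Qed.

Definition pushC : R := 4 * flowK hD hX ^+ 2.

Lemma pushC_ge0 : 0 <= pushC.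
Proof. by rewrite /pushC mulr_ge0// sqr_ge0. Qed.

Lemma eflow_push t (f : mplane -> \bar R) : `|t| <= 1 -> measurable_fun setT f ->
  (forall x, 0 <= f x)%E -> (\int[leb2]_x f (fl t x) <= pushC%:E * \int[leb2]_x f x)%E.
Proof.
move=> t1; apply: (@ge0_integral_push R (fl t) (fl (- t)) Lam).
- exact: (eflow_continuous hD hX hPhi).
- exact: (eflowK hD hX hPhi).
- exact: lt_le_trans ltr01 (flowK_ge1 hD hX).
- by move=> x y; apply: (eflow_lip hD hX hPhi); rewrite normrN.
Qed.

(** Allows a function to be replaced by an a.e. equal representative also at the transported
    points. *)
Lemma eflow_null t (N : set (R * R)) : `|t| <= 1 -> leb2.-negligible (N : set mplane) ->
  leb2.-negligible (fl t @^-1` N : set mplane).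
Proof.
move=> t1 [A [mA A0 NA]]; exists (fl t @^-1` A); split.
- have := continuous_mplane2 (eflow_continuous hD hX hPhi t1) measurableT mA.
  by rewrite setTI.
- apply/eqP; rewrite eq_le measure_ge0 andbT.
  have := @push_measurable R (fl t) (fl (- t)) Lam (eflow_continuous hD hX hPhi t1) (eflowK hD hX hPhi t)
     (lt_le_trans ltr01 (flowK_ge1 hD hX)).
  have tN : `|- t| <= 1 by rewrite normrN.
  move=> /(_ (fun x y => eflow_lip hD hX hPhi x y tN) A mA).
  by rewrite A0 mule0.
- by move=> x /=; exact: NA.
Qed.

Lemma measurable_eflow_comp t f : `|t| <= 1 -> measurable_fun (D : set mplane) (f : mplane -> R) ->
  measurable_fun (D : set mplane) (fun x : mplane => f (fl t x)).
Proof.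
move=> t1 mf; apply: (@measurable_comp _ _ _ mplane mplane _ D f D (fl t)) => //.
- by move=> _ [x Dx <-]; exact: (eflow_in hD hX hPhi).
- apply: measurable_funTS; exact: continuous_mplane2 (eflow_continuous hD hX hPhi t1).
Qed.

Lemma Lp_norm_push t f : `|t| <= 1 -> measurable_fun (D : set mplane) (f : mplane -> R) ->
  (Lp_norm D q (fun x => f (fl t x)) <= (pushC `^ q^-1)%:E * Lp_norm D q f)%E.
Proof.
move=> t1 mf; rewrite !Lp_normE ?gt_eqF//.
have C0 := pushC_ge0.
have I0 : (0 <= \int[leb2]_(x in D) (`|f x| `^ q)%:E)%E.
  by apply: integral_ge0 => x _; rewrite lee_fin powR_ge0.
rewrite -poweR_EFin -poweRM ?lee_fin//.
have H : (\int[leb2]_(x in D) (`|f (fl t x)| `^ q)%:E <=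
   pushC%:E * \int[leb2]_(x in D) (`|f x| `^ q)%:E)%E.
  rewrite integral_mkcond [in leRHS]integral_mkcond.
  have := @eflow_push t ((fun x => (`|f x| `^ q)%:E) \_ D) t1.
  have mi := @measurable_Lp_int R D q f mf.
  move=> /(_ ((measurable_restrictT _ mD).1 mi)).
  have p0 x : (0 <= ((fun x => (`|f x| `^ q)%:E) \_ D) x)%E.
    by rewrite patchE; case: ifP => // _; rewrite lee_fin powR_ge0.
  move=> /(_ p0); apply: le_trans; rewrite le_eqVlt; apply/orP; left; apply/eqP.
  apply: (@eq_integral _ mplane R leb2) => x _; rewrite !patchE.
  have [Dx|NDx] := pselect (D x).
    by rewrite !mem_set//; exact: (eflow_in hD hX hPhi).
  by rewrite !memNset// /fl (eflow_out hD hX hPhi).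
apply: gt0_ler_poweR H; rewrite ?invr_ge0 ?ltW//.
  by rewrite in_itv/= leey andbT integral_ge0// => x _; rewrite lee_fin powR_ge0.
by rewrite in_itv/= leey andbT mule_ge0.
Qed.

Definition Lp_transport_cvg f := forall e : R, 0 < e -> exists2 d, 0 < d & forall t,
  0 <= t <= d -> t <= 1 -> (Lp_norm D q (fun x => f (fl t x) - f x)%R <= e%:E)%E.

Let mdiff t f : `|t| <= 1 -> measurable_fun (D : set mplane) (f : mplane -> R) ->
  measurable_fun (D : set mplane) (fun x : mplane => f (fl t x) - f x).
Proof. by move=> t1 mf; apply: measurable_funB => //; exact: measurable_eflow_comp. Qed.

Let t1 t d : 0 <= t <= d -> t <= 1 -> `|t| <= 1.
Proof. by move=> /andP[t0 _] t1; rewrite ger0_norm. Qed.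

Lemma transport_lin a f g : measurable_fun (D : set mplane) (f : mplane -> R) ->
  measurable_fun (D : set mplane) (g : mplane -> R) ->
  Lp_transport_cvg f -> Lp_transport_cvg g -> Lp_transport_cvg (fun x => a * f x + g x).
Proof.
move=> mf mg tf tg e e0.
have na : 0 < 2 * (`|a| + 1) by rewrite mulr_gt0// ltr_wpDl.
have [d1 d10 H1] := tf (e / (2 * (`|a| + 1))) (divr_gt0 e0 na).
have [d2 d20 H2] := tg (e / 2) (divr_gt0 e0 (ltr0Sn _ 1)).
exists (Order.min d1 d2); first by rewrite lt_min d10.
move=> t td t01; have tt := t1 td t01.
move: td; rewrite le_min => /and3P[t0 td1 td2].
have -> : (fun x => a * f (fl t x) + g (fl t x) - (a * f x + g x)) =
    (fun x => a * (f (fl t x) - f x) + (g (fl t x) - g x)).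
  by apply/funext => x; ring.
apply: le_trans (Lp_normD q1 mD _ (mdiff tt mg)) _.
  by apply: measurable_funM => //; exact: mdiff.
rewrite Lp_normZ//; last exact: mdiff.
have {}H1 := H1 t (introT andP (conj t0 td1)) t01.
have {}H2 := H2 t (introT andP (conj t0 td2)) t01.
apply: (@le_trans _ _ (`|a|%:E * (e / (2 * (`|a| + 1)))%:E + (e / 2)%:E)%E).
  by apply: leeD => //; apply: lee_wpmul2l; rewrite ?lee_fin.
rewrite -EFinM -EFinD lee_fin.
have : e = `|a| * (e / (2 * (`|a| + 1))) + e / (2 * (`|a| + 1)) + e / 2 :> R.
  by field; rewrite gt_eqF//; move: na; lra.
have := divr_gt0 e0 na; lra.
Qed.

Lemma transport_sum (s : seq R) (a : R -> R) (F : R -> R * R -> R) :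
  (forall y : R, measurable_fun (D : set mplane) (F y : mplane -> R)) ->
  (forall y : R, Lp_transport_cvg (F y)) ->
  measurable_fun (D : set mplane) (fun x : mplane => \sum_(y <- s) a y * F y x) /\
  Lp_transport_cvg (fun x => \sum_(y <- s) a y * F y x).
Proof.
move=> mF tF; elim: s => [|y s [IHm IH]].
  have -> : (fun x => \sum_(y <- [::]) a y * F y x) = (fun=> 0).
    by apply/funext => x; rewrite big_nil.
  split; first exact: measurable_cst.
  move=> e e0; exists 1 => // t _ _; apply: Lp_norm_le_int => //; first exact: ltW.
  rewrite integral0_eq ?lee_fin ?powR_ge0// => x _.
  by rewrite subrr normr0 powR0// gt_eqF.
have -> : (fun x => \sum_(y <- y :: s) a y * F y x) =
    (fun x => a y * F y x + \sum_(y <- s) a y * F y x).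
  by apply/funext => x; rewrite big_cons.
split; last exact: transport_lin.
by apply: measurable_funD => //; exact: measurable_funM.
Qed.

(** Transport is bounded on L_q uniformly in t by [Lp_norm_push], so convergence passes to limits.
    The approximation error is paid twice, once transported and once at rest, hence the denominator
    of [e']. *)
Lemma transport_approx f : measurable_fun (D : set mplane) (f : mplane -> R) ->
  (forall e : R, 0 < e -> exists h : R * R -> R, [/\ measurable_fun (D : set mplane) (h : mplane -> R),
     Lp_transport_cvg h & (Lp_norm D q (fun x => f x - h x)%R <= e%:E)%E]) ->
  Lp_transport_cvg f.
Proof.
move=> mf H e e0.
have C0 : 0 <= pushC `^ q^-1 by exact: powR_ge0.
pose e' := e / (pushC `^ q^-1 + 2).
have C2 : 0 < pushC `^ q^-1 + 2 by lra.
have e'0 : 0 < e' by rewrite divr_gt0.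
have [h [mh th fh]] := H e' e'0.
have [d d0 Hd] := th e' e'0.
exists d => // t td t01; have tt := t1 td t01.
have mfh : measurable_fun (D : set mplane) (fun x : mplane => f x - h x) by exact: measurable_funB.
have -> : (fun x => f (fl t x) - f x) = (fun x => (f (fl t x) - h (fl t x)) +
    ((h (fl t x) - h x) + - 1 * (f x - h x))).
  by apply/funext => x; ring.
have mN : measurable_fun (D : set mplane) (fun x : mplane => - 1 * (f x - h x)) by exact: measurable_funM.
have mfhc := @measurable_eflow_comp t (fun x => f x - h x) tt mfh.
apply: le_trans (Lp_normD q1 mD mfhc _) _.
  by apply: measurable_funD => //; exact: mdiff.
apply: (@le_trans _ _ ((pushC `^ q^-1 * e')%:E + (e' + e')%:E)%E); last first.
  rewrite -EFinD lee_fin /e' le_eqVlt; apply/orP; left; apply/eqP.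
  by field; rewrite gt_eqF.
apply: leeD.
  apply: le_trans (@Lp_norm_push t (fun x => f x - h x) tt mfh) _.
  by rewrite EFinM; apply: lee_wpmul2l; rewrite ?lee_fin.
apply: le_trans (Lp_normD q1 mD (mdiff tt mh) mN) _.
rewrite EFinD; apply: leeD; first exact: Hd.
by rewrite Lp_normZ// normrN normr1 mul1e.
Qed.

Lemma transport_eq f g : (forall x, D x -> f x = g x) -> Lp_transport_cvg f -> Lp_transport_cvg g.
Proof.
move=> fg tf e e0; have [d d0 H] := tf e e0; exists d => // t td t01.
apply: le_trans (H t td t01); rewrite le_eqVlt; apply/orP; left; apply/eqP.
by apply: Lp_norm_eq => x Dx; rewrite !fg//; exact: (eflow_in hD hX hPhi).
Qed.

(** With K compact inside E and U open around it, a displacement below the margin of K in U cannot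
    carry a point of K out of U. So whenever x and its image are separated by E, one of them lies in
    U minus K, a set of small measure. *)
Lemma transport_indic (E : set mplane) : measurable E -> E `<=` D -> Lp_transport_cvg (\1_E : R * R -> R).
Proof.
move=> mE ED e e0.
have [r r0 Dr] := bounded_cbox hD.2.
have Eb : E `<=` obox 0 (r + 1).
  by move=> x /ED /Dr; apply: cbox_obox; lra.
have C1 : 0 < pushC + 1 by have := pushC_ge0; lra.
have e'0 : 0 < e `^ q / (pushC + 1) by rewrite divr_gt0// powR_gt0.
have [|K [U [cK oU KE EU [_ HK]]]] := @bounded_regular R (r + 1) E _ mE Eb _ e'0; first lra.
have [rho rho0 KU] := compact_open_margin cK oU (subset_trans KE EU).
have [C C0 disp] := eflow_disp hD hX hPhi.
exists (rho / C); first exact: divr_gt0.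
move=> t td t01; have tt := t1 td t01; case/andP: td => t0; rewrite ler_pdivlMr// => td.
have near x : cbox x rho (fl t x) /\ cbox (fl t x) rho x.
  have := disp t x (introT andP (conj t0 t01)); rewrite mulrC => H.
  have [a b] := coord_norm1 (fl t x - x).
  have ra := le_trans a (le_trans H td); have rb := le_trans b (le_trans H td).
  by split; split => //; rewrite distrC.
have mUK : measurable (U `\` K : set (@mplane R)).
  by apply: measurableD; [exact: open_mplane|exact: measurable_compact].
have bnd x : `|\1_E (fl t x) - \1_E x| `^ q <= \1_(U `\` K) (fl t x) + \1_(U `\` K) x :> R.
  have [nx nfx] := near x.
  have i0 (A : set (R * R)) z : 0 <= \1_A z :> R by rewrite indicE.
  have [Ex|NEx] := pselect (E x); have [Efx|NEfx] := pselect (E (fl t x)).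
  - rewrite ![\1_E _]indicE !(mem_set Ex) !(mem_set Efx) subrr normr0 powR0 ?gt_eqF//; exact: addr_ge0.
  - rewrite [\1_E _]indicE (memNset NEfx) [\1_E _]indicE (mem_set Ex) sub0r normrN normr1 powR1.
    have [Kx|NKx] := pselect (K x).
      rewrite [X in X + _]indicE mem_set ?lerDl//; split; last by move=> /KE.
      exact: KU nx.
    by rewrite [X in _ + X]indicE mem_set ?lerDr//; split => //; exact: EU.
  - rewrite [\1_E _]indicE (mem_set Efx) [\1_E x]indicE (memNset NEx) subr0 normr1 powR1.
    have [Kx|NKx] := pselect (K (fl t x)).
      rewrite [X in _ + X]indicE mem_set ?lerDr//; split; last by move=> /KE.
      exact: KU nfx.
    by rewrite [X in X + _]indicE mem_set ?lerDl//; split => //; exact: EU.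
  - rewrite ![\1_E _]indicE !(memNset NEx) !(memNset NEfx) subrr normr0 powR0 ?gt_eqF//; exact: addr_ge0.
apply: Lp_norm_le_int => //; first exact: ltW.
have mi : measurable_fun setT (fun x : mplane => (\1_(U `\` K) x)%:E : \bar R).
  by apply/measurable_EFinP; exact: measurable_indic.
have mic : measurable_fun setT (fun x : mplane => (\1_(U `\` K) (fl t x))%:E : \bar R).
  apply: (@measurableT_comp _ _ _ mplane mplane _ (fun x => (\1_(U `\` K) x)%:E) setT (fl t)) => //.
  exact: continuous_mplane2 (eflow_continuous hD hX hPhi tt).
have p0 (x : mplane) : (0 <= (\1_(U `\` K) x)%:E :> \bar R)%E by rewrite lee_fin indicE.
apply: (@le_trans _ _ (\int[leb2]_x ((\1_(U `\` K) (fl t x))%:E + (\1_(U `\` K) x)%:E))%E).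
  apply: (@le_trans _ _ (\int[leb2]_(x in D) ((\1_(U `\` K) (fl t x))%:E + (\1_(U `\` K) x)%:E))%E).
    have mE1 : measurable_fun D (fun x : mplane => \1_E (fl t x) - \1_E x : R).
      by apply: mdiff => //; apply: measurable_funTS; exact: measurable_indic.
    have ms := measurable_Lp_int q mE1.
    have md : measurable_fun D (fun x : mplane => (\1_(U `\` K) (fl t x))%:E + (\1_(U `\` K) x)%:E : \bar R)%E.
      by apply: emeasurable_funD; exact: measurable_funTS.
    apply: (@ge0_le_integral _ mplane R leb2 D mD) => //.
    by move=> x _; rewrite -EFinD lee_fin.
  apply: (@ge0_subset_integral _ mplane R leb2 D setT) => //.
  - exact: emeasurable_funD.
  - by move=> x _; exact: adde_ge0.
rewrite ge0_integralD// [X in (_ + X <= _)%E]integral_indicT//.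
have H := eflow_push tt mi p0; rewrite [X in (_ <= _ * X)%E]integral_indicT// in H.
apply: (@le_trans _ _ (pushC%:E * leb2 (U `\` K) + leb2 (U `\` K))%E); first exact: leeD2r.
rewrite -[X in (_ + X <= _)%E]mul1e -ge0_muleDl ?lee_fin ?pushC_ge0// -EFinD.
apply: (@le_trans _ _ ((pushC + 1)%:E * (e `^ q / (pushC + 1))%:E)%E).
  by apply: lee_wpmul2l; [rewrite lee_fin ltW|exact: ltW].
by rewrite -EFinM mulrC divfK// gt_eqF.
Qed.

Import HBNNSimple.

Lemma transport_nnsfun (h : {nnsfun mplane >-> R}) : Lp_transport_cvg (h : R * R -> R).
Proof.
have fin : finite_set (range h) by exact: fimfunP.
refine (@transport_eq (fun x => \sum_(y <- finmap.enum_fset (fset_set (range h))) y * \1_(h @^-1` [set y] `&` D) x) h _ _).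
  move=> x Dx; rewrite [RHS](fimfunE h) fsbig_finite//=.
  by apply: eq_bigr => y _; rewrite !indicE in_setI (mem_set Dx) andbT.
have mhy (y : R) : measurable (h @^-1` [set y] `&` D : set mplane).
  by apply: measurableI => //; exact: measurable_funPTI.
have [] // := @transport_sum (finmap.enum_fset (fset_set (range h))) id (fun y : R => \1_(h @^-1` [set y] `&` D)).
by move=> y; apply: transport_indic => //; exact: subIsetr.
Qed.

Lemma transport_nneg f : (forall x, 0 <= f x) -> Lp D q f -> Lp_transport_cvg f.
Proof.
move=> f0 [mf Lf]; apply: transport_approx => // e e0.
have mEf : measurable_fun (D : set mplane) (EFin \o (f : mplane -> R)) by exact/measurable_EFinP.
pose h := nnsfun_approx mD mEf.
have hf x : D x -> h n x @[n --> \oo] --> f x.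
  move=> Dx; have : (EFin \o (h ^~ x)) n @[n --> \oo] --> (f x)%:E.
    by apply: cvg_nnsfun_approx => // y _; rewrite lee_fin.
  by move/fine_cvgP => [].
have h0 n x : 0 <= h n x by exact: fun_ge0.
have hle n x : D x -> h n x <= f x.
  move=> Dx; rewrite -(cvg_lim _ (hf x Dx))//; apply: limr_ge.
    by apply/cvg_ex; eexists; exact: hf.
  by exists n => // m /= nm; have /lefP := nd_nnsfun_approx mD mEf nm; apply.
have mh n : measurable_fun (D : set mplane) (h n : mplane -> R) by exact: measurable_funTS.
have If : leb2.-integrable (D : set mplane) (EFin \o (fun x : mplane => `|f x| `^ q)).
  apply/integrableP; split; first by exact: measurable_Lp_int.
  under eq_integral do rewrite /= ger0_norm ?powR_ge0//.
  move: Lf; rewrite Lp_normE ?gt_eqF//; set I := (\int[_]_(_ in _) _)%E => HI.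
  rewrite ltey; apply/eqP => Ioo; move: HI; by rewrite Ioo poweRyr ?invr_neq0 ?gt_eqF.
have lim := @cvg_Rintegral_dominated _ mplane R leb2 D (fun n x => `|f x - h n x| `^ q) (fun=> 0)
   (fun x => `|f x| `^ q) mD.
have {}lim : Rintegral leb2 D (fun x => `|f x - h n x| `^ q) @[n --> \oo] --> (0 : R).
  have -> : 0 = Rintegral leb2 D (fun=> 0 : R) by rewrite Rintegral_cst// mul0r.
  apply: lim => //.
  - by move=> n; apply/measurable_EFinP; apply: measurable_Lp_int; exact: measurable_funB.
  - move=> x Dx.
    have : (fun n => `|f x - h n x|) @ \oo --> `|f x - f x|.
      by apply: cvg_norm; apply: cvgB; [exact: cvg_cst|exact: hf].
    rewrite subrr normr0 => H.
    apply/cvgrPdist_le => eps eps0.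
    have epq : 0 < eps `^ q^-1 by exact: powR_gt0.
    have /cvgrPdist_le/(_ _ epq) := H; apply: filterS => n.
    rewrite !sub0r !normrN normr_id (ger0_norm (powR_ge0 _ _)) => Hn.
    rewrite -[leRHS]powRr1 ?(ltW eps0)// -(mulVf (lt0r_neq0 q0)) powRrM.
    by apply: ge0_ler_powR; rewrite ?nnegrE ?powR_ge0// ltW.
  - move=> n x Dx; rewrite ger0_norm ?powR_ge0//; apply: ge0_ler_powR; [exact: ltW|by rewrite nnegrE|by rewrite nnegrE|].
    by rewrite !ger0_norm ?subr_ge0 ?hle// gerBl.
have eq0 : 0 < e `^ q by exact: powR_gt0.
have /cvgrPdist_le/(_ _ eq0)[N _ HN] := lim.
exists (h N); split => //; first exact: transport_nnsfun.
apply: Lp_norm_le_int => //; first exact: ltW.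
have := HN N (leqnn N); rewrite sub0r normrN => Hle.
have mdif : measurable_fun (D : set mplane) (fun x : mplane => f x - h N x) by exact: measurable_funB.
have Id : leb2.-integrable (D : set mplane) (EFin \o (fun x : mplane => `|f x - h N x| `^ q)).
  apply: (@integrable_dominated _ mplane R leb2 D _ (fun x => `|f x| `^ q)) => //.
    by apply/measurable_EFinP; exact: measurable_Lp_int.
  move=> x Dx; rewrite !(ger0_norm (powR_ge0 _ _)); apply: ge0_ler_powR; [exact: ltW|by rewrite nnegrE|by rewrite nnegrE|].
  by rewrite !ger0_norm ?subr_ge0 ?hle// gerBl.
rewrite -[X in (X <= _)%E]fineK; last exact: (integrable_fin_num mD Id).
rewrite lee_fin; apply: le_trans Hle; exact: ler_norm.
Qed.

Lemma Lp_transport f : Lp D q f -> Lp_transport_cvg f.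
Proof.
move=> [mf Lf].
have P (g : R * R -> R) : (forall x, `|g x| = `|f x|) -> measurable_fun (D : set mplane) (g : mplane -> R) ->
   measurable_fun (D : set mplane) (fun x : mplane => Order.max (g x) 0) /\
   Lp_transport_cvg (fun x => Order.max (g x) 0).
  move=> gf mg; have mm : measurable_fun (D : set mplane) (fun x : mplane => Order.max (g x) 0).
    by apply: measurable_maxr.
  split => //; apply: transport_nneg; first by move=> x; rewrite le_max lexx orbT.
  split => //; apply: le_lt_trans Lf; apply: Lp_norm_le => //.
  apply/aeW => x _; rewrite -gf ger0_norm ?le_max ?lexx ?orbT//.
  by rewrite ge_max ler_norm normr_ge0.
have [m1 t1'] := P f (fun=> erefl) mf.
have [m2 t2] := P (fun x => - f x) (fun x => normrN (f x)) (measurable_funN mf).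
refine (transport_eq _ (@transport_lin (-1) _ _ m2 m1 t2 t1')) => x _.
by rewrite /Order.max; case: ltP => ?; case: ltP => ?; lra.
Qed.

End flow_transport.

(** * Transport of Sobolev functions *)

Section kernel_symmetry.
Context {R : realType}.

(** Makes the bump even, hence the kernel symmetric in its two points: averaging becomes
    self-adjoint under Fubini. *)
Lemma stepN (x : R) : step (- x) = 1 - step x.
Proof.
have D : 0 < theta (1 + x) + theta (1 - x).
  have [x0|x0] := leP 0 x.
    by have := theta_ge0 (1 - x); have : 0 < theta (1 + x) by [apply: theta_gt0; lra]; lra.
  by have := theta_ge0 (1 + x); have : 0 < theta (1 - x) by [apply: theta_gt0; lra]; lra.
rewrite /step opprK; move: D; set a := theta _; set b := theta _ => D.
by field; rewrite ?(addrC b a) gt_eqF.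
Qed.

Lemma bumpfN (x : R) : bumpf (- x) = bumpf x.
Proof.
have H := @is_derive_affine R step (-1) 0 x (bumpf (- x)).
rewrite mulN1r addr0 in H; have {}H := H (is_derive_step (- x)).
have H2 : is_derive x (1 : R) step (bumpf (- x)).
  rewrite (_ : step = cst 1 - (fun s => step (-1 * s + 0))); last first.
    by apply/funext => s; rewrite -[RHS]/(1 - _) mulN1r addr0 stepN opprB addrC subrK.
  by apply: is_derive_eq; rewrite sub0r mulN1r opprK.
by rewrite /bumpf [RHS](@derive_val _ _ _ _ _ _ _ H2).
Qed.

Lemma kern_sym (x : R * R) r y : kern x r y = kern y r x.
Proof.
have B (a b : R) : bump_at a r b = bump_at b r a.
  by rewrite /bump_at -bumpfN opprD opprK addrC.
by rewrite /kern (B x.1) (B x.2).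
Qed.

End kernel_symmetry.

Section kernel_fubini.
Context {R : realType} (g phi : @mplane R -> R) (r c : R).
Context (ig : leb2.-integrable setT (EFin \o g)) (mphi : measurable_fun setT phi)
  (phic : forall x, `|phi x| <= c) (r0 : 0 < r).

Let h (w : @mplane R * @mplane R) : R := g w.2 * kern w.1 r w.2 * phi w.1.

Let mg : measurable_fun setT g.
Proof. by apply/measurable_EFinP; exact: measurable_int ig. Qed.

Let c0 : 0 <= c := le_trans (normr_ge0 _) (phic 0).

Let mkern : measurable_fun setT (fun w : @mplane R * @mplane R => kern w.1 r w.2).
Proof.
have m1 : measurable_fun setT (fun w : @mplane R * @mplane R => w.1) by exact: measurable_fst.
have m2 : measurable_fun setT (fun w : @mplane R * @mplane R => w.2) by exact: measurable_snd.
have [m11 m12] := (measurable_fun_pairP _).1 m1.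
have [m21 m22] := (measurable_fun_pairP _).1 m2.
have cb : measurable_fun setT (bumpf : R -> R).
  by apply: continuous_measurable_fun; exact: (smooth1_bumpf 0%N).
have B (a b : @mplane R * @mplane R -> R) : measurable_fun setT a -> measurable_fun setT b ->
    measurable_fun setT (fun w => bump_at (a w) r (b w)).
  move=> ma mb; apply: measurable_funM; first exact: measurable_cst.
  apply: (measurableT_comp cb); apply: measurable_funD; first exact: measurable_funM.
  by apply: measurableT_comp => //; exact: measurable_funM.
by apply: measurable_funM; exact: B.
Qed.

Let mh : measurable_fun setT (EFin \o h).
Proof.
apply/measurable_EFinP; apply: measurable_funM.
  apply: measurable_funM mkern => mT Y mY.
  exact: (@measurable_snd _ _ mplane mplane measurableT _ (eq_ind _ _ (mg measurableT mY) _ (setTI _))).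
move=> mT Y mY.
exact: (@measurable_fst _ _ mplane mplane measurableT _ (eq_ind _ _ (mphi measurableT mY) _ (setTI _))).
Qed.

Let B := (bumpM / r) ^+ 2 : R.

Let B0 : 0 <= B. Proof. exact: sqr_ge0. Qed.

Let ih : ((@leb2s R) \x (@leb2s R))%E.-integrable setT (EFin \o h).
Proof.
apply/(integrable21ltyP leb2s leb2s mh).
apply: (@le_lt_trans _ _ (\int[leb2]_y ((B * c * (2 * r) ^+ 2)%:E * `|(g y)%:E|))%E); last first.
  rewrite ge0_integralZl//.
  - have /integrableP[_ Ig] := ig; apply: lte_mul_pinfty => //.
    by rewrite lee_fin; apply: mulr_ge0; [exact: mulr_ge0|exact: sqr_ge0].
  - by apply: measurableT_comp => //; exact/measurable_EFinP.
  - by rewrite lee_fin; apply: mulr_ge0; [exact: mulr_ge0|exact: sqr_ge0].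
have p0 y x : 0 <= B * c * `|g y| * \1_(cbox y r) x :> R.
  by apply: mulr_ge0; [exact: mulr_ge0 (mulr_ge0 _ _) _|rewrite indicE].
apply: ge0_le_integral => //.
- by move=> y _; exact: integral_ge0.
- have mnh : measurable_fun setT (fun w => `|(EFin \o h) w|)%E by exact: measurableT_comp.
  exact: (@measurable_fun_fubini_tonelli_G _ _ mplane mplane R leb2s _ mnh (fun w => abse_ge0 _)).
- apply: measurable_funeM; apply: measurableT_comp => //; exact/measurable_EFinP.
move=> y _.
have mc := @measurable_cbox R y r.
have -> : ((B * c * (2 * r) ^+ 2)%:E * `|(g y)%:E| = \int[leb2]_x (B * c * `|g y| * \1_(cbox y r) x)%:E)%E.
  under [RHS]eq_integral do rewrite EFinM.
  rewrite ge0_integralZl//.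
  - by rewrite integral_indicT// leb2_cbox ?(ltW r0)// -!EFinM; congr (_%:E); ring.
  - by apply/measurable_EFinP; exact: measurable_indic.
  - by rewrite lee_fin; apply: mulr_ge0 => //; exact: mulr_ge0.
apply: ge0_le_integral => //.
- have mnh : measurable_fun setT (fun w => `|(EFin \o h) w|)%E by exact: measurableT_comp.
  exact: (measurableT_comp mnh (@pair2_measurable _ _ mplane mplane y)).
- by apply/measurable_EFinP; apply: measurable_funM => //; exact: measurable_indic.
move=> x _; rewrite /h/= lee_fin.
have [cx|Ncx] := pselect (cbox y r x); last first.
  by rewrite kern_sym kern0// mulr0 mul0r normr0.
rewrite indicE mem_set// mulr1 (normrM (g y * kern x r y)) (normrM (g y)).
have := kern_le x y r0; rewrite -/B => kB.
have -> : B * c * `|g y| = `|g y| * B * c by ring.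
by apply: ler_pM => //; exact: ler_wpM2l.
Qed.

Lemma integrable_kern x : leb2.-integrable setT (EFin \o (fun y : mplane => g y * kern x r y)).
Proof.
apply: (@integrable_dominated _ mplane R leb2 setT _ (fun y => B * g y)) => //.
- apply: measurable_funM => //; apply: continuous_mplane; apply: smooth_continuous; exact: smooth_kern.
- by move=> y _; rewrite (normrM B) (normrM (g y)) mulrC ler_wpM2r// (ger0_norm B0) kern_le.
- by apply: (integrableZl measurableT B ig).
Qed.

Let integrable_kern_phi y : leb2.-integrable setT (EFin \o (fun x : mplane => kern x r y * phi x)).
Proof.
apply: (@integrable_dominated _ mplane R leb2 setT _ (fun x => cst c x * kern y r x)) => //.
- apply: measurable_funM => //.
  rewrite (_ : (fun x => kern x r y) = kern y r); last by apply/funext => x; exact: kern_sym.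
  apply: continuous_mplane; apply: smooth_continuous; exact: smooth_kern.
- by move=> x _; rewrite (normrM (cst c x)) (normrM (kern x r y)) kern_sym /cst mulrC (ger0_norm c0) ler_wpM2r.
- apply: loc_integrable_test; first exact: openT.
    by apply: loc_integrable_continuous => //; [exact: openT|exact: cst_continuous].
  by apply: test_kern.
Qed.

(** Moves the average from the merely integrable [g] onto [phi], which will be a test function,
    where convergence of averages is elementary. *)
Lemma kern_fubini :
  Rintegral leb2 setT (fun x => Rintegral leb2 setT (fun y => g y * kern x r y) * phi x) =
  Rintegral leb2 setT (fun y => g y * Rintegral leb2 setT (fun x => kern x r y * phi x)).
Proof.
have := @Fubini _ _ mplane mplane R leb2s leb2s _ ih.
rewrite /Rintegral => HF; congr (fine _).
transitivity (\int[leb2]_x \int[leb2]_y (h (x, y))%:E)%E.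
  apply: (@eq_integral _ mplane R leb2) => x _.
  rewrite /h/=; under [RHS]eq_integral do rewrite EFinM muleC.
  rewrite integralZl//; last exact: integrable_kern.
  rewrite EFinM fineK; first by rewrite muleC.
  exact: integrable_fin_num (integrable_kern x).
transitivity (\int[leb2]_y \int[leb2]_x (h (x, y))%:E)%E; first exact: HF.
apply: (@eq_integral _ mplane R leb2) => y _.
rewrite /h/=; under eq_integral do rewrite -mulrA EFinM.
rewrite integralZl//; last exact: integrable_kern_phi.
by rewrite EFinM fineK//; exact: integrable_fin_num (integrable_kern_phi y).
Qed.

Lemma measurable_kern_phi : measurable_fun setT
  (fun x : mplane => Rintegral leb2 setT (fun y => g y * kern x r y) * phi x).
Proof.
have -> : (fun x : mplane => Rintegral leb2 setT (fun y => g y * kern x r y) * phi x) =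
    (fun x => fine (\int[leb2]_y (h (x, y))%:E)%E).
  apply/funext => x; rewrite /h/=; under [in RHS]eq_integral do rewrite EFinM muleC.
  rewrite integralZl//; last exact: integrable_kern.
  by rewrite fineM//= 1?mulrC//; exact: integrable_fin_num (integrable_kern x).
apply: measurableT_comp; first exact: measurable_realfun.fine_measurable.
exact: (@measurable_fubini_F _ _ mplane mplane R leb2s leb2s _ ih).
Qed.

End kernel_fubini.

Lemma Lp_integrable (R : realType) (O : set (R * R)) (q : R) (f : R * R -> R) : 1 <= q ->
  measurable (O : set mplane) -> (leb2 O < +oo)%E -> Lp O q f ->
  leb2.-integrable (O : set mplane) (EFin \o (f : mplane -> R)) /\
  leb2.-integrable (O : set mplane) (EFin \o (fun x : mplane => `|f x| `^ q)).
Proof.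
move=> q1 mO fO [mf Lf]; have q0 : 0 < q by exact: lt_le_trans ltr01 q1.
have If : leb2.-integrable (O : set mplane) (EFin \o (fun x : mplane => `|f x| `^ q)).
  apply/integrableP; split; first by exact: measurable_Lp_int.
  under eq_integral do rewrite /= ger0_norm ?powR_ge0//.
  move: Lf; rewrite Lp_normE ?gt_eqF//; set I := (\int[_]_(_ in _) _)%E => HI.
  by rewrite ltey; apply/eqP => Ioo; move: HI; rewrite Ioo poweRyr ?invr_neq0 ?gt_eqF.
split => //.
have I1 : leb2.-integrable (O : set mplane) (EFin \o (cst 1 : mplane -> R)).
  apply/integrableP; split; first exact/measurable_EFinP.
  by under eq_integral do rewrite /= normr1; rewrite integral_cst// mul1e.
have I2 : leb2.-integrable (O : set mplane) (EFin \o (fun x : mplane => 1 + `|f x| `^ q)).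
  exact: (integrableD mO I1 If).
apply: (@integrable_dominated _ mplane R leb2 O _ (fun x => 1 + `|f x| `^ q)) => // x Ox.
rewrite [leRHS]ger0_norm ?addr_ge0 ?powR_ge0//.
have [f1|f1] := leP `|f x| 1; first by apply: le_trans f1 _; rewrite lerDl powR_ge0.
apply: (@le_trans _ _ (`|f x| `^ q)); last by rewrite lerDr.
by rewrite -[leLHS]powRr1// ler_powR// ltW.
Qed.

(** * Pointwise representative inside D as a limit of dyadic averages *)

Section representative.
Context {R : realType} (D : set (R * R)) (f : R * R -> R) (G : R * R -> 'cV[R]_2) (q E : R).
Context (oD : open D) (bD : bounded_set D) (q2 : 2 < q) (fG : is_wgrad D f G) (Lf : Lp D q f)
  (GE : forall i, (Lp_norm D q (fun x => G x i 0)%R <= E%:E)%E).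
Implicit Types (x y : R * R) (n N : nat).

Let mD : measurable (D : set mplane) := open_mplane oD.

Let q1 : 1 < q. Proof. by apply: lt_trans q2; rewrite ltr1n. Qed.

(** The radii rho h (1 - rho)^n of [avg_chain] for rho = 1/2 and h = 1; starting at h = (1/2)^N only
    shifts the index by N. *)
Definition dyrad n : R := 1 / 2 * (1 / 2) ^+ n.

Lemma dyrad_gt0 n : 0 < dyrad n. Proof. by rewrite mulr_gt0// exprn_gt0. Qed.

Definition dyavg n x : R := avg D f x (dyrad n).

(* The continuous representative of f inside D. *)
Definition lebrep x : R := limn (fun n => dyavg n x).

Definition repC : R := 32 * bumpM / (1 - (1 - 1 / 2) `^ (1 - 2 / q)).

Let a0 : 0 < 1 - 2 / q.
Proof. by rewrite subr_gt0 ltr_pdivrMr ?mul1r//; exact: lt_trans ltr01 q1. Qed.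

Lemma repC_gt0 : 0 < repC.
Proof.
apply: divr_gt0; first by apply: mulr_gt0 => //; exact: bumpM_gt0.
rewrite subr_gt0; have := @gt0_ltr_powR R _ a0 (1 - 1 / 2) 1.
by rewrite powR1; apply; rewrite ?nnegrE//; lra.
Qed.

Lemma dyavg_rep (S : set (R * R)) N x e : measurable (S : set mplane) -> S `<=` D ->
  cbox x ((1 / 2) ^+ N) `<=` S ->
  (forall i, (Lp_norm S q (fun x => G x i 0)%R <= e%:E)%E) ->
  dyavg n x @[n --> \oo] --> lebrep x /\
  `|dyavg N x - lebrep x| <= repC * ((1 / 2) ^+ N) `^ (1 - 2 / q) * e.
Proof.
move=> mS SD sub Ge; pose h : R := (1 / 2) ^+ N.
have h0 : 0 < h by rewrite exprn_gt0.
have sc s : scale_pt x 0 s = x by rewrite /scale_pt/= mulr0 !addr0 -surjective_pairing.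
have n01 : `|(0 : R * R).1| <= 1 /\ `|(0 : R * R).2| <= 1 by rewrite /= normr0.
have rho0 : 0 < 1 / 2 :> R by [].
have subs s : 0 < s -> s <= h -> cbox (scale_pt x 0 s) (2 * (1 / 2) * s) `<=` S.
  move=> s0 sh; rewrite sc; apply: subset_trans sub => y [y1 y2].
  by split; [apply: le_trans y1 _|apply: le_trans y2 _]; move: sh; rewrite /h; lra.
have [L Lc LB] := avg_chain oD q2 fG mS SD n01.1 n01.2 rho0 (lexx _) h0 subs Ge.
have E1 n : avg D f (scale_pt x 0 (h * (1 - 1 / 2) ^+ n)) (1 / 2 * (h * (1 - 1 / 2) ^+ n)) = dyavg (n + N) x.
  rewrite sc /dyavg /dyrad; congr (avg _ _ _ (_ * _)).
  by rewrite (_ : 1 - 1 / 2 = 1 / 2) ?exprD 1?mulrC//; field.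
have {}Lc : dyavg n x @[n --> \oo] --> L.
  rewrite -(cvg_shiftn N).
  by under eq_fun do rewrite -E1.
have -> : lebrep x = L by exact: cvg_lim.
split => //; move: LB; rewrite sc => /le_trans; apply.
rewrite /repC -/h (_ : 2 * (1 / 2) * h = h); last by field.
by rewrite le_eqVlt; apply/orP; left; apply/eqP; ring.
Qed.

Let E0 : 0 <= E.
Proof. by rewrite -lee_fin; apply: le_trans (GE 0); exact: Lp_norm_ge0. Qed.

(** The margin of K in D fixes one scale N from which all boxes stay in D. The average at scale N is
    bounded by the L_q norm of f, the later ones by their distance to the limit. The result serves
    as dominating function. *)
Lemma dyavg_bounded (K : set (R * R)) : compact K -> K `<=` D ->
  exists N M, forall x, K x -> dyavg n x @[n --> \oo] --> lebrep x /\ `|lebrep x| <= M /\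
    forall n, (N <= n)%N -> `|dyavg n x| <= M.
Proof.
move=> cK KD; have [r r0 Kr] := compact_open_margin cK oD KD.
have [N Nr] : exists N, (1 / 2 : R) ^+ N < r.
  have /cvgrPdist_lt/(_ _ r0)[N _ HN] := @cvg_expr R (1 / 2) (ltac:(rewrite ger0_norm; lra)).
  by exists N; have := HN N (leqnn N); rewrite sub0r normrN ger0_norm.
have [F F0 FE] : exists2 F, 0 <= F & (Lp_norm D q f <= F%:E)%E.
  have := Lf.2; have := Lp_norm_ge0 D q f; case: (Lp_norm D q f) => //= r1.
  by rewrite lee_fin => r10 _; exists r1.
pose M0 := (bumpM / dyrad N) ^+ 2 * (2 * dyrad N) `^ (2 - 2 / q) * F.
exists N, (M0 + 2 * (repC * E)) => x Kx.
have half n : (N <= n)%N -> (1 / 2 : R) ^+ n <= (1 / 2) ^+ N.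
  by move=> Nn; rewrite ler_wiXn2l//; lra.
have sub n : (N <= n)%N -> cbox x ((1 / 2) ^+ n) `<=` D.
  move=> Nn y [y1 y2]; apply: (Kr x Kx); split.
    by apply: le_trans y1 _; have := half n Nn; lra.
  by apply: le_trans y2 _; have := half n Nn; lra.
have near n : (N <= n)%N -> `|dyavg n x - lebrep x| <= repC * E.
  move=> Nn; have [_ H] := dyavg_rep mD (@subset_refl _ D) (sub n Nn) GE.
  apply: le_trans H _; rewrite ler_wpM2r// ler_piMr ?(ltW repC_gt0)//.
  rewrite -[leRHS](congr1 (fun F => F (1 - 2 / q)) (@powR1 R)).
  apply: ge0_ler_powR; rewrite ?nnegrE ?(ltW a0) ?exprn_ge0//.
  by rewrite exprn_ile1//; lra.
have [cv _] := dyavg_rep mD (@subset_refl _ D) (sub N (leqnn N)) GE.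
have bN : `|dyavg N x| <= M0.
  rewrite /dyavg /M0; apply: (avg_bound oD q1) => //; first by have [] := fG.
  - exact: dyrad_gt0.
  - move=> y [y1 y2]; apply: (sub N (leqnn N)).
    have radN : dyrad N <= (1 / 2) ^+ N.
      by rewrite /dyrad; have : 0 <= (1 / 2 : R) ^+ N by [rewrite exprn_ge0]; lra.
    by split; [apply: le_trans y1 _|apply: le_trans y2 _].
  - apply: le_trans FE; apply: Lp_norm_sub => //.
    + exact: lt_trans ltr01 q1.
    + move=> y [y1 y2]; apply: (sub N (leqnn N)).
      have radN : dyrad N <= (1 / 2) ^+ N.
        by rewrite /dyrad; have : 0 <= (1 / 2 : R) ^+ N by [rewrite exprn_ge0]; lra.
      by split; [apply: le_trans y1 _|apply: le_trans y2 _].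
    + exact: measurable_cbox.
    + exact: Lf.1.
clearbody M0.
have E2 : 0 <= repC * E by rewrite mulr_ge0// ltW// repC_gt0.
have bL : `|lebrep x| <= M0 + repC * E.
  have := ler_distD (dyavg N x) (lebrep x) 0; rewrite !subr0 distrC.
  have := near N (leqnn N); lra.
split => //; split; first lra.
move=> n Nn; have := ler_distD (lebrep x) (dyavg n x) 0; rewrite !subr0 => /le_trans; apply.
by rewrite mulr_natl mulr2n addrCA; apply: lerD => //; exact: near.
Qed.

Let g : @mplane R -> R := f \_ D.

Let ig : leb2.-integrable setT (EFin \o g).
Proof.
have [If _] := Lp_integrable (ltW q1) mD (bounded_leb2 bD mD) Lf.
by rewrite /g -restrict_EFin; apply/(integrable_restrict leb2 mD measurableT); rewrite setTI.
Qed.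

Let dyavgE n x : dyavg n x = Rintegral leb2 setT (fun y => g y * kern x (dyrad n) y).
Proof.
rewrite /dyavg /avg Rintegral_mkcond; apply: eq_Rintegral => y _.
by rewrite /g !patchE; case: ifP => // _; rewrite mul0r.
Qed.

Let measurable_dyavg n : measurable_fun (setT : set mplane) (dyavg n : mplane -> R).
Proof.
have -> : dyavg n = (fun x => Rintegral leb2 setT (fun y => g y * kern x (dyrad n) y) * 1).
  by apply/funext => x; rewrite mulr1 dyavgE.
apply: (@measurable_kern_phi R g (fun=> 1) (dyrad n) 1) => //; last exact: dyrad_gt0.
by move=> x; rewrite normr1.
Qed.

Let pt_cvg x : D x -> dyavg n x @[n --> \oo] --> lebrep x.
Proof.
move=> Dx; have [|y -> |N [M H]] := @dyavg_bounded [set x]; [exact: compact_set1|by []|].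
by have [] := H x erefl.
Qed.

Lemma measurable_lebrep : measurable_fun (D : set mplane) (lebrep : mplane -> R).
Proof.
apply: (@measurable_fun_cvg _ mplane R D (fun n x => dyavg n x)) => //.
by move=> n; apply: measurable_funTS; exact: measurable_dyavg.
Qed.

Lemma loc_integrable_lebrep : loc_integrable D lebrep.
Proof.
split; first exact: measurable_lebrep.
move=> A AD cA; have mA := measurable_compact cA.
have [N [M H]] := dyavg_bounded cA AD.
have fA : (leb2 A < +oo)%E by apply: bounded_leb2 => //; exact: compact_bounded.
have M0 : 0 <= Order.max M 0 by rewrite le_max lexx orbT.
apply: (@le_lt_trans _ _ (\int[leb2]_(x in A) (Order.max M 0)%:E)%E).
  apply: (@ge0_le_integral _ mplane R leb2 A mA) => //.
  - apply/measurable_EFinP; apply: measurableT_comp => //.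
    exact: measurable_funS mD AD measurable_lebrep.
  - by move=> x /H[_ [? _]]; rewrite lee_fin le_max; apply/orP; left.
by rewrite integral_cst//; apply: lte_mul_pinfty.
Qed.

Let psi_cvg phi y : test_function D phi ->
  Rintegral leb2 setT (fun x => kern x (dyrad n) y * phi x) @[n --> \oo] --> phi y.
Proof.
move=> [sphi _ _]; have cphi := smooth_continuous sphi.
apply/cvgrPdist_le => e e0.
have [d d0 Hd] := @avg_continuous R setT phi y openT cphi e e0.
have /cvgrPdist_lt/(_ _ d0) := @cvg_expr R (1 / 2) (ltac:(rewrite ger0_norm; lra)).
apply: filterS => n; rewrite sub0r normrN ger0_norm ?exprn_ge0// => nd.
rewrite distrC (_ : Rintegral _ _ _ = avg setT phi y (dyrad n)); last first.
  by apply: eq_Rintegral => x _; rewrite kern_sym mulrC.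
apply: Hd => //; first exact: dyrad_gt0.
have : dyrad n < d by rewrite /dyrad; have : 0 <= (1 / 2 : R) ^+ n by [rewrite exprn_ge0]; lra.
by move=> rd x [x1 x2]; split; [apply: le_lt_trans rd|apply: le_lt_trans rd].
Qed.

Let psi_bound phi : test_function D phi -> exists2 M, 0 <= M & forall n y,
  `|Rintegral leb2 setT (fun x => kern x (dyrad n) y * phi x)| <= M.
Proof.
move=> tphi; have [c c0 phic] := test_function_bounded tphi.
have cphi := smooth_continuous (let: And3 s _ _ := tphi in s).
exists (4 * bumpM ^+ 2 * c); first by rewrite mulr_ge0 ?(ltW c0)// mulr_ge0// sqr_ge0.
move=> n y; have r0 := dyrad_gt0 n.
rewrite (_ : Rintegral _ _ _ = avg setT phi y (dyrad n)); last first.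
  by apply: eq_Rintegral => x _; rewrite kern_sym mulrC.
have lphi := loc_integrable_continuous openT cphi.
have mQ := @measurable_cbox R y (dyrad n).
(* With exponent 2 both Hölder factors are powers of the side, and the radius cancels: the bound
   does not depend on n. *)
have := avg_bound (E := c * (2 * dyrad n)) openT (ltac:(by rewrite ltr1n) : 1 < 2 :> R) lphi r0 (@subsetT _ (cbox y (dyrad n))).
have -> : (bumpM / dyrad n) ^+ 2 * (2 * dyrad n) `^ (2 - 2 / 2) * (c * (2 * dyrad n)) = 4 * bumpM ^+ 2 * c.
  rewrite (_ : 2 - 2 / 2 = 1 :> R); last by field.
  by rewrite powRr1 ?mulr_ge0 ?ltW//; field; rewrite gt_eqF.
apply; have := @Lp_norm_bounded R (cbox y (dyrad n)) 2 phi c (ler1n R 2) mQ.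
have -> : (c%:E * leb2 (cbox y (dyrad n)) `^ 2^-1 = (c * (2 * dyrad n))%:E)%E.
  rewrite leb2_cbox ?(ltW r0)// poweR_EFin -EFinM powR12_sqrt ?sqr_ge0// sqrtr_sqr ger0_norm//.
  by rewrite mulr_ge0// ltW.
apply => //; last exact: ltW.
by apply: measurable_funTS; exact: continuous_mplane.
Qed.

(** Against a test function the dyadic averages of f have two limits: the pairing with f, by moving
    the average onto the test function, and the pairing with [lebrep], by dominated convergence.
    Equality of the pairings suffices. *)
Lemma lebrep_ae : {ae leb2, forall x, D x -> f x = lebrep x}.
Proof.
have [lf _ _] := fG.
have ld : loc_integrable D (fun x => -1 * lebrep x + f x).
  by apply: loc_integrable_lin => //; exact: loc_integrable_lebrep.
have : {ae leb2, forall x, D x -> -1 * lebrep x + f x = 0}.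
  apply: ae_eq0_test => // phi tphi; have [sphi cK KD] := tphi.
  have I1 := loc_integrable_test oD lf tphi.
  have I2 := loc_integrable_test oD loc_integrable_lebrep tphi.
  have mphi : measurable_fun setT (phi : mplane -> R).
    by apply: continuous_mplane; exact: smooth_continuous.
  have [c c0 phic] := test_function_bounded tphi.
  have lim1 : Rintegral leb2 D (fun x => dyavg n x * phi x) @[n --> \oo] -->
      Rintegral leb2 D (fun x => f x * phi x).
    have En n : Rintegral leb2 D (fun x => dyavg n x * phi x) = Rintegral leb2 setT
        (fun y => g y * Rintegral leb2 setT (fun x => kern x (dyrad n) y * phi x)).
      rewrite -(kern_fubini ig mphi phic (dyrad_gt0 n)) [LHS]Rintegral_mkcond.
      apply: eq_Rintegral => x _; rewrite patchE -dyavgE; case: ifPn => //.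
      by rewrite notin_setE => NDx; rewrite (tsupp0 (f := phi)) ?mulr0// => /KD.
    have -> : Rintegral leb2 D (fun x => f x * phi x) = Rintegral leb2 setT (fun y => g y * phi y).
      rewrite [LHS]Rintegral_mkcond; apply: eq_Rintegral => x _.
      by rewrite /g !patchE; case: ifP => // _; rewrite mul0r.
    under eq_fun do rewrite En.
    have [M M0 HM] := psi_bound tphi.
    have mg : measurable_fun setT g by apply/measurable_EFinP; exact: measurable_int ig.
    have mpsi n : measurable_fun setT (fun y : mplane => Rintegral leb2 setT (fun x => kern x (dyrad n) y * phi x)).
      have iphi : leb2.-integrable setT (EFin \o (phi : mplane -> R)).
        rewrite (_ : EFin \o _ = EFin \o (fun x => cst 1 x * phi x)); last first.
          by apply/funext => x /=; rewrite mul1r.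
        apply: loc_integrable_test; [exact: openT| |split => //].
        by apply: loc_integrable_continuous => //; [exact: openT|exact: cst_continuous].
      have := @measurable_kern_phi R phi (fun=> 1) (dyrad n) 1 iphi.
      move=> /(_ (measurable_cst _) (fun=> ltac:(by rewrite normr1)) (dyrad_gt0 n)).
      rewrite (_ : (fun x : mplane => _) = (fun y : mplane => Rintegral leb2 setT (fun x => kern x (dyrad n) y * phi x)))//.
      by apply/funext => y; rewrite mulr1; apply: eq_Rintegral => x _; rewrite kern_sym mulrC.
    apply: (@cvg_Rintegral_dominated _ mplane R leb2 setT _ _ (fun y => M * `|g y|)) => //.
    - by move=> n; exact: measurable_funM.
    - exact: measurable_funM.
    - by move=> y _; apply: cvgMr; exact: psi_cvg.
    - apply: (@integrableZl _ mplane R leb2 setT measurableT M (fun y => `|g y|%:E)).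
      exact: integrable_abse ig.
    - by move=> n y _; rewrite normrM mulrC ler_wpM2r.
  have [N [M H]] := dyavg_bounded cK KD.
  (* The shift by N is needed because the averages are uniformly bounded on the support only from
     that scale on. *)
  have lim2 : Rintegral leb2 D (fun x => dyavg (n + N) x * phi x) @[n --> \oo] -->
      Rintegral leb2 D (fun x => lebrep x * phi x).
    have lphi : loc_integrable D (fun=> Order.max M 0).
      by apply: loc_integrable_continuous => //; exact: cst_continuous.
    have I3 := loc_integrable_test oD lphi tphi.
    apply: (@cvg_Rintegral_dominated _ mplane R leb2 D _ _ (fun y => `|Order.max M 0 * phi y|)) => //.
    - move=> n; apply: measurable_funM; apply: measurable_funTS => //; exact: measurable_dyavg.
    - by apply: measurable_funM; [exact: measurable_lebrep|exact: measurable_funTS].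
    - by move=> x Dx; apply: cvgMl; rewrite (cvg_shiftn N (dyavg^~ x)); exact: pt_cvg.
    - exact: integrable_abse I3.
    - move=> n x Dx; rewrite !normrM; have [Kx|NKx] := pselect (tsupp phi x); last first.
        by rewrite (tsupp0 NKx) normr0 !mulr0.
      have [_ [_ Hn]] := H x Kx.
      rewrite ler_wpM2r// (le_trans (Hn _ (leq_addl _ _)))// ger0_norm ?le_max ?lexx ?orbT//.
  rewrite -(cvg_shiftn N) in lim1.
  have LE := cvg_unique (@Rhausdorff R) lim2 lim1.
  rewrite (_ : Rintegral _ _ _ = Rintegral leb2 D (fun x => -1 * (lebrep x * phi x) + f x * phi x)); last first.
    by apply: eq_Rintegral => x _; ring.
  have IZ : leb2.-integrable D (EFin \o (fun x => (-1) * (lebrep x * phi x))).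
    exact: (integrableZl mD (-1) I2).
  by rewrite (RintegralD mD IZ I1) (RintegralZl _ mD I2) LE mulN1r addNr.
by apply: aeS => x H Dx; have := H Dx; lra.
Qed.

End representative.

(** * Linear rate of transport for Sobolev functions *)

Section transport_rate.
Context {R : realType} (D : set (R * R)) (f : R * R -> R) (q : R).
Context (oD : open D) (bD : bounded_set D) (q2 : 2 < q) (W1f : W1 D q f).
Implicit Types (x y : R * R) (n N : nat).

Let mD : measurable (D : set mplane) := open_mplane oD.
Let G := wgrad D f.
Let fG : is_wgrad D f G := wdiffP W1f.1.
Let q1 : 1 < q. Proof. by apply: lt_trans q2; rewrite ltr1n. Qed.
Let q0 : 0 < q. Proof. exact: lt_trans ltr01 q1. Qed.

Definition rateC : R := 2 * repC q + 32 * bumpM.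

Lemma rateC_gt0 : 0 < rateC.
Proof.
by apply: addr_gt0; apply: mulr_gt0 => //; [exact: repC_gt0|exact: bumpM_gt0].
Qed.

(** From y to its average at a scale comparable to d, across to the average at x, and down to x. Two
    chains and one comparison make up [rateC], and all boxes fit into the square of radius 4 d. *)
Lemma lebrep_diff x y d e : 0 < d -> d <= 1 -> cbox x d y -> cbox x (4 * d) `<=` D ->
  (forall i, (Lp_norm (cbox x (4 * d)) q (fun x => G x i 0)%R <= e%:E)%E) ->
  `|lebrep D f y - lebrep D f x| <= rateC * (4 * d) `^ (1 - 2 / q) * e.
Proof.
move=> d0 d1 [y1 y2] sD Ge.
have e0 : 0 <= e by rewrite -lee_fin; apply: le_trans (Ge 0); exact: Lp_norm_ge0.
have a0 : 0 <= 1 - 2 / q by rewrite subr_ge0 ler_pdivrMr ?mul1r//; exact: ltW.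
(* N is minimal with (1/2)^(N+1) < d, so N - 1 fails this bound; for N = 0 the lower estimate is the
   hypothesis [d <= 1]. *)
have [N [dN Nd]] : exists N, d <= (1 / 2) ^+ N /\ (1 / 2) ^+ N <= 2 * d :> R.
  have ex : exists n, (1 / 2) ^+ n.+1 < d.
    have /cvgrPdist_lt/(_ _ d0)[n _ Hn] := @cvg_expr R (1 / 2) (ltac:(rewrite ger0_norm; lra)).
    by exists n; have := Hn n.+1 (leqnSn n); rewrite sub0r normrN ger0_norm ?exprn_ge0.
  case: (ex_minnP ex) => N HN min; exists N; split.
    case: N HN min => [|N] HN min; first by rewrite expr0.
    by rewrite leNgt; apply/negP => /min; rewrite ltnn.
  by move: HN; rewrite exprS; lra.
pose h : R := (1 / 2) ^+ N; rewrite -/h in dN Nd.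
have h0 : 0 < h by rewrite /h exprn_gt0.
have mS := @measurable_cbox R x (4 * d).
have sx : cbox x h `<=` cbox x (4 * d).
  by move=> z [z1 z2]; split; [apply: le_trans z1 _|apply: le_trans z2 _]; lra.
have sy : cbox y h `<=` cbox x (4 * d).
  move=> z [z1 z2]; split.
    by have := ler_distD y.1 z.1 x.1; lra.
  by have := ler_distD y.2 z.2 x.2; lra.
have hr : dyrad N = h / 2 :> R by rewrite /dyrad -/h mul1r mulrC.
have hN : (1 / 2) ^+ N = h by [].
clearbody h.
have sh : cbox x (2 * h) `<=` cbox x (4 * d).
  by move=> z [z1 z2]; split; lra.
have rx : cbox x (dyrad N) `<=` cbox x (2 * h).
  by rewrite hr => z [z1 z2]; split; lra.
have ry : cbox y (dyrad N) `<=` cbox x (2 * h).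
  rewrite hr => z [z1 z2]; split.
    by have := ler_distD y.1 z.1 x.1; lra.
  by have := ler_distD y.2 z.2 x.2; lra.
have lr : 2 * h / 4 <= dyrad N by rewrite hr; lra.
have h20 : 0 < 2 * h by lra.
have mG i : measurable_fun (cbox x (4 * d) : set mplane) (fun x : mplane => G x i 0).
  by apply: measurable_funS mD sD _; exact: wgrad_measurable W1f.1.
have Ge2 i : (Lp_norm (cbox x (2 * h)) q (fun x => G x i 0)%R <= e%:E)%E.
  by apply: le_trans (Ge i); apply: Lp_norm_sub => //; exact: measurable_cbox.
have pw (s : R) : 0 <= s -> s <= 4 * d -> s `^ (1 - 2 / q) * e <= (4 * d) `^ (1 - 2 / q) * e.
  move=> s0 sd; apply: ler_wpM2r => //; apply: ge0_ler_powR; rewrite ?nnegrE//.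
  exact: le_trans sd.
have p1 : repC q * h `^ (1 - 2 / q) * e <= repC q * ((4 * d) `^ (1 - 2 / q) * e).
  rewrite -mulrA; apply: ler_wpM2l; first exact/ltW/repC_gt0.
  by apply: pw; lra.
have p2 : 32 * bumpM * (2 * h) `^ (1 - 2 / q) * e <= 32 * bumpM * ((4 * d) `^ (1 - 2 / q) * e).
  rewrite -mulrA; apply: ler_wpM2l; first by apply: mulr_ge0 => //; exact/ltW/bumpM_gt0.
  by apply: pw; lra.
have Hxy := avg_compare oD q1 fG erefl (subset_trans sh sD) h20 ry rx lr lr Ge2.
rewrite -hN in sx sy.
have [_ Hx] := dyavg_rep oD q2 fG mS sD sx Ge.
have [_ Hy] := dyavg_rep oD q2 fG mS sD sy Ge.
rewrite hN in Hx Hy.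
rewrite /rateC -mulrA mulrDl -[2 * _ * _]mulrA mulr_natl mulr2n.
have t1 := ler_distD (dyavg D f N y) (lebrep D f y) (lebrep D f x).
have t2 := ler_distD (dyavg D f N x) (dyavg D f N y) (lebrep D f x).
apply: le_trans t1 _; rewrite -addrA; apply: lerD.
  by rewrite distrC; exact: (le_trans Hy p1).
apply: le_trans t2 _; rewrite addrC; apply: lerD.
  exact: (le_trans Hxy p2).
exact: (le_trans Hx p1).
Qed.

Let w : @mplane R -> \bar R := (fun y => (norm2 (Lop D f y) `^ q)%:E) \_ D.

Let w0 y : (0 <= w y)%E.
Proof. by rewrite /w patchE; case: ifP => // _; rewrite lee_fin powR_ge0. Qed.

Let mw : measurable_fun setT w.
Proof.
apply: (measurable_restrictT _ mD).1; apply/measurable_EFinP.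
apply: (@measurableT_comp _ _ _ _ _ _ (fun x : R => x `^ q)); first exact: measurable_powR.
exact: measurable_norm2Lop W1f.1.
Qed.

Let E := fine (W1_norm D q f).

Let E0 : 0 <= E. Proof. exact: fine_ge0 (W1_norm_ge0 _ _ _). Qed.

Let WE : W1_norm D q f = E%:E.
Proof.
rewrite fineK//; have := W1f.2; have := W1_norm_ge0 D q f.
by case: (W1_norm D q f).
Qed.

Let int_w : (\int[leb2]_y w y = (E `^ q)%:E)%E.
Proof.
have := WE; rewrite /W1_norm Lp_normE ?gt_eqF// => H.
rewrite /w -integral_mkcond.
have {H} := congr1 (fun z => z `^ q)%E H; rewrite poweR_EFin -poweRrM ?mulVf ?gt_eqF// poweRe1; last first.
  by apply: integral_ge0 => x _; rewrite lee_fin powR_ge0.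
move=> <-; apply: (@eq_integral _ mplane R leb2) => x _.
by rewrite ger0_norm// norm2_ge0.
Qed.

(** The local energy on a window whose radius does not depend on x, unlike the squares of Morrey's
    estimate; only so can Tonelli evaluate its integral over x. *)
Let I r x : \bar R := (\int[leb2]_(y in cbox x r) w y)%E.

Let I_le r x : (I r x <= (E `^ q)%:E)%E.
Proof.
rewrite -int_w; apply: (@ge0_subset_integral _ mplane R leb2 _ setT) => //.
- exact: measurable_cbox.
Qed.

Let grad_le r x d i : 4 * d <= r -> cbox x (4 * d) `<=` D ->
  (Lp_norm (cbox x (4 * d)) q (fun x => G x i 0)%R <= ((fine (I r x)) `^ q^-1)%:E)%E.
Proof.
move=> dr sD; have mS := @measurable_cbox R x (4 * d).
have I0 : (0 <= I r x)%E by apply: integral_ge0 => y _.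
have If : I r x \is a fin_num by rewrite ge0_fin_numE//; apply: le_lt_trans (I_le r x) _; rewrite ltry.
apply: Lp_norm_le_int => //; first exact: powR_ge0.
rewrite -powRrM mulVf ?gt_eqF// powRr1 ?fine_ge0// fineK//.
have mG : measurable_fun (cbox x (4 * d) : set mplane) (fun x : mplane => G x i 0).
  by apply: measurable_funS mD sD _; exact: wgrad_measurable W1f.1.
apply: (@le_trans _ _ (\int[leb2]_(y in cbox x (4 * d)) w y)%E).
  apply: (@ge0_le_integral _ mplane R leb2 _ mS) => //.
  - exact: measurable_Lp_int.
  - exact: measurable_funTS.
  move=> y Sy; rewrite /w patchE mem_set; last exact: sD.
  rewrite lee_fin; apply: ge0_ler_powR; rewrite ?nnegrE ?(ltW q0) ?norm2_ge0//.
  rewrite /Lop /norm2 dot_col_mx; have := coord_norm2 (G y) i; rewrite /norm2 => /le_trans; apply.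
  by rewrite ler_sqrt ?addr_ge0 ?dot_ge0 ?sqr_ge0// -expr2 ?addr_ge0 ?dot_ge0 ?sqr_ge0// lerDr sqr_ge0.
apply: (@ge0_subset_integral _ mplane R leb2) => //.
- exact: measurable_cbox.
- exact: measurable_funTS.
- by move=> z [z1 z2]; split; lra.
Qed.

Let int_I_measurable r : measurable_fun setT (fun x : mplane => I r x) /\
  (0 <= r -> (\int[leb2]_x I r x = ((2 * r) ^+ 2 * E `^ q)%:E)%E).
Proof.
pose P : set (@mplane R * @mplane R) := [set u | cbox 0 r (u.1 - u.2)].
have m1 : measurable_fun setT (fun w : @mplane R * @mplane R => w.1) by exact: measurable_fst.
have m2 : measurable_fun setT (fun w : @mplane R * @mplane R => w.2) by exact: measurable_snd.
have [m11 m12] := (measurable_fun_pairP _).1 m1.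
have [m21 m22] := (measurable_fun_pairP _).1 m2.
have mV : measurable_fun setT (fun u : @mplane R * @mplane R => (u.1 - u.2 : @mplane R)).
  apply/measurable_fun_pairP; split.
    exact: (measurable_funB m11 m21).
  exact: (measurable_funB m12 m22).
have mP : measurable P.
  by have := mV measurableT _ (measurable_cbox 0 r); rewrite setTI.
have mw2 : measurable_fun setT (fun u : @mplane R * @mplane R => w u.2).
  exact: (measurableT_comp mw m2).
have mF : measurable_fun setT (fun u : @mplane R * @mplane R => w u.2 * (\1_P u)%:E)%E.
  apply: emeasurable_funM => //; apply/measurable_EFinP; exact: measurable_indic.
have F0 (u : @mplane R * @mplane R) : (0 <= w u.2 * (\1_P u)%:E)%E by rewrite mule_ge0// lee_fin.
have cb x y : P (x, y) <-> cbox x r y.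
  by rewrite /P /cbox/= !subr0 (distrC x.1) (distrC x.2).
have IE : (fun x : mplane => I r x) = (fun x => \int[leb2]_y (w y * (\1_P (x, y))%:E))%E.
  apply/funext => x; rewrite /I integral_mkcond.
  apply: (@eq_integral _ mplane R leb2) => y _; rewrite patchE indicE.
  have [cy|Ncy] := pselect (cbox x r y).
    by rewrite !mem_set ?mule1//; apply/cb.
  by rewrite !memNset ?mule0// => /cb.
split; rewrite IE.
  exact: (@measurable_fun_fubini_tonelli_F _ _ mplane mplane R leb2s _ mF F0).
move=> r0; rewrite (leb2_tonelli mF F0).
transitivity (\int[leb2]_y (((2 * r) ^+ 2)%:E * w y))%E; last first.
  rewrite ge0_integralZl//; last by rewrite lee_fin sqr_ge0.
  by rewrite int_w -EFinM.
apply: (@eq_integral _ mplane R leb2) => y _ /=.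
have mc := @measurable_cbox R y r.
rewrite (_ : (fun x => _) = (fun x => w y * (\1_(cbox y r) x)%:E)%E); last first.
  apply/funext => x; rewrite !indicE; congr (_ * (nat_of_bool _)%:R%:E)%E.
  by apply/idP/idP; rewrite !inE; rewrite /P /cbox/= !subr0.
rewrite ge0_integralZl//; first by rewrite integral_indicT// leb2_cbox// muleC.
by apply/measurable_EFinP; exact: measurable_indic.
Qed.

Let measurable_I r : measurable_fun setT (fun x : mplane => I r x) := (int_I_measurable r).1.

Let int_I r := (int_I_measurable r).2.

(** The q-th power turns the exponent 1 - 2/q into q - 2. Since that exponent is nonnegative, 4 d
    may be enlarged to the common radius r. The value d = 0, which occurs at fixed points of the
    flow, is settled apart. *)
Lemma lebrep_diff_pow x y d r : 0 < r -> 0 <= d -> d <= 1 -> cbox x d y ->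
  cbox x (4 * d) `<=` D -> 4 * d <= r ->
  ((`|lebrep D f y - lebrep D f x| `^ q)%:E <= (rateC `^ q * r `^ (q - 2))%:E * I r x)%E.
Proof.
move=> r0; rewrite le_eqVlt => /predU1P[<-|d0] d1 dy sD dr.
  have -> : y = x.
    case: dy; rewrite !normr_le0 !subr_eq0 => /eqP a /eqP b.
    by rewrite [y]surjective_pairing a b -surjective_pairing.
  rewrite subrr normr0 powR0 ?gt_eqF//; apply: mule_ge0.
    by rewrite lee_fin mulr_ge0 ?powR_ge0.
  by apply: integral_ge0 => z _.
have I0 : (0 <= I r x)%E by apply: integral_ge0 => z _.
have If : I r x \is a fin_num by rewrite ge0_fin_numE//; apply: le_lt_trans (I_le r x) _; rewrite ltry.
have H := lebrep_diff d0 d1 dy sD (fun i => grad_le i dr sD).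
rewrite -(fineK If) -EFinM lee_fin.
have a0 : 0 <= 1 - 2 / q by rewrite subr_ge0 ler_pdivrMr ?mul1r//; exact: ltW.
have rc := ltW rateC_gt0.
apply: (@le_trans _ _ ((rateC * r `^ (1 - 2 / q) * fine (I r x) `^ q^-1) `^ q)).
  apply: ge0_ler_powR; rewrite ?nnegrE ?(ltW q0)//.
    by rewrite !mulr_ge0 ?powR_ge0.
  apply: le_trans H _; apply: ler_wpM2r; first exact: powR_ge0.
  by apply: ler_wpM2l => //; apply: ge0_ler_powR; rewrite ?nnegrE ?mulr_ge0 ?(ltW d0) ?(ltW r0).
rewrite powRM ?mulr_ge0 ?powR_ge0// powRM ?powR_ge0// -!powRrM mulVf ?gt_eqF//.
rewrite powRr1 ?fine_ge0// (_ : (1 - 2 / q) * q = q - 2)//.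
by rewrite mulrBl mul1r divfK// gt_eqF.
Qed.

Context (X : R * R -> R * R) (Phi : R -> R * R -> R * R).
Context (hX : C1_zero_bd D X) (hPhi : is_flow D X Phi).

Let hD : open D /\ bounded_set D := conj oD bD.
Let fl := eflow D Phi.

Lemma Lp_transport_rate : exists K tau, [/\ 0 <= K, 0 < tau, tau <= 1 & forall t, 0 <= t <= tau ->
  (Lp_norm D q (fun x => f (fl t x) - f x)%R <= (K * t)%:E)%E].
Proof.
have Lf : Lp D q f.
  split; first exact: wdiff_measurable W1f.1.
  by apply: le_lt_trans W1f.2; exact: Lp_norm_W1 W1f.1.
have GE i : (Lp_norm D q (fun x => G x i 0)%R <= E%:E)%E.
  by rewrite -WE; exact: Lp_norm_wgrad W1f.1.
have fae := lebrep_ae oD bD q2 fG Lf GE.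
have mL := measurable_lebrep oD bD q2 fG Lf GE.
have [C2 C20 disp] := eflow_disp hD hX hPhi.
have C0 := flowC_gt0 hD hX; set C := flowC hD hX in C0.
pose tau := Order.min 1 (Order.min (1 / (16 * C)) (1 / C2)).
have tau0 : 0 < tau by rewrite !lt_min ltr01 !divr_gt0// mulr_gt0.
have tau1 : tau <= 1 by rewrite ge_min lexx.
have tauC : tau * (16 * C) <= 1.
  have : tau <= 1 / (16 * C) by rewrite /tau !ge_min lexx orbT.
  by rewrite ler_pdivlMr// mulr_gt0.
have tauC2 : tau * C2 <= 1.
  have : tau <= 1 / C2 by rewrite /tau !ge_min lexx !orbT.
  by rewrite ler_pdivlMr.
(* With r = 4 C2 t, the product r^(q-2) (2 r)^2 equals 4 r^q; the q-th root leaves 4^(1/q) times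
   r. *)
pose K := rateC * 4 `^ q^-1 * (4 * C2) * E.
have K0 : 0 <= K.
  by rewrite /K !mulr_ge0 ?powR_ge0 ?(ltW rateC_gt0) ?(ltW C20).
exists K, tau; split => // t /andP[t0 tt].
have t1 : `|t| <= 1 by rewrite ger0_norm//; exact: le_trans tau1.
have t01 : 0 <= t <= 1 by rewrite t0 (le_trans tt tau1).
have [t00|tn0] := eqVneq t 0.
  rewrite t00 mulr0; apply: Lp_norm_le_int => //.
  rewrite integral0_eq ?lee_fin ?powR_ge0// => x _.
  by rewrite /fl (eflow0 hPhi) subrr normr0 powR0// gt_eqF.
have {tn0}tp : 0 < t by rewrite lt_neqAle eq_sym tn0.
pose r := 4 * (C2 * t).
have r0 : 0 < r by rewrite /r !mulr_gt0.
apply: Lp_norm_le_int => //; first exact: mulr_ge0.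
have key x : D x -> ((`|lebrep D f (fl t x) - lebrep D f x| `^ q)%:E <=
    (rateC `^ q * r `^ (q - 2))%:E * I r x)%E.
  move=> Dx; pose d := norm1 (fl t x - x).
  have d0 : 0 <= d by exact: norm1_ge0.
  have dC : d <= C2 * t by exact: disp.
  have d1 : d <= 1.
    apply: le_trans dC _; apply: le_trans tauC2; rewrite mulrC ler_wpM2r//.
    exact: ltW.
  apply: (@lebrep_diff_pow _ _ d) => //.
  - by have [a b] := coord_norm1 (fl t x - x); split.
  (* If p in this square were outside D, the displacement d would be at most C t times
     [norm1 (x - p)], so at most (1/16)(8 d). Then d = 0 and p = x, which lies in D. *)
  - move=> p [p1 p2]; apply: contrapT => ND.
    have H := eflow_disp_out hD hX hPhi x t01 ND.
    rewrite -/C -/fl -/d in H.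
    have Hp : norm1 (x - p) <= 8 * d.
      rewrite norm1_dist -[norm1 _]/(`|p.1 - x.1| + `|p.2 - x.2|); lra.
    have Ct : C * t <= 1 / 16.
      rewrite ler_pdivlMr//; apply: le_trans tauC.
      have -> : C * t * 16 = t * (16 * C) by ring.
      by apply: ler_wpM2r => //; rewrite mulr_ge0// ltW.
    have Ct0 : 0 <= C * t by rewrite mulr_ge0// ltW.
    have H2 : d <= 1 / 16 * (8 * d).
      apply: le_trans H _; apply: ler_pM => //; exact: norm1_ge0.
    have d00 : d = 0 by lra.
    rewrite d00 mulr0 in p1 p2; apply: ND.
    move: p1 p2; rewrite !normr_le0 !subr_eq0 => /eqP a /eqP b.
    by rewrite [p]surjective_pairing a b -surjective_pairing.
  - by rewrite /r ler_wpM2l.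
(* At the transported point this holds because the exceptional set of f, pulled back by the flow, is
   still negligible. *)
have aeq : {ae leb2, forall x, D x -> f x = lebrep D f x /\ f (fl t x) = lebrep D f (fl t x)}.
  have Nn : leb2.-negligible (fl t @^-1` (~` [set x | D x -> f x = lebrep D f x]) : set mplane).
    exact: (eflow_null hD hX hPhi t1 fae).
  have ae2 : {ae leb2, forall x, D (fl t x) -> f (fl t x) = lebrep D f (fl t x)} by exact: Nn.
  apply: (aeS _ (ae_and fae ae2)) => x [h1 h2] Dx; split; first exact: h1.
  by apply: h2; exact: (eflow_in hD hX hPhi).
have mfl : measurable_fun (D : set mplane) (fun x : mplane => f (fl t x) - f x).
  by apply: measurable_funB Lf.1; exact: (measurable_eflow_comp hD hX hPhi t1 Lf.1).
have c0 : 0 <= rateC `^ q * r `^ (q - 2) by rewrite mulr_ge0// powR_ge0.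
have I0 x : (0 <= (rateC `^ q * r `^ (q - 2))%:E * I r x)%E.
  by rewrite mule_ge0 ?lee_fin//; apply: integral_ge0 => z _.
apply: (@le_trans _ _ (\int[leb2]_(x in D) ((rateC `^ q * r `^ (q - 2))%:E * I r x))%E).
  apply: (@ae_ge0_le_integral _ mplane R leb2 D mD) => //.
  - exact: measurable_Lp_int.
  - by apply: measurable_funTS; apply: measurable_funeM; exact: measurable_I.
  - by apply: (aeS _ aeq) => x H Dx; have [-> ->] := H Dx; exact: key.
apply: (@le_trans _ _ (\int[leb2]_x ((rateC `^ q * r `^ (q - 2))%:E * I r x))%E).
  apply: (@ge0_subset_integral _ mplane R leb2 D setT) => //.
  by apply: measurable_funeM; exact: measurable_I.
rewrite ge0_integralZl//; do ?[exact: (measurable_I r)|by move=> x _; apply: integral_ge0 => z _].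
rewrite (int_I (ltW r0)) -EFinM lee_fin.
rewrite le_eqVlt; apply/orP; left; apply/eqP.
rewrite /K (_ : _ * t = rateC * 4 `^ q^-1 * r * E); last by rewrite /r; ring.
clearbody r; rewrite !powRM ?mulr_ge0 ?powR_ge0 ?(ltW rateC_gt0) ?(ltW r0)//.
rewrite -powRrM mulVf ?gt_eqF// powRr1//.
have -> : r `^ q = r `^ (q - 2) * r ^+ 2.
  by rewrite -[r ^+ 2]powR_mulrn ?(ltW r0)// -powRD ?subrK// (gt_eqF r0) implybT.
by rewrite exprMn; ring.
Qed.

End transport_rate.

(** If B^2 exceeded A C, the values at (C, -B) and (-B, A) would force A = C = 0, and then (1, 1)
    and (1, -1) force B = 0. Degenerate forms are thus included. *)
Lemma quadratic_form_CS (R : realFieldType) (A B C : R) :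
  (forall x y, 0 <= A * x ^+ 2 + 2 * B * (x * y) + C * y ^+ 2) -> B ^+ 2 <= A * C.
Proof.
move=> H; rewrite leNgt; apply/negP => lt.
have A0 : 0 <= A by have := H 1 0; rewrite expr1n expr0n/=; lra.
have C0 : 0 <= C by have := H 0 1; rewrite expr1n expr0n/=; lra.
have d0 : 0 < B ^+ 2 - A * C by lra.
have h1 : 0 <= C * (A * C - B ^+ 2).
  by have := H C (- B); rewrite (_ : _ + _ = C * (A * C - B ^+ 2))//; ring.
have h2 : 0 <= A * (A * C - B ^+ 2).
  by have := H (- B) A; rewrite (_ : _ + _ = A * (A * C - B ^+ 2))//; ring.
have C00 : C = 0.
  apply/eqP; rewrite eq_le C0 andbT leNgt; apply/negP => Cp.
  by have := mulr_gt0 Cp d0; move: h1; rewrite !mulrBr; lra.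
have A00 : A = 0.
  apply/eqP; rewrite eq_le A0 andbT leNgt; apply/negP => Ap.
  by have := mulr_gt0 Ap d0; move: h2; rewrite !mulrBr; lra.
have := H 1 1; have := H 1 (-1); rewrite A00 C00 => h3 h4.
have B0 : B = 0 by lra.
by move: lt; rewrite B0 A00 expr0n/= mul0r ltxx.
Qed.

Lemma is_derive_quadratic (R : realType) (a b c s : R) :
  is_derive s (1 : R) (fun s => c + 2 * s * a + s ^+ 2 * b) (2 * (a + s * b)).
Proof.
have -> : (fun s => c + 2 * s * a + s ^+ 2 * b) = cst c + (2 * a) *: id + b *: (id * id).
  by apply/funext => r; rewrite -[RHS]/(c + 2 * a * r + b * (r * r)); ring.
have h := is_deriveD (is_deriveD (is_derive_cst c s 1) (is_deriveZ (2 * a) (is_derive_id s 1)))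
  (is_deriveZ b (is_deriveM (is_derive_id s 1) (is_derive_id s 1))).
by apply: (is_derive_eq h); rewrite /GRing.scale/=; ring.
Qed.

(** * Energy estimate *)

Section nonlinearity.
Context {R : realType} (beta : R -> R) (bmin bmax k K : R).
Context (hb : beta_admissible beta bmin bmax k K).
Implicit Types (e y z p a c : 'cV[R]_2).

Definition bfield y : 'cV[R]_2 := beta (norm2 y ^+ 2) *: y.

(** The derivative of [bfield] at p as a bilinear form. It is symmetric, which is what allows bounds
    on the diagonal to be polarised by Cauchy-Schwarz. *)
Let bform p a c : R := beta (norm2 p ^+ 2) * dot a c +
  2 * derive1 beta (norm2 p ^+ 2) * (dot p a * dot p c).

Lemma beta_is_derive s : is_derive s (1 : R) beta (derive1 beta s).
Proof.
have [[db _] _ _ _] := hb; rewrite derive1E; apply: DeriveDef => //.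
Qed.

Lemma beta_continuous : continuous beta.
Proof.
move=> s; apply/differentiable_continuous/derivable1_diffP.
by have [[db _] _ _ _] := hb.
Qed.

Let bform_bounds p a : k * norm2 a ^+ 2 <= bform p a a <= K * norm2 a ^+ 2.
Proof.
have [_ _ _ [_ _ /(_ a p)]] := hb.
by rewrite real_normK ?num_real// /bform -sqr_norm2 -expr2.
Qed.

(** The mean value theorem fails for vector-valued maps, but holds for the component along a fixed
    e; the intermediate point depends on e, which is harmless as the bounds are uniform in p. *)
Lemma bfield_mvt e y z : exists p, dot e (bfield y - bfield z) = bform p e (y - z).
Proof.
pose eta := y - z; pose P s : 'cV[R]_2 := z + s *: eta.
pose N s := dot z z + 2 * s * dot z eta + s ^+ 2 * dot eta eta.
have NE s : norm2 (P s) ^+ 2 = N s.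
  rewrite sqr_norm2 /P !dotDl !dotDr !dotZl !dotZr (dotC eta z) /N; ring.
pose g s := beta (N s) * (dot e z + s * dot e eta).
have gE s : dot e (bfield (P s)) = g s.
  by rewrite /bfield NE dotZr /P dotDr dotZr.
have dN (s : R) : is_derive s (1 : R) N (2 * dot (P s) eta).
  have -> : 2 * dot (P s) eta = 2 * (dot z eta + s * dot eta eta) by rewrite /P dotDl dotZl.
  exact: is_derive_quadratic.
have dg (s : R) : is_derive s (1 : R) g (bform (P s) e eta).
  have dc := is_derive1_comp (beta_is_derive (N s)) (dN s).
  have dl := is_deriveD (is_derive_cst (dot e z) s 1) (is_deriveZ (dot e eta) (is_derive_id s 1)).
  have -> : g = (beta \o N) * (cst (dot e z) + (dot e eta) *: id).
    by apply/funext => r; rewrite /g -[RHS]/(beta (N r) * (dot e z + dot e eta * r)); ring.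
  apply: (is_derive_eq (is_deriveM dc dl)); rewrite /bform NE.
  have -> : dot (P s) e = dot e z + s * dot e eta by rewrite dotC /P dotDr dotZr.
  rewrite -[(cst (dot e z) + _) s]/(dot e z + dot e eta * s) -[(beta \o N) s]/(beta (N s)) /GRing.scale/=.
  by move: (beta (N s)) (derive1 beta (N s)) (dot e z) (dot e eta) (dot (P s) eta) => b b' r a c; ring.
have cg : {within `[0, 1], continuous g}.
  by apply: continuous_subspaceT => s; apply/differentiable_continuous/derivable1_diffP.
have [s _ H] := @MVT R g (fun s => bform (P s) e eta) 0 1 ltr01 (fun s _ => dg s) cg.
exists (P s); rewrite -/eta -[RHS]mulr1 -[X in _ * X](subr0 1) -H -!gE /P scale1r scale0r addr0.
by rewrite /eta subrKC dotBr.
Qed.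

Let bform_expand p a c s t : bform p (s *: a + t *: c) (s *: a + t *: c) =
  bform p a a * s ^+ 2 + 2 * bform p a c * (s * t) + bform p c c * t ^+ 2.
Proof. by rewrite /bform !dotDl !dotDr !dotZl !dotZr (dotC c a); ring. Qed.

Let nrm_expand a c (s t : R) : norm2 (s *: a + t *: c) ^+ 2 =
  norm2 a ^+ 2 * s ^+ 2 + 2 * dot a c * (s * t) + norm2 c ^+ 2 * t ^+ 2.
Proof. by rewrite !sqr_norm2 !dotDl !dotDr !dotZl !dotZr (dotC c a); ring. Qed.

Let sq_le (B x y : R) : 0 <= x -> 0 <= y -> B ^+ 2 <= x ^+ 2 * y ^+ 2 -> `|B| <= x * y.
Proof.
move=> x0 y0 H; rewrite -ler_sqr ?nnegrE ?mulr_ge0// real_normK ?num_real//.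
by rewrite exprMn.
Qed.

Lemma bfield_lip e y z : `|dot e (bfield y - bfield z)| <= K * (norm2 e * norm2 (y - z)).
Proof.
have [_ _ _ [k0 K0 _]] := hb.
have [p ->] := bfield_mvt e y z; set eta := y - z.
rewrite mulrA; apply: sq_le; rewrite ?mulr_ge0 ?norm2_ge0 ?(ltW K0)//.
have P s t := bform_bounds p (s *: e + t *: eta).
have [/andP[_ ee] /andP[ee0 _]] := (bform_bounds p e, bform_bounds p e).
have [/andP[_ nn] /andP[nn0 _]] := (bform_bounds p eta, bform_bounds p eta).
have k1 a : 0 <= k * norm2 a ^+ 2 by rewrite mulr_ge0 ?sqr_ge0// ltW.
apply: (@le_trans _ _ (bform p e e * bform p eta eta)).
  apply: quadratic_form_CS => s t; rewrite -bform_expand.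
  by have /andP[+ _] := P s t; apply: le_trans.
rewrite (_ : (K * norm2 e) ^+ 2 * norm2 eta ^+ 2 = (K * norm2 e ^+ 2) * (K * norm2 eta ^+ 2)); last by ring.
by apply: ler_pM => //; [exact: le_trans (k1 e) ee0|exact: le_trans (k1 eta) nn0].
Qed.

Lemma bfield_bound e y : `|dot e (bfield y)| <= bmax * (norm2 e * norm2 y).
Proof.
have [_ [b0 _ bb] _ _] := hb.
rewrite /bfield dotZr normrM.
have /andP[b1 b2] := bb (norm2 y ^+ 2).
by apply: ler_pM => //; [rewrite ger0_norm//; exact: le_trans (ltW b0) b1|exact: dot_CS].
Qed.

Let m := Order.min k 1.
Let M := Order.max K 1.

(** The classical step length for a strongly monotone Lipschitz map with constants m and M. *)
Definition contr_rate : R := m / M ^+ 2.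

Lemma contr_consts : [/\ 0 < m, m <= 1, 1 <= M & m <= k /\ K <= M].
Proof.
have [_ _ _ [k0 K0 _]] := hb; rewrite /m /M; split.
- by rewrite lt_min k0 ltr01.
- by rewrite ge_min lexx orbT.
- by rewrite le_max lexx orbT.
- by rewrite ge_min le_max !lexx.
Qed.

Lemma contr_rate_bounds : [/\ 0 < contr_rate, contr_rate <= 1, contr_rate * M <= 1,
  contr_rate * m = m ^+ 2 / M ^+ 2 & 0 <= 1 - m ^+ 2 / M ^+ 2 <= 1].
Proof.
have [m0 m1 M1 _] := contr_consts; have M0 := lt_le_trans ltr01 M1.
have MM : M <= M ^+ 2 by rewrite expr2 ler_peMl// ltW.
have rM : contr_rate * M = m / M by rewrite /contr_rate; field; rewrite gt_eqF.
have rM1 : contr_rate * M <= 1 by rewrite rM ler_pdivrMr// mul1r (le_trans m1).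
have r0 : 0 < contr_rate by rewrite divr_gt0// exprn_gt0.
split => //.
- by apply: le_trans rM1; rewrite ler_peMr// ltW.
- by rewrite /contr_rate; field; rewrite gt_eqF.
- have mM0 : 0 <= m / M by rewrite divr_ge0// ltW.
  rewrite -expr_div_n subr_ge0 gerBl sqr_ge0 andbT; apply: exprn_ile1 => //.
  by rewrite -rM.
Qed.

(** The form [S] is nonnegative because [contr_rate * M <= 1] and at most 1 - [contr_rate * m] times
    the Euclidean one, which is exactly the stated constant. *)
Lemma bfield_contract e y z :
  `|dot e (y - z) - contr_rate * dot e (bfield y - bfield z)| <=
  (1 - m ^+ 2 / M ^+ 2) * (norm2 e * norm2 (y - z)).
Proof.
have [m0 m1 M1 [mk KM]] := contr_consts.
have [r0 r1 rM rm /andP[kap0 kap1]] := contr_rate_bounds.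
have [p ->] := bfield_mvt e y z; set eta := y - z; set kap := 1 - _ in kap0 kap1 *.
pose S a c := dot a c - contr_rate * bform p a c.
have S1 a : 0 <= S a a <= kap * norm2 a ^+ 2.
  have /andP[lo hi] := bform_bounds p a; rewrite /S -sqr_norm2.
  set n := norm2 a ^+ 2 in lo hi *; have n0 : 0 <= n by exact: sqr_ge0.
  apply/andP; split.
    rewrite subr_ge0; apply: (@le_trans _ _ (contr_rate * (M * n))).
      by rewrite ler_wpM2l ?(ltW r0)//; apply: le_trans hi _; rewrite ler_wpM2r.
    by rewrite mulrA ler_piMl.
  have h : contr_rate * (m * n) <= contr_rate * bform p a a.
    by rewrite ler_wpM2l ?(ltW r0)//; apply: le_trans lo; rewrite ler_wpM2r.
  by rewrite /kap mulrBl mul1r -rm; apply: lerB => //; rewrite -(mulrA contr_rate).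
rewrite -[X in `|X|]/(S e eta) mulrA; apply: sq_le; rewrite ?mulr_ge0 ?norm2_ge0//.
have [/andP[_ ee] /andP[ee0 _]] := (S1 e, S1 e).
have [/andP[_ nn] /andP[nn0 _]] := (S1 eta, S1 eta).
apply: (@le_trans _ _ (S e e * S eta eta)).
  apply: quadratic_form_CS => s t.
  have /andP[+ _] := S1 (s *: e + t *: eta).
  by rewrite {1}/S -sqr_norm2 nrm_expand bform_expand /S -!sqr_norm2; move/le_trans; apply; rewrite le_eqVlt; apply/orP; left; apply/eqP; ring.
rewrite (_ : (kap * norm2 e) ^+ 2 * norm2 eta ^+ 2 = (kap * norm2 e ^+ 2) * (kap * norm2 eta ^+ 2)); last by ring.
exact: ler_pM.
Qed.

End nonlinearity.

(** * Jacobians close to the identity *)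

Section matrix2.
Context {R : realType}.
Implicit Types (A Jm : 'M[R]_2) (v w y z : 'cV[R]_2) (d : R).

Lemma dot_mulmx A v w : dot (A *m v) w = dot v (A^T *m w).
Proof.
rewrite !dot2E !mxE !big_ord_recl !big_ord0 !mxE.
rewrite (_ : lift ord0 ord0 = 1 :> 'I_2); last by apply/val_inj.
by rewrite -[ord0]/(0 : 'I_2); ring.
Qed.

Lemma mulmx2E A v i : (A *m v) i 0 = A i 0 * v 0 0 + A i 1 * v 1 0.
Proof.
rewrite mxE !big_ord_recl big_ord0 addr0.
by rewrite (_ : lift ord0 ord0 = 1 :> 'I_2)//; apply/val_inj.
Qed.

Lemma det2E A : \det A = A 0 0 * A 1 1 - A 0 1 * A 1 0.
Proof. 
rewrite (expand_det_row _ 0) !big_ord_recl big_ord0 addr0 /cofactor !det_mx11 !mxE /=.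
transitivity (A 0 0 * ((-1) ^+ 0 * A 1 1) + A 0 1 * ((-1) ^+ 1 * A 1 0)); last by rewrite expr0 expr1; ring.
by congr (A _ _ * (_ * A _ _) + A _ _ * (_ * A _ _)); apply/val_inj. Qed.

Let near_id Jm d := forall i j, `|Jm i j - (i == j)%:R| <= d.

Lemma det_near_id Jm d : near_id Jm d -> d <= 1 / 8 -> `|\det Jm - 1| <= 3 * d.
Proof.
move=> H d8; rewrite det2E.
have a := H 0 0; have b := H 1 1; have c := H 0 1; have e := H 1 0.
rewrite /= in a b c e; rewrite subr0 in c; rewrite subr0 in e.
have d0 : 0 <= d by apply: le_trans a.
have -> : Jm 0 0 * Jm 1 1 - Jm 0 1 * Jm 1 0 - 1 = (Jm 0 0 - 1) + (Jm 1 1 - 1) +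
  (Jm 0 0 - 1) * (Jm 1 1 - 1) - Jm 0 1 * Jm 1 0 by ring.
apply: le_trans (ler_normB _ _) _; rewrite normrM.
have ce : `|Jm 0 1| * `|Jm 1 0| <= d * (1 / 8).
  by apply: ler_pM => //; apply: le_trans e d8.
have ab : `|(Jm 0 0 - 1) * (Jm 1 1 - 1)| <= d * (1 / 8).
  by rewrite normrM; apply: ler_pM => //; apply: le_trans b d8.
have := ler_normD (Jm 0 0 - 1 + (Jm 1 1 - 1)) ((Jm 0 0 - 1) * (Jm 1 1 - 1)).
have := ler_normD (Jm 0 0 - 1) (Jm 1 1 - 1); lra.
Qed.

Lemma det_near_id_unit Jm d : near_id Jm d -> d <= 1 / 8 -> Jm \in unitmx.
Proof.
move=> H d8; rewrite unitmxE unitfE; have := det_near_id H d8.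
by apply: contraPneq => ->; rewrite sub0r normrN normr1; lra.
Qed.

Lemma norm2_coord2 v c : `|v 0 0| <= c -> `|v 1 0| <= c -> norm2 v <= 2 * c.
Proof.
move=> a b; have c0 := le_trans (normr_ge0 _) a.
rewrite -ler_sqr ?nnegrE ?norm2_ge0 ?mulr_ge0// sqr_norm2 dot2E.
have a2 : v 0 0 * v 0 0 <= c * c by rewrite -!expr2 -real_normK ?num_real// ler_sqr ?nnegrE.
have b2 : v 1 0 * v 1 0 <= c * c by rewrite -!expr2 -real_normK ?num_real// ler_sqr ?nnegrE.
have := mulr_ge0 c0 c0; rewrite expr2; lra.
Qed.

(** For x the solution of J^T x = y, the difference x - y is minus (J^T - 1) x, at most 4 d |x|. As
    4 d <= 1/2 this first gives |x| <= 2 |y|, and then the bound in terms of y. *)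
Lemma invmx_tr_near_id Jm d y : near_id Jm d -> d <= 1 / 8 ->
  norm2 ((invmx Jm)^T *m y - y) <= 8 * d * norm2 y.
Proof.
move=> H d8; have uJ := det_near_id_unit H d8.
have d0 : 0 <= d by apply: le_trans (H 0 0).
have [x xE xy] : exists2 x, (invmx Jm)^T *m y = x & Jm^T *m x = y.
  by exists ((invmx Jm)^T *m y) => //; rewrite mulmxA -trmx_mul mulVmx// trmx1 mul1mx.
rewrite xE.
have yE i : y i 0 = Jm 0 i * x 0 0 + Jm 1 i * x 1 0 by rewrite -xy mulmx2E !mxE.
have xB : norm2 (x - y) <= 2 * (d * (2 * norm2 x)).
  have E i : (x - y) i 0 = - ((Jm 0 i - (0 == i)%:R) * x 0 0 + (Jm 1 i - (1 == i)%:R) * x 1 0).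
    rewrite !mxE yE; by case: (ord2P i) => -> /=; ring.
  have B i : `|(x - y) i 0| <= d * (2 * norm2 x).
    rewrite E normrN; apply: le_trans (ler_normD _ _) _; rewrite !normrM.
    rewrite mulr_natl mulr2n mulrDr; apply: lerD; apply: ler_pM => //; exact: coord_norm2.
  exact: norm2_coord2.
have xn : norm2 x <= 2 * norm2 y.
  have := norm2D (x - y) y; rewrite subrK.
  have nx := norm2_ge0 x.
  have : d * (2 * norm2 x) <= 1 / 8 * (2 * norm2 x) by rewrite ler_wpM2r// mulr_ge0.
  lra.
apply: le_trans xB _.
have : d * norm2 x <= d * (2 * norm2 y) by rewrite ler_wpM2l.
rewrite (mulrCA d 2); lra.
Qed.

Lemma invmx_tr2E Jm y : Jm \in unitmx -> (invmx Jm)^T *m y =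
  \col_i (if i == 0 then (y 0 0 * Jm 1 1 - y 1 0 * Jm 1 0) / \det Jm
          else (y 1 0 * Jm 0 0 - y 0 0 * Jm 0 1) / \det Jm).
Proof.
move=> uJ; set x := \col_i _.
have xy : Jm^T *m x = y.
  have d0 : \det Jm != 0 by move: uJ; rewrite unitmxE unitfE.
  apply/matrixP => i j; rewrite (ord1 j) mulmx2E !mxE /= det2E; rewrite det2E in d0.
  by case: (ord2P i) => ->; field.
by rewrite -xy mulmxA -trmx_mul mulmxV// trmx1 mul1mx.
Qed.

End matrix2.

Section pointwise_estimates.
Context {R : realType} (beta : R -> R) (bmin bmax k K : R).
Context (hb : beta_admissible beta bmin bmax k K).
Implicit Types (y z : 'cV[R]_2) (Jm : 'M[R]_2) (a b d : R).

Local Notation bf := (bfield beta).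

Lemma transported_formE Jm y z :
  beta (norm2 ((invmx Jm)^T *m y) ^+ 2) *
    dot ((\det Jm *: (invmx Jm *m (invmx Jm)^T)) *m y) z =
  \det Jm * dot (bf ((invmx Jm)^T *m y)) ((invmx Jm)^T *m z).
Proof.
by rewrite -scalemxAl -mulmxA dotZl dot_mulmx /bfield dotZl; ring.
Qed.

(** Four replacements of size d: the determinant costs 12 bmax, the argument of the nonlinearity 16
    K, the test gradient 8 bmax and the zero-order term 3. *)
Definition pertC : R := 20 * bmax + 16 * K + 3.

Lemma pertC_gt0 : 0 < pertC.
Proof. by have [_ [_ b0 _] _ [_ K0 _]] := hb; rewrite /pertC; lra. Qed.

Lemma transported_form_near Jm d y z a b : (forall i j, `|Jm i j - (i == j)%:R| <= d) ->
  d <= 1 / 8 ->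
  `|(dot (bf y) z + a * b) - (\det Jm * dot (bf ((invmx Jm)^T *m y)) ((invmx Jm)^T *m z) +
     \det Jm * a * b)| <= pertC * d * (norm2 y * norm2 z + `|a| * `|b|).
Proof.
move=> H d8; have [_ [_ b0 _] _ [_ K0 _]] := hb.
have d0 : 0 <= d by apply: le_trans (H 0 0).
have hdet := det_near_id H d8.
have hy := invmx_tr_near_id y H d8; have hz := invmx_tr_near_id z H d8.
set By := _ *m y in hy *; set Bz := _ *m z in hz *.
have ny := norm2_ge0 y; have nz := norm2_ge0 z.
have d81 : 8 * d <= 1 by lra.
have By2 : norm2 By <= 2 * norm2 y.
  have := norm2D (By - y) y; rewrite subrK => h.
  have := ler_wpM2r ny d81; lra.
have Bz2 : norm2 Bz <= 2 * norm2 z.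
  have := norm2D (Bz - z) z; rewrite subrK => h.
  have := ler_wpM2r nz d81; lra.
have yz0 : 0 <= norm2 y * norm2 z by exact: mulr_ge0.
have ab0 : 0 <= `|a| * `|b| by exact: mulr_ge0.
have yz : norm2 Bz * norm2 By <= 4 * (norm2 y * norm2 z).
  rewrite (_ : 4 * _ = (2 * norm2 z) * (2 * norm2 y)); last by ring.
  by apply: ler_pM => //; exact: norm2_ge0.
have t1 : `|(\det Jm - 1) * dot (bf By) Bz| <= 12 * bmax * d * (norm2 y * norm2 z).
  rewrite normrM (_ : 12 * bmax * d * _ = 3 * d * (bmax * (4 * (norm2 y * norm2 z)))); last by ring.
  apply: ler_pM => //; rewrite dotC; apply: le_trans (bfield_bound hb _ _) _.
  by rewrite ler_wpM2l// ltW.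
have t2 : `|dot (bf By - bf y) Bz| <= 16 * K * d * (norm2 y * norm2 z).
  rewrite dotC; apply: le_trans (bfield_lip hb _ _ _) _.
  rewrite (_ : 16 * K * d * _ = K * ((2 * norm2 z) * (8 * d * norm2 y))); last by ring.
  by rewrite ler_wpM2l ?(ltW K0)//; apply: ler_pM => //; exact: norm2_ge0.
have t3 : `|dot (bf y) (Bz - z)| <= 8 * bmax * d * (norm2 y * norm2 z).
  rewrite dotC; apply: le_trans (bfield_bound hb _ _) _.
  rewrite (_ : 8 * bmax * d * _ = bmax * ((8 * d * norm2 z) * norm2 y)); last by ring.
  by rewrite ler_wpM2l ?(ltW b0)//; apply: ler_pM => //; exact: norm2_ge0.
have t4 : `|(\det Jm - 1) * (a * b)| <= 3 * d * (`|a| * `|b|).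
  by rewrite normrM (normrM a) ler_pM.
have -> : dot (bf y) z + a * b - (\det Jm * dot (bf By) Bz + \det Jm * a * b) =
  - ((\det Jm - 1) * dot (bf By) Bz + dot (bf By - bf y) Bz + dot (bf y) (Bz - z) +
     (\det Jm - 1) * (a * b)).
  by rewrite dotBl dotBr; ring.
rewrite normrN; apply: (le_trans (ler_normD _ _)); apply: (le_trans (lerD (ler_normD _ _) (lexx _))).
apply: (le_trans (lerD (lerD (ler_normD _ _) (lexx _)) (lexx _))).
apply: le_trans (lerD (lerD (lerD t1 t2) t3) t4) _.
have e1 : 0 <= bmax * d * (`|a| * `|b|) by rewrite !mulr_ge0// ltW.
have e2 : 0 <= K * d * (`|a| * `|b|) by rewrite !mulr_ge0// ltW.
have e3 : 0 <= d * (norm2 y * norm2 z) by rewrite mulr_ge0.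
rewrite -subr_ge0 /pertC.
rewrite [X in 0 <= X](_ : _ = 20 * (bmax * d * (`|a| * `|b|)) + 16 * (K * d * (`|a| * `|b|)) +
  3 * (d * (norm2 y * norm2 z))); last by ring.
by rewrite !addr_ge0// mulr_ge0.
Qed.

(** The zero-order term scales by 1 - [contr_rate], which stays below the contraction constant
    because m <= 1; this is the reason for the minimum and maximum with 1. *)
Lemma contraction_pointwise y y' z a b :
  `|(dot (y - y') z + a * b) - contr_rate k K * ((dot (bf y) z - dot (bf y') z) + a * b)| <=
  (1 - Num.min k 1 ^+ 2 / Num.max K 1 ^+ 2) * (norm2 (y - y') * norm2 z + `|a| * `|b|).
Proof.
set rho := contr_rate k K; have [r0 r1 rM rm kap] := contr_rate_bounds hb.
have [m0 m1 M1 _] := contr_consts hb.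
have -> : dot (y - y') z + a * b - rho * (dot (bf y) z - dot (bf y') z + a * b) =
  (dot z (y - y') - rho * dot z (bf y - bf y')) + (1 - rho) * (a * b).
  by rewrite !(dotC z) dotBl (dotBl (bf y)); ring.
apply: le_trans (ler_normD _ _) _; rewrite mulrDr; apply: lerD.
  by rewrite (mulrC (norm2 (y - y'))); exact: bfield_contract hb _ _ _.
rewrite normrM (normrM a) ler_wpM2r ?mulr_ge0// ger0_norm ?subr_ge0//.
by rewrite lerB// -rm ler_piMr// ltW.
Qed.

Lemma pair_CS (y z : 'cV[R]_2) a b : norm2 y * norm2 z + `|a| * `|b| <=
  norm2 (col_mx (a%:M : 'M[R]_1) y) * norm2 (col_mx (b%:M : 'M[R]_1) z).
Proof.
have ny := norm2_ge0 y; have nz := norm2_ge0 z.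
rewrite -ler_sqr ?nnegrE ?mulr_ge0 ?addr_ge0 ?mulr_ge0 ?norm2_ge0//.
rewrite exprMn !sqr_norm2 !dot_col_mx -!sqr_norm2 -!expr2.
rewrite -(real_normK (num_real a)) -(real_normK (num_real b)).
rewrite -subr_ge0 [X in 0 <= X](_ : _ = (`|a| * norm2 z - `|b| * norm2 y) ^+ 2); last by ring.
exact: sqr_ge0.
Qed.

End pointwise_estimates.

Section measurability.
Context {R : realType} (Omega : set (R * R)) (mO : measurable (Omega : set (@mplane R))).
Implicit Types (y z : @mplane R -> 'cV[R]_2) (Jm : @mplane R -> 'M[R]_2).

Definition mvec y := forall i, measurable_fun (Omega : set mplane) (fun x => y x i 0).

Lemma measurable_dot y z : mvec y -> mvec z -> measurable_fun Omega (fun x => dot (y x) (z x)).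
Proof.
move=> my mz; under eq_fun do rewrite dot2E.
by apply: measurable_funD; apply: measurable_funM; first [exact: my|exact: mz].
Qed.

Lemma mvec_bfield (beta : R -> R) y : continuous beta -> mvec y -> mvec (fun x => bfield beta (y x)).
Proof.
move=> cb my i; rewrite /bfield.
rewrite (_ : (fun x => _) = (fun x => beta (dot (y x) (y x)) * y x i 0)).
  apply: measurable_funM => //; apply: measurableT_comp; last exact: measurable_dot.
  exact: continuous_measurable_fun.
by apply/funext => x; rewrite mxE sqr_norm2.
Qed.

Lemma measurable_det Jm : (forall i j, measurable_fun (Omega : set mplane) (fun x => Jm x i j)) ->
  measurable_fun Omega (fun x => \det (Jm x)).
Proof.
move=> mJ; under eq_fun do rewrite det2E.
by apply: measurable_funB; apply: measurable_funM; exact: mJ.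
Qed.

Lemma mvec_invmx_tr Jm y : (forall i j, measurable_fun (Omega : set mplane) (fun x => Jm x i j)) ->
  (forall x, Omega x -> 0 < \det (Jm x)) -> mvec y ->
  mvec (fun x => (invmx (Jm x))^T *m y x).
Proof.
move=> mJ uJ my i.
have md : measurable_fun Omega (fun x => (\det (Jm x))^-1).
  (* The inverse of the determinant is written as a real power, which agrees with it because the
     determinant is positive on [Omega]. *)
  apply: (eq_measurable_fun (fun x => \det (Jm x) `^ (-1))).
    by move=> x; rewrite inE => Ox; rewrite powR_inv1// ltW// uJ.
  apply: (@measurableT_comp _ _ _ _ _ _ (fun x : R => x `^ (-1))); first exact: measurable_powR.
  exact: measurable_det.
have mf : measurable_fun Omega (fun x => if i == 0 then (y x 0 0 * Jm x 1 1 - y x 1 0 * Jm x 1 0) / \det (Jm x)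
   else (y x 1 0 * Jm x 0 0 - y x 0 0 * Jm x 0 1) / \det (Jm x)).
  by case: (i == 0); apply: measurable_funM => //; apply: measurable_funB; apply: measurable_funM; first [exact: my|exact: mJ].
apply: eq_measurable_fun mf => x; rewrite inE => Ox.
by rewrite invmx_tr2E ?mxE// unitmxE unitfE gt_eqF// uJ.
Qed.

End measurability.

(** * Dual pairings and the constant M_q *)

Section weak_forms.
Context {R : realType} (Omega Gamma : set (R * R)) (oO : open Omega).
Implicit Types (u v w phi : R * R -> R) (q a : R).

Let mO : measurable (Omega : set (@mplane R)) := open_mplane oO.

Lemma Rintegral_ae (f g : @mplane R -> R) : measurable_fun Omega f -> measurable_fun Omega g ->
  {ae leb2, forall x, Omega x -> f x = g x} -> Rintegral leb2 Omega f = Rintegral leb2 Omega g.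
Proof.
move=> mf mg fg; rewrite /Rintegral; congr fine; apply: ae_eq_integral => //.
- exact/measurable_EFinP.
- exact/measurable_EFinP.
- by apply: (aeS _ fg) => x H Ox; rewrite H.
Qed.

Lemma mvec_wgrad u : wdiff Omega u -> mvec Omega (wgrad Omega u).
Proof. by move=> wu i; exact: wgrad_measurable. Qed.

Lemma wgrad_lin_ae a u v : wdiff Omega u -> wdiff Omega v -> {ae leb2, forall x, Omega x ->
  wgrad Omega (fun x => a * u x + v x) x = a *: wgrad Omega u x + wgrad Omega v x}.
Proof.
move=> wu wv; have H := is_wgrad_lin a oO (wdiffP wu) (wdiffP wv).
exact: wgrad_ae H.
Qed.

(** Fits multiples into the shape a u + v of the linearity lemmas without bringing in the zero
    function. *)
Lemma scale_split a u : (fun x => a * u x) = (fun x => (a - 1) * u x + u x).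
Proof. by apply/funext => x; ring. Qed.

Lemma W1G_scale q a u : 1 <= q -> W1G Omega Gamma q u -> W1G Omega Gamma q (fun x => a * u x).
Proof. by move=> q1 Wu; rewrite scale_split; exact: W1G_lin. Qed.

Section pairing.
Context (q : R) (q1 : 1 < q) (phi : R * R -> R).
Context (wphi : wdiff Omega phi) (Wphi : (W1_norm Omega (conj_exp q) phi < +oo)%E).

Lemma form_pairing u (g : @mplane R -> R) c : wdiff Omega u -> (W1_norm Omega q u < +oo)%E ->
  0 <= c -> measurable_fun Omega g ->
  {ae leb2, forall x, Omega x -> `|g x| <= c * (norm2 (wgrad Omega u x) * norm2 (wgrad Omega phi x) +
     `|u x| * `|phi x|)} ->
  leb2.-integrable Omega (EFin \o g) /\
  (`|Rintegral leb2 Omega g|%:E <= c%:E * W1_norm Omega q u * W1_norm Omega (conj_exp q) phi)%E.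
Proof.
move=> wu Wu c0 mg H.
have mu := measurable_norm2Lop wu; have mphi := measurable_norm2Lop wphi.
have q0 : 0 < q by exact: lt_trans ltr01 q1.
have mcu : measurable_fun (Omega : set mplane) (fun x : mplane => c * norm2 (Lop Omega u x)).
  exact: measurable_funM.
have cuE : Lp_norm Omega q (fun x => c * norm2 (Lop Omega u x)) = (c%:E * W1_norm Omega q u)%E.
  rewrite (Lp_normZ c q0 mO mu) (ger0_norm c0); reflexivity.
have fcu : (Lp_norm Omega q (fun x => c * norm2 (Lop Omega u x))%R < +oo)%E.
  by rewrite cuE; exact: lte_mul_pinfty.
have le : {ae leb2, forall x, Omega x -> `|g x| <= `|(c * norm2 (Lop Omega u x)) * norm2 (Lop Omega phi x)|}.
  apply: (aeS _ H) => x Hx Ox; apply: le_trans (Hx Ox) _.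
  rewrite normrM (normrM c) (ger0_norm c0) -mulrA ler_wpM2l//.
  by rewrite !(ger0_norm (norm2_ge0 _)); exact: pair_CS.
have [I B] := Holder_pairing q1 mO mcu mphi mg le fcu Wphi.
by split => //; rewrite -cuE.
Qed.

Lemma Lp_pairing (f : R * R -> R) : measurable_fun (Omega : set mplane) (f : mplane -> R) ->
  (Lp_norm Omega q f < +oo)%E ->
  leb2.-integrable Omega (EFin \o (fun x : mplane => f x * phi x)) /\
  (`|Rintegral leb2 Omega (fun x : mplane => f x * phi x)|%:E <=
    Lp_norm Omega q f * W1_norm Omega (conj_exp q) phi)%E.
Proof.
move=> mf Lf; have mphi := wdiff_measurable wphi.
have [_ _ q'0 _] := conj_expP q1.
have le := Lp_norm_W1 oO q'0 wphi.
have [] := @Holder_pairing R Omega q f phi (fun x => f x * phi x) q1 mO mf mphi _ _ Lf.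
- exact: measurable_funM.
- by apply/aeW => x _.
- exact: le_lt_trans le Wphi.
move=> I H; split => //; apply: le_trans H _; apply: lee_wpmul2l => //; exact: Lp_norm_ge0.
Qed.

Lemma measurable_J u : wdiff Omega u -> measurable_fun Omega
  (fun x : mplane => dot (wgrad Omega u x) (wgrad Omega phi x) + u x * phi x).
Proof.
move=> wu; apply: measurable_funD.
  by apply: measurable_dot; exact: mvec_wgrad.
by apply: measurable_funM; exact: wdiff_measurable.
Qed.

Lemma J_integrable u : wdiff Omega u -> (W1_norm Omega q u < +oo)%E ->
  leb2.-integrable Omega (EFin \o (fun x : mplane =>
    dot (wgrad Omega u x) (wgrad Omega phi x) + u x * phi x)).
Proof.
move=> wu Wu; have [] // := @form_pairing u _ 1 wu Wu ler01 (measurable_J wu).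
apply/aeW => x _; rewrite mul1r; apply: le_trans (ler_normD _ _) _.
by rewrite normrM lerD// dot_CS.
Qed.

Lemma J_scale a u : wdiff Omega u -> (W1_norm Omega q u < +oo)%E ->
  J Omega (fun x => a * u x) phi = a * J Omega u phi.
Proof.
move=> wu Wu; rewrite /J -(RintegralZl _ mO (J_integrable wu Wu)).
have wau : wdiff Omega (fun x => a * u x) by rewrite scale_split; exact: wdiff_lin.
apply: Rintegral_ae; first exact: measurable_J.
  by apply: measurable_funM => //; exact: measurable_J.
rewrite scale_split; apply: (aeS _ (wgrad_lin_ae (a - 1) wu wu)) => x H Ox.
by rewrite H// dotDl dotZl; ring.
Qed.

End pairing.

(** Homogeneity: v / N is a competitor in the supremum that defines [M_const]. *)
Lemma M_const_bound q v (N : R) : 1 < q -> W1G Omega Gamma q v -> 0 < N ->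
  (forall phi, W1G Omega Gamma (conj_exp q) phi -> (W1_norm Omega (conj_exp q) phi <= 1)%E ->
     `|J Omega v phi| <= N) ->
  (W1_norm Omega q v <= N%:E * M_const Omega Gamma q)%E.
Proof.
move=> q1 Wv N0 H; have [[wv fv] _] := Wv.
have W' : (N%:E * W1_norm Omega q (fun x => N^-1 * v x)%R = W1_norm Omega q v)%E.
  rewrite W1_normZ ?(ltW q1)// muleA -EFinM ger0_norm ?invr_ge0 ?ltW// mulfV ?gt_eqF// mul1e//.
rewrite -W'; apply: lee_wpmul2l; first by rewrite lee_fin ltW.
apply: ereal_sup_ubound; exists (fun x => N^-1 * v x); last by reflexivity.
split.
  by apply: W1G_scale => //; exact: ltW.
apply: ge_ereal_sup => _ [phi [Wphi phi1] <-]; rewrite lee_fin.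
have [[wphi fphi] _] := Wphi.
have iN : 0 < N^-1 by rewrite invr_gt0.
rewrite (J_scale q1 wphi fphi _ wv fv) normrM (gtr0_norm iN) mulrC ler_pdivrMr// mul1r.
exact: H.
Qed.

End weak_forms.

(** * Comparison of the two weak equations *)

Section energy.
Context {R : realType} (D Omega Gamma : set (R * R)) (X : R * R -> R * R)
  (Phi : R -> R * R -> R * R) (beta : R -> R) (bmin bmax k K q : R) (f : R * R -> R).
Context (hD : open D /\ bounded_set D) (hX : C1_zero_bd D X) (hPhi : is_flow D X Phi)
  (oO : open Omega) (OD : Omega `<=` D) (hb : beta_admissible beta bmin bmax k K)
  (q1 : 1 < q) (Lf : Lp D q f).
Implicit Types (x : R * R) (t : R).

Let mO : measurable (Omega : set (@mplane R)) := open_mplane oO.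
Let mD : measurable (D : set (@mplane R)) := open_mplane hD.1.
Let C := flowC hD hX.
Let rho := contr_rate k K.
Let kap := 1 - Num.min k 1 ^+ 2 / Num.max K 1 ^+ 2.
Local Notation bf := (bfield beta).

Definition load_diff t x := xi (Phi t) x * f (Phi t x) - f x.

Let flE t x : Omega x -> Phi t x = eflow D Phi t x.
Proof. by move=> /OD Dx; rewrite eflowE//; exact: subset_closure. Qed.

Lemma measurable_flow_load t : 0 <= t <= 1 ->
  measurable_fun (Omega : set mplane) (fun x : mplane => f (Phi t x)).
Proof.
move=> t01; have t1 : `|t| <= 1 by case/andP: t01 => t0 ?; rewrite ger0_norm.
apply: (eq_measurable_fun (fun x => f (eflow D Phi t x))).
  by move=> x; rewrite inE => Ox; rewrite flE.
by apply: measurable_funS mD OD _; exact: (measurable_eflow_comp hD hX hPhi t1 Lf.1).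
Qed.

Lemma measurable_xi t : 0 <= t <= 1 ->
  measurable_fun (Omega : set mplane) (fun x : mplane => xi (Phi t) x).
Proof.
move=> t01; apply: measurable_det => // i j.
by apply: measurable_funS mD OD _; exact: (flow_jac_measurable hD hX hPhi i j t01).
Qed.

Lemma measurable_load_diff t : 0 <= t <= 1 ->
  measurable_fun (Omega : set mplane) (fun x : mplane => load_diff t x).
Proof.
move=> t01; apply: measurable_funB; last exact: measurable_funS mD OD Lf.1.
by apply: measurable_funM; [exact: measurable_xi|exact: measurable_flow_load].
Qed.

Lemma energy_estimate t (ut u0 phi : R * R -> R) (V U F P : R) :
  0 <= t <= 1 -> C * t <= 1 / 8 ->
  is_solution Omega Gamma beta (Phi t) f q ut -> is_solution Omega Gamma beta (Phi 0) f q u0 ->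
  W1G Omega Gamma (conj_exp q) phi ->
  W1_norm Omega q (fun x => ut x - u0 x) = V%:E -> W1_norm Omega q ut = U%:E ->
  Lp_norm Omega q (load_diff t) = F%:E -> W1_norm Omega (conj_exp q) phi = P%:E ->
  `|J Omega (fun x => ut x - u0 x) phi| <=
    (kap * V + rho * (pertC bmax K * (C * t) * U + F)) * P.
Proof.
move=> t01 Ct [Wt solt] [W0 sol0] Wphi hV hU hF hP.
have [[wphi fphi] _] := Wphi; have [[wt ft] _] := Wt; have [[w0 f0] _] := W0.
have Wv := W1GB oO (ltW q1) Wt W0; have [[wv fv] _] := Wv.
pose v x := ut x - u0 x.
have mphi := wdiff_measurable wphi; have mut := wdiff_measurable wt; have mu0 := wdiff_measurable w0.
have near x : Omega x -> forall i j, `|jac (Phi t) x i j - (i == j)%:R| <= C * t.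
  by move=> /OD Dx i j; exact: (flow_jac_near_id hD hX hPhi i j Dx t01).
have mJ i j : measurable_fun (Omega : set mplane) (fun x : mplane => jac (Phi t) x i j).
  by apply: measurable_funS mD OD _; exact: (flow_jac_measurable hD hX hPhi i j t01).
have detp x : Omega x -> 0 < \det (jac (Phi t) x).
  move=> Ox; have := det_near_id (near x Ox) Ct; have := Ct.
  by rewrite ler_norml => h /andP[a _]; lra.
pose z x := wgrad Omega phi x; pose y x := wgrad Omega ut x; pose y0 x := wgrad Omega u0 x.
have mz : mvec Omega z by exact: mvec_wgrad.
have my : mvec Omega y by exact: mvec_wgrad.
have my0 : mvec Omega y0 by exact: mvec_wgrad.
have cb := beta_continuous hb.
(* [gt] and [g0] are the untransported integrands at [ut] and [u0], and [It] is the integrand in the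
   equation of [ut]; thus [gt - It] isolates the effect of the Jacobian. *)
pose gt x := dot (bf (y x)) (z x) + ut x * phi x.
pose g0 x := dot (bf (y0 x)) (z x) + u0 x * phi x.
pose B x (w : 'cV[R]_2) := (invmx (jac (Phi t) x))^T *m w.
pose It x := xi (Phi t) x * dot (bf (B x (y x))) (B x (z x)) + xi (Phi t) x * ut x * phi x.
have mg (u : R * R -> R) (yy : R * R -> 'cV[R]_2) : measurable_fun (Omega : set mplane) (u : mplane -> R) ->
    mvec Omega yy -> measurable_fun (Omega : set mplane) (fun x : mplane => dot (bf (yy x)) (z x) + u x * phi x).
  move=> mu myy; apply: measurable_funD; last exact: measurable_funM.
  by apply: measurable_dot => //; exact: mvec_bfield.
have mgt : measurable_fun (Omega : set mplane) (gt : mplane -> R) by exact: mg.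
have mg0 : measurable_fun (Omega : set mplane) (g0 : mplane -> R) by exact: mg.
have mBy : mvec Omega (fun x => B x (y x)) by apply: mvec_invmx_tr.
have mBz : mvec Omega (fun x => B x (z x)) by apply: mvec_invmx_tr.
have mxi := measurable_xi t01.
have mIt : measurable_fun (Omega : set mplane) (It : mplane -> R).
  apply: measurable_funD; last by apply: measurable_funM => //; exact: measurable_funM.
  by apply: measurable_funM => //; apply: measurable_dot => //; exact: mvec_bfield.
have [_ [_ bmax0 _] _ [_ K0 _]] := hb.
have bp (u : R * R -> R) (yy : R * R -> 'cV[R]_2) x : `|dot (bf (yy x)) (z x) + u x * phi x| <=
    (bmax + 1) * (norm2 (yy x) * norm2 (z x) + `|u x| * `|phi x|).
  apply: le_trans (ler_normD _ _) _; rewrite (normrM (u x)).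
  have := bfield_bound hb (z x) (yy x); rewrite dotC (mulrC (norm2 (z x))) => h.
  have n0 : 0 <= norm2 (yy x) * norm2 (z x) by rewrite mulr_ge0 ?norm2_ge0.
  have n1 : 0 <= `|u x| * `|phi x| by rewrite mulr_ge0.
  have n2 : 0 <= bmax * (`|u x| * `|phi x|) by rewrite mulr_ge0// ltW.
  rewrite mulrDl mul1r mulrDr; lra.
have b10 : 0 <= bmax + 1 by lra.
have aet : {ae leb2, forall x, Omega x -> `|gt x| <= (bmax + 1) *
    (norm2 (wgrad Omega ut x) * norm2 (wgrad Omega phi x) + `|ut x| * `|phi x|)}.
  by apply/aeW => x _; exact: (bp ut y x).
have ae0 : {ae leb2, forall x, Omega x -> `|g0 x| <= (bmax + 1) *
    (norm2 (wgrad Omega u0 x) * norm2 (wgrad Omega phi x) + `|u0 x| * `|phi x|)}.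
  by apply/aeW => x _; exact: (bp u0 y0 x).
have [igt _] := @form_pairing R Omega oO q q1 phi wphi fphi ut gt _ wt ft b10 mgt aet.
have [ig0 _] := @form_pairing R Omega oO q q1 phi wphi fphi u0 g0 _ w0 f0 b10 mg0 ae0.
pose h0 x := dot (wgrad Omega v x) (z x) + v x * phi x.
have ih0 := J_integrable oO q1 wphi fphi wv fv.
have mh0 := measurable_J wphi wv.
pose h1 x := h0 x - rho * (gt x - g0 x).
have mh1 : measurable_fun (Omega : set mplane) (h1 : mplane -> R).
  apply: measurable_funB => //; apply: measurable_funM => //; exact: measurable_funB.
have [r0 r1 _ _ /andP[kap0 _]] := contr_rate_bounds hb.
have vae : {ae leb2, forall x, Omega x -> wgrad Omega v x = y x - y0 x}.
  have -> : v = (fun x => -1 * u0 x + ut x) by apply/funext => x; rewrite /v mulN1r addrC.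
  apply: (aeS _ (wgrad_lin_ae oO (-1) w0 wt)) => x H Ox.
  by rewrite H// scaleN1r addrC.
have [_ B1] : leb2.-integrable Omega (EFin \o h1) /\
    (`|Rintegral leb2 Omega h1|%:E <= kap%:E * W1_norm Omega q v * W1_norm Omega (conj_exp q) phi)%E.
  apply: (form_pairing oO q1 wphi fphi wv fv kap0 mh1).
  apply: (aeS _ vae) => x Hx Ox.
  have := contraction_pointwise hb (y x) (y0 x) (z x) (v x) (phi x).
  rewrite -/rho -/kap /h1 /h0 (Hx Ox).
  rewrite (_ : gt x - g0 x = dot (bf (y x)) (z x) - dot (bf (y0 x)) (z x) + v x * phi x)//.
  by rewrite /gt /g0 /v; ring.
pose h2 x := gt x - It x.
have mh2 : measurable_fun (Omega : set mplane) (h2 : mplane -> R) by exact: measurable_funB.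
have Ct0 : 0 <= C * t by rewrite mulr_ge0//; [exact/ltW/flowC_gt0|by case/andP: t01].
have pC0 : 0 <= pertC bmax K * (C * t) by rewrite mulr_ge0//; exact/ltW/(pertC_gt0 hb).
have [ih2 B2] : leb2.-integrable Omega (EFin \o h2) /\
    (`|Rintegral leb2 Omega h2|%:E <=
      (pertC bmax K * (C * t))%:E * W1_norm Omega q ut * W1_norm Omega (conj_exp q) phi)%E.
  apply: (form_pairing oO q1 wphi fphi wt ft pC0 mh2).
  apply/aeW => x Ox.
  exact: (transported_form_near hb (y x) (z x) (ut x) (phi x) (near x Ox) Ct).
have fF : (Lp_norm Omega q (load_diff t) < +oo)%E by rewrite hF ltry.
have [ih3 B3] := Lp_pairing oO q1 wphi fphi (measurable_load_diff t01) fF.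
have LfO : (Lp_norm Omega q f < +oo)%E.
  apply: le_lt_trans Lf.2; apply: Lp_norm_sub => //; first exact: lt_trans ltr01 q1.
  exact: Lf.1.
have [ifp _] := Lp_pairing oO q1 wphi fphi (measurable_funS mD OD Lf.1) LfO.
have E1 : Rintegral leb2 Omega h1 = J Omega v phi - rho * (Rintegral leb2 Omega gt - Rintegral leb2 Omega g0).
  have igB : leb2.-integrable Omega (EFin \o (fun x => gt x - g0 x)) by exact: (integrableB mO igt ig0).
  have igZ : leb2.-integrable Omega (EFin \o (fun x => rho * (gt x - g0 x))) by exact: (integrableZl mO rho igB).
  by rewrite (RintegralB mO ih0 igZ) (RintegralZl _ mO igB) (RintegralB mO igt ig0).
have E2 : Rintegral leb2 Omega It = Rintegral leb2 Omega gt - Rintegral leb2 Omega h2.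
  rewrite -(RintegralB mO igt ih2); apply: eq_Rintegral => x _.
  by rewrite -[LHS]/(It x) /h2 subKr.
have E3 : Rintegral leb2 Omega (fun x => xi (Phi t) x * f (Phi t x) * phi x) =
    Rintegral leb2 Omega (fun x => load_diff t x * phi x) + Rintegral leb2 Omega (fun x => f x * phi x).
  rewrite -(RintegralD mO ih3 ifp); apply: eq_Rintegral => x _.
  by rewrite /load_diff; ring.
have E4 : Rintegral leb2 Omega It = Rintegral leb2 Omega (fun x => xi (Phi t) x * f (Phi t x) * phi x).
  rewrite -(solt phi Wphi); apply: eq_Rintegral => x _.
  by rewrite /It /Bmat /Amat transported_formE.
have E5 : Rintegral leb2 Omega g0 = Rintegral leb2 Omega (fun x => f x * phi x).
  have jac1 x : Omega x -> jac (Phi 0) x = 1%:M.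
    by move=> /OD Dx; apply/matrixP => i j; rewrite (flow_jac0 hD hX hPhi i j Dx) mxE.
  transitivity (Rintegral leb2 Omega (fun x => xi (Phi 0) x * f (Phi 0 x) * phi x)).
    rewrite -(sol0 phi Wphi); apply: eq_Rintegral => x; rewrite inE => Ox.
    rewrite /Bmat /Amat transported_formE /xi (jac1 x Ox) det1 invmx1 trmx1 !mul1mx !mul1r.
    by rewrite /g0.
  apply: eq_Rintegral => x; rewrite inE => Ox.
  rewrite /xi (jac1 x Ox) det1 mul1r.
  by have [-> _] := hPhi (subset_closure (OD Ox)).
(* The integral of [h1] is the contraction defect. The rest, the integral of gt - g0, is rewritten
   by the two equations into the Jacobian error plus the load difference. *)
have EJ : J Omega v phi = Rintegral leb2 Omega h1 +
    rho * (Rintegral leb2 Omega h2 + Rintegral leb2 Omega (fun x => load_diff t x * phi x)).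
  rewrite E1; have -> : Rintegral leb2 Omega h2 = Rintegral leb2 Omega gt - Rintegral leb2 Omega It.
    by rewrite E2; ring.
  by rewrite E4 E3 E5; ring.
rewrite -[X in `|J _ X _|]/v EJ.
rewrite hV hP -!EFinM lee_fin in B1.
rewrite hU hP -!EFinM lee_fin in B2.
rewrite hF hP -!EFinM lee_fin in B3.
apply: le_trans (ler_normD _ _) _; rewrite mulrDl; apply: lerD => //.
rewrite normrM (gtr0_norm r0) -(mulrA rho); apply: ler_wpM2l; first exact: ltW.
rewrite mulrDl; by apply: le_trans (ler_normD _ _) _; exact: lerD.
Qed.

End energy.

Section main_bound.
Context {R : realType} (D Omega Gamma : set (R * R)) (X : R * R -> R * R)
  (Phi : R -> R * R -> R * R) (beta : R -> R) (bmin bmax k K q delta : R) (f : R * R -> R)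
  (u : R -> R * R -> R).
Context (hD : open D /\ bounded_set D) (hX : C1_zero_bd D X) (hPhi : is_flow D X Phi)
  (oO : open Omega) (OD : Omega `<=` D) (hb : beta_admissible beta bmin bmax k K)
  (q1 : 1 < q) (Lf : Lp D q f) (d0 : 0 < delta)
  (hu : forall t : R, 0 <= t <= delta -> is_solution Omega Gamma beta (Phi t) f q (u t))
  (Mfin : (M_const Omega Gamma q < +oo)%E)
  (Mcontr : (M_const Omega Gamma q
       * (Num.sqrt (1 - Num.min k 1 ^+ 2 / Num.max K 1 ^+ 2))%:E < 1)%E).
Implicit Types (x : R * R) (t N : R).

Let mO : measurable (Omega : set (@mplane R)) := open_mplane oO.
Let mD : measurable (D : set (@mplane R)) := open_mplane hD.1.
Let C := flowC hD hX.
Let rho := contr_rate k K.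
Let kap := 1 - Num.min k 1 ^+ 2 / Num.max K 1 ^+ 2.
Let q0 : 0 < q. Proof. exact: lt_trans ltr01 q1. Qed.
Let pc := pushC hD hX `^ q^-1.

Lemma fin_real (x : \bar R) : (0 <= x)%E -> (x < +oo)%E -> exists2 r, 0 <= r & x = r%:E.
Proof. by case: x => // r r0 _; exists r. Qed.

(** The load difference splits into (xi - 1) f o Phi_t, of order t whatever the regularity of f, and
    f o Phi_t - f, whose bound N is left open for the two cases. *)
Lemma load_diff_bound t Ff N : 0 <= t <= 1 -> C * t <= 1 / 8 ->
  Lp_norm D q f = Ff%:E ->
  (Lp_norm D q (fun x => f (eflow D Phi t x) - f x)%R <= N%:E)%E ->
  (Lp_norm Omega q (load_diff Phi f t) <= (3 * (C * t) * (pc * Ff) + N)%:E)%E.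
Proof.
move=> t01 Ct hFf hN.
have t1 : `|t| <= 1 by case/andP: t01 => t0 ?; rewrite ger0_norm.
have Ct0 : 0 <= C * t by rewrite mulr_ge0//; [exact/ltW/flowC_gt0|by case/andP: t01].
have C30 : 0 <= 3 * (C * t) by exact: mulr_ge0.
pose g x := f (eflow D Phi t x).
have mg : measurable_fun (D : set mplane) (g : mplane -> R).
  exact: (measurable_eflow_comp hD hX hPhi t1 Lf.1).
have mgO := measurable_funS mD OD mg.
have mfO := measurable_funS mD OD Lf.1.
have mxi := measurable_xi hD hX hPhi OD t01.
have mxg : measurable_fun (Omega : set mplane) (fun x : mplane => (xi (Phi t) x - 1) * g x).
  by apply: measurable_funM => //; exact: measurable_funB.
have mgf : measurable_fun (Omega : set mplane) (fun x : mplane => g x - f x) by exact: measurable_funB.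
rewrite (@Lp_norm_eq R Omega q _ (fun x => (xi (Phi t) x - 1) * g x + (g x - f x))); last first.
  move=> x Ox; rewrite /load_diff /g eflowE; last exact: subset_closure (OD Ox).
  by ring.
apply: le_trans (Lp_normD (ltW q1) mO mxg mgf) _; rewrite EFinD; apply: leeD; last first.
  apply: le_trans hN; apply: Lp_norm_sub => //.
  exact: measurable_funB mg Lf.1.
apply: (@le_trans _ _ (Lp_norm Omega q (fun x => 3 * (C * t) * g x)%R)).
  apply: Lp_norm_le => //; first exact: measurable_funM.
  apply/aeW => x Ox; rewrite (normrM _ (g x)) (normrM (3 * (C * t))) (ger0_norm C30) ler_wpM2r//.
  have nr i j := flow_jac_near_id hD hX hPhi i j (OD Ox) t01.
  exact: (det_near_id nr Ct).
rewrite (Lp_normZ _ q0 mO mgO) (ger0_norm C30) (EFinM (3 * (C * t))); apply: lee_wpmul2l; first by rewrite lee_fin.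
apply: (@le_trans _ _ (Lp_norm D q g)); first exact: Lp_norm_sub.
rewrite EFinM -hFf; exact: (Lp_norm_push hD hX hPhi (ltW q1) t1 Lf.1).
Qed.

(** Both parts of the theorem are instances. The constants do not depend on N, so N may be a fixed
    small number or a multiple of t. *)
Lemma solution_bound : exists A tau, [/\ 0 < A, 0 < tau, tau <= 1, tau <= delta &
  forall t N, 0 <= t <= tau -> 0 <= N ->
    (Lp_norm D q (fun x => f (eflow D Phi t x) - f x)%R <= N%:E)%E ->
    (W1_norm Omega q (fun x => u t x - u 0 x)%R <= (A * (t + N))%:E)%E].
Proof.
have q1' := ltW q1.
have hu0 : is_solution Omega Gamma beta (Phi 0) f q (u 0) by apply: hu; rewrite lexx ltW.
have [W0 _] := hu0; have [[w0 f0] _] := W0.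
have [U0 U00 hU0] := fin_real (W1_norm_ge0 Omega q (u 0)) f0.
have [Ff Ff0 hFf] := fin_real (Lp_norm_ge0 D q f) Lf.2.
have [r0 _ _ _ /andP[kap0 kap1]] := contr_rate_bounds hb; rewrite -/kap in kap0 kap1.
(* The zero function, written as 0 times [u 0], is a competitor, so the supremum is not that of the
   empty set. *)
have M0 : (0 <= M_const Omega Gamma q)%E.
  have W00 : W1G Omega Gamma q (fun x => 0 * u 0 x) by exact: W1G_scale.
  have := @M_const_bound R Omega Gamma oO q _ 1 q1 W00 ltr01; rewrite mul1e.
  move=> H; apply: le_trans (W1_norm_ge0 _ _ _) (H _) => phi [[wphi fphi] _] _.
  by rewrite (J_scale oO q1 wphi fphi 0 w0 f0) mul0r normr0.
have [M Mge0 hM] := fin_real M0 Mfin.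
have Mk : M * kap < 1.
  have sk : kap <= Num.sqrt kap.
    rewrite -{1}(sqr_sqrtr kap0) expr2 ler_piMl ?sqrtr_ge0//.
    by rewrite -sqrtr1 ler_sqrt.
  have := Mcontr; rewrite hM -EFinM lte_fin -/kap => H.
  by apply: le_lt_trans H; exact: ler_wpM2l.
pose mu := 1 - M * kap; have mu0 : 0 < mu by rewrite subr_gt0.
have C0 : 0 < C := flowC_gt0 hD hX.
have pC0 : 0 < pertC bmax K := pertC_gt0 hb.
have pc0 : 0 <= pc by exact: powR_ge0.
pose a := M * rho * (pertC bmax K * C).
have a0 : 0 <= a.
  by apply: mulr_ge0; [apply: mulr_ge0 => //; exact: ltW|apply: mulr_ge0; exact: ltW].
(* The first two summands collect the coefficients of t not involving V; the 1 covers the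
   coefficient of N. *)
pose H := pertC bmax K * C * U0 + 3 * C * (pc * Ff) + 1.
have H1 : 1 <= H.
  rewrite lerDr; apply: addr_ge0; first by apply: mulr_ge0 => //; apply: mulr_ge0; exact: ltW.
  by apply: mulr_ge0; apply: mulr_ge0 => //; exact: ltW.
pose A := 2 / mu * (M * rho * H) + 1.
have MrH : 0 <= M * rho * H.
  by apply: mulr_ge0; [apply: mulr_ge0 => //; exact: ltW|exact: le_trans ler01 H1].
have A0 : 0 < A.
  by apply: ltr_wpDl => //; apply: mulr_ge0 => //; apply: divr_ge0 => //; exact: ltW.
(* The third bound keeps the Jacobian within 1/8 of the identity; the last makes a t at most mu / 2,
   so that half of mu V survives the absorption. *)
pose tau := Order.min (Order.min 1 delta) (Order.min (1 / (8 * C)) (mu / (2 * (a + 1)))).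
have a1 : 0 < 2 * (a + 1) by rewrite mulr_gt0// ltr_wpDl.
have tau0 : 0 < tau by rewrite /tau !lt_min ltr01 d0 !divr_gt0// mulr_gt0.
have tau1 : tau <= 1 by rewrite /tau !ge_min lexx.
have taud : tau <= delta by rewrite /tau !ge_min lexx !orbT.
have tauC : tau * (8 * C) <= 1.
  have : tau <= 1 / (8 * C) by rewrite /tau !ge_min lexx !orbT.
  by rewrite ler_pdivlMr// mulr_gt0.
have taua : tau * (2 * (a + 1)) <= mu.
  have : tau <= mu / (2 * (a + 1)) by rewrite /tau !ge_min lexx !orbT.
  by rewrite ler_pdivlMr.
exists A, tau; split => // t N /andP[t0 tt] N0 hN.
have t01 : 0 <= t <= 1 by rewrite t0 (le_trans tt tau1).
have td : 0 <= t <= delta by rewrite t0 (le_trans tt taud).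
have Ct : C * t <= 1 / 8.
  rewrite ler_pdivlMr//; apply: le_trans tauC.
  rewrite (_ : C * t * 8 = t * (8 * C)); last by ring.
  by apply: ler_wpM2r => //; apply: mulr_ge0 => //; exact: ltW.
have ta : 2 * (a * t) <= mu.
  apply: le_trans taua; rewrite (_ : 2 * (a * t) = t * (2 * a)); last by ring.
  apply: ler_pM => //; first by apply: mulr_ge0.
  by apply: ler_wpM2l => //; rewrite lerDl.
have hut := hu td; have [Wt _] := hut; have [[wt ft] _] := Wt.
have Wv := W1GB oO q1' Wt W0; have [[wv fv] _] := Wv.
have [V V0 hV] := fin_real (W1_norm_ge0 Omega q _) fv.
have [U Ut0 hU] := fin_real (W1_norm_ge0 Omega q (u t)) ft.
have UV : U <= V + U0.
  rewrite -lee_fin EFinD -hU -hV -hU0.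
  have := W1_norm_lin 1 oO q1' wv w0; rewrite normr1 mul1e.
  by under [X in (W1_norm _ _ X <= _)%E -> _]eq_fun do rewrite mul1r subrK.
have Lb := load_diff_bound t01 Ct hFf hN.
have [F F0 hF] := fin_real (Lp_norm_ge0 Omega q (load_diff Phi f t)) (le_lt_trans Lb (ltry _)).
rewrite hF lee_fin in Lb.
pose E := kap * V + rho * (pertC bmax K * (C * t) * U + F).
have Ct0 : 0 <= C * t by apply: mulr_ge0 => //; exact: ltW.
have E0 : 0 <= E.
  apply: addr_ge0; first exact: mulr_ge0.
  apply: mulr_ge0; first exact: ltW.
  by apply: addr_ge0 => //; apply: mulr_ge0 => //; apply: mulr_ge0 => //; exact: ltW.
have VE : V <= M * E.
  (* [M_const_bound] asks for a positive N while E may be 0, hence the small positive excess,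
     removed in the limit. *)
  apply/ler_addgt0Pr => e e0.
  have e'0 : 0 < e / (M + 1) by rewrite divr_gt0// ltr_wpDl.
  have Ee : 0 < E + e / (M + 1) by exact: ltr_wpDl.
  have := M_const_bound oO q1 Wv Ee; rewrite hV hM -EFinM lee_fin => HV.
  apply: le_trans (HV _) _ => [phi Wphi phi1|].
    have [P P0 hP] := fin_real (W1_norm_ge0 Omega (conj_exp q) phi) Wphi.1.2.
    rewrite hP lee_fin in phi1.
    have := energy_estimate hPhi oO OD hb q1 Lf t01 Ct hut hu0 Wphi hV hU hF hP.
    rewrite -/rho -/kap -/E => /le_trans; apply.
    by apply: (@le_trans _ _ E); [rewrite ler_piMr|rewrite lerDl ltW].
  rewrite mulrDl (mulrC E) lerD2l -mulrA ler_piMr ?(ltW e0)// mulrC ler_pdivrMr ?ltr_wpDl// mul1r.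
  by rewrite lerDl.
rewrite hV lee_fin.
have step : mu * V - a * t * V <= M * rho * H * (t + N).
  have s1 : M * E <= M * (kap * V + rho * (pertC bmax K * (C * t) * (V + U0) + (3 * (C * t) * (pc * Ff) + N))).
    apply: ler_wpM2l => //; rewrite /E lerD2l; apply: ler_wpM2l; first exact: ltW.
    by apply: lerD => //; apply: ler_wpM2l => //; apply: mulr_ge0 => //; exact: ltW.
  have s2 : 0 <= M * rho * (H * N - N + t).
    apply: mulr_ge0; first by apply: mulr_ge0 => //; exact: ltW.
    by rewrite addr_ge0// -{2}[N]mul1r -mulrBl mulr_ge0// subr_ge0.
  have s3 := le_trans VE s1.
  rewrite -subr_ge0 in s3; rewrite -subr_ge0.
  rewrite (_ : _ - _ = (M * (kap * V + rho * (pertC bmax K * (C * t) * (V + U0) +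
     (3 * (C * t) * (pc * Ff) + N))) - V) + M * rho * (H * N - N + t)); first exact: addr_ge0.
  by rewrite /mu /a /H; ring.
have half : mu / 2 * V <= M * rho * H * (t + N).
  apply: le_trans step.
  have : a * t * V <= mu / 2 * V by apply: ler_wpM2r => //; lra.
  by lra.
have tN : 0 <= t + N by exact: addr_ge0.
rewrite /A mulrDl mul1r; apply: ler_wpDr => //.
rewrite -(mulrA (2 / mu)) {1}(_ : V = 2 / mu * (mu / 2 * V)); last by field; rewrite gt_eqF.
by apply: ler_wpM2l => //; apply: divr_ge0 => //; exact: ltW.
Qed.

End main_bound.

(** * One-sided limits and the conclusion *)

Lemma cvge0_right (R : realType) (F : R -> \bar R) :
  (forall t, 0 <= F t)%E ->
  (forall e : R, 0 < e -> exists2 d, 0 < d & forall t, 0 < t -> t <= d -> (F t <= e%:E)%E) ->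
  F t @[t --> 0^'+] --> 0%E.
Proof.
move=> F0 H.
have near e : 0 < e -> \forall t \near 0^'+, (F t <= e%:E)%E.
  move=> e0; have [d d0 Hd] := H e e0; near=> t; apply: Hd.
    by near: t; exact: nbhs_right_gt.
  by near: t; exact: nbhs_right_le.
apply/fine_cvgP; split.
  apply: filterS (near 1 ltr01) => t Ft; rewrite ge0_fin_numE//.
  exact: le_lt_trans Ft (ltry _).
apply/cvgrPdist_le => e e0; apply: filterS (near e e0) => t Ft.
rewrite sub0r normrN ger0_norm ?fine_ge0//= -lee_fin fineK//.
by rewrite ge0_fin_numE//; exact: le_lt_trans Ft (ltry _).
Unshelve. all: by end_near. Qed.

Theorem corollary2p11 (R : realType) (D Omega Gamma : set (R * R))
  (X : R * R -> R * R) (Phi : R -> R * R -> R * R)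
  (beta : R -> R) (bmin bmax k K q0 q : R)
  (f : R * R -> R) (delta : R) (u : R -> R * R -> R)
  (hD : open D /\ bounded_set D)
  (hX : C1_zero_bd D X)
  (hPhi : is_flow D X Phi)
  (hOmega : Xi D Omega Gamma)
  (hbeta : beta_admissible beta bmin bmax k K)
  (hq0 : 2 < q0)
  (hRq0 : R_class Omega Gamma q0)
  (hMq : forall p : R, 2 <= p <= q0 ->
    (M_const Omega Gamma p < +oo)%E /\
    (M_const Omega Gamma p
       * (Num.sqrt (1 - Num.min k 1 ^+ 2 / Num.max K 1 ^+ 2))%:E < 1)%E)
  (hq : 2 < q <= q0)
  (hdelta : 0 < delta)
  (hu : forall t : R, 0 <= t <= delta ->
    is_solution Omega Gamma beta (Phi t) f q (u t)) :
  (Lp D q f ->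
     ((fun t => W1_norm Omega q (fun x => u t x - u 0 x)) @ 0^'+ --> 0%E) /\
     ((fun t => C_norm Omega (fun x => u t x - u 0 x)) @ 0^'+ --> 0%E)) /\
  (W1 D q f ->
     exists tau c : R, [/\ 0 < tau, 0 < c &
       forall t : R, 0 <= t <= tau ->
         (C_norm Omega (fun x => u t x - u 0 x)%R
          + W1_norm Omega q (fun x => u t x - u 0 x)%R <= (c * t)%:E)%E]).

Proof.
have [OD _ [[bO lO] _ _ _]] := hOmega.
have [ne0 oO _ _] := lO; have [q2 qq0] := andP hq.
have q1 : 1 < q by apply: lt_trans q2; rewrite ltr1n.
have [Mfin Mcontr] : (M_const Omega Gamma q < +oo)%E /\ (M_const Omega Gamma q
       * (Num.sqrt (1 - Num.min k 1 ^+ 2 / Num.max K 1 ^+ 2))%:E < 1)%E.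
  by apply: hMq; rewrite (ltW q2).
have [Cc Cc0 HC] := C_norm_le_W1 Gamma bO lO q2.
have Wt t : 0 <= t <= delta -> W1G Omega Gamma q (fun x => u t x - u 0 x).
  move=> td; have [W1t _] := hu t td.
  have [W10 _] := hu 0 (ltac:(by rewrite lexx ltW)).
  exact: W1GB oO (ltW q1) W1t W10.
split=> [Lf|W1f].
  have [A [tau [A0 tau0 tau1 taud HA]]] :=
    solution_bound hD hX hPhi oO OD hbeta q1 Lf hdelta hu Mfin Mcontr.
  have small e : 0 < e -> exists2 d, 0 < d & forall t, 0 < t -> t <= d ->
      t <= delta /\ (W1_norm Omega q (fun x => u t x - u 0 x)%R <= e%:E)%E.
    (* With also t <= N, the bound A (t + N) is at most e. *)
    move=> e0; pose N := e / (2 * A).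
    have N0 : 0 < N by rewrite divr_gt0// mulr_gt0.
    have [d d0 Hd] := Lp_transport hD hX hPhi (ltW q1) Lf N0.
    exists (Num.min tau (Num.min d N)); first by rewrite !lt_min tau0 d0.
    move=> t t0; rewrite !le_min => /and3P[tt td tN].
    have H1 : 0 <= t <= tau by rewrite (ltW t0).
    have H2 : 0 <= t <= d by rewrite (ltW t0).
    split; first exact: le_trans taud.
    apply: le_trans (HA t N H1 (ltW N0) (Hd t H2 (le_trans tt tau1))) _.
    rewrite lee_fin; apply: (@le_trans _ _ (A * (N + N))).
      by rewrite ler_wpM2l ?(ltW A0)// lerD2r.
    by rewrite /N le_eqVlt; apply/orP; left; apply/eqP; field; rewrite gt_eqF.
  split; apply: cvge0_right.
  - by move=> t; exact: W1_norm_ge0.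
  - move=> e e0; have [d d0 Hd] := small e e0; exists d => // t t0 td.
    by have [] := Hd t t0 td.
  - by move=> t; exact: C_norm_ge0.
  - move=> e e0; have eC : 0 < e / Cc by rewrite divr_gt0.
    have [d d0 Hd] := small _ eC; exists d => // t t0 td.
    have [tdel H] := Hd t t0 td.
    have t01 : 0 <= t <= delta by rewrite (ltW t0).
    apply: le_trans (HC _ (Wt t t01)) _.
    have -> : e%:E = (Cc%:E * (e / Cc)%:E)%E by rewrite -EFinM mulrC divfK// gt_eqF.
    by apply: lee_wpmul2l => //; rewrite lee_fin ltW.
have Lf : Lp D q f.
  split; first exact: wdiff_measurable W1f.1.
  apply: le_lt_trans W1f.2; apply: (Lp_norm_W1 hD.1 _ W1f.1); exact: lt_trans ltr01 q1.
have [A [tau [A0 tau0 tau1 taud HA]]] :=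
  solution_bound hD hX hPhi oO OD hbeta q1 Lf hdelta hu Mfin Mcontr.
have [L [tau2 [L0 tau20 tau21 HL]]] := Lp_transport_rate hD.1 hD.2 q2 W1f hX hPhi.
exists (Num.min tau tau2), ((Cc + 1) * (A * (1 + L))); split.
- by rewrite lt_min tau0.
- by apply: mulr_gt0; [exact: addr_gt0|apply: mulr_gt0 => //; exact: ltr_pwDl].
move=> t /andP[t0]; rewrite le_min => /andP[tt tt2].
have H1 : 0 <= t <= tau by rewrite t0.
have H2 : 0 <= t <= tau2 by rewrite t0.
have H3 : 0 <= t <= delta by rewrite t0 (le_trans tt taud).
(* For Sobolev data the transport error at time t is itself at most L t, so both contributions are
   linear in t. *)
have HW := HA t (L * t) H1 (mulr_ge0 L0 t0) (HL t H2).
have -> : (Cc + 1) * (A * (1 + L)) * t = Cc * (A * (t + L * t)) + A * (t + L * t) by ring.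
rewrite EFinD; apply: leeD => //; apply: le_trans (HC _ (Wt t H3)) _.
by rewrite EFinM; apply: lee_wpmul2l => //; rewrite lee_fin ltW.
Qed.
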